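(* Let $W:\mathbb{R}^2\to\mathbb{R}_+$ be continuous and $u^\pm=(a,u_2^\pm)$ two zeros of $W$ for some $a\in\mathbb{R}$. Assume that $W\ge\frac12w^2$ on $\mathbb{R}^2$, and that $W=\frac12w^2$ and $w>0$ on the open segment $(u^-,u^+)$, for some harmonic function $w\in\mathcal{C}^2(\mathbb{R}^2,\mathbb{R})$. If $u$ is a global minimizer of problem $(\mathcal P)$ such that either $u\in L^\infty$ or there exist $C,\beta>0$ with $|w(z)|\le Ce^{\beta|z|^2}$ for all $z$, then $u(x)=g(x_1)$ a.e., where $g:\mathbb{R}\to\mathbb{R}^2_a$ is, up to translation, the unique minimizer of $\inf\{\int_\mathbb{R}\frac12|\dot\gamma|^2+W(\gamma)\,dt:\gamma\in\dot H^1(\mathbb{R},\mathbb{R}^2_a),\ \gamma(\pm\infty)=u^\pm\}$.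
   Context: $\mathbb{T}=\mathbb{R}/\mathbb{Z}$, $\Omega=\mathbb{R}\times\mathbb{T}$, $x=(x_1,x_2)$. $\dot H^1_{div}(\Omega,\mathbb{R}^2)=\{u\in H^1_{loc}:\nabla u\in L^2,\ \nabla\cdot u=0\}$, $E(u)=\int_\Omega\frac12|\nabla u|^2+W(u)dx$, $\overline{u}(x_1)=\int_\mathbb{T}u(x_1,x_2)dx_2$. Problem $(\mathcal P)$: minimize $E$ over $u\in\dot H^1_{div}(\Omega,\mathbb{R}^2)$ with $\lim_{x_1\to\pm\infty}\overline{u}(x_1)=u^\pm$; a global minimizer attains this infimum. $\mathbb{R}^2_a=\{z:z_1=a\}$. *)

(* Defs.v *)
From mathcomp Require Import all_boot all_order all_algebra all_classical all_reals all_analysis.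
Import numFieldNormedType.Exports.
Import Order.TTheory GRing.Theory Num.Theory.
Set Implicit Arguments. Unset Strict Implicit. Unset Printing Implicit Defensive.
Local Open Scope classical_set_scope.
Local Open Scope ring_scope.

Section Defs.
Context {R : realType}.

Definition lebR := @lebesgue_measure R.
Definition mu2 := (lebR \x lebR)%E.

Definition e1 : R * R := (1, 0).
Definition e2 : R * R := (0, 1).

(** Points of Omega = R x T are represented by points of R^2; functions on
    Omega are functions on R^2 that are 1-periodic in x2. *)
Definition periodic2 (T : Type) (f : R * R -> T) :=
  forall p : R * R, f (p.1, p.2 + 1) = f p.

(** Fundamental domain R x [0,1) of Omega, used for integration over Omega. *)
Definition cyl : set (R * R) := [set p | 0 <= p.2 /\ p.2 < 1].

Definition box (r : R) : set (R * R) := [set p | `|p.1| <= r /\ `|p.2| <= r].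

Definition test2 (phi : R * R -> R) :=
  [/\ continuous phi,
      (exists r : R, forall p : R * R, r < `|p.1| \/ r < `|p.2| -> phi p = 0),
      (forall p, derivable phi p e1 /\ derivable phi p e2),
      continuous ('D_e1 phi) & continuous ('D_e2 phi)].

Definition L2loc2 (f : R * R -> R) :=
  measurable_fun setT f /\
  forall r : R, mu2.-integrable (box r) (fun p => (f p ^+ 2)%:E).

Definition weak_deriv2 (f : R * R -> R) (d : R * R) (g : R * R -> R) :=
  [/\ L2loc2 f, L2loc2 g &
  forall phi, test2 phi ->
    (\int[mu2]_p (f p * 'D_d phi p)%:E = - \int[mu2]_p (g p * phi p)%:E)%E].

Definition weak_grad (u : R * R -> R * R) (G : R * R -> (R * R) * (R * R)) :=
  [/\ weak_deriv2 (fun p => (u p).1) e1 (fun p => (G p).1.1),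
      weak_deriv2 (fun p => (u p).1) e2 (fun p => (G p).1.2),
      weak_deriv2 (fun p => (u p).2) e1 (fun p => (G p).2.1) &
      weak_deriv2 (fun p => (u p).2) e2 (fun p => (G p).2.2)].

Definition grad_sq (G : R * R -> (R * R) * (R * R)) (p : R * R) : R :=
  (G p).1.1 ^+ 2 + (G p).1.2 ^+ 2 + (G p).2.1 ^+ 2 + (G p).2.2 ^+ 2.

Definition Hdiv (u : R * R -> R * R) :=
  periodic2 u /\
  exists G, [/\ weak_grad u G,
    (\int[mu2]_(p in cyl) (grad_sq G p)%:E < +oo)%E &
    {ae mu2, forall p, (G p).1.1 + (G p).2.2 = 0}].

(** Energy E(u) = int_Omega 1/2 |grad u|^2 + W(u), computed with a weak
    gradient G of u (a.e. unique, so the value does not depend on G). *)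
Definition energy (W : R * R -> R) (u : R * R -> R * R)
    (G : R * R -> (R * R) * (R * R)) : \bar R :=
  (\int[mu2]_(p in cyl) (grad_sq G p / 2 + W (u p))%:E)%E.

Definition ubar (u : R * R -> R * R) (t : R) : R * R :=
  (Rintegral lebR `[0, 1[ (fun s => (u (t, s)).1),
   Rintegral lebR `[0, 1[ (fun s => (u (t, s)).2)).

Definition ess_lim_pinfty (f : R -> R * R) (l : R * R) :=
  forall eps : R, 0 < eps -> exists M : R,
    {ae lebR, forall t, M < t -> `|(f t).1 - l.1| < eps /\ `|(f t).2 - l.2| < eps}.
Definition ess_lim_ninfty (f : R -> R * R) (l : R * R) :=
  forall eps : R, 0 < eps -> exists M : R,
    {ae lebR, forall t, t < M -> `|(f t).1 - l.1| < eps /\ `|(f t).2 - l.2| < eps}.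

Definition admissibleP (um up : R * R) (u : R * R -> R * R) :=
  [/\ Hdiv u, ess_lim_ninfty (ubar u) um & ess_lim_pinfty (ubar u) up].

Definition global_minP (W : R * R -> R) (um up : R * R) (u : R * R -> R * R) :=
  admissibleP um up u /\
  forall v, admissibleP um up v -> forall Gu Gv, weak_grad u Gu -> weak_grad v Gv ->
    (energy W u Gu <= energy W v Gv)%E.

Definition test1 (phi : R -> R) :=
  [/\ continuous phi,
      (exists r : R, forall t : R, r < `|t| -> phi t = 0),
      (forall t, derivable phi t 1) & continuous (derive1 phi)].

Definition weak_deriv1 (f g : R -> R) :=
  [/\ measurable_fun setT f, measurable_fun setT g,
      (forall r : R, lebR.-integrable `[- r, r] (fun t => (f t)%:E) /\
                     lebR.-integrable `[- r, r] (fun t => (g t)%:E)) &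
  forall phi, test1 phi ->
    (\int[lebR]_t (f t * derive1 phi t)%:E = - \int[lebR]_t (g t * phi t)%:E)%E].

Definition admissible1 (a : R) (um up : R * R) (gamma : R -> R * R) :=
  [/\ (forall t, (gamma t).1 = a),
      (exists dg, weak_deriv1 (fun t => (gamma t).2) dg /\
                  (\int[lebR]_t (dg t ^+ 2)%:E < +oo)%E),
      ess_lim_ninfty gamma um & ess_lim_pinfty gamma up].

(** 1D energy; dg is the weak derivative of the second component
    (the first component is the constant a). *)
Definition energy1 (W : R * R -> R) (gamma : R -> R * R) (dg : R -> R) : \bar R :=
  (\int[lebR]_t (dg t ^+ 2 / 2 + W (gamma t))%:E)%E.

Definition minimizer1 (W : R * R -> R) (a : R) (um up : R * R) (g : R -> R * R) :=
  admissible1 a um up g /\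
  forall h, admissible1 a um up h -> forall dg dh,
    weak_deriv1 (fun t => (g t).2) dg -> weak_deriv1 (fun t => (h t).2) dh ->
    (energy1 W g dg <= energy1 W h dh)%E.

Definition is_C2 (w : R * R -> R) :=
  [/\ continuous w,
      (forall p, derivable w p e1 /\ derivable w p e2),
      (forall p, [/\ derivable ('D_e1 w) p e1, derivable ('D_e1 w) p e2,
                     derivable ('D_e2 w) p e1 & derivable ('D_e2 w) p e2]),
      continuous ('D_e1 w) /\ continuous ('D_e2 w) &
      [/\ continuous ('D_e1 ('D_e1 w)), continuous ('D_e2 ('D_e1 w)),
          continuous ('D_e1 ('D_e2 w)) & continuous ('D_e2 ('D_e2 w))]].

Definition is_harmonic (w : R * R -> R) :=
  forall p, 'D_e1 ('D_e1 w) p + 'D_e2 ('D_e2 w) p = 0.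

End Defs.

(* Main.v *)
(* Let alpha be a harmonic conjugate of w; since div u = 0, the product of w(u) with the
   vorticity omega of u is the divergence of a function of u, with total flux c = the integral
   of w along the segment. As |grad u|^2 = omega^2 - 2 det(grad u), the determinant integrates
   to 0, and a reparametrized segment has energy at most c + delta, minimality forces
   omega = w(u). The truncations of u_1 - a then satisfy a superlinear energy estimate
   (Gagliardo-Nirenberg twice), which gives u_1 = a, so that u_2 solves the ODE g' = w(a, g) in x_1.
   The exponential growth of w is absorbed by a Moser-Trudinger estimate on slabs, and the bounds
   on grad w come from a harmonic barrier. Functions on the cylinder are handled through
   representatives that are absolutely continuous on almost every line. *)
From HB Require Import structures.
Require Import Defs.
From mathcomp Require Import all_boot all_order all_algebra all_classical all_reals all_analysis.
From mathcomp Require Import measurable_realfun.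
From mathcomp Require Import ring lra.
Import numFieldNormedType.Exports.
Import Order.TTheory GRing.Theory Num.Theory.
Set Implicit Arguments. Unset Strict Implicit. Unset Printing Implicit Defensive.
Local Open Scope classical_set_scope.
Local Open Scope ring_scope.

(** The step to $u_1=a$ is an absorption. Let phi be the positive part of $\pm(u_1-a)-k$, cut to a
    slab whose end slices lie close to $(a,u_2^-)$ and $(a,u_2^+)$. Once omega = w(u), two null
    integrals, of the Jacobian of (phi, u_2) and of the x_2-derivative of phi w(u), bound the
    Dirichlet integral E of phi by the integral of chi phi^2 |grad w|^2(u), where chi marks the
    points above level k with nonzero gradient. Gagliardo-Nirenberg for phi and for phi^2 bounds the
    integral of phi^4 by E^2, so E^2 <= C theta E^2 with theta the integral of chi |grad w|^4(u),
    and E = 0 once theta is small. Now theta tends to 0 as k grows, and also as k increases to the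
    essential supremum, since gradients vanish on level sets; so the supremum can be lowered to the
    level of the end slices. The growth condition makes theta and the fluxes finite. Uniqueness
    comes from the same calibration: a one-dimensional minimizer lifts to a function on the cylinder
    of energy at most c, hence solves the ODE too, and two solutions are aligned where they cross
    the midpoint of the segment. *)

Section RealIntegral.
Context d (T : measurableType d) (R : realType) (m : {measure set T -> \bar R}).
Implicit Types f g : T -> R.

(** * Integration of real-valued functions *)

Definition L1 f := m.-integrable [set: T] (EFin \o f).
(** An infinite integral is read as 0, which is why linearity and comparison below ask for [L1]. *)
Definition Int f : R := Rintegral m [set: T] f.

Lemma L1_mf f : L1 f -> measurable_fun setT f.
Proof. by move=> /integrableP[/measurable_EFinP]. Qed.

Lemma L1_finE f : L1 f -> (\int[m]_x (f x)%:E)%E = (Int f)%:E.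
Proof. by move=> h; rewrite /Int /Rintegral fineK// integrable_fin_num. Qed.

Lemma L1P f : measurable_fun setT f ->
  (\int[m]_x `|f x|%:E < +oo)%E -> L1 f.
Proof. by move=> mf h; apply/integrableP; split => //; exact/measurable_EFinP. Qed.

Lemma ae_meas_ge0_int (f : T -> R) : measurable_fun setT f ->
  (forall x, 0 <= f x) -> L1 f -> Int f = 0 -> {ae m, forall x, f x = 0}.
Proof.
move=> mf f0 Lf If.
have : (\int[m]_x `|(f x)%:E| = 0)%E.
  rewrite -[RHS]/(0%:E) -If -L1_finE//.
  by apply: eq_integral => x _; rewrite gee0_abs// lee_fin.
move/(ae_eq_integral_abs m measurableT); have mf' : measurable_fun setT (EFin \o f) by exact/measurable_EFinP.
by move=> /(_ mf'); apply: filterS => x /(_ I) [].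
Qed.

Lemma L1_dom f g : measurable_fun setT f -> L1 g ->
  {ae m, forall x, `|f x| <= g x} -> L1 f.
Proof.
move=> mf Lg fg; apply: L1P => //.
have /integrableP[mg] := Lg; apply: le_lt_trans.
apply: ae_ge0_le_integral => //.
- by apply/measurable_EFinP; exact: measurableT_comp.
- exact: measurableT_comp.
- by apply: filterS fg => x fg _; rewrite lee_fin (le_trans fg)// ler_norm.
Qed.

Lemma L1_domT f g : measurable_fun setT f -> L1 g ->
  (forall x, `|f x| <= g x) -> L1 f.
Proof. by move=> mf Lg fg; apply: (L1_dom mf Lg); exact: aeW. Qed.

Lemma L1D f g : L1 f -> L1 g -> L1 (fun x => f x + g x).
Proof.
move=> Lf Lg; rewrite /L1; have -> : EFin \o (fun x => f x + g x) = (EFin \o f) \+ (EFin \o g) by apply/funext => x /=; rewrite EFinD.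
exact: integrableD.
Qed.

Lemma L1Z c f : L1 f -> L1 (fun x => c * f x).
Proof.
move=> Lf; have := integrableZl measurableT c Lf.
by congr (_.-integrable _ _); apply/funext => x /=; rewrite EFinM.
Qed.

Lemma L1N f : L1 f -> L1 (fun x => - f x).
Proof. by move=> /(L1Z (-1)); congr L1; apply/funext => x; rewrite mulN1r. Qed.

Lemma L1B f g : L1 f -> L1 g -> L1 (fun x => f x - g x).
Proof. by move=> Lf Lg; apply: L1D => //; exact: L1N. Qed.

Lemma L1_0 : L1 (fun=> 0).
Proof. by rewrite /L1; apply: eq_integrable (integrable0 _ _). Qed.

Lemma L1_norm f : L1 f -> L1 (fun x => `|f x|).
Proof. by move=> Lf; apply: integrable_norm. Qed.

Lemma L1_ae f g : measurable_fun setT g -> L1 f ->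
  {ae m, forall x, f x = g x} -> L1 g.
Proof.
move=> mg Lf fg; apply: (L1_dom mg (L1_norm Lf)).
by apply: filterS fg => x ->.
Qed.

Lemma L1_bM c f g : measurable_fun setT f -> (forall x, `|f x| <= c) ->
  L1 g -> L1 (fun x => f x * g x).
Proof.
move=> mf fc Lg; apply: (@L1_domT _ (fun x => c * `|g x|)).
- by apply: measurable_funM => //; exact: L1_mf.
- by apply: L1Z; exact: L1_norm.
- by move=> x; rewrite normrM ler_wpM2r.
Qed.

Lemma IntD f g : L1 f -> L1 g -> Int (fun x => f x + g x) = Int f + Int g.
Proof. by move=> *; exact: RintegralD. Qed.

Lemma IntB f g : L1 f -> L1 g -> Int (fun x => f x - g x) = Int f - Int g.
Proof. by move=> *; exact: RintegralB. Qed.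

Lemma IntZ c f : L1 f -> Int (fun x => c * f x) = c * Int f.
Proof. by move=> *; exact: RintegralZl. Qed.

Lemma IntN f : L1 f -> Int (fun x => - f x) = - Int f.
Proof.
move=> /(IntZ (-1)); rewrite mulN1r => <-.
by congr Int; apply/funext => x; rewrite mulN1r.
Qed.

Lemma Int0 : Int (fun=> 0) = 0.
Proof. by rewrite /Int /Rintegral integral0. Qed.

Lemma Int_ge0 f : (forall x, 0 <= f x) -> 0 <= Int f.
Proof. by move=> f0; apply: Rintegral_ge0 => x _. Qed.

Lemma Int_ae f g : measurable_fun setT f -> measurable_fun setT g ->
  {ae m, forall x, f x = g x} -> Int f = Int g.
Proof.
move=> mf mg fg; congr fine; apply: ae_eq_integral => //; try exact/measurable_EFinP.
by apply: filterS fg => x /= -> _.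
Qed.

Lemma Int_le f g : L1 f -> L1 g -> {ae m, forall x, f x <= g x} -> Int f <= Int g.
Proof.
move=> Lf Lg fg; rewrite -subr_ge0 -IntB//.
have Lh := L1B Lg Lf.
(* Replacing [g - f] by its positive part turns the a.e. inequality into the pointwise one that
   [Int_ge0] asks for. *)
rewrite (@Int_ae _ (fun x => Num.max 0 (g x - f x))).
- by apply: Int_ge0 => x; rewrite le_max lexx.
- exact: L1_mf.
- by apply: measurable_maxr => //; exact: L1_mf.
- by apply: filterS fg => x fg; rewrite max_r// subr_ge0.
Qed.

Lemma Int_leT f g : L1 f -> L1 g -> (forall x, f x <= g x) -> Int f <= Int g.
Proof. by move=> Lf Lg fg; apply: Int_le => //; exact: aeW. Qed.

Lemma Int_norm f : L1 f -> `|Int f| <= Int (fun x => `|f x|).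
Proof. by move=> Lf; exact: le_normr_Rintegral. Qed.

Lemma Int_ge0_eq0 f : L1 f -> {ae m, forall x, 0 <= f x} -> Int f <= 0 ->
  {ae m, forall x, f x = 0}.
Proof.
move=> Lf f0 If; have mf := L1_mf Lf.
have fE : {ae m, forall x, `|f x| = f x} by apply: filterS f0 => x; exact: ger0_norm.
have : {ae m, forall x, `|f x| = 0}.
  apply: ae_meas_ge0_int => //; [exact: measurableT_comp|exact: L1_norm|].
  apply/eqP; rewrite eq_le Int_ge0// andbT (@Int_ae _ f)//; exact: measurableT_comp.
by apply: filterS => x /normr0P/eqP.
Qed.

Lemma L1_sqM f g : measurable_fun setT f -> measurable_fun setT g ->
  L1 (fun x => f x ^+ 2) -> L1 (fun x => g x ^+ 2) -> L1 (fun x => f x * g x).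
Proof.
move=> mf mg Lf Lg; apply: (@L1_domT _ (fun x => f x ^+ 2 + g x ^+ 2)).
- exact: measurable_funM.
- exact: L1D.
- move=> x; rewrite normrM -[f x ^+ 2]real_normK ?num_real// -[g x ^+ 2]real_normK ?num_real//.
  by have := sqr_ge0 (`|f x| - `|g x|); have := normr_ge0 (f x); have := normr_ge0 (g x); nra.
Qed.

Lemma L1_sqD f g : measurable_fun setT f -> measurable_fun setT g ->
  L1 (fun x => f x ^+ 2) -> L1 (fun x => g x ^+ 2) -> L1 (fun x => (f x + g x) ^+ 2).
Proof.
move=> mf mg Lf Lg.
have := L1D (L1D Lf Lg) (L1Z 2 (L1_sqM mf mg Lf Lg)).
by congr L1; apply/funext => x; ring.
Qed.

Lemma cauchy_schwarz f g : measurable_fun setT f -> measurable_fun setT g ->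
  L1 (fun x => f x ^+ 2) -> L1 (fun x => g x ^+ 2) ->
  Int (fun x => f x * g x) ^+ 2 <= Int (fun x => f x ^+ 2) * Int (fun x => g x ^+ 2).
Proof.
move=> mf mg Lf Lg; have Lfg := L1_sqM mf mg Lf Lg.
set A := Int (fun x => f x ^+ 2); set B := Int (fun x => g x ^+ 2); set C := Int _.
have q t : 0 <= A + t * (2 * C) + t ^+ 2 * B.
  have -> : A + t * (2 * C) + t ^+ 2 * B = Int (fun x => (f x + t * g x) ^+ 2).
    have L2 := L1Z (2 * t) Lfg; have L3 := L1Z (t ^+ 2) Lg.
    have -> : (fun x => (f x + t * g x) ^+ 2) =
        (fun x => f x ^+ 2 + (2 * t) * (f x * g x) + t ^+ 2 * g x ^+ 2).
      by apply/funext => x; ring.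
    rewrite (IntD (L1D Lf L2) L3) (IntD Lf L2) (IntZ _ Lfg) (IntZ _ Lg).
    by rewrite -/A -/B -/C; ring.
  by apply: Int_ge0 => x; exact: sqr_ge0.
have A0 : 0 <= A by apply: Int_ge0 => x; exact: sqr_ge0.
have B0 : 0 <= B by apply: Int_ge0 => x; exact: sqr_ge0.
have [B0'|Bn0] := eqVneq B 0.
  have C0 : C = 0.
    apply/eqP; apply: contraT => Cn0.
    (* With [B] = 0 the polynomial is affine in t, and at this point it takes the value -1. *)
    have := q (- (A + 1) / (2 * C)); rewrite B0' mulr0 addr0 divfK ?mulf_neq0 ?pnatr_eq0//; lra.
  by rewrite C0 B0' expr0n mulr0.
have := q (- C / B); have -> : A + - C / B * (2 * C) + (- C / B) ^+ 2 * B = A - C ^+ 2 / B by field.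
by rewrite subr_ge0 ler_pdivrMr// lt_neqAle eq_sym Bn0.
Qed.

Lemma DCT (f_ : nat -> T -> R) f g : (forall n, measurable_fun setT (f_ n)) ->
  measurable_fun setT f -> L1 g ->
  {ae m, forall x, f_ n x @[n --> \oo] --> f x} ->
  {ae m, forall x, forall n, `|f_ n x| <= g x} ->
  L1 f /\ Int (f_ n) @[n --> \oo] --> Int f.
Proof.
move=> mf_ mf Lg cv dom.
have mfE n : measurable_fun setT (EFin \o f_ n) by exact/measurable_EFinP.
have mfE' : measurable_fun setT (EFin \o f) by exact/measurable_EFinP.
have cv' : {ae m, forall x, setT x -> (EFin \o f_ n) x @[n --> \oo] --> (EFin \o f) x}.
  by apply: filterS cv => x cx _; apply: cvg_EFin => //; exact: nearW.
have dom' : {ae m, forall x, forall n, setT x -> (`|(EFin \o f_ n) x| <= (EFin \o g) x)%E}.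
  by apply: filterS dom => x cx n _; rewrite /= lee_fin.
have [Lf _ cvI] := dominated_convergence measurableT mfE mfE' cv' Lg dom'.
split; first exact: Lf.
have -> : Int f = fine (\int[m]_x (EFin \o f) x)%E by [].
apply: fine_cvg; rewrite fineK; first exact: cvI.
exact: (integrable_fin_num _ Lf).
Qed.

End RealIntegral.

(** * Fubini's theorem and null sets of product measures *)

Section FubiniReal.
Context d1 d2 (T1 : measurableType d1) (T2 : measurableType d2) (R : realType).
Context (m1 : {sigma_finite_measure set T1 -> \bar R}).
Context (m2 : {sigma_finite_measure set T2 -> \bar R}).
Implicit Type f : T1 * T2 -> R.

Lemma mf_pairr f x : measurable_fun setT f -> measurable_fun setT (fun y => f (x, y)).
Proof. by move=> mf; apply: (measurableT_comp mf); exact: measurable_pair1. Qed.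

Lemma mf_pairl f y : measurable_fun setT f -> measurable_fun setT (fun x => f (x, y)).
Proof. by move=> mf; apply: (measurableT_comp mf); exact: measurable_pair2. Qed.

Lemma fub1 f : L1 (m1 \x m2)%E f ->
  [/\ {ae m1, forall x, L1 m2 (fun y => f (x, y))},
      L1 m1 (fun x => Int m2 (fun y => f (x, y))) &
      Int (m1 \x m2)%E f = Int m1 (fun x => Int m2 (fun y => f (x, y)))].
Proof.
move=> Lf.
have h1 : {ae m1, forall x, L1 m2 (fun y => f (x, y))} by exact: (ae_integrable1 Lf).
have h2 := integrable_fubini_F Lf.
have mF : measurable_fun setT (fun x => Int m2 (fun y => f (x, y))).
  exact: (measurableT_comp (fine_measurable measurableT) (measurable_int _ h2)).
have h3 : {ae m1, forall x, fubini_F m2 (EFin \o f) x = (Int m2 (fun y => f (x, y)))%:E}.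
  by apply: filterS h1 => x hx; rewrite -L1_finE.
have mFE : measurable_fun setT (fun x => (Int m2 (fun y => f (x, y)))%:E).
  exact/measurable_EFinP.
split => //.
- apply/integrableP; split => //.
  have /integrableP[mh2] := h2; apply: le_lt_trans.
  apply: ae_ge0_le_integral => //; [exact: measurableT_comp|exact: measurableT_comp|].
  by apply: filterS h3 => x hx _ /=; rewrite hx.
- congr fine; rewrite -(integral12_prod_meas1 Lf); apply: ae_eq_integral => //.
    exact: (measurable_int _ h2).
  by apply: filterS h3 => x hx _; rewrite hx.
Qed.

Lemma fub2 f : L1 (m1 \x m2)%E f ->
  [/\ {ae m2, forall y, L1 m1 (fun x => f (x, y))},
      L1 m2 (fun y => Int m1 (fun x => f (x, y))) &
      Int (m1 \x m2)%E f = Int m2 (fun y => Int m1 (fun x => f (x, y)))].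
Proof.
move=> Lf.
have h1 : {ae m2, forall y, L1 m1 (fun x => f (x, y))} by exact: (ae_integrable2 Lf).
have mEf := measurable_int _ Lf.
have mabs : measurable_fun setT (abse \o (EFin \o f)) by exact: measurableT_comp.
have h2 : m2.-integrable setT (fubini_G m1 (EFin \o f)).
  apply/integrableP; split; first exact: (measurable_fubini_G Lf).
  have := (integrable21ltyP m1 m2 mEf).1 Lf; apply: le_lt_trans.
  apply: ge0_le_integral => //.
  - by apply: measurableT_comp => //; exact: (measurable_fubini_G Lf).
  - by apply: (measurable_fun_fubini_tonelli_G (abse \o (EFin \o f))) => //=.
  - by move=> y _; apply: le_abse_integral => //; exact: (measurableT_comp mEf (measurable_pair2 y)).
have mF : measurable_fun setT (fun y => Int m1 (fun x => f (x, y))).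
  exact: (measurableT_comp (fine_measurable measurableT) (measurable_int _ h2)).
have h3 : {ae m2, forall y, fubini_G m1 (EFin \o f) y = (Int m1 (fun x => f (x, y)))%:E}.
  by apply: filterS h1 => x hx; rewrite -L1_finE.
have mFE : measurable_fun setT (fun y => (Int m1 (fun x => f (x, y)))%:E).
  exact/measurable_EFinP.
split => //.
- apply/integrableP; split => //.
  have /integrableP[mh2] := h2; apply: le_lt_trans.
  apply: ae_ge0_le_integral => //; [exact: measurableT_comp|exact: measurableT_comp|].
  by apply: filterS h3 => x hx _ /=; rewrite hx.
- congr fine; rewrite -(integral21_prod_meas1 Lf); apply: ae_eq_integral => //.
    exact: (measurable_int _ h2).
  by apply: filterS h3 => x hx _; rewrite hx.
Qed.

Lemma L1_prod12 f : measurable_fun setT f ->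
  (\int[m1]_x \int[m2]_y `|f (x, y)|%:E < +oo)%E -> L1 (m1 \x m2)%E f.
Proof. by move=> mf h; apply/integrable12ltyP => //; exact/measurable_EFinP. Qed.

Lemma L1_prod21 f : measurable_fun setT f ->
  (\int[m2]_y \int[m1]_x `|f (x, y)|%:E < +oo)%E -> L1 (m1 \x m2)%E f.
Proof. by move=> mf h; apply/integrable21ltyP => //; exact/measurable_EFinP. Qed.

Lemma L1_tensor (f1 : T1 -> R) (f2 : T2 -> R) : L1 m1 f1 -> L1 m2 f2 ->
  L1 (m1 \x m2)%E (fun p => f1 p.1 * f2 p.2) /\
  Int (m1 \x m2)%E (fun p => f1 p.1 * f2 p.2) = Int m1 f1 * Int m2 f2.
Proof.
move=> L1f L2f.
have L : L1 (m1 \x m2)%E (fun p => f1 p.1 * f2 p.2).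
  apply: L1_prod12.
    apply: measurable_funM; first exact: (measurableT_comp (L1_mf L1f) measurable_fst).
    exact: (measurableT_comp (L1_mf L2f) measurable_snd).
  rewrite (_ : (\int[m1]_x _)%E = (Int m1 (fun x => `|f1 x| * Int m2 (fun y => `|f2 y|)))%:E) ?ltry//.
  rewrite -L1_finE; last first.
    have := L1Z (Int m2 (fun y => `|f2 y|)) (L1_norm L1f).
    by congr L1; apply/funext => x; rewrite mulrC.
  apply: eq_integral => x _; rewrite -IntZ; last exact: L1_norm.
  rewrite -L1_finE; last by apply: L1Z; exact: L1_norm.
  by apply: eq_integral => y _; rewrite normrM.
split => //; have [_ _ ->] := fub1 L.
have -> : (fun x => Int m2 (fun y => f1 (x, y).1 * f2 (x, y).2)) =
          (fun x => Int m2 f2 * f1 x).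
  by apply/funext => x /=; rewrite IntZ// mulrC.
by rewrite IntZ// mulrC.
Qed.

Lemma ae_prod1 (P : T1 * T2 -> Prop) : {ae (m1 \x m2)%E, forall p, P p} ->
  {ae m1, forall x, {ae m2, forall y, P (x, y)}}.
Proof.
move=> [N [mN N0 PN]].
have : (\int[m1]_x `|m2 (xsection N x)| = 0)%E.
  rewrite -[RHS]N0; apply: eq_integral => x _; rewrite gee0_abs//.
move/(ae_eq_integral_abs m1 measurableT) => h.
have {}h := h (measurable_fun_xsection m2 mN).
apply: filterS h => x /(_ I) /= h0.
exists (xsection N x); split => //; first exact: measurable_xsection.
by move=> y /= nP; rewrite /xsection /= inE; apply: PN.
Qed.

Lemma ae_prod2 (P : T1 * T2 -> Prop) : {ae (m1 \x m2)%E, forall p, P p} ->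
  {ae m2, forall y, {ae m1, forall x, P (x, y)}}.
Proof.
move=> [N [mN N0 PN]].
have N0' : (m1 \x^ m2)%E N = 0.
  rewrite -N0; apply/esym; apply: product_measure_unique => // A B mA mB.
  by rewrite /= product_measure2E.
have : (\int[m2]_y `|m1 (ysection N y)| = 0)%E.
  rewrite -[RHS]N0'; apply: eq_integral => x _; rewrite gee0_abs//.
move/(ae_eq_integral_abs m2 measurableT) => h.
have {}h := h (measurable_fun_ysection m1 mN).
apply: filterS h => y /(_ I) /= h0.
exists (ysection N y); split => //; first exact: measurable_ysection.
by move=> x /= nP; rewrite /ysection /= inE; apply: PN.
Qed.

Lemma prod_ae1 (P : T1 * T2 -> Prop) : measurable [set p | P p] ->
  {ae m1, forall x, {ae m2, forall y, P (x, y)}} -> {ae (m1 \x m2)%E, forall p, P p}.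
Proof.
move=> mP h; exists (~` [set p | P p]); split => //; first exact: measurableC.
rewrite /product_measure1 /=.
rewrite (ae_eq_integral (cst 0%E)) ?integral0//.
  exact: (measurable_fun_xsection m2 (measurableC mP)).
apply: filterS h => x hx _ /=.
apply: measure_negligible; first by apply: measurable_xsection; exact: measurableC.
by apply: negligibleS hx => y /=; rewrite /xsection /= inE.
Qed.

Lemma prod_ae2 (P : T1 * T2 -> Prop) : measurable [set p | P p] ->
  {ae m2, forall y, {ae m1, forall x, P (x, y)}} -> {ae (m1 \x m2)%E, forall p, P p}.
Proof.
move=> mP h; exists (~` [set p | P p]); split => //; first exact: measurableC.
(* The product measure integrates the measures of x-sections; uniqueness on rectangles identifies it
   with the one that integrates the measures of y-sections. *)
transitivity ((m1 \x^ m2)%E (~` [set p | P p])).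
  apply: product_measure_unique => // [A B mA mB|]; last exact: measurableC.
  by rewrite /= product_measure2E.
rewrite /product_measure2 /=.
rewrite (ae_eq_integral (cst 0%E)) ?integral0//.
  exact: (measurable_fun_ysection m1 (measurableC mP)).
apply: filterS h => x hx _ /=.
apply: measure_negligible; first by apply: measurable_ysection; exact: measurableC.
by apply: negligibleS hx => y /=; rewrite /ysection /= inE.
Qed.

Lemma measurable_eq_set f g : measurable_fun setT f -> measurable_fun setT g ->
  measurable [set p | f p = g p].
Proof.
move=> mf mg; rewrite (_ : [set p | _] = (f \- g) @^-1` [set 0]).
  by rewrite -[X in measurable X]setTI; apply: (measurable_funB mf mg).
by apply/seteqP; split => p /=; [move=> ->; rewrite subrr|move/eqP; rewrite subr_eq0 => /eqP].
Qed.

End FubiniReal.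

(** Rounding both coordinates down to the grid of mesh 1/(n+1) leaves countably many values, so the
    rounded composite is measurable; continuity of [F] then gives the composite as a pointwise
    limit. *)
Lemma measurable_comp2 {R : realType} d (T : measurableType d) (F : R * R -> R) (f g : T -> R) :
  continuous F -> measurable_fun setT f -> measurable_fun setT g ->
  measurable_fun setT (fun x => F (f x, g x)).
Proof.
move=> cF mf mg.
pose q (n : nat) (x : R) : R := (Num.floor (x * n.+1%:R))%:~R / n.+1%:R.
have q_cvg x : q n x @[n --> \oo] --> x.
  apply/cvgrPdist_le => e e0.
  near=> n.
  rewrite /q; have n0 : (0:R) < n.+1%:R by [].
  have /andP[] := floor_itv (x * n.+1%:R).
  set z := Num.floor _; rewrite intrD -[1%:~R]/(1:R) => h2 h1.
  have -> : x - z%:~R / n.+1%:R = (x * n.+1%:R - z%:~R) / n.+1%:R by rewrite mulrBl mulfK// gt_eqF.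
  rewrite ger0_norm; last by rewrite divr_ge0 ?subr_ge0// ltW.
  rewrite ler_pdivrMr//; apply: (@le_trans _ _ 1); first lra.
  rewrite mulrC -ler_pdivrMr// div1r.
  have : e^-1 <= n%:R by near: n; exact: nbhs_infty_ger.
  by rewrite -[n.+1%:R]natr1; lra.
apply: (@measurable_fun_cvg _ _ _ _ (fun n x => F (q n (f x), q n (g x)))) => //; last first.
  move=> x _; apply: (cvg_comp (fun n => (q n (f x), q n (g x))) F _ (cF (f x, g x))).
  exact: (cvg_pair (q_cvg (f x)) (q_cvg (g x))).
move=> n _ Y mY; rewrite setTI.
have mfl (h : T -> R) (r : rat) : measurable_fun setT h ->
    measurable [set x | Num.floor (h x * n.+1%:R) = numq r].
  move=> mh; rewrite (_ : [set x | _] = (fun x => h x * n.+1%:R) @^-1`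
    `[(numq r)%:~R, (numq r + 1)%:~R[).
    rewrite -[X in measurable X]setTI.
    by apply: (measurable_funM mh (measurable_cst _)).
  apply/seteqP; split => x /=; rewrite in_itv /= -floor_eq; first by move=> ->.
  by move/eqP.
(* Grid points are indexed by numerators of rationals, which makes the preimage a union over pairs
   of rationals. *)
pose c (r r' : rat) : bool := `[< Y (F ((numq r)%:~R / n.+1%:R, (numq r')%:~R / n.+1%:R)) >].
rewrite (_ : _ @^-1` Y = \bigcup_(r : rat) \bigcup_(r' : rat)
  (if c r r' then [set x | Num.floor (f x * n.+1%:R) = numq r] `&`
                   [set x | Num.floor (g x * n.+1%:R) = numq r'] else set0)).
  apply: bigcupT_measurable_rat => r; apply: bigcupT_measurable_rat => r'.
  by case: ifP => // _; apply: measurableI; exact: mfl.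
apply/seteqP; split => x /=.
  move=> Yx; exists (Num.floor (f x * n.+1%:R))%:~R => //.
  exists (Num.floor (g x * n.+1%:R))%:~R => //.
  by rewrite /c !numq_int; case: asboolP.
by move=> [r _ [r' _]]; case: ifP => // /asboolP Yrr [e1 e2]; rewrite /q e1 e2.
Unshelve. all: end_near. Qed.

#[global] Instance ae_leb_filter {R : realType} :
  Filter (almost_everywhere (@lebesgue_measure R)).
Proof. exact: (ae_filter_ringOfSetsType (@lebesgue_measure R)). Qed.

(** * Absolutely continuous functions on the line and their chain rule *)

Section AbsolutelyContinuous.
Context {R : realType}.
Implicit Types (f g h : R -> R) (a b c t x y : R).
Local Notation leb := (@lebesgue_measure R).

Definition ind a b : R -> R := \1_(`[a, b]%classic : set R).

Lemma indE a b t : ind a b t = if a <= t <= b then 1 else 0.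
Proof. by rewrite /ind indicE mem_setE in_itv; case: (_ <= _ <= _). Qed.

Lemma ind_bnd a b t : `|ind a b t| <= 1.
Proof. by rewrite indE; case: (_ <= _ <= _); rewrite ?normr1 ?normr0. Qed.

Lemma ind_ge0 a b t : 0 <= ind a b t.
Proof. by rewrite indE; case: (_ <= _ <= _). Qed.

Lemma mf_ind a b : measurable_fun [set: R] (ind a b).
Proof. exact: measurable_indic. Qed.

Definition li g := forall a b, L1 leb (fun t => ind a b t * g t).
(** The indicator makes this 0 for [b < a], not the oriented integral. *)
Definition J a b g := Int leb (fun t => ind a b t * g t).

Lemma ind_patch a b g : (fun t => ind a b t * g t) = g \_ `[a, b].
Proof. by rewrite patch_indic; apply/funext => t /=; rewrite mulrC. Qed.

Lemma li_integrable a b g : L1 leb (fun t => ind a b t * g t) <->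
  leb.-integrable `[a, b] (EFin \o g).
Proof.
rewrite /L1 ind_patch -restrict_EFin; apply: iff_sym.
exact: integrable_mkcond.
Qed.

Lemma J_itv a b g : J a b g = Rintegral leb `[a, b] g.
Proof. by rewrite /J ind_patch /Int -Rintegral_mkcond. Qed.

Lemma L1_mf_li g : measurable_fun setT g -> L1 leb g -> li g.
Proof. by move=> mg Lg a b; apply: (@L1_bM _ _ _ _ 1) => //; [exact: mf_ind|exact: ind_bnd]. Qed.

Lemma li_mf g : li g -> measurable_fun setT g.
Proof.
move=> lg; apply: (@measurable_fun_cvg _ _ _ _ (fun (n : nat) t => ind (- n%:R) n%:R t * g t)) => //.
  by move=> n; exact: (L1_mf (lg _ _)).
move=> t _; apply: cvg_near_cst; near=> n.
rewrite indE (_ : (- n%:R <= t <= n%:R) = true) /= ?mul1r//.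
by rewrite -ler_norml; near: n; exact: nbhs_infty_ger.
Unshelve. all: end_near. Qed.

Lemma liD f g : li f -> li g -> li (fun t => f t + g t).
Proof.
by move=> lf lg a b; have := L1D (lf a b) (lg a b); congr L1; apply/funext => t; rewrite mulrDr.
Qed.

Lemma liZ c g : li g -> li (fun t => c * g t).
Proof. by move=> lg a b; have := L1Z c (lg a b); congr L1; apply/funext => t; rewrite mulrCA. Qed.

Lemma li_norm g : li g -> li (fun t => `|g t|).
Proof.
by move=> lg a b; have := L1_norm (lg a b); congr L1; apply/funext => t; rewrite normrM (ger0_norm (ind_ge0 _ _ _)).
Qed.

Lemma cont_bnd h a b : continuous h -> exists2 C, 0 <= C & forall t, a <= t <= b -> `|h t| <= C.
Proof.
move=> ch; have [ab|ba] := leP a b; last first.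
  by exists 0 => // t /andP[h1 h2]; move: (lt_le_trans ba (le_trans h1 h2)); rewrite ltxx.
have cn : {within `[a, b], continuous (fun t => `|h t|)}.
  apply: continuous_subspaceT => t; apply: continuous_comp; first exact: ch.
  exact: norm_continuous.
have [c _ hc] := EVT_max ab cn.
by exists `|h c| => // t tab; apply: hc; rewrite in_itv.
Qed.

Lemma li_contM h g : continuous h -> li g -> li (fun t => h t * g t).
Proof.
move=> ch lg a b; have [C C0 hC] := cont_bnd a b ch.
have mh : measurable_fun setT h by exact: continuous_measurable_fun.
have h1 : L1 leb (fun x => (ind a b x * h x) * (ind a b x * g x)).
  apply: (@L1_bM _ _ _ _ C) => //; first exact: (measurable_funM (mf_ind a b) mh).
  move=> x; rewrite normrM indE; case: ifPn => [xab|_]; last by rewrite normr0 mul0r.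
  by rewrite normr1 mul1r; exact: hC.
move: h1; congr L1; apply/funext => x; rewrite indE.
by case: (a <= x <= b) => /=; ring.
Qed.

Lemma li_cont h : continuous h -> li h.
Proof.
move=> ch a b; apply/li_integrable; apply: continuous_compact_integrable.
  exact: segment_compact.
exact: continuous_subspaceT.
Qed.

Lemma J_cat a b c g : li g -> a <= b <= c -> J a c g = J a b g + J b c g.
Proof.
move=> lg /andP[ab bc]; rewrite !J_itv.
have ig x y : leb.-integrable `[x, y] (EFin \o g) by exact/li_integrable.
rewrite -(subrK (Rintegral leb `[a, b] g) (Rintegral leb `[a, c] g)) addrC; congr (_ + _).
rewrite Rintegral_itvB ?bnd_simp//.
rewrite Rintegral_itv_obnd_cbnd//.
by apply: integrableS (ig b c) => //; exact: subset_itv_oc_cc.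
Qed.

Lemma J_D a b f g : li f -> li g -> J a b (fun t => f t + g t) = J a b f + J a b g.
Proof. by move=> lf lg; rewrite -IntD//; congr Int; apply/funext => t; rewrite mulrDr. Qed.

Lemma J_Z a b c g : li g -> J a b (fun t => c * g t) = c * J a b g.
Proof. by move=> lg; rewrite -IntZ//; congr Int; apply/funext => t; rewrite mulrCA. Qed.

Lemma J_le a b f g : li f -> li g -> (forall t, a <= t <= b -> f t <= g t) ->
  J a b f <= J a b g.
Proof.
move=> lf lg fg; apply: Int_leT => // t; rewrite indE.
by case: ifPn => [tab|]; rewrite ?mul0r// !mul1r; exact: fg.
Qed.

Lemma J_norm a b g : li g -> `|J a b g| <= J a b (fun t => `|g t|).
Proof.
move=> lg; apply: (le_trans (Int_norm (lg a b))); rewrite le_eqVlt; apply/orP; left; apply/eqP.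
by congr Int; apply/funext => t; rewrite normrM (ger0_norm (ind_ge0 _ _ _)).
Qed.

Lemma J_cst a b c : a <= b -> J a b (fun=> c) = c * (b - a).
Proof.
move=> ab; rewrite J_itv Rintegral_cst//= lebesgue_measure_itv/= lte_fin.
by move: ab; rewrite le_eqVlt => /predU1P[->|->]//; rewrite ltxx subrr.
Qed.

Lemma J_ae a b f g : measurable_fun setT f -> measurable_fun setT g ->
  {ae leb, forall t, a <= t <= b -> f t = g t} -> J a b f = J a b g.
Proof.
move=> mf mg fg; apply: Int_ae.
- exact: (measurable_funM (mf_ind _ _) mf).
- exact: (measurable_funM (mf_ind _ _) mg).
- by apply: filterS fg => t; rewrite indE; case: ifPn => [_ ->|]//; rewrite !mul0r.
Qed.

Lemma J_xx a g : J a a g = 0.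
Proof. by rewrite J_itv set_itv1 Rintegral_set1. Qed.

Lemma J_continuous g a : li g -> forall x, a < x -> {for x, continuous (fun y => J a y g)}.
Proof.
move=> lg x ax.
have h : {within `[a, x + 1], continuous (fun y => Rintegral leb `[a, y] g)}.
  apply: parameterized_integral_continuous; first lra.
  exact/li_integrable.
have -> : (fun y => J a y g) = (fun y => Rintegral leb `[a, y] g) by apply/funext => y; rewrite J_itv.
move: h; rewrite continuous_subspace_in => /(_ x); rewrite inE/= in_itv/= => h.
have xin : x \in `]a, x + 1[%classic by rewrite inE/= in_itv/=; lra.
have : {within `]a, x + 1[, continuous (fun y => Rintegral leb `[a, y] g)}.
  apply: (@continuous_subspaceW _ _ _ `[a, x + 1]); first exact: subset_itv_oo_cc.
  apply: parameterized_integral_continuous; first lra.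
  exact/li_integrable.
by rewrite continuous_open_subspace; [move=> /(_ x xin)|exact: interval_open].
Qed.

(** Local absolute continuity in integrated form: [g] is any a.e. derivative of [f] and may be
    changed on a null set. *)
Definition ac f g := li g /\ forall a b, a <= b -> f b - f a = J a b g.

Lemma ac_continuous f g : ac f g -> continuous f.
Proof.
move=> [lg fg] x.
have fE : f x = f (x - 1) + J (x - 1) x g by rewrite -fg; [ring|lra].
rewrite /continuous_at fE.
apply: (@cvg_trans _ ((f (x - 1) + J (x - 1) y g) @[y --> x])); last first.
  have h1 : (fun _ : R => f (x - 1)) @ x --> f (x - 1) by exact: cvg_cst.
  have h2 : (fun y => J (x - 1) y g) @ x --> J (x - 1) x g by apply: J_continuous => //; lra.
  exact: (cvgD h1 h2).
apply: near_eq_cvg; near=> y; rewrite -fg; first by ring.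
by near: y; apply/nbhs_ballP; exists 1 => //= z; rewrite /ball/= ltr_norml; lra.
Unshelve. all: end_near. Qed.

(** Let S be the supremum of the points up to which the estimate holds from [a]. Around S it holds
    on every short interval containing S, so it reaches S and passes beyond unless S = [b]. This
    lets the chain rule be proved without differentiating almost everywhere. *)
Lemma gauge (D V : R -> R) a b : a <= b ->
  (forall t, a <= t <= b -> exists2 e, 0 < e & forall x y, a <= x -> y <= b ->
    t - e < x -> x <= t -> t <= y -> y < t + e -> `|D y - D x| <= V y - V x) ->
  `|D b - D a| <= V b - V a.
Proof.
move=> ab H.
pose S := [set s | a <= s <= b /\ `|D s - D a| <= V s - V a].
have Sa : S a by split; [rewrite lexx|rewrite !subrr normr0].
have hS : has_sup S.
  by split; [exists a|exists b => s [/andP[]]].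
have as_ : a <= sup S by exact: (sup_upper_bound hS Sa).
have sb : sup S <= b by apply: ge_sup; [exists a|move=> s [/andP[]]].
have [e e0 He] := H (sup S) (introT andP (conj as_ sb)).
have [x Sx ex] := sup_adherent e0 hS.
have [/andP[ax xb] Dx] := Sx.
have xs : x <= sup S by exact: (sup_upper_bound hS Sx).
pose y := Num.min (sup S + e / 2) b.
have sy : sup S <= y by rewrite le_min sb andbT; lra.
have yb : y <= b by rewrite ge_min lexx orbT.
have Dyx : `|D y - D x| <= V y - V x.
  apply: He => //; rewrite /y gt_min; apply/orP; left; lra.
have Sy : S y.
  split; first by rewrite (le_trans as_ sy).
  have -> : D y - D a = (D y - D x) + (D x - D a) by ring.
  by apply: (le_trans (ler_normD _ _)); lra.
have ys : y <= sup S by exact: (sup_upper_bound hS Sy).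
have yE : y = b.
  move: ys; rewrite /y; have [|_ _] := leP (sup S + e / 2) b => //; lra.
by have [_] := Sy; rewrite yE.
Qed.

Definition C1 (F F1 F2 : R * R -> R) :=
  [/\ continuous F1, continuous F2,
      forall x y : R, is_derive x 1 (fun x => F (x, y)) (F1 (x, y)) &
      forall x y : R, is_derive y 1 (fun y => F (x, y)) (F2 (x, y))].

Lemma MVT_lin h (dh : R -> R) x y c (e : R) : (forall z : R, is_derive z 1 h (dh z)) ->
  (forall z, Num.min x y <= z <= Num.max x y -> `|dh z - c| <= e) ->
  `|h y - h x - c * (y - x)| <= e * `|y - x|.
Proof.
move=> hd.
have hc z : {for z, continuous h}.
  by apply: differentiable_continuous; apply/derivable1_diffP; have [] := hd z.
wlog xy : x y / x < y => [W H|H].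
  have [xy|yx|<-] := ltgtP x y.
  - exact: W.
  - have -> : h y - h x - c * (y - x) = - (h x - h y - c * (x - y)) by ring.
    rewrite normrN (distrC y x).
    by apply: W => // z; rewrite minC maxC; exact: H.
  - by rewrite !subrr mulr0 subr0 normr0 mulr0.
have [z zxy ->] := @MVT_segment _ h dh x y (ltW xy) (fun z _ => hd z) (continuous_subspaceT hc).
rewrite -mulrBl normrM ler_wpM2r//; apply: H.
by move: zxy; rewrite in_itv/= min_l ?max_r// ltW.
Qed.

(** Strict differentiability: both end points of the increment are free near [p], as intervals that
    merely contain a point require in [gauge]. *)
Lemma C1_lin F F1 F2 (p : R * R) (e : R) : C1 F F1 F2 -> 0 < e ->
  exists2 d, 0 < d & forall x y x' y', `|x - p.1| < d -> `|y - p.2| < d ->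
    `|x' - p.1| < d -> `|y' - p.2| < d ->
  `|F (x', y') - F (x, y) - F1 p * (x' - x) - F2 p * (y' - y)| <=
     e * (`|x' - x| + `|y' - y|).
Proof.
move=> [c1 c2 d1 d2] e0.
have n1 := c1 p; have n2 := c2 p.
move/cvgrPdist_le: n1 => /(_ e e0); move/cvgrPdist_le: n2 => /(_ e e0) => n2 n1.
have : \forall z \near p, `|F1 p - F1 z| <= e /\ `|F2 p - F2 z| <= e.
  by near=> z; split; near: z.
move=> /nbhs_ballP[d d0 Hd]; exists d => // x y x' y' hx hy hx' hy'.
have Hd' u v : `|u - p.1| < d -> `|v - p.2| < d ->
    `|F1 (u, v) - F1 p| <= e /\ `|F2 (u, v) - F2 p| <= e.
  move=> hu hv; rewrite (distrC _ (F1 p)) (distrC _ (F2 p)); apply: (Hd (u, v)).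
  by split; rewrite /ball/= distrC.
have btw u u' z q : `|u - q| < d -> `|u' - q| < d -> Num.min u u' <= z <= Num.max u u' ->
    `|z - q| < d.
  move=> h1 h2 h3; move: h1 h2; rewrite !ltr_norml => /andP[? ?] /andP[? ?].
  move: h3; rewrite ge_min le_max => /andP[/orP[?|?] /orP[?|?]]; lra.
have -> : F (x', y') - F (x, y) - F1 p * (x' - x) - F2 p * (y' - y) =
  (F (x', y') - F (x, y') - F1 p * (x' - x)) + (F (x, y') - F (x, y) - F2 p * (y' - y)) by ring.
apply: (le_trans (ler_normD _ _)); rewrite [e * _]mulrDr; apply: lerD.
  apply: (@MVT_lin (fun x => F (x, y')) (fun x => F1 (x, y'))) => z hz.
  by apply: (Hd' _ _ _ _).1 => //; exact: (btw _ _ _ _ _ _ hz).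
apply: (@MVT_lin (fun y => F (x, y)) (fun y => F2 (x, y))) => z hz.
by apply: (Hd' _ _ _ _).2 => //; exact: (btw _ _ _ _ _ _ hz).
Unshelve. all: end_near. Qed.

Lemma C1_continuous F F1 F2 : C1 F F1 F2 -> continuous F.
Proof.
move=> C p; have [d d0 Hd] := C1_lin p C ltr01.
apply/cvgrPdist_lt => e e0.
have K0 : 0 < `|F1 p| + `|F2 p| + 2 by have := normr_ge0 (F1 p); have := normr_ge0 (F2 p); lra.
have m0 : 0 < Num.min d (e / (`|F1 p| + `|F2 p| + 2)) by rewrite lt_min d0 divr_gt0.
apply: filterS (@nbhsx_ballx R (R * R)%type p _ m0) => -[u v] [/=]; rewrite /ball/= !lt_min => /andP[h1 h2] /andP[h3 h4].
have dd1 : `|p.1 - p.1| < d by rewrite subrr normr0.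
have dd2 : `|p.2 - p.2| < d by rewrite subrr normr0.
have := Hd p.1 p.2 u v dd1 dd2; rewrite ![`|_ - p.1|]distrC ![`|_ - p.2|]distrC -surjective_pairing.
move=> /(_ h1 h3); move: h2 h4; rewrite !ltr_pdivlMr// => h2 h4 h5.
rewrite distrC.
have -> : F (u, v) - F p = (F (u, v) - F p - F1 p * (u - p.1) - F2 p * (v - p.2)) + (F1 p * (u - p.1) + F2 p * (v - p.2)) by ring.
apply: (le_lt_trans (ler_normD _ _)).
have h6 : `|F1 p * (u - p.1) + F2 p * (v - p.2)| <= `|F1 p| * `|p.1 - u| + `|F2 p| * `|p.2 - v|.
  by apply: (le_trans (ler_normD _ _)); rewrite !normrM ![`|_ - p.1|]distrC ![`|_ - p.2|]distrC.
have := normr_ge0 (F1 p); have := normr_ge0 (F2 p); have := normr_ge0 (p.1 - u); have := normr_ge0 (p.2 - v).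
set A := `|F1 p|; set B := `|F2 p|; set X := `|p.1 - u|; set Y := `|p.2 - v|.
move: h2 h4 h5 h6; rewrite -/A -/B -/X -/Y mul1r => h2 h4 h5 h6 ? ? ? ?.
apply: (@le_lt_trans _ _ ((X + Y) + (A * X + B * Y))); first by apply: lerD.
nra.
Qed.

(** On a short interval around t, the increment of the composite differs from the linear one, with
    partial derivatives frozen at t, by at most e times the integral of |g1| + |g2|; freezing the
    coefficients under the integral costs as much again. So [gauge] applies with 2e times that
    integral as the control, and e is arbitrary. *)
Lemma ac_chain F F1 F2 f1 g1 f2 g2 : C1 F F1 F2 -> ac f1 g1 -> ac f2 g2 ->
  ac (fun t => F (f1 t, f2 t))
     (fun t => F1 (f1 t, f2 t) * g1 t + F2 (f1 t, f2 t) * g2 t).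
Proof.
move=> CF A1 A2; have [l1 E1] := A1; have [l2 E2] := A2.
have c1 := ac_continuous A1; have c2 := ac_continuous A2.
have [cF1 cF2 _ _] := CF.
have cH (H : R * R -> R) : continuous H -> continuous (fun t => H (f1 t, f2 t)).
  move=> cH t; apply: (cvg_comp (fun t => (f1 t, f2 t)) H _ (cH _)).
  exact: (cvg_pair (c1 t) (c2 t)).
have lk1 := li_contM (cH _ cF1) l1; have lk2 := li_contM (cH _ cF2) l2.
have lk := liD lk1 lk2.
split => // a b ab; set k := (fun t => _) in lk *.
pose V0 t := `|g1 t| + `|g2 t|.
have lV : li V0 by apply: liD; exact: li_norm.
suff main e : 0 < e -> `|F (f1 b, f2 b) - F (f1 a, f2 a) - J a b k| <= 2 * e * J a b V0.
  apply/eqP; rewrite -subr_eq0 -normr_le0; apply/ler_addgt0Pr => e e0; rewrite add0r.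
  have K0 : 0 <= J a b V0.
    by apply: Int_ge0 => t; rewrite mulr_ge0 ?ind_ge0// addr_ge0.
  apply: (le_trans (main (e / (2 * (J a b V0 + 1))) _)); first by rewrite divr_gt0//; lra.
  have -> : 2 * (e / (2 * (J a b V0 + 1))) * J a b V0 = e * (J a b V0 / (J a b V0 + 1)) by field; lra.
  apply: ler_piMr; first exact: ltW.
  by rewrite ler_pdivrMr; lra.
move=> e0.
have := @gauge (fun t => F (f1 t, f2 t) - J a t k) (fun t => 2 * e * J a t V0) a b ab.
rewrite !J_xx mulr0 !subr0 => G.
rewrite addrAC; apply: G => t tab.
have [d d0 Hd] := C1_lin (f1 t, f2 t) CF e0.
have [dA dA0 HA] : exists2 r, 0 < r & forall x, `|x - t| < r ->
   [/\ `|f1 x - f1 t| < d, `|f2 x - f2 t| < d,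
     `|F1 (f1 x, f2 x) - F1 (f1 t, f2 t)| <= e & `|F2 (f1 x, f2 x) - F2 (f1 t, f2 t)| <= e].
  have : \forall x \near t, [/\ `|f1 t - f1 x| < d, `|f2 t - f2 x| < d,
     `|F1 (f1 t, f2 t) - F1 (f1 x, f2 x)| <= e & `|F2 (f1 t, f2 t) - F2 (f1 x, f2 x)| <= e].
    near=> x; split.
    - by near: x; move/cvgrPdist_lt : (c1 t); exact.
    - by near: x; move/cvgrPdist_lt : (c2 t); exact.
    - by near: x; move/cvgrPdist_le : (cH _ cF1 t); exact.
    - by near: x; move/cvgrPdist_le : (cH _ cF2 t); exact.
  move=> /nbhs_ballP[r r0 Hr]; exists r => // x hx.
  have := Hr x; rewrite /ball/= distrC => /(_ hx).
  by rewrite ![`|_ - f1 x|]distrC ![`|_ - f2 x|]distrC ![`|_ - F1 (f1 x, f2 x)|]distrC ![`|_ - F2 (f1 x, f2 x)|]distrC.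
exists dA => // x y ax yb tx xt ty yt.
have nx : `|x - t| < dA by rewrite ltr_norml; lra.
have ny : `|y - t| < dA by rewrite ltr_norml; lra.
have [h1 h2 _ _] := HA _ nx; have [h3 h4 _ _] := HA _ ny.
have := Hd _ _ _ _ h1 h2 h3 h4; have xy : x <= y by lra.
rewrite /= (E1 _ _ xy) (E2 _ _ xy) => h5.
have -> : F (f1 y, f2 y) - J a y k - (F (f1 x, f2 x) - J a x k) =
   F (f1 y, f2 y) - F (f1 x, f2 x) - J x y k.
  by rewrite (@J_cat a x y)// ?ax//; ring.
rewrite (@J_cat a x y V0) ?ax//.
have -> : 2 * e * (J a x V0 + J x y V0) - 2 * e * J a x V0 = 2 * e * J x y V0 by ring.
have EJ : J x y k = J x y (fun t => F1 (f1 t, f2 t) * g1 t) + J x y (fun t => F2 (f1 t, f2 t) * g2 t) by rewrite -J_D.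
have dif (H : R * R -> R) g : continuous H -> li g ->
   (forall s, `|s - t| < dA -> `|H (f1 s, f2 s) - H (f1 t, f2 t)| <= e) ->
   `|H (f1 t, f2 t) * J x y g - J x y (fun t => H (f1 t, f2 t) * g t)| <= e * J x y (fun t => `|g t|).
  move=> cHH lg HH.
  have lHg := li_contM (cH _ cHH) lg.
  rewrite -normrN opprB -J_Z// -mulN1r -J_Z; last exact: liZ.
  rewrite -J_D//; last by apply: liZ; exact: liZ.
  have lq := liD lHg (liZ (-1) (liZ (H (f1 t, f2 t)) lg)).
  apply: (le_trans (J_norm _ _ lq)); rewrite -J_Z; last exact: li_norm.
  apply: J_le; [exact: li_norm|by apply: liZ; exact: li_norm|move=> s sxy].
  have -> : H (f1 s, f2 s) * g s + -1 * (H (f1 t, f2 t) * g s) = (H (f1 s, f2 s) - H (f1 t, f2 t)) * g s by ring.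
  by rewrite normrM ler_wpM2r//; apply: HH; rewrite ltr_norml; lra.
have k1 := dif _ _ cF1 l1 (fun s hs => let: And4 _ _ h _ := HA s hs in h).
have k2 := dif _ _ cF2 l2 (fun s hs => let: And4 _ _ _ h := HA s hs in h).
have k3 := J_norm x y l1; have k4 := J_norm x y l2.
have -> : J x y V0 = J x y (fun t => `|g1 t|) + J x y (fun t => `|g2 t|) by rewrite -J_D//; exact: li_norm.
rewrite EJ.
move: k1 k2 k3 k4 h5; set X1 := J x y g1; set X2 := J x y g2.
set N1 := J x y (fun t => `|g1 t|); set N2 := J x y (fun t => `|g2 t|).
set Y1 := J x y _; set Y2 := J x y _; set Z1 := F1 _; set Z2 := F2 _.
move=> k1 k2 k3 k4 h5.
set DF := F (f1 y, f2 y) - F (f1 x, f2 x); rewrite -/DF in h5.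
have -> : DF - (Y1 + Y2) = (DF - Z1 * X1 - Z2 * X2) + ((Z1 * X1 - Y1) + (Z2 * X2 - Y2)) by ring.
apply: (le_trans (ler_normD _ _)).
have k5 := ler_normD (Z1 * X1 - Y1) (Z2 * X2 - Y2).
have k6 : e * (`|X1| + `|X2|) <= e * (N1 + N2) by apply: ler_wpM2l; [exact: ltW|exact: lerD].
have := lerD (le_trans h5 k6) (le_trans k5 (lerD k1 k2)).
by move/le_trans; apply; rewrite le_eqVlt; apply/orP; left; apply/eqP; ring.
Unshelve. all: end_near. Qed.

End AbsolutelyContinuous.

(** * Primitives, the du Bois-Reymond lemma and weak derivatives in one variable *)

Section Primitive.
Context {R : realType}.
Implicit Types (f g h eta : R -> R) (a b c t x y : R).
Local Notation leb := (@lebesgue_measure R).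

(** The primitive that vanishes at 0: [J] is zero when its end points are reversed, so at most one
    of the two terms is nonzero. *)
Definition S0 g t : R := J 0 t g - J t 0 g.

Lemma J_gt a b g : b < a -> J a b g = 0.
Proof.
move=> ba; rewrite /J (_ : (fun t => _) = (fun=> 0)) ?Int0//.
apply/funext => t; rewrite indE; case: ifPn => [/andP[h1 h2]|]; last by rewrite mul0r.
by move: (lt_le_trans ba (le_trans h1 h2)); rewrite ltxx.
Qed.

Lemma S0_ac g : li g -> ac (S0 g) g.
Proof.
move=> lg; split => // a b ab; rewrite /S0.
have [a0|a0] := leP 0 a.
  have [->|a0'] := eqVneq a 0.
    rewrite !J_xx; have [->|b0] := eqVneq b 0; first by rewrite !J_xx; ring.
    by rewrite (@J_gt b 0)//; [ring|lra].
  have a00 : 0 < a by rewrite lt_neqAle eq_sym a0'.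
  rewrite (@J_gt b 0) ?(@J_gt a 0)//; last lra.
  by rewrite (@J_cat _ 0 a b)// ?ab ?a0//; ring.
rewrite (@J_gt 0 a)//.
have [b0|b0] := leP b 0.
  have -> : J 0 b g = 0.
    have [->|b0'] := eqVneq b 0; first exact: J_xx.
    by apply: J_gt; rewrite lt_neqAle b0'.
  by rewrite (@J_cat _ a b 0)// ?ab ?b0//; ring.
rewrite (@J_gt b 0)// (@J_cat _ a 0 b)//; first by ring.
by rewrite !ltW.
Qed.

Lemma ac_is_derive f g x : ac f g -> {for x, continuous g} -> is_derive x 1 f (g x).
Proof.
move=> [lg fg] cg.
have li' : leb.-integrable `[x - 1, x + 1] (EFin \o g) by exact/li_integrable.
have xx : x < x + 1 by lra.
have xx' : x - 1 < x by lra.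
have [dF FE] := continuous_FTC1_closed xx li' xx' cg.
apply: (@near_eq_is_derive _ _ _ (fun y => f (x - 1) + Rintegral leb `[x - 1, y] g)).
  near=> y; rewrite -J_itv -fg; first by ring.
  by near: y; apply/nbhs_ballP; exists 1 => //= z; rewrite /ball/= ltr_norml; lra.
have h : is_derive x 1 (fun y => Rintegral leb `[x - 1, y] g) (g x).
  by apply: DeriveDef; [exact: dF|rewrite -derive1E FE].
have := is_deriveD (is_derive_cst (f (x - 1)) x 1) h.
by rewrite add0r.
Unshelve. all: end_near. Qed.

Lemma primitive g : continuous g -> {P : R -> R | ac P g & forall x : R, is_derive x 1 P (g x)}.
Proof.
move=> cg; exists (S0 g); first by apply: S0_ac; exact: li_cont.
by move=> x; apply: ac_is_derive; [apply: S0_ac; exact: li_cont|exact: cg].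
Qed.

Lemma derive_ac f g : continuous g -> (forall x : R, is_derive x 1 f (g x)) -> ac f g.
Proof.
move=> cg fd; split; first exact: li_cont.
move=> a b; have [P [_ PE] Pd] := primitive cg; move=> ab; rewrite -PE//.
have d0 (z : R) : is_derive z 1 (fun x => f x - P x) 0.
  by rewrite -(subrr (g z)); apply: is_deriveB.
have := @MVT_lin R (fun x => f x - P x) (fun=> 0) a b 0 0 d0.
rewrite subrr normr0 lexx mul0r subr0 => /(_ (fun _ _ => isT)).
by rewrite mul0r normr_le0 => /eqP; lra.
Qed.

(** With q the positive part of (t-a)(b-t), this is q/(q+1/(n+1)): continuous, zero outside the
    interval, and tending to the indicator of its interior. Continuity suffices, since it serves to
    build the derivative of a test function. *)
Definition bump a b (n : nat) t : R :=
  Num.max 0 ((t - a) * (b - t)) / (Num.max 0 ((t - a) * (b - t)) + n.+1%:R^-1).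

Lemma bump_den a b n t : 0 < Num.max 0 ((t - a) * (b - t)) + n.+1%:R^-1.
Proof. by rewrite ltr_wpDl// ?le_max ?lexx// invr_gt0. Qed.

Lemma bump_cont a b n : continuous (bump a b n).
Proof.
have cq : continuous (fun t => Num.max 0 ((t - a) * (b - t))).
  move=> t; apply: (@continuous_max _ _ (fun=> 0) (fun t => (t - a) * (b - t))).
    exact: cst_continuous.
  by apply: continuousM; apply: continuousB; try exact: cst_continuous; exact: cvg_id.
move=> t.
have h1 : {for t, continuous (fun t => Num.max 0 ((t - a) * (b - t)) + n.+1%:R^-1)}.
  by apply: continuousD; [exact: cq|exact: cst_continuous].
have h2 : {for t, continuous (fun t => (Num.max 0 ((t - a) * (b - t)) + n.+1%:R^-1)^-1)}.
  by apply: continuousV => //; rewrite gt_eqF// bump_den.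
exact: (continuousM (cq t) h2).
Qed.

Lemma bump_01 a b n t : 0 <= bump a b n t <= 1.
Proof.
have d0 := bump_den a b n t.
have m0 : 0 <= Num.max 0 ((t - a) * (b - t)) by rewrite le_max lexx.
rewrite /bump; apply/andP; split; first by apply: divr_ge0 => //; exact: ltW.
by rewrite ler_pdivrMr// mul1r lerDl invr_ge0.
Qed.

Lemma bump_out a b n t : a <= b -> ~~ (a < t < b) -> bump a b n t = 0.
Proof.
move=> ab h; rewrite /bump max_l ?mul0r//.
move: h; rewrite negb_and -!leNgt => /orP[h|h].
  by rewrite mulr_le0_ge0//; lra.
by rewrite mulr_ge0_le0//; lra.
Qed.

Lemma bump_cvg a b t : a < t < b -> bump a b n t @[n --> \oo] --> (1 : R).
Proof.
move=> /andP[at_ tb]; rewrite /bump max_r ?mulr_ge0//; try lra.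
set q := (t - a) * (b - t); have q0 : 0 < q by apply: mulr_gt0; lra.
have h0 : (n.+1%:R^-1 : R) @[n --> \oo] --> (0 : R) by exact: (@cvg_harmonic R).
have hq : (fun _ : nat => q) @ \oo --> q by exact: cvg_cst.
have h1 : (fun n : nat => q + n.+1%:R^-1) @ \oo --> q + 0 by exact: (cvgD hq h0).
rewrite addr0 in h1.
have h2 : (fun n : nat => q / (q + n.+1%:R^-1)) @ \oo --> q / q.
  exact: (cvgM hq (cvgV (lt0r_neq0 q0) h1)).
by rewrite divff ?lt0r_neq0// in h2.
Qed.

Lemma bump_le_ind a b n t : a <= b -> bump a b n t <= ind a b t.
Proof.
move=> ab; rewrite indE; case: ifPn => [_|h]; first by case/andP: (bump_01 a b n t).
rewrite bump_out//; apply: contra h => /andP[h1 h2]; by rewrite !ltW.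
Qed.

Lemma ind_bump_cvg a b : a <= b -> {ae leb, forall t, bump a b n t @[n --> \oo] --> ind a b t}.
Proof.
move=> ab; exists [set a; b]; split.
- by apply: measurableU.
- by apply: countable_lebesgue_measure0; exact: finite_set_countable.
- move=> t /= h; apply: contrapT => /not_orP[ta tb]; apply: h.
  rewrite indE; case: ifPn => [/andP[h1 h2]|h].
    apply: bump_cvg; rewrite !lt_neqAle h1 h2 !andbT; apply/andP; split; apply/eqP; auto.
  rewrite (_ : (fun n => _) = (fun=> 0)); first exact: cvg_cst.
  apply/funext => n; apply: bump_out => //; apply: contra h => /andP[h1 h2]; by rewrite !ltW.
Qed.

Lemma bump_DCT a b K : a <= b -> li K ->
  (forall n, L1 leb (fun t => K t * bump a b n t)) /\
  Int leb (fun t => K t * bump a b n t) @[n --> \oo] --> J a b K.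
Proof.
move=> ab lK; have mK := li_mf lK.
have mb n : measurable_fun setT (bump a b n) by apply: continuous_measurable_fun; exact: bump_cont.
have dom n t : `|K t * bump a b n t| <= `|ind a b t * K t|.
  have /andP[b0 _] := bump_01 a b n t.
  rewrite (normrM (K t)) (normrM (ind a b t)) (mulrC `|K t|); apply: ler_wpM2r => //.
  by rewrite (ger0_norm b0) (ger0_norm (ind_ge0 _ _ _)); exact: bump_le_ind.
split; first by move=> n; apply: (L1_domT _ (L1_norm (lK a b))); [exact: (measurable_funM mK (mb n))|exact: dom].
apply: (proj2 (@DCT _ _ _ leb _ _ _ _ _ (L1_norm (lK a b)) _ _)).
- by move=> n; exact: (measurable_funM mK (mb n)).
- exact: (measurable_funM (mf_ind a b) mK).
- apply: filterS (ind_bump_cvg ab) => t ht; rewrite mulrC.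
  by apply: cvgM => //; exact: cvg_cst.
- by apply: aeW => t n; exact: dom.
Qed.

Lemma L1_bump a b n : a <= b -> L1 leb (bump a b n).
Proof.
move=> ab; have [h _] := bump_DCT ab (li_cont (@cst_continuous _ _ (1:R))).
by have := h n; congr L1; apply/funext => t; rewrite mul1r.
Qed.

(** The difference of two bumps, each weighted by the mass of the other, has integral 0, so its
    primitive has compact support and is a test function. Testing [K] against it compares the
    integrals of [K] on [a,b] and on [0,1], up to the limit of the bumps. *)
Lemma dubois K : li K ->
  (forall eta, test1 eta -> Int leb (fun t => K t * derive1 eta t) = 0) ->
  forall a b, a <= b -> J a b K = (b - a) * J 0 1 K.
Proof.
move=> lK H a b ab.
pose rb n := Int leb (bump a b n); pose r1 n := Int leb (bump 0 1 n).
have main n : r1 n * Int leb (fun t => K t * bump a b n t) = rb n * Int leb (fun t => K t * bump 0 1 n t).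
  pose rho t := r1 n * bump a b n t - rb n * bump 0 1 n t.
  have crho : continuous rho.
    move=> t.
    have k (c x y : R) : {for t, continuous (fun t => c * bump x y n t)}.
      by apply: (@continuousM R R (fun=> c) (bump x y n)); [exact: cst_continuous|exact: bump_cont].
    exact: (continuousB (k (r1 n) a b) (k (rb n) 0 1)).
  have [P [lr PE] Pd] := primitive crho.
  pose r := `|a| + `|b| + 1.
  have [ra rb_] : - r < a /\ b < r.
    have := ler_norm (- a); have := ler_norm b; rewrite normrN => h1 h2.
    by have := normr_ge0 a; have := normr_ge0 b; rewrite /r; split; lra.
  have r0 : 1 <= r by rewrite /r; have := normr_ge0 a; have := normr_ge0 b; lra.
  have rho0 t : ~~ (- r < t < r) -> rho t = 0.
    rewrite negb_and -!leNgt => h; rewrite /rho !bump_out ?mulr0 ?subr0// negb_and -!leNgt;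
      by case/orP: h => h; apply/orP; [left|right]; lra.
  have Irho : Int leb rho = 0.
    rewrite /rho IntB; [|by apply: L1Z; exact: L1_bump..].
    rewrite !IntZ; [|by exact: L1_bump..].
    by rewrite /rb /r1 mulrC subrr.
  have Jrho : J (- r) r rho = 0.
    rewrite -Irho; congr Int; apply/funext => t; rewrite indE; case: ifPn; rewrite ?mul1r// mul0r => h.
    rewrite rho0//; apply: contra h => /andP[h1 h2]; by rewrite !ltW.
  have J0 x y : x <= y -> (y <= - r \/ r <= x) -> J x y rho = 0.
    move=> xy h; rewrite /J (_ : (fun t => _) = (fun=> 0)) ?Int0//.
    apply/funext => t; rewrite indE; case: ifPn => [txy|_]; rewrite ?mul0r// mul1r.
    by apply: rho0; apply/negP => ?; lra.
  pose eta t := P t - P (- r).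
  have deta t : is_derive t 1 eta (rho t).
    by rewrite -(subr0 (rho t)); apply: is_deriveB.
  have eE : derive1 eta = rho.
    by apply/funext => t; rewrite derive1E; apply: derive_val.
  have teta : test1 eta.
    split.
    - move=> t; apply: differentiable_continuous; apply/derivable1_diffP; by have [] := deta t.
    - exists r => t; rewrite lter_normr => /orP[h|h]; rewrite /eta.
        have rt : r <= t by exact: ltW.
        have rr : - r <= r by lra.
        have := PE _ _ rt; rewrite (J0 _ _ rt (or_intror (lexx r))).
        by have := PE _ _ rr; rewrite Jrho; lra.
      have rt : t <= - r by lra.
      by have := PE _ _ rt; rewrite (J0 _ _ rt (or_introl (lexx _))); lra.
    - by move=> t; have [] := deta t.
    - by rewrite eE.
  have := H _ teta; rewrite eE /rho.
  have [h1 _] := bump_DCT ab lK; have [h2 _] := bump_DCT ler01 lK.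
  have -> : (fun t => K t * (r1 n * bump a b n t - rb n * bump 0 1 n t)) =
    (fun t => r1 n * (K t * bump a b n t) - rb n * (K t * bump 0 1 n t)).
    by apply/funext => t; ring.
  rewrite IntB; [|exact: L1Z..]; rewrite !IntZ//.
  by move/eqP; rewrite subr_eq0 => /eqP.
have lc : li (fun=> 1 : R) by apply: li_cont; exact: cst_continuous.
have E1 x y : (fun n => Int leb (bump x y n)) = (fun n => Int leb (fun t => 1 * bump x y n t)).
  by apply/funext => n; congr Int; apply/funext => t; rewrite mul1r.
have cr1 : r1 n @[n --> \oo] --> (1 : R).
  have [_] := bump_DCT ler01 lc; rewrite J_cst// mul1r subr0.
  by rewrite -E1.
have crb : rb n @[n --> \oo] --> (b - a).
  by have [_] := bump_DCT ab lc; rewrite J_cst// mul1r -E1.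
have [_ c1] := bump_DCT ab lK; have [_ c2] := bump_DCT ler01 lK.
have k1 : (fun n => r1 n * Int leb (fun t => K t * bump a b n t)) @ \oo --> 1 * J a b K.
  exact: (cvgM cr1 c1).
have k2 : (fun n => rb n * Int leb (fun t => K t * bump 0 1 n t)) @ \oo --> (b - a) * J 0 1 K.
  exact: (cvgM crb c2).
rewrite mul1r (_ : (fun n => _) = (fun n => rb n * Int leb (fun t => K t * bump 0 1 n t))) in k1; last first.
  by apply/funext => n; rewrite main.
exact: (cvg_unique (@Rhausdorff R) k1 k2).
Qed.

Lemma li_locally g : li g -> locally_integrable [set: R] g.
Proof.
move=> lg; split; [exact: li_mf|exact: openT|].
move=> K _ cK; have [M [Mr HM]] := compact_bounded cK.
have KM : K `<=` `[- (`|M| + 1), `|M| + 1].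
  move=> t Kt; rewrite /= in_itv/= -ler_norml.
  by apply: HM Kt; rewrite (le_lt_trans (ler_norm M))// ltrDl.
have /integrableP[_] : leb.-integrable K (EFin \o g).
  apply: (@integrableS _ _ _ leb `[- (`|M| + 1), `|M| + 1]) => //.
    exact: compact_measurable.
  exact/li_integrable.
by [].
Qed.

(** By Lebesgue differentiation [g] is a.e. the derivative of a primitive that is identically
    zero. *)
Lemma J0_ae0 g : li g -> (forall a b, a <= b -> J a b g = 0) -> {ae leb, forall t, g t = 0}.
Proof.
move=> lg J0.
have := lebesgue_differentiation (li_locally lg); apply: filterS => x hx.
have li' : leb.-integrable `[x - 1, x + 1] (EFin \o g) by exact/li_integrable.
have xx : x < x + 1 by lra.
have xx' : (BLeft (x - 1)%R < BRight x)%E by rewrite (@lte_fin R); lra.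
have [_ <-] := FTC1_lebesgue_pt xx li' xx' hx.
rewrite derive1E; apply: derive_val.
apply: (@near_eq_is_derive _ _ _ (fun=> 0)).
near=> y; rewrite -J_itv J0//.
by near: y; apply/nbhs_ballP; exists 1 => //= z; rewrite /ball/= ltr_norml; lra.
Unshelve. all: end_near. Qed.

Lemma dubois_ae K : li K ->
  (forall eta, test1 eta -> Int leb (fun t => K t * derive1 eta t) = 0) ->
  {ae leb, forall t, K t = J 0 1 K}.
Proof.
move=> lK H; have D := dubois lK H.
have lc : li (fun=> - J 0 1 K) by apply: li_cont; exact: cst_continuous.
have : {ae leb, forall t, K t + - J 0 1 K = 0}.
  by apply: J0_ae0 => [|a b ab]; [exact: liD|rewrite J_D// J_cst// D//; ring].
by apply: filterS => t /eqP; rewrite subr_eq0 => /eqP.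
Qed.

Lemma test1_ac eta : test1 eta -> ac eta (derive1 eta).
Proof.
move=> [_ _ d c]; apply: derive_ac => // x; apply: DeriveDef; first exact: d.
by rewrite derive1E.
Qed.

Lemma C1_mul : C1 (fun p : R * R => p.1 * p.2) (fun p : R * R => p.2) (fun p : R * R => p.1).
Proof.
split; [by move=> p; exact: cvg_snd|by move=> p; exact: cvg_fst| |] => x y /=.
  apply: (is_derive_eq (is_deriveM (is_derive_id x 1) (is_derive_cst y x 1))).
  by rewrite scaler0 add0r /GRing.scale /= mulr1.
apply: (is_derive_eq (is_deriveM (is_derive_cst x y 1) (is_derive_id y 1))).
by rewrite scaler0 addr0 /GRing.scale /= mulr1.
Qed.

Lemma ac_mul f1 g1 f2 g2 : ac f1 g1 -> ac f2 g2 ->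
  ac (fun t => f1 t * f2 t) (fun t => g1 t * f2 t + f1 t * g2 t).
Proof.
move=> A1 A2; have := ac_chain C1_mul A1 A2.
by congr ac; apply/funext => t /=; ring.
Qed.

Lemma test1_supp eta : test1 eta -> exists2 r, 0 < r &
  forall t, r <= `|t| -> eta t = 0 /\ derive1 eta t = 0.
Proof.
move=> [ce [r er] de cd].
exists (`|r| + 1); first by rewrite ltr_wpDl.
move=> t h; have rt : r < `|t| by rewrite (lt_le_trans _ h)// (le_lt_trans (ler_norm r))// ltrDl.
split; first exact: er.
rewrite derive1E; apply: derive_val; apply: (@near_eq_is_derive _ _ _ (fun=> 0)).
apply/nbhs_ballP; exists (`|t| - r); first by rewrite /= subr_gt0.
move=> z; rewrite /ball/= => hz; rewrite er//.
by have := ler_normD (t - z) z; rewrite subrK; lra.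
Qed.

Lemma li_test h eta : li h -> continuous eta ->
  (exists r, forall t, r <= `|t| -> eta t = 0) -> L1 leb (fun t => h t * eta t).
Proof.
move=> lh ce [r er]; have := li_contM ce lh (- r) r; congr L1; apply/funext => t.
rewrite indE -ler_norml; case: ifPn => [_|]; first by rewrite mul1r mulrC.
by rewrite mul0r -ltNge => /ltW/er ->; rewrite mulr0.
Qed.

Lemma ac_ibp f g eta : ac f g -> test1 eta ->
  L1 leb (fun t => f t * derive1 eta t) /\ L1 leb (fun t => g t * eta t) /\
  Int leb (fun t => f t * derive1 eta t) = - Int leb (fun t => g t * eta t).
Proof.
move=> A T; have [ce _ de cd] := T; have Ae := test1_ac T.
have [r' r'0_ er0] := test1_supp T.
have [lk E] := ac_mul A Ae.
have l1 : li (fun t => g t * eta t).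
  have [lg _] := A; have := li_contM ce lg; congr li; apply/funext => t; exact: mulrC.
have l2 : li (fun t => f t * derive1 eta t).
  by have := li_contM (ac_continuous A) (li_cont cd).
have ex (q : R -> R) : (forall t, r' <= `|t| -> q t = 0) -> (fun t => ind (- r') r' t * q t) = q.
  move=> h; apply/funext => t; rewrite indE -ler_norml; case: ifPn => [_|]; first by rewrite mul1r.
    by rewrite mul0r -ltNge => /ltW/h ->.
have e1 : (fun t => ind (- r') r' t * (g t * eta t)) = (fun t => g t * eta t).
  by apply: ex => t /er0[-> _]; rewrite mulr0.
have e2 : (fun t => ind (- r') r' t * (f t * derive1 eta t)) = (fun t => f t * derive1 eta t).
  by apply: ex => t /er0[_ ->]; rewrite mulr0.
have L1' := l1 (- r') r'; have L2' := l2 (- r') r'; rewrite e1 in L1'; rewrite e2 in L2'.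
split => //; split => //.
have r'0 : - r' <= r' by lra.
have := E _ _ r'0; rewrite J_D// /J e1 e2.
rewrite (er0 r' _).1 ?(er0 (- r') _).1 ?mulr0 ?subrr ?normrN ?ler_norm//.
by move/esym/eqP; rewrite addrC addr_eq0 => /eqP.
Qed.

(** [f] minus the primitive of [g] has weak derivative zero, hence is a.e. a constant by du
    Bois-Reymond. *)
Lemma weak_ac f g : li f -> li g ->
  (forall eta, test1 eta -> Int leb (fun t => f t * derive1 eta t) = - Int leb (fun t => g t * eta t)) ->
  exists2 h, ac h g & {ae leb, forall t, f t = h t}.
Proof.
move=> lf lg H; have A := S0_ac lg.
pose K t := f t + -1 * S0 g t.
have lK : li K by apply: liD => //; apply: liZ; apply: li_cont; exact: ac_continuous A.
have := @dubois_ae K lK _; set C := J 0 1 K => HC.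
exists (fun t => S0 g t + C).
  by split => // a b ab; have [_ <-//] := A; ring.
have : {ae leb, forall t, K t = C}.
  apply: HC => eta T; have [h1 [h2 h3]] := ac_ibp A T.
  have lfe : L1 leb (fun t => f t * derive1 eta t).
    have [_ _ _ cd] := T; have [r _ er] := test1_supp T.
    by apply: li_test => //; exists r => t /er[].
  rewrite (_ : (fun t => _) = (fun t => f t * derive1 eta t - S0 g t * derive1 eta t)); last by apply/funext => t; rewrite /K; ring.
  by rewrite IntB// H// h3 subrr.
by apply: filterS => t; rewrite /K => <-; ring.
Qed.

End Primitive.

(** * Truncations of absolutely continuous functions *)

Section Truncation.
Context {R : realType}.
Implicit Types (f g h : R -> R) (a b c t x y : R).
Local Notation leb := (@lebesgue_measure R).

Lemma ac_comp p p' f g : continuous p' -> (forall x : R, is_derive x 1 p (p' x)) ->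
  ac f g -> ac (fun t => p (f t)) (fun t => p' (f t) * g t).
Proof.
move=> cp' dp A.
have C : C1 (fun z : R * R => p z.1) (fun z : R * R => p' z.1) (fun=> 0).
  split => /=.
  - by move=> z; apply: (cvg_comp fst p' _ (cp' _)); exact: cvg_fst.
  - exact: cst_continuous.
  - by move=> x y.
  - by move=> x y; exact: is_derive_cst.
have := ac_chain C A A; congr ac; apply/funext => t /=; by rewrite mul0r addr0.
Qed.

Lemma J_DCT (h_ : nat -> R -> R) h g a b : li g ->
  (forall n, measurable_fun setT (h_ n)) -> measurable_fun setT h ->
  (forall n t, `|h_ n t| <= 1) -> (forall t, h_ n t @[n --> \oo] --> h t) ->
  L1 leb (fun t => ind a b t * (h t * g t)) /\
  J a b (fun t => h_ n t * g t) @[n --> \oo] --> J a b (fun t => h t * g t).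
Proof.
move=> lg mh_ mh b1 cv; have mg := li_mf lg.
apply: (@DCT _ _ _ leb _ _ _ _ _ (L1_norm (lg a b))).
- by move=> n; exact: (measurable_funM (mf_ind a b) (measurable_funM (mh_ n) mg)).
- exact: (measurable_funM (mf_ind a b) (measurable_funM mh mg)).
- apply: aeW => t.
  have c1 : (fun n => h_ n t * g t) @ \oo --> h t * g t by exact: (cvgM (cv t) (@cvg_cst _ (g t) _ \oo _)).
  exact: (cvgM (@cvg_cst _ (ind a b t) _ \oo _) c1).
- apply: aeW => t n; rewrite (normrM (ind a b t)) (normrM (h_ n t)) (normrM (ind a b t)).
  apply: ler_wpM2l => //; rewrite -[leRHS]mul1r; exact: ler_wpM2r.
Qed.

(** With derivatives bounded by 1, dominated convergence carries the integrated chain rule to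
    pointwise limits, where [q'] may be discontinuous; truncations are such limits. *)
Lemma ac_limit (p p' : nat -> R -> R) (q q' : R -> R) f g :
  (forall n, continuous (p' n)) -> (forall n (x : R), is_derive x 1 (p n) (p' n x)) ->
  (forall n x, `|p' n x| <= 1) -> (forall x, p n x @[n --> \oo] --> q x) ->
  (forall x, p' n x @[n --> \oo] --> q' x) ->
  ac f g -> ac (fun t => q (f t)) (fun t => q' (f t) * g t).
Proof.
move=> cp' dp b1 cp cq' A; have [lg _] := A; have cf := ac_continuous A.
have mf : measurable_fun setT f by exact: continuous_measurable_fun.
have mp n : measurable_fun setT (fun t => p' n (f t)).
  by apply: continuous_measurable_fun => t; apply: (cvg_comp f (p' n) (cf t) (cp' n _)).
have mq : measurable_fun setT (fun t => q' (f t)).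
  by apply: (measurable_fun_cvg mp) => t _; exact: cq'.
have D a b := @J_DCT (fun n t => p' n (f t)) (fun t => q' (f t)) g a b lg mp mq
    (fun n t => b1 n (f t)) (fun t => cq' (f t)).
split; first by move=> a b; exact: (D a b).1.
move=> a b ab.
have E n : J a b (fun t => p' n (f t) * g t) = p n (f b) - p n (f a).
  by have [_ ->//] := ac_comp (cp' n) (dp n) A.
have [_ c1] := D a b.
have c2 : (fun n => J a b (fun t => p' n (f t) * g t)) @ \oo --> q (f b) - q (f a).
  have -> : (fun n => J a b (fun t => p' n (f t) * g t)) = (fun n => p n (f b) - p n (f a)).
    by apply/funext => n; rewrite E.
  exact: (cvgB (cp _) (cp _)).
exact: (cvg_unique (@Rhausdorff R) c2 c1).
Qed.

Lemma cvg_inv_shift (c : R) : c != 0 -> (fun n : nat => (c + n.+1%:R^-1)^-1) @ \oo --> c^-1.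
Proof.
move=> c0.
have h0 : (n.+1%:R^-1 : R) @[n --> \oo] --> (0 : R) by exact: (@cvg_harmonic R).
have h1 : (fun n : nat => c + n.+1%:R^-1) @ \oo --> c + 0 by exact: (cvgD (@cvg_cst _ c _ \oo _) h0).
by rewrite addr0 in h1; exact: cvgV.
Qed.

(* Approximate [s] by [0] with the derivatives [(e-s^2)e/(e+s^2)^2], which tend to the indicator of [s = 0]. *)
Lemma ac_level0 f g : ac f g -> {ae leb, forall t, f t = 0 -> g t = 0}.
Proof.
move=> A.
pose e n : R := n.+1%:R^-1.
have e0 n : 0 < e n by rewrite invr_gt0.
have d0 n s : 0 < e n + s ^+ 2 by rewrite ltr_wpDr ?sqr_ge0.
have ce : e n @[n --> \oo] --> (0 : R) by exact: (@cvg_harmonic R).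
have := @ac_limit (fun n s => e n * s * (e n + s ^+ 2)^-1)
  (fun n s => (e n - s ^+ 2) * e n * (e n + s ^+ 2) ^- 2)
  (fun=> 0) (fun s => if s == 0 then 1 else 0) f g.
have cden n : continuous (fun s : R => e n + s ^+ 2).
  by move=> s; exact: (cvgD (@cvg_cst _ (e n) _ (nbhs s) _) (@exprn_continuous R 2 s)).
have cinv n : continuous (fun s : R => (e n + s ^+ 2)^-1).
  by move=> s; exact: (cvgV (lt0r_neq0 (d0 n s)) (cden n s)).
move=> H; have {}H : ac (fun=> 0) (fun t => (if f t == 0 then 1 else 0) * g t).
  apply: H => //.
  - move=> n s.
    have c1 : {for s, continuous (fun s : R => (e n - s ^+ 2) * e n)}.
      exact: (cvgM (cvgB (@cvg_cst _ (e n) _ (nbhs s) _) (@exprn_continuous R 2 s)) (@cvg_cst _ (e n) _ (nbhs s) _)).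
    have c2 : {for s, continuous (fun s : R => (e n + s ^+ 2) ^- 2)}.
      have -> : (fun s : R => (e n + s ^+ 2) ^- 2) = (fun s : R => (e n + s ^+ 2)^-1 * (e n + s ^+ 2)^-1).
        by apply/funext => z; rewrite -exprVn expr2.
      by exact: (cvgM (cinv n s) (cinv n s)).
    exact: (continuousM c1 c2).
  - move=> n s.
    have dd : is_derive s 1 (fun s : R => e n + s ^+ 2) (2 * s).
      apply: is_derive_eq; rewrite /GRing.scale/=; ring.
    have di : is_derive s 1 (fun s : R => (e n + s ^+ 2)^-1) (- (e n + s ^+ 2) ^- 2 *: (2 * s)).
      by apply: (@is_deriveV _ (fun s : R => e n + s ^+ 2)); exact: lt0r_neq0.
    have dn : is_derive s 1 (fun s : R => e n * s) (e n).
      by apply: is_derive_eq; rewrite /GRing.scale/= mulr1.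
    apply: (is_derive_eq (is_deriveM dn di)).
    rewrite /GRing.scale/=; field; exact: lt0r_neq0.
  - move=> n s; have d := d0 n s; rewrite normrM normfV (ger0_norm (sqr_ge0 (e n + s ^+ 2))).
    rewrite ler_pdivrMr ?exprn_gt0// mul1r ler_norml; have := sqr_ge0 s; have := e0 n.
    by set X := s ^+ 2; move=> *; apply/andP; split; nra.
  - move=> s; have [->|s0] := eqVneq s 0.
      by rewrite (_ : (fun n => _) = (fun=> 0)); [exact: cvg_cst|apply/funext => n; rewrite mulr0 mul0r].
    have c1 : (fun n => e n * s) @ \oo --> 0 * s by exact: (cvgM ce (@cvg_cst _ s _ \oo _)).
    have s20 : s ^+ 2 != 0 by rewrite sqrf_eq0.
    have c2 : (fun n => (e n + s ^+ 2)^-1) @ \oo --> (s ^+ 2)^-1.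
      by have := cvg_inv_shift s20; under eq_fun do rewrite addrC.
    have c5 : (fun n => e n * s * (e n + s ^+ 2)^-1) @ \oo --> 0 * s * (s ^+ 2)^-1.
      exact: (cvgM c1 c2).
    by rewrite !mul0r in c5.
  - move=> s; case: eqVneq => [->|s0].
      rewrite (_ : (fun n => _) = (fun=> 1)); first exact: cvg_cst.
      by apply/funext => n; rewrite expr0n/= subr0 addr0 -expr2 divff// sqrf_eq0 lt0r_neq0.
    have c1 : (fun n => e n - s ^+ 2) @ \oo --> 0 - s ^+ 2 by exact: (cvgB ce (@cvg_cst _ (s ^+ 2) _ \oo _)).
    have c2 : (fun n => (e n - s ^+ 2) * e n) @ \oo --> (0 - s ^+ 2) * 0 by exact: (cvgM c1 ce).
    have s20 : s ^+ 2 != 0 by rewrite sqrf_eq0.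
    have c3 : (fun n => (e n + s ^+ 2)^-1) @ \oo --> (s ^+ 2)^-1.
      by have := cvg_inv_shift s20; under eq_fun do rewrite addrC.
    have c4 : (fun n => (e n + s ^+ 2) ^- 2) @ \oo --> (s ^+ 2)^-1 * (s ^+ 2)^-1.
      rewrite (_ : (fun n => _) = (fun n => (e n + s ^+ 2)^-1 * (e n + s ^+ 2)^-1)); first exact: (cvgM c3 c3).
      by apply/funext => n; rewrite -exprVn expr2.
    have c5 : (fun n => (e n - s ^+ 2) * e n * (e n + s ^+ 2) ^- 2) @ \oo --> (0 - s ^+ 2) * 0 * ((s ^+ 2)^-1 * (s ^+ 2)^-1).
      exact: (cvgM c2 c4).
    by rewrite mulr0 mul0r in c5.
have [lk E] := H.
have := J0_ae0 lk (fun a b ab => etrans (esym (E a b ab)) (subrr _)).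
by apply: filterS => t + ft0; rewrite ft0 eqxx mul1r.
Qed.

(** The positive part is the limit of (s + sqrt(s^2+e))/2. The limiting derivative has the value 1/2
    at s = 0, which does no harm because [g] vanishes a.e. on the zero set of [f] by [ac_level0]. *)
Lemma ac_pos f g : ac f g ->
  ac (fun t => Num.max (f t) 0) (fun t => if 0 < f t then g t else 0).
Proof.
move=> A.
pose e n : R := n.+1%:R^-1.
have e0 n : 0 < e n by rewrite invr_gt0.
have d0 n s : 0 < s ^+ 2 + e n by rewrite ltr_wpDl ?sqr_ge0.
have ce : e n @[n --> \oo] --> (0 : R) by exact: (@cvg_harmonic R).
pose S n s := Num.sqrt (s ^+ 2 + e n).
have S0 n s : 0 < S n s by rewrite sqrtr_gt0.
have sS n s : `|s| <= S n s by rewrite -sqrtr_sqr ler_wsqrtr// lerDl ltW.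
have cS n : continuous (S n).
  move=> s; apply: (continuous_comp (f := fun s : R => s ^+ 2 + e n)); last exact: sqrt_continuous.
  exact: (cvgD (@exprn_continuous R 2 s) (@cvg_cst _ (e n) _ (nbhs s) _)).
have cvS s : S n s @[n --> \oo] --> `|s|.
  have c : (fun n => s ^+ 2 + e n) @ \oo --> s ^+ 2 + 0.
    exact: (cvgD (@cvg_cst _ (s ^+ 2) _ \oo _) ce).
  rewrite addr0 in c; rewrite -sqrtr_sqr.
  exact: (cvg_comp (fun n => s ^+ 2 + e n) Num.sqrt c (@sqrt_continuous R _)).
have := @ac_limit (fun n s => (s + S n s) / 2) (fun n s => (1 + s / S n s) / 2)
  (fun s => (s + `|s|) / 2) (fun s => if s == 0 then 2^-1 else if 0 < s then 1 else 0) f g.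
move=> H; have {}H : ac (fun t => (f t + `|f t|) / 2)
   (fun t => (if f t == 0 then 2^-1 else if 0 < f t then 1 else 0) * g t).
  apply: H => //.
  - move=> n s; have k2 : (fun s => (S n s)^-1) @ s --> (S n s)^-1.
      by exact: (cvgV (lt0r_neq0 (S0 n s)) (cS n s)).
    have k0 : (fun z : R => z) @ s --> s by exact: cvg_id.
    have k3 : (fun z : R => z / S n z) @ s --> s / S n s by exact: (cvgM k0 k2).
    have k4 : (fun z : R => 1 + z / S n z) @ s --> 1 + s / S n s.
      exact: (cvgD (@cvg_cst _ (1 : R) _ (nbhs s) _) k3).
    exact: (cvgM k4 (@cvg_cst _ (2^-1 : R) _ (nbhs s) _)).
  - move=> n s.
    have dd : is_derive s 1 (fun s : R => s ^+ 2 + e n) (2 * s).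
      apply: is_derive_eq; rewrite /GRing.scale/=; ring.
    have dS : is_derive s 1 (S n) (s / S n s).
      have dq := @is_derive1_comp _ Num.sqrt (fun s : R => s ^+ 2 + e n) s _ _ (is_derive1_sqrt (d0 n s)) dd.
      have -> : s / S n s = (2 * Num.sqrt (s ^+ 2 + e n))^-1 * (2 * s).
        by rewrite -/(S n s); field; exact: lt0r_neq0.
      exact: dq.
    have dsum : is_derive s 1 (fun s => s + S n s) (1 + s / S n s) by apply: is_deriveD.
    have dm := is_deriveM dsum (is_derive_cst (2^-1 : R) s 1).
    have e1 : (1 + s / S n s) / 2 = (s + S n s) *: (0 : R) + 2^-1 *: (1 + s / S n s).
      by rewrite /GRing.scale/=; ring.
    rewrite e1; exact: dm.
  - move=> n s; have h := sS n s.
    have : `|s / S n s| <= 1 by rewrite normrM normfV (gtr0_norm (S0 n s)) ler_pdivrMr// mul1r.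
    rewrite !ler_norml => /andP[h1 h2]; apply/andP; split; lra.
  - move=> s; exact: (cvgM (cvgD (@cvg_cst _ s _ \oo _) (cvS s)) (@cvg_cst _ (2^-1 : R) _ \oo _)).
  - move=> s; case: eqVneq => [->|s0].
      rewrite (_ : (fun n => _) = (fun=> 2^-1)); first exact: cvg_cst.
      by apply/funext => n; rewrite mul0r addr0 mul1r.
    have s0' : `|s| != 0 by rewrite normr_eq0.
    have c1 : (fun n => s / S n s) @ \oo --> s / `|s|.
      exact: (cvgM (@cvg_cst _ s _ \oo _) (cvgV s0' (cvS s))).
    have c2 : (fun n => (1 + s / S n s) / 2) @ \oo --> (1 + s / `|s|) / 2.
      exact: (cvgM (cvgD (@cvg_cst _ (1 : R) _ \oo _) c1) (@cvg_cst _ (2^-1 : R) _ \oo _)).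
    suff -> : (if 0 < s then 1 else 0) = (1 + s / `|s|) / 2 by [].
    case: ltgtP s0 => // sl _; last by rewrite ltr0_norm// invrN mulrN divff ?lt_eqF// subrr mul0r.
    by rewrite gtr0_norm// divff ?gt_eqF//; field.
have [lk E] := H; have [lg _] := A.
have L0 := ac_level0 A; have mf := continuous_measurable_fun (ac_continuous A).
have mp : measurable_fun setT (fun t => if 0 < f t then g t else 0).
  apply: measurable_fun_ifT => //; last exact: li_mf.
  by apply: measurable_fun_ltr.
have ee : {ae leb, forall t, (if f t == 0 then 2^-1 else if 0 < f t then 1 else 0) * g t = (if 0 < f t then g t else 0)}.
  apply: filterS L0 => t h; case: eqVneq => [f0|_]; first by rewrite f0 ltxx h ?mulr0.
  by case: ifP => _; rewrite ?mul1r ?mul0r.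
split.
  move=> a b; apply: (L1_ae _ (lk a b)); first exact: (measurable_funM (mf_ind a b) mp).
  by apply: filterS ee => t ->.
move=> a b ab.
have <- : J a b (fun t => (if f t == 0 then 2^-1 else if 0 < f t then 1 else 0) * g t) =
    J a b (fun t => if 0 < f t then g t else 0).
  by apply: (J_ae (li_mf lk) mp); apply: filterS ee => t h _.
rewrite -E//.
have mE (s : R) : Num.max s 0 = (s + `|s|) / 2.
  by have [s0|s0] := leP s 0; [rewrite ler0_norm//; lra|rewrite gtr0_norm//; lra].
by rewrite !mE.
Qed.

End Truncation.

Lemma measurable_Int_param d1 d2 (T1 : measurableType d1) (T2 : measurableType d2)
  (R : realType) (m2 : {sigma_finite_measure set T2 -> \bar R}) (h : T1 * T2 -> R) :
  measurable_fun setT h -> measurable_fun setT (fun x => Int m2 (fun y => h (x, y))).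
Proof.
move=> mh; have mE : measurable_fun setT (EFin \o h) by exact/measurable_EFinP.
apply: (measurableT_comp (fine_measurable measurableT)).
have -> : (fun x => (\int[m2]_y (h (x, y))%:E)%E) =
  (fun x => (\int[m2]_y ((EFin \o h)^\+ (x, y)) - \int[m2]_y ((EFin \o h)^\- (x, y)))%E).
  apply/funext => x; rewrite [LHS]integralE.
  by congr (_ - _)%E; apply: eq_integral => y _; rewrite ?funeposE ?funenegE.
apply: emeasurable_funB.
  apply: (measurable_fun_fubini_tonelli_F (m2 := m2) ((EFin \o h)^\+)%E).
    exact: measurable_funepos.
  by move=> p; exact: funepos_ge0.
apply: (measurable_fun_fubini_tonelli_F (m2 := m2) ((EFin \o h)^\-)%E).
  exact: measurable_funeneg.
by move=> p; exact: funeneg_ge0.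
Qed.

(** * Representatives that are absolutely continuous on almost every horizontal line *)

Section WeakRep.
Context {R : realType}.
Implicit Types (a b c t x y r : R) (eta zeta : R -> R) (f g : R * R -> R).
Local Notation leb := (@lebesgue_measure R).
Local Notation mm := (leb \x leb)%E.

Definition ind2 r (p : R * R) : R := ind (- r) r p.1 * ind (- r) r p.2.
Definition li2 f := forall r, L1 mm (fun p => ind2 r p * f p).

Lemma mf_ind2 r : measurable_fun setT (ind2 r).
Proof.
apply: measurable_funM.
  exact: (measurableT_comp (mf_ind (- r) r) measurable_fst).
exact: (measurableT_comp (mf_ind (- r) r) measurable_snd).
Qed.

Lemma ind2_ge0 r p : 0 <= ind2 r p.
Proof. by rewrite mulr_ge0 ?ind_ge0. Qed.

Lemma ind2E r p : ind2 r p = if (`|p.1| <= r) && (`|p.2| <= r) then 1 else 0.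
Proof. by rewrite /ind2 !indE -!ler_norml; do 2 case: ifP; rewrite ?mulr1 ?mulr0. Qed.

Lemma li2_mf f : li2 f -> measurable_fun setT f.
Proof.
move=> lg; apply: (@measurable_fun_cvg _ _ _ _ (fun (n : nat) p => ind2 n%:R p * f p)) => //.
  by move=> n; exact: (L1_mf (lg _)).
move=> t _; apply: cvg_near_cst; near=> n.
rewrite ind2E (_ : _ && _ = true) /= ?mul1r//; apply/andP; split; near: n; exact: nbhs_infty_ger.
Unshelve. all: end_near. Qed.

Lemma li2_slice f : li2 f -> {ae leb, forall s, li (fun t => f (t, s))}.
Proof.
move=> lf; have mf := li2_mf lf.
have : {ae leb, forall s, forall n : nat, L1 leb (fun t => ind2 n%:R (t, s) * f (t, s))}.
  by apply/ae_foralln => n; have [h _ _] := fub2 (lf n%:R).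
apply: filterS => s H a b.
pose N := (Num.truncn (`|a| + `|b| + `|s|)).+1.
have N1 : `|a| + `|b| + `|s| <= N%:R by rewrite ltW// truncnS_gt.
apply: (@L1_domT _ _ _ leb _ _ _ (L1_norm (H N))).
  exact: (measurable_funM (mf_ind a b) (mf_pairl s mf)).
move=> t; rewrite (normrM (ind a b t)) (normrM (ind2 N%:R (t, s))); apply: ler_wpM2r => //.
rewrite (ger0_norm (ind2_ge0 _ _)) (ger0_norm (ind_ge0 _ _ _)) indE; case: ifPn => [/andP[h1 h2]|_]; last exact: ind2_ge0.
have a0 := normr_ge0 a; have b0 := normr_ge0 b; have s0 := normr_ge0 s.
have := ler_norm (- a); have := ler_norm b; rewrite normrN => h3 h4.
rewrite ind2E /= ifT//; apply/andP; split; last by lra.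
rewrite ler_norml; apply/andP; split; lra.
Qed.

Lemma li2_domM f (K : R * R -> R) : li2 f -> measurable_fun setT K ->
  (exists C, forall p, `|K p| <= C) -> (exists r, forall p, r < `|p.1| \/ r < `|p.2| -> K p = 0) ->
  L1 mm (fun p => K p * f p).
Proof.
move=> lf mK [C KC] [r K0].
have := @L1_bM _ _ _ mm C K _ mK KC (lf r); congr L1; apply/funext => p.
rewrite ind2E; case: ifPn => [_|]; first by rewrite mul1r.
by rewrite negb_and -!ltNge => /orP h; rewrite (K0 p h) !mul0r.
Qed.

Lemma test1_bnd eta : test1 eta -> exists2 C, 0 <= C & forall t, `|eta t| <= C /\ `|derive1 eta t| <= C.
Proof.
move=> T; have [r r0 er] := test1_supp T; have [ce _ _ cd] := T.
have [C1 C10 h1] := cont_bnd (- r) r ce; have [C2 C20 h2] := cont_bnd (- r) r cd.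
exists (C1 + C2) => [|t]; first exact: addr_ge0.
have [tr|/ltW tr] := leP `|t| r.
  have ht : - r <= t <= r by rewrite -ler_norml.
  by have := h1 t ht; have := h2 t ht; split; lra.
by have [-> ->] := er t tr; rewrite normr0 addr_ge0.
Qed.

Lemma mf_test1 eta : test1 eta -> measurable_fun setT eta /\ measurable_fun setT (derive1 eta).
Proof. by move=> [c _ _ d]; split; exact: continuous_measurable_fun. Qed.

Lemma li2_test f eta zeta : li2 f -> test1 eta -> test1 zeta ->
  L1 mm (fun p => eta p.1 * zeta p.2 * f p) /\ L1 mm (fun p => derive1 eta p.1 * zeta p.2 * f p).
Proof.
move=> lf Te Tz.
have [r1 r10 e1] := test1_supp Te; have [r2 r20 e2] := test1_supp Tz.
have [C1 C10 b1] := test1_bnd Te; have [C2 C20 b2] := test1_bnd Tz.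
have [me md] := mf_test1 Te; have [mz _] := mf_test1 Tz.
split; apply: li2_domM => //.
- exact: (measurable_funM (measurableT_comp me measurable_fst) (measurableT_comp mz measurable_snd)).
- by exists (C1 * C2) => p; rewrite normrM ler_pM//; [have [] := b1 p.1|have [] := b2 p.2].
- exists (Num.max r1 r2) => p; rewrite !gt_max => -[/andP[/ltW h _]|/andP[_ /ltW h]].
    by rewrite (e1 _ h).1 mul0r.
  by rewrite (e2 _ h).1 mulr0.
- exact: (measurable_funM (measurableT_comp md measurable_fst) (measurableT_comp mz measurable_snd)).
- by exists (C1 * C2) => p; rewrite normrM ler_pM//; [have [] := b1 p.1|have [] := b2 p.2].
- exists (Num.max r1 r2) => p; rewrite !gt_max => -[/andP[/ltW h _]|/andP[_ /ltW h]].
    by rewrite (e1 _ h).2 mul0r.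
  by rewrite (e2 _ h).1 mulr0.
Qed.

(** With end points depending on [p], the interval becomes an indicator in a third variable, and the
    integral a parametric one. *)
Lemma mf_J2 g (k1 k2 : R * R -> R) : measurable_fun setT g -> measurable_fun setT k1 ->
  measurable_fun setT k2 ->
  measurable_fun setT (fun p => J (k1 p) (k2 p) (fun t => g (t, p.2))).
Proof.
move=> mg mk1 mk2.
have -> : (fun p => J (k1 p) (k2 p) (fun t => g (t, p.2))) =
  (fun p => Int leb (fun t => (if (k1 p <= t) && (t <= k2 p) then 1 else 0) * g (t, p.2))).
  by apply/funext => p; congr Int; apply/funext => t; rewrite indE.
apply: (@measurable_Int_param _ _ _ _ _ leb
  (fun q => (if (k1 q.1 <= q.2) && (q.2 <= k2 q.1) then 1 else 0) * g (q.2, q.1.2))).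
have m1 : measurable_fun setT (fun q : (R * R) * R => q.1) by exact: measurable_fst.
have m2 : measurable_fun setT (fun q : (R * R) * R => q.2) by exact: measurable_snd.
apply: measurable_funM.
  apply: measurable_fun_ifT => //; apply: measurable_and.
    by apply: measurable_fun_ler => //; exact: (measurableT_comp mk1 m1).
  by apply: measurable_fun_ler => //; exact: (measurableT_comp mk2 m1).
apply: (measurableT_comp mg); apply: measurable_fun_pair => //.
exact: (measurableT_comp measurable_snd m1).
Qed.

Lemma mf_Js (k : R * R -> R) x y : measurable_fun setT k ->
  measurable_fun setT (fun s => J x y (fun t => k (t, s))).
Proof.
move=> mk; have h := mf_J2 mk (measurable_cst x) (measurable_cst y).
have hp : measurable_fun setT (fun s : R => (0 : R, s)).
  by apply: measurable_fun_pair => //; exact: measurable_cst.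
exact: (measurableT_comp h hp).
Qed.

(** The primitive is continuous, so rational end points decide. Countability is the point: a
    condition known for almost every line and each fixed interval then holds on almost every line
    for all rational intervals at once. *)
Lemma J0_rat_ae0 (g : R -> R) : li g -> (forall q1 q2 : rat, (q1 <= q2)%R -> J (ratr q1) (ratr q2) g = 0) ->
  {ae leb, forall t, g t = 0}.
Proof.
move=> lg H; have A := S0_ac lg; have cS := ac_continuous A; have [_ E] := A.
have C (q1 q2 : rat) : S0 g (ratr q1) = S0 g (ratr q2).
  wlog q12 : q1 q2 / (q1 <= q2)%R => [W|].
    by case/orP: (le_total q1 q2) => h; [exact: W|apply/esym; exact: W].
  apply/eqP; rewrite eq_sym -subr_eq0 E ?ler_rat// H//.
have S00 x : S0 g x = S0 g 0.
  apply/eqP; rewrite -subr_eq0 -normr_le0; apply/ler_addgt0Pr => e e0; rewrite add0r.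
  have := cS x; move/cvgrPdist_le => /(_ e e0) /nbhs_ballP[d d0 Hd].
  have [q] := @rat_in_itvoo R (x - d) (x + d) ltac:(move: d0; rewrite /=; lra).
  rewrite in_itv/= => /andP[q1 q2].
  have := Hd (ratr q); rewrite /ball/= distrC ltr_norml => /(_ _).
  by rewrite (C q 0) rmorph0; apply; lra.
apply: J0_ae0 => // a b ab; by rewrite -E// (S00 b) (S00 a) subrr.
Qed.

(** Let I be the primitive of [g] along horizontal lines. The difference k = f - I has zero weak
    x_1-derivative against products of test functions, hence on almost every line its mean over any
    rational interval is its mean over [0,1], and k(t,s) = k0(s) a.e. The representative is I +
    k0. *)
Lemma weak_rep f g : li2 f -> li2 g ->
  (forall eta zeta, test1 eta -> test1 zeta ->
    Int mm (fun p => f p * (derive1 eta p.1 * zeta p.2)) =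
    - Int mm (fun p => g p * (eta p.1 * zeta p.2))) ->
  exists fH : R * R -> R, [/\ measurable_fun setT fH, {ae mm, forall p, f p = fH p} &
    {ae leb, forall s, ac (fun t => fH (t, s)) (fun t => g (t, s))}].
Proof.
move=> lf lg H; have mf := li2_mf lf; have mg := li2_mf lg.
have sg := li2_slice lg; have sf := li2_slice lf.
pose I p := S0 (fun t => g (t, p.2)) p.1.
have mI : measurable_fun setT I.
  by apply: measurable_funB; apply: mf_J2 => //; try exact: measurable_fst; exact: measurable_cst.
(* On a box the primitive is at most the integral of |g| over the whole horizontal segment, which is
   integrable in s. *)
have lI : li2 I.
  move=> r.
  have Lr := lg r; have [_ L2 _] := fub2 (L1_norm Lr).
  have L3 := L1_tensor (li_cont (@cst_continuous _ _ (1 : R)) (- r) r) L2.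
  have {}L3 := L3.1.
  apply: (L1_dom _ L3); first exact: (measurable_funM (mf_ind2 r) mI).
  apply: prod_ae2.
    rewrite -[X in measurable X]setTI.
    apply: measurable_fun_ler => //; last exact: (L1_mf L3).
    by apply: measurableT_comp => //; exact: (measurable_funM (mf_ind2 r) mI).
  apply: filterS sg => s ls; apply: aeW => t /=.
  rewrite (normrM (ind2 _ _)) (ger0_norm (ind2_ge0 _ _)) ind2E /= indE -ler_norml mulr1.
  case: (boolP (`|t| <= r)) => tr; last by rewrite !mul0r.
  rewrite mul1r; case: (boolP (`|s| <= r)) => sr /=; last by rewrite mul0r Int_ge0.
  have r0 : 0 <= r by apply: le_trans tr.
  have -> : (fun x : R => `|ind2 r (x, s) * g (x, s)|) = (fun x => ind (- r) r x * `|g (x, s)|).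
    apply/funext => x; rewrite (normrM (ind2 _ _)) (ger0_norm (ind2_ge0 _ _)) /ind2 /= [X in _ * X * _]indE -ler_norml sr mulr1//.
  rewrite mul1r -/(J (- r) r (fun x => `|g (x, s)|)).
  move: tr; rewrite ler_norml => /andP[t1 t2].
  have lns := li_norm ls.
  have J0 x y : 0 <= J x y (fun x => `|g (x, s)|) by apply: Int_ge0 => z; rewrite mulr_ge0 ?ind_ge0.
  have mon x y : - r <= x -> y <= r -> J x y (fun x => `|g (x, s)|) <= J (- r) r (fun x => `|g (x, s)|).
    move=> h1 h2; have [xy|yx] := leP x y; last by rewrite J_gt.
    by rewrite (@J_cat _ (- r) x r)// ?(@J_cat _ x y r)// ?xy ?h1 ?h2 ?(le_trans xy)//; have := J0 (- r) x; have := J0 y r; lra.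
  rewrite /I /S0 /=; have [t0|t0] := leP 0 t.
    have -> : J t 0 (fun t0 => g (t0, s)) = 0.
      by move: t0; rewrite le_eqVlt => /predU1P[<-|t0]; [rewrite J_xx|rewrite J_gt].
    rewrite subr0; apply: (le_trans (J_norm _ _ ls)); apply: mon => //; lra.
  rewrite (@J_gt _ 0 t)// sub0r normrN.
  by apply: (le_trans (J_norm _ _ ls)); apply: mon.
pose k p := f p + -1 * I p.
have mk : measurable_fun setT k.
  by apply: measurable_funD => //; apply: measurable_funM => //; exact: measurable_cst.
have lk : li2 k.
  move=> r; have := L1D (lf r) (L1Z (-1) (lI r)); congr L1; apply/funext => p.
  by rewrite /k; ring.
have sk := li2_slice lk.
have kz eta zeta : test1 eta -> test1 zeta -> Int mm (fun p => derive1 eta p.1 * zeta p.2 * k p) = 0.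
  move=> Te Tz.
  have [_ Lf] := li2_test lf Te Tz; have [_ LI] := li2_test lI Te Tz; have [Lg _] := li2_test lg Te Tz.
  have -> : (fun p => derive1 eta p.1 * zeta p.2 * k p) =
     (fun p => derive1 eta p.1 * zeta p.2 * f p - derive1 eta p.1 * zeta p.2 * I p).
    by apply/funext => p; rewrite /k; ring.
  rewrite IntB//.
  have -> : Int mm (fun p => derive1 eta p.1 * zeta p.2 * f p) = - Int mm (fun p => eta p.1 * zeta p.2 * g p).
    have := H _ _ Te Tz.
    rewrite (_ : (fun p => f p * _) = (fun p => derive1 eta p.1 * zeta p.2 * f p)); last by apply/funext => p; ring.
    by rewrite (_ : (fun p => g p * _) = (fun p => eta p.1 * zeta p.2 * g p)); last by apply/funext => p; ring.
  have [_ L1' ->] := fub2 LI; have [_ L2' ->] := fub2 Lg.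
  apply/eqP; rewrite -opprD oppr_eq0 addr_eq0; apply/eqP.
  rewrite -IntN//; apply: Int_ae; [exact: (L1_mf L2')|exact: (L1_mf (L1N L1'))|].
  apply: filterS sg => s ls /=.
  have [h1 [h2 h3]] := ac_ibp (S0_ac ls) Te.
  have -> : (fun x => eta x * zeta s * g (x, s)) = (fun x => zeta s * (g (x, s) * eta x)) by apply/funext => x; ring.
  have -> : (fun x => derive1 eta x * zeta s * I (x, s)) = (fun x => zeta s * (S0 (fun t => g (t, s)) x * derive1 eta x)).
    by apply/funext => x; rewrite /I /=; ring.
  by rewrite !IntZ// h3; ring.
have liz zeta a b : test1 zeta -> L1 mm (fun p => ind a b p.1 * zeta p.2 * k p).
  move=> Tz; have [r2 r20 e2] := test1_supp Tz; have [C2 C20 b2] := test1_bnd Tz.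
  have [mz _] := mf_test1 Tz.
  apply: li2_domM => //.
  - exact: (measurable_funM (measurableT_comp (mf_ind a b) measurable_fst) (measurableT_comp mz measurable_snd)).
  - by exists (1 * C2) => p; rewrite normrM ler_pM//; [exact: ind_bnd|have [] := b2 p.2].
  - exists (Num.max (`|a| + `|b|) r2) => p; rewrite !gt_max => -[/andP[h _]|/andP[_ /ltW h]].
      rewrite indE ifF ?mul0r//; apply/negbTE/negP => /andP[h1 h2].
      have := ler_norm (- a); have := ler_norm b; rewrite normrN => h3 h4.
      have := normr_ge0 a; have := normr_ge0 b => h5 h6.
      have : `|p.1| <= `|a| + `|b| by rewrite ler_norml; lra.
      by rewrite leNgt h.
    by rewrite (e2 _ h).1 mulr0.
have main a b : a <= b -> {ae leb, forall s, J a b (fun t => k (t, s)) = (b - a) * J 0 1 (fun t => k (t, s))}.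
  move=> ab.
  have mJ x y : measurable_fun setT (fun s => J x y (fun t => k (t, s))).
    exact: mf_Js.
  have lJ x y : li (fun s => J x y (fun t => k (t, s))).
    move=> c d; pose r := `|x| + `|y| + `|c| + `|d|.
    have [_ L2 _] := fub2 (L1_norm (lk r)); have [h1 _ _] := fub2 (lk r).
    apply: (L1_dom _ L2); first exact: (measurable_funM (mf_ind c d) (mJ x y)).
    apply: filterS h1 => s Ls.
    rewrite indE; case: ifPn => [/andP[h1 h2]|_]; last by rewrite mul0r normr0 Int_ge0.
    rewrite mul1r.
    have rr : (fun t => ind x y t * k (t, s)) = (fun t => ind x y t * (ind2 r (t, s) * k (t, s))).
      apply/funext => t; rewrite ind2E indE; case: ifPn => [/andP[h3 h4]|_]; last by rewrite !mul0r.
      have := ler_norm (- x); have := ler_norm y; have := ler_norm (- c); have := ler_norm d; rewrite !normrN => h5 h6 h7 h8.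
      have := normr_ge0 x; have := normr_ge0 y; have := normr_ge0 c; have := normr_ge0 d => h9 h10 h11 h12.
      rewrite ifT ?mul1r//; apply/andP; split; rewrite ler_norml /r; apply/andP; split; rewrite /=; lra.
    rewrite /J rr.
    have L' : L1 leb (fun t => ind x y t * (ind2 r (t, s) * k (t, s))).
      by apply: (@L1_bM _ _ _ _ 1) => //; [exact: mf_ind|exact: ind_bnd].
    apply: (le_trans (Int_norm L')); apply: Int_leT => [||t]; [exact: L1_norm|exact: L1_norm|].
    by rewrite normrM -[leRHS]mul1r ler_wpM2r// ind_bnd.
  pose Q s := J a b (fun t => k (t, s)) + - (b - a) * J 0 1 (fun t => k (t, s)).
  have lQ : li Q by apply: liD => //; exact: liZ.
  have Q0 zeta : test1 zeta -> Int leb (fun s => Q s * zeta s) = 0.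
    (* Averaging [k] against [zeta] leaves a function of t alone with zero weak derivative, to which
       [dubois] applies. *)
    move=> Tz; pose K t := Int leb (fun s => zeta s * k (t, s)).
    have KE x y t : Int leb (fun s => ind x y t * zeta s * k (t, s)) = ind x y t * K t.
      rewrite indE; case: ifP => _.
        by rewrite mul1r; congr Int; apply/funext => s; rewrite mul1r.
      by rewrite mul0r -[RHS](Int0 leb); congr Int; apply/funext => s; rewrite !mul0r.
    have lK : li K.
      move=> x y; have [_ L _] := fub1 (@liz zeta x y Tz); move: L; congr L1.
      by apply/funext => t; rewrite /= KE.
    have JK x y : J x y K = Int leb (fun s => zeta s * J x y (fun t => k (t, s))).
      have L := @liz zeta x y Tz; have [_ _ e1] := fub1 L; have [h2 L2 e2] := fub2 L.
      rewrite /J -(_ : (fun t => Int leb (fun s => ind x y t * zeta s * k (t, s))) = (fun t => ind x y t * K t)); last by apply/funext => t; rewrite KE.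
      rewrite -e1 e2; apply: Int_ae; first exact: (L1_mf L2).
        have [mz _] := mf_test1 Tz.
        exact: (measurable_funM mz (mJ x y)).
      apply: filterS sk => s ls /=; rewrite -IntZ//; congr Int; apply/funext => t; ring.
    have DK := @dubois R K lK _ a b ab.
    have {}DK : J a b K = (b - a) * J 0 1 K.
      apply: DK => eta Te; have [_ L] := li2_test lk Te Tz; have [_ L2 e1] := fub1 L.
      have [r _ er] := test1_supp Te; have [_ md] := mf_test1 Te.
      rewrite -(@kz eta zeta Te Tz) e1.
      apply: Int_ae; [exact: (measurable_funM (li_mf lK) md)|exact: (L1_mf L2)|].
      have [hr _ _] := fub1 (@liz zeta (- r) r Tz); apply: filterS hr => t Lt /=.
      have [tr|/ltW tr] := leP `|t| r; last first.
        rewrite (er t tr).2 mulr0 -[LHS](Int0 leb); congr Int; apply/funext => s; by rewrite !mul0r.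
      have Ls : L1 leb (fun s => zeta s * k (t, s)).
        by move: Lt; congr L1; apply/funext => s; rewrite /= indE -ler_norml tr mul1r.
      by rewrite /K mulrC -IntZ//; congr Int; apply/funext => s; rewrite mulrA.
    have LJ x y : L1 leb (fun s => zeta s * J x y (fun t => k (t, s))).
      have [r _ er] := test1_supp Tz; have [cz _ _ _] := Tz.
      have := @li_test R _ zeta (lJ x y) cz (ex_intro _ r (fun t h => (er t h).1)).
      by congr L1; apply/funext => s; rewrite mulrC.
    have -> : (fun s => Q s * zeta s) = (fun s => zeta s * J a b (fun t => k (t, s)) + - (b - a) * (zeta s * J 0 1 (fun t => k (t, s)))).
      by apply/funext => s; rewrite /Q; ring.
    by rewrite IntD ?IntZ//; [rewrite -!JK DK; ring|exact: L1Z].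
  (* [Q] is orthogonal to all test functions, so it is a weak derivative of 0: an absolutely
     continuous function that vanishes a.e. has derivative [Q], and [ac_level0] gives [Q] = 0
     a.e. *)
  have [h Ah h0] : exists2 h, ac h Q & {ae leb, forall t, 0 = h t}.
    apply: weak_ac => //; first by apply: li_cont; exact: cst_continuous.
    move=> eta Te; rewrite Q0// oppr0 -[RHS](Int0 leb); congr Int; apply/funext => t; exact: mul0r.
  have := ac_level0 Ah; apply: filterS2 h0 => s h0 /(_ (esym h0)); rewrite /Q => e.
  set X := J a b _ in e *; set Y := J 0 1 _ in e *.
  have -> : X = (X + - (b - a) * Y) + (b - a) * Y by ring.
  by rewrite e add0r.
have mainq : {ae leb, forall s, forall q1 q2 : rat, (q1 <= q2)%R ->
    J (ratr q1) (ratr q2) (fun t => k (t, s)) = (ratr q2 - ratr q1) * J 0 1 (fun t => k (t, s))}.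
  have : {ae leb, forall s, forall n : nat, forall q1 q2 : rat, unpickle n = Some (q1, q2) -> (q1 <= q2)%R ->
      J (ratr q1) (ratr q2) (fun t => k (t, s)) = (ratr q2 - ratr q1) * J 0 1 (fun t => k (t, s))}.
    apply/ae_foralln => n; case: (unpickle n) => [[q1 q2]|]; last exact: aeW.
    have [q12|q12] := boolP (q1 <= q2)%R; last by apply: aeW => s ? ? [<- <-]; rewrite (negbTE q12).
    have q12' : (ratr q1 : R) <= ratr q2 by rewrite ler_rat.
    by apply: filterS (main _ _ q12') => s hs ? ? [<- <-].
  by apply: filterS => s hs q1 q2; apply: (hs (pickle (q1, q2))); exact: pickleK.
pose k0 s := J 0 1 (fun t => k (t, s)).
have mk0 : measurable_fun setT k0.
  exact: mf_Js.
have kk0 : {ae leb, forall s, {ae leb, forall t, k (t, s) = k0 s}}.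
  apply: filterS2 sk mainq => s ls hs.
  have lc : li (fun=> - k0 s) by apply: li_cont; exact: cst_continuous.
  have : {ae leb, forall t, k (t, s) + - k0 s = 0}.
    apply: J0_rat_ae0 => [|q1 q2 q12]; first exact: liD.
    by rewrite J_D// J_cst ?ler_rat// hs// /k0; ring.
  by apply: filterS => t /eqP; rewrite subr_eq0 => /eqP.
have mfH : measurable_fun setT (fun p => I p + k0 p.2).
  apply: measurable_funD => //; exact: (measurableT_comp mk0 measurable_snd).
exists (fun p => I p + k0 p.2); split => //.
  apply: prod_ae2; first exact: measurable_eq_set.
  apply: filterS kk0 => s; apply: filterS => t /= <-; rewrite /k; ring.
apply: filterS sg => s ls; have [_ E] := S0_ac ls.
by split => // a b ab; rewrite -E// /I /=; ring.
Qed.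

End WeakRep.

(** * Translation invariance of Lebesgue measure *)

Section Translation.
Context {R : realType}.
Implicit Types (a b c t x y : R).
Local Notation leb := (@lebesgue_measure R).

Lemma mf_shift c : measurable_fun [set: R] (fun x : R => x + c).
Proof. by apply: measurable_funD => //; exact: measurable_cst. Qed.

Definition leb_pre c (A : set (measurableTypeR R)) : \bar R :=
  leb ((fun x : measurableTypeR R => (x + c : measurableTypeR R)) @^-1` A).

Let mpre c (A : set (measurableTypeR R)) : measurable A ->
  measurable ((fun x : measurableTypeR R => (x + c : measurableTypeR R)) @^-1` A).
Proof. by move=> mA; rewrite -[X in measurable X]setTI; exact: mf_shift. Qed.

Let leb_pre0 c : leb_pre c set0 = 0%E.
Proof. by rewrite /leb_pre preimage_set0 measure0. Qed.

Let leb_pre_ge0 c A : (0 <= leb_pre c A)%E.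
Proof. exact: measure_ge0. Qed.

Let leb_pre_sigma c : semi_sigma_additive (leb_pre c).
Proof.
move=> F mF tF mUF; rewrite /leb_pre preimage_bigcup.
apply: measure_semi_sigma_additive.
- by move=> n; exact: mpre.
- apply/trivIsetP => /= i j _ _ ij; rewrite -preimage_setI.
  by move/trivIsetP : tF => /(_ _ _ _ _ ij) ->//; rewrite preimage_set0.
- by rewrite -preimage_bigcup; exact: mpre.
Qed.

HB.instance Definition _ c := isMeasure.Build _ _ _ (leb_pre c) (leb_pre0 c) (leb_pre_ge0 c) (@leb_pre_sigma c).

Lemma leb_shift c (A : set R) : measurable A -> leb ((fun x => x + c) @^-1` A) = leb A.
Proof.
move=> mA; rewrite -[LHS]/(leb_pre c A); apply/esym.
apply: (@lebesgue_measure_unique R (leb_pre c)) => //.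
move=> X [[x y] _ <-] /=; rewrite /leb_pre.
rewrite (_ : _ @^-1` _ = `]x - c, y - c]%classic); last first.
  by apply/seteqP; split => z /=; rewrite !in_itv/= => /andP[? ?]; apply/andP; split; lra.
rewrite !lebesgue_measure_itv/= !lte_fin ltrD2r; case: ifP => // _.
by rewrite -!EFinD; congr EFin; ring.
Qed.

Lemma ge0_int_shift c (f : R -> \bar R) : measurable_fun setT f -> (forall x, 0 <= f x)%E ->
  (\int[leb]_x f (x + c)%R = \int[leb]_x f x)%E.
Proof.
move=> mf f0.
have := @ge0_integral_pushforward _ _ _ _ R (fun x : measurableTypeR R => (x + c : measurableTypeR R))
  (mf_shift c) leb setT f measurableT mf (fun x _ => f0 x).
rewrite preimage_setT => <-.
rewrite -[LHS]/(\int[leb_pre c]_y f y)%E.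
by apply: eq_measure_integral => A mA _; exact: leb_shift.
Qed.

Lemma Int_shift c (f : R -> R) : L1 leb f ->
  L1 leb (fun x => f (x + c)) /\ Int leb (fun x => f (x + c)) = Int leb f.
Proof.
move=> Lf; have mf := L1_mf Lf.
have mfs : measurable_fun setT (fun x => f (x + c)) by exact: (measurableT_comp mf (mf_shift c)).
have mE : measurable_fun setT (EFin \o f) by exact/measurable_EFinP.
split.
  apply: L1P => //; have /integrableP[_] := Lf.
  rewrite -(@ge0_int_shift c (fun x : R => `|(EFin \o f) x|%E)) //; exact: measurableT_comp.
congr fine; rewrite integralE [RHS]integralE; congr (_ - _)%E.
  have := @ge0_int_shift c ((EFin \o f)^\+)%E (measurable_funepos mE) (fun x => funepos_ge0 _ x).
  by move=> <-; apply: eq_integral => x _; rewrite !funeposE.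
have := @ge0_int_shift c ((EFin \o f)^\-)%E (measurable_funeneg mE) (fun x => funeneg_ge0 _ x).
by move=> <-; apply: eq_integral => x _; rewrite !funenegE.
Qed.

Lemma ae_shift c (P : R -> Prop) : {ae leb, forall t, P t} -> {ae leb, forall t, P (t + c)}.
Proof.
move=> [N [mN N0 PN]]; exists ((fun x => x + c) @^-1` N); split.
- by rewrite -[X in measurable X]setTI; exact: mf_shift.
- by rewrite -[RHS]N0; exact: leb_shift.
- by move=> t /= nP; exact: PN.
Qed.

Lemma ae_cont_eq (f g : R -> R) : continuous f -> continuous g ->
  {ae leb, forall t, f t = g t} -> forall t, f t = g t.
Proof.
move=> cf cg fg t; apply/eqP; rewrite -subr_eq0; apply/negPn/negP => h.
pose d t := `|f t - g t|.
have cd : {for t, continuous d} by apply: continuous_comp; [apply: continuousB; [exact: cf|exact: cg]|exact: norm_continuous].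
have d0 : 0 < d t by rewrite normr_gt0.
move/cvgrPdist_lt : cd => /(_ _ d0) /nbhs_ballP[e /= e0 He].
have [N [mN N0 PN]] := fg.
have : leb `]t - e, t + e[%classic = 0%E.
  apply: (subset_measure0 _ mN _ N0) => // z /=; rewrite in_itv/= => /andP[z1 z2]; apply: PN => /= E.
  have zb : ball t e z by rewrite /ball/= ltr_norml; lra.
  by have := He z zb; rewrite /= {2}/d E subrr normr0 subr0 normr_id ltxx.
rewrite lebesgue_measure_itv/= lte_fin ifT; last by lra.
by rewrite -EFinD => -[]; lra.
Qed.

End Translation.

(** * The cylinder as a measure space *)

Section Strip.
Context {R : realType}.
Implicit Types (a b c t x y : R).
Local Notation leb := (@lebesgue_measure R).

Lemma leb01 : (leb `[0%R, 1%R[%classic < +oo)%E.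
Proof. by rewrite lebesgue_measure_itv/= lte_fin ltr01 -EFinD ltry. Qed.

(** The circle is modelled by the whole line carrying Lebesgue measure of one period: functions stay
    defined on R while the measure has mass 1. *)
Definition nu : set (measurableTypeR R) -> \bar R :=
  mrestr leb (measurable_itv `[(0 : R), 1[).
HB.instance Definition _ := Measure.on nu.

Let nu_fin : fin_num_fun nu.
Proof.
move=> U mU; rewrite /nu /mrestr ge0_fin_numE ?measure_ge0//.
by apply: le_lt_trans leb01; apply: le_measure; rewrite ?inE//; exact: measurableI.
Qed.
HB.instance Definition _ := Measure_isFinite.Build _ _ _ nu nu_fin.

Definition M := (leb \x nu)%E.

#[global] Instance ae_nu_filter : Filter (almost_everywhere nu).
Proof. exact: (ae_filter_ringOfSetsType nu). Qed.
#[global] Instance ae_M_filter : Filter (almost_everywhere M).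
Proof. exact: (ae_filter_ringOfSetsType M). Qed.

Lemma nuE (A : set R) : nu A = leb (A `&` `[0, 1[%classic).
Proof. by []. Qed.

Lemma ae_nu (P : R -> Prop) : {ae leb, forall t, P t} -> {ae nu, forall t, P t}.
Proof.
move=> [N [mN N0 PN]]; exists N; split => //.
rewrite nuE; apply/eqP; rewrite -measure_le0 -N0; apply: le_measure; rewrite ?inE//.
by apply: measurableI.
Qed.

Lemma nu_ae (P : R -> Prop) : {ae nu, forall t, P t} -> {ae leb, forall t, 0 <= t <= 1 -> P t}.
Proof.
move=> [N [mN N0 PN]]; exists ((N `&` `[0, 1[%classic) `|` [set 1]); split.
- by apply: measurableU => //; exact: measurableI.
- apply/negligibleP; first by apply: measurableU => //; exact: measurableI.
  apply: negligibleU; apply/negligibleP => //; [exact: measurableI|].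
  exact: lebesgue_measure_set1.
- move=> t /= /not_implyP[/andP[t0 t1] nP].
  have [->|t1'] := eqVneq t 1; [by right|left]; split; first exact: PN.
  by rewrite /= in_itv/= t0 lt_neqAle t1' t1.
Qed.

Lemma ge0_int_nu (f : R -> \bar R) : measurable_fun setT f -> (forall x, 0 <= f x)%E ->
  (\int[nu]_x f x = \int[leb]_(x in `[0%R, 1%R[) f x)%E.
Proof.
move=> mf f0; have mD : measurable (`[0%R, 1%R[%classic : set R) by [].
rewrite -(setUv `[0%R, 1%R[%classic) ge0_integral_setU//=; last 3 first.
- exact: measurableC.
- by rewrite setUv.
- by rewrite disj_set2E setICr.
rewrite [X in (_ + X)%E](_ : _ = 0%E) ?adde0.
  apply: eq_measure_integral => A mA AD.
  transitivity (leb (A `&` `[0%R, 1%R[%classic)) => //; congr (leb _).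
  by apply/setIidl.
apply: null_set_integral; first exact: measurableC.
  exact: measurable_funTS.
transitivity (leb (~` `[0%R, 1%R[%classic `&` `[0%R, 1%R[%classic)) => //.
by rewrite setICl measure0.
Qed.

Lemma nu_integrable (f : R -> R) : measurable_fun setT f ->
  L1 nu f <-> leb.-integrable `[0%R, 1%R[ (EFin \o f).
Proof.
move=> mf; have mE : measurable_fun setT (EFin \o f) by exact/measurable_EFinP.
have e : (\int[nu]_x `|(EFin \o f) x| = \int[leb]_(x in `[0%R, 1%R[) `|(EFin \o f) x|)%E.
  by apply: ge0_int_nu => //; exact: measurableT_comp.
split => /integrableP[_ h]; apply/integrableP; split => //.
- exact: measurable_funTS.
- by rewrite -e.
- by rewrite e.
Qed.

Lemma Int_nuE (f : R -> R) : measurable_fun setT f -> Int nu f = Rintegral leb `[0, 1[ f.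
Proof.
move=> mf; have mE : measurable_fun setT (EFin \o f) by exact/measurable_EFinP.
congr fine; rewrite integralE [RHS]integralE; congr (_ - _)%E; apply: ge0_int_nu => //.
  exact: measurable_funepos.
exact: measurable_funeneg.
Qed.

Lemma ind01_nu (f : R -> R) : L1 leb (fun t => ind 0 1 t * f t) -> measurable_fun setT f ->
  L1 nu f /\ Int nu f = J 0 1 f.
Proof.
move=> /li_integrable lf mf.
have lf' : leb.-integrable `[0%R, 1%R[ (EFin \o f).
  by apply: integrableS lf => //; exact: subset_itv_co_cc.
split; first exact/nu_integrable.
by rewrite Int_nuE// J_itv -Rintegral_itv_bndo_bndc.
Qed.

Lemma Int_nu_cst (c : R) : L1 nu (fun=> c) /\ Int nu (fun=> c) = c.
Proof.
have lc : li (fun=> c) by apply: li_cont; exact: cst_continuous.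
have [-> ->] := ind01_nu (lc 0 1) (measurable_cst c).
by rewrite J_cst//; split => //; ring.
Qed.

Lemma ae_M (P : R * R -> Prop) : {ae (leb \x leb)%E, forall p, P p} -> {ae M, forall p, P p}.
Proof.
move=> [N [mN N0 PN]].
have h : {ae (leb \x leb)%E, forall p, ~ N p} by exists N; split => // p /= /contrapT.
have h2 : {ae M, forall p, ~ N p}.
  apply: prod_ae1; first exact: measurableC.
  by apply: filterS (ae_prod1 h) => t; exact: ae_nu.
by apply: filterS h2 => p np; apply: contrapT => nP; apply: np; exact: PN.
Qed.

Lemma ae_M_t (P : R -> Prop) : {ae leb, forall t, P t} -> {ae M, forall p, P p.1}.
Proof.
move=> [N [mN N0 PN]].
have h2 : {ae M, forall p, ~ N p.1}.
  apply: prod_ae1.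
    rewrite (_ : [set p | _] = fst @^-1` (~` N))//.
    by rewrite -[X in measurable X]setTI; apply: measurable_fst => //; exact: measurableC.
  exists N; split => // x /= h; apply: contrapT => nN; apply: h; exact: aeW.
by apply: filterS h2 => p np; apply: contrapT => nP; apply: np; exact: PN.
Qed.

Lemma ae_M_s (P : R -> Prop) : {ae nu, forall t, P t} -> {ae M, forall p, P p.2}.
Proof.
move=> [N [mN N0 PN]].
have h2 : {ae M, forall p, ~ N p.2}.
  apply: prod_ae2.
    rewrite (_ : [set p | _] = snd @^-1` (~` N))//.
    by rewrite -[X in measurable X]setTI; apply: measurable_snd => //; exact: measurableC.
  exists N; split => // x /= h; apply: contrapT => nN; apply: h; exact: aeW.
by apply: filterS h2 => p np; apply: contrapT => nP; apply: np; exact: PN.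
Qed.

Lemma ge0_cyl_M (f : R * R -> \bar R) : measurable_fun setT f -> (forall p, 0 <= f p)%E ->
  (\int[mu2]_(p in cyl) f p = \int[M]_p f p)%E.
Proof.
move=> mf f0.
have mc : measurable (cyl : set (R * R)).
  rewrite (_ : cyl = snd @^-1` `[0%R, 1%R[%classic).
    by rewrite -[X in measurable X]setTI; apply: measurable_snd.
  by apply/seteqP; split => p /=; rewrite in_itv/= => /andP.
rewrite integral_mkcond /mu2 /lebR.
have mfr : measurable_fun setT (f \_ cyl).
  by apply/(measurable_restrictT _ mc); exact: measurable_funTS.
have fr0 (x : R * R) : (0 <= (f \_ cyl) x)%E by rewrite patchE; case: ifP.
rewrite (fubini_tonelli1 (m1 := leb) (m2 := leb) _ mfr fr0).
rewrite (fubini_tonelli1 (m1 := leb) (m2 := nu) _ mf f0).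
apply: eq_integral => t _; rewrite /fubini_F.
rewrite ge0_int_nu//; last exact: (measurableT_comp mf (measurable_pair1 t)).
rewrite [RHS]integral_mkcond; apply: eq_integral => s _; rewrite !patchE.
congr (if _ then _ else _); apply/idP/idP; rewrite !inE /cyl /= in_itv/= => /andP//.
Qed.

End Strip.

(** * Sobolev functions on the cylinder, described line by line *)

Section W12.
Context {R : realType}.
Implicit Types (a b c t x y : R).
Local Notation leb := (@lebesgue_measure R).
Local Notation nu := (@nu R).
Local Notation M := (@M R).

Lemma ac_ae (f g g' : R -> R) : ac f g -> measurable_fun setT g' ->
  {ae leb, forall t, g t = g' t} -> ac f g'.
Proof.
move=> [lg fg] mg' gg; split.
  move=> a b; apply: (L1_ae _ (lg a b)); first exact: (measurable_funM (mf_ind a b) mg').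
  by apply: filterS gg => t ->.
move=> a b ab; rewrite fg//; apply: (J_ae (li_mf lg) mg').
by apply: filterS gg => t h _.
Qed.

Lemma ac_cst c : ac (fun=> c) (fun=> 0 : R).
Proof.
split; first by apply: li_cont; exact: cst_continuous.
by move=> a b ab; rewrite J_cst// subrr mul0r.
Qed.

Lemma ac_shift c (f g : R -> R) : ac f g -> ac (fun t => f (t + c)) (fun t => g (t + c)).
Proof.
move=> [lg fg].
have E a b : (fun t => ind a b t * g (t + c)) = (fun t => ind (a + c) (b + c) (t + c) * g (t + c)).
  by apply/funext => t; rewrite !indE !lerD2r.
split.
  by move=> a b; have := (Int_shift c (lg (a + c) (b + c))).1; rewrite -E.
move=> a b ab; rewrite fg ?lerD2r// /J E.
by rewrite (Int_shift c (lg (a + c) (b + c))).2.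
Qed.

Lemma ac_lin x y (f1 g1 f2 g2 : R -> R) : ac f1 g1 -> ac f2 g2 ->
  ac (fun t => x * f1 t + y * f2 t) (fun t => x * g1 t + y * g2 t).
Proof.
move=> [l1 e1] [l2 e2]; split; first by apply: liD; exact: liZ.
move=> a b ab; rewrite J_D ?J_Z//; [|exact: liZ..].
by rewrite -e1// -e2//; ring.
Qed.

Lemma ac_cut a b (f g : R -> R) : a <= b -> ac f g -> f a = 0 -> f b = 0 ->
  ac (fun t => ind a b t * f t) (fun t => ind a b t * g t).
Proof.
move=> ab [lg fg] fa fb.
have mg := li_mf lg.
have lk : li (fun t => ind a b t * g t).
  move=> x y; apply: (@L1_bM _ _ _ leb 1) => //; [exact: mf_ind|exact: ind_bnd].
split => // x y xy.
(* both sides are the increment of the clipped function *)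
pose cl z := Num.min (Num.max z a) b.
have acl z : a <= cl z <= b.
  by rewrite /cl le_min le_max lexx orbT ab ge_min lexx orbT.
have fcl z : ind a b z * f z = f (cl z).
  rewrite indE /cl; case: ifPn => [/andP[h1 h2]|]; first by rewrite mul1r max_l// min_l.
  rewrite negb_and -!ltNge mul0r => /orP[h|h]; first by rewrite max_r ?ltW// min_l// fa.
  by rewrite max_l; [rewrite min_r ?fb// ltW|lra].
have clxy : cl x <= cl y by rewrite /cl; apply: le_min2 => //; apply: le_max2.
rewrite !fcl fg//.
apply: Int_ae.
- exact: (measurable_funM (mf_ind _ _) mg).
- exact: (measurable_funM (mf_ind _ _) (measurable_funM (mf_ind _ _) mg)).
(* At the clipped end points the indicators may disagree, for instance when [x,y] lies to the right
   of b and both are clipped to b. *)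
exists [set cl x; cl y]; split; first exact: measurableU.
  by apply: countable_lebesgue_measure0; exact: finite_set_countable.
move=> t /= h; apply: contrapT => /not_orP[/eqP t1 /eqP t2]; apply: h.
have [t0|] := eqVneq (g t) 0; first by rewrite t0 !mulr0.
move=> _; rewrite mulrA; congr (_ * _); rewrite !indE.
have cl3 z : [\/ z <= a /\ cl z = a, a < z <= b /\ cl z = z | b < z /\ cl z = b].
  rewrite /cl; have [h1|h1] := leP z a; first by constructor 1; rewrite ?min_l.
  have [h2|h2] := leP z b; first by constructor 2.
  by constructor 3.
have L1' : t <= b -> (cl x <= t) = (x <= t) && (a <= t).
  move=> tb; apply/idP/andP => [h|[h1 h2]].
    case: (cl3 x) => -[h3 h4]; rewrite h4 in h t1.
    - by split=> //; lra.
    - by split=> //; lra.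
    - by exfalso; move/eqP: t1; apply; apply/le_anti; rewrite tb h.
  by case: (cl3 x) => -[h3 ->] //; lra.
have L2' : a <= t -> (t <= cl y) = (t <= y) && (t <= b).
  move=> at_; apply/idP/andP => [h|[h1 h2]].
    case: (cl3 y) => -[h3 h4]; rewrite h4 in h t2.
    - by exfalso; move/eqP: t2; apply; apply/le_anti; rewrite at_ h.
    - by split=> //; lra.
    - by split=> //; lra.
  by case: (cl3 y) => -[h3 ->] //; lra.
have [/andP[xa xb] /andP[ya yb]] := (acl x, acl y).
have [at_|ta] := leP a t; last first.
  by rewrite (_ : cl x <= t = false) ?andbF ?mulr0//; apply/negbTE; rewrite -ltNge; lra.
have [tb|bt] := leP t b; last first.
  by rewrite andbF mulr0 (_ : t <= cl y = false) ?andbF//; apply/negbTE; rewrite -ltNge; lra.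
by rewrite (L1' tb) (L2' at_) at_ tb !andbT mulr1.
Qed.

(** Absolute continuity on one period with equal end values. The witness [H] is constant outside
    [0,1], so that [h] and [g] are constrained on [0,1] only. *)
Definition per (h g : R -> R) := h 0 = h 1 /\
  exists2 H, ac H (fun s => ind 0 1 s * g s) & forall s, 0 <= s <= 1 -> H s = h s.

Definition AC1 (f g : R * R -> R) := [/\ measurable_fun setT f, measurable_fun setT g &
  {ae nu, forall s, ac (fun t => f (t, s)) (fun t => g (t, s))}].

(** The representative that is good on vertical lines may differ on a null set from [f], which in
    [W12] is already the good one on horizontal lines; hence the separate [h]. *)
Definition D2 (f g : R * R -> R) := measurable_fun setT g /\
  exists h : R * R -> R, [/\ measurable_fun setT h, {ae M, forall p, f p = h p} &
  {ae leb, forall t, per (fun s => h (t, s)) (fun s => g (t, s))}].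

Definition W12 f f1 f2 := AC1 f f1 /\ D2 f f2.

Lemma per_ae h (g g' : R -> R) : per h g -> measurable_fun setT g' ->
  {ae nu, forall s, g s = g' s} -> per h g'.
Proof.
move=> [h01 [H A HE]] mg' gg; split => //; exists H => //.
apply: (ac_ae A); first exact: (measurable_funM (mf_ind _ _) mg').
apply: filterS (nu_ae gg) => s hs; rewrite indE; case: ifPn => [/hs ->//|_].
by rewrite !mul0r.
Qed.

Lemma per_L1 h (g : R -> R) : per h g -> measurable_fun setT g ->
  L1 nu g /\ Int nu g = 0 /\
  forall s s', 0 <= s <= 1 -> 0 <= s' <= 1 -> `|h s - h s'| <= Int nu (fun s => `|g s|).
Proof.
move=> [h01 [H [lg E] HE]] mg.
have L : L1 leb (fun t => ind 0 1 t * g t).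
  by have := lg 0 1; congr L1; apply/funext => t; rewrite indE; case: ifP; rewrite !(mul1r, mul0r).
have [Ln In] := ind01_nu L mg; split => //.
have E01 x y : 0 <= x -> x <= y -> y <= 1 -> h y - h x = J x y g.
  move=> x0 xy y1; rewrite -!HE; [|by apply/andP; split; lra..].
  rewrite E//; congr Int; apply/funext => t; rewrite !indE; case: ifPn => [/andP[h1 h2]|_]; last by rewrite !mul0r.
  by rewrite ifT ?mul1r//; apply/andP; split; lra.
split; first by rewrite In -E01// h01 subrr.
have main x y : 0 <= x -> x <= y -> y <= 1 -> `|h y - h x| <= Int nu (fun s => `|g s|).
  move=> x0 xy y1; rewrite E01//.
  have Lxy : L1 leb (fun t => ind x y t * g t).
    have := @L1_bM _ _ _ leb 1 (ind x y) _ (mf_ind x y) (ind_bnd x y) L; congr L1; apply/funext => t.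
    rewrite !indE; case: ifPn => [/andP[h1 h2]|_]; last by rewrite !mul0r.
    by rewrite ifT ?mul1r//; apply/andP; split; lra.
  have Lab : L1 leb (fun t => ind 0 1 t * `|g t|).
    by have := L1_norm L; congr L1; apply/funext => t; rewrite normrM (ger0_norm (ind_ge0 _ _ _)).
  have [_ ->] := ind01_nu Lab (measurableT_comp (@normr_measurable R setT) mg).
  apply: (le_trans (Int_norm Lxy)); apply: Int_leT => //; first exact: L1_norm.
  move=> t; rewrite normrM (ger0_norm (ind_ge0 _ _ _)); apply: ler_wpM2r => //.
  rewrite !indE; case: ifPn => [/andP[h1 h2]|_]; last by case: ifP.
  by rewrite ifT//; apply/andP; split; lra.
move=> s s' /andP[s0 s1] /andP[s0' s1'].
by have [ss|/ltW ss] := leP s' s; [exact: main|rewrite distrC; exact: main].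
Qed.

Lemma per_chain F F1 F2 h1 g1 h2 g2 : C1 F F1 F2 -> per h1 g1 -> per h2 g2 ->
  per (fun s => F (h1 s, h2 s)) (fun s => F1 (h1 s, h2 s) * g1 s + F2 (h1 s, h2 s) * g2 s).
Proof.
move=> C [e1 [H1 A1 E1]] [e2 [H2 A2 E2]]; split; first by rewrite e1 e2.
exists (fun s => F (H1 s, H2 s)); last by move=> s hs; rewrite E1// E2.
have := ac_chain C A1 A2; congr ac; apply/funext => s.
by rewrite indE; case: ifPn => [hs|_]; [rewrite E1// E2// !mul1r|rewrite !mul0r !mulr0 addr0].
Qed.

Lemma per_pos h g : per h g ->
  per (fun s => Num.max (h s) 0) (fun s => if 0 < h s then g s else 0).
Proof.
move=> [e [H A E]]; split; first by rewrite e.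
exists (fun s => Num.max (H s) 0); last by move=> s hs; rewrite E.
have := ac_pos A; congr ac; apply/funext => s.
rewrite indE; have [hs|_] := boolP (0 <= s <= 1); first by rewrite E// !mul1r.
by rewrite !mul0r if_same.
Qed.

Lemma per_scale c h g : per h g -> per (fun s => c * h s) (fun s => c * g s).
Proof.
move=> [e [H A E]]; split; first by rewrite e.
exists (fun s => c * H s); last by move=> s hs; rewrite E.
have := ac_lin c 0 A A; congr ac; apply/funext => s; ring.
Qed.

Lemma D2_ae f g g' : D2 f g -> measurable_fun setT g' ->
  {ae M, forall p, g p = g' p} -> D2 f g'.
Proof.
move=> [mg [h [mh fh A]]] mg' gg; split => //; exists h; split => //.
apply: filterS2 A (ae_prod1 gg) => s As gs.
by apply: (per_ae As) => //; exact: mf_pairr.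
Qed.

Lemma D2_aef f f' g : D2 f g -> {ae M, forall p, f' p = f p} -> D2 f' g.
Proof.
move=> [mg [h [mh fh A]]] ff; split => //; exists h; split => //.
by apply: filterS2 ff fh => p -> ->.
Qed.

Lemma W12_mf f f1 f2 : W12 f f1 f2 ->
  [/\ measurable_fun setT f, measurable_fun setT f1 & measurable_fun setT f2].
Proof. by move=> [[? ? _] [? _]]. Qed.

Lemma AC1_chain F F1 F2 u u1 v v1 : C1 F F1 F2 -> AC1 u u1 -> AC1 v v1 ->
  AC1 (fun p => F (u p, v p)) (fun p => F1 (u p, v p) * u1 p + F2 (u p, v p) * v1 p).
Proof.
move=> C [mu_ mu1 A] [mv mv1 B]; have [cF1 cF2 _ _] := C.
split.
- exact: measurable_comp2 (C1_continuous C) mu_ mv.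
- by apply: measurable_funD; apply: measurable_funM => //; exact: measurable_comp2.
- by apply: filterS2 A B => s As Bs; exact: (ac_chain C As Bs).
Qed.

Lemma D2_chain F F1 F2 u u2 v v2 : measurable_fun setT u -> measurable_fun setT v ->
  C1 F F1 F2 -> D2 u u2 -> D2 v v2 ->
  D2 (fun p => F (u p, v p)) (fun p => F1 (u p, v p) * u2 p + F2 (u p, v p) * v2 p).
Proof.
move=> mu_ mv C [mu2 [h [mh uh A]]] [mv2 [k [mk vk B]]]; have [cF1 cF2 _ _] := C.
have D : D2 (fun p => F (h p, k p)) (fun p => F1 (h p, k p) * u2 p + F2 (h p, k p) * v2 p).
  split; first by apply: measurable_funD; apply: measurable_funM => //; exact: measurable_comp2.
  exists (fun p => F (h p, k p)); split => //.
  - exact: measurable_comp2 (C1_continuous C) mh mk.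
  - exact: aeW.
  - by apply: filterS2 A B => t At Bt; exact: (per_chain C At Bt).
apply: (@D2_aef (fun p => F (h p, k p))); last by apply: filterS2 uh vk => p -> ->.
apply: (D2_ae D); first by apply: measurable_funD; apply: measurable_funM => //; exact: measurable_comp2.
by apply: filterS2 uh vk => p -> ->.
Qed.

Lemma W12_chain F F1 F2 u u1 u2 v v1 v2 : C1 F F1 F2 -> W12 u u1 u2 -> W12 v v1 v2 ->
  W12 (fun p => F (u p, v p)) (fun p => F1 (u p, v p) * u1 p + F2 (u p, v p) * v1 p)
      (fun p => F1 (u p, v p) * u2 p + F2 (u p, v p) * v2 p).
Proof.
move=> C Wu Wv; have [mu_ _ _] := W12_mf Wu; have [mv _ _] := W12_mf Wv.
by case: Wu Wv => [A B] [A' B']; split; [exact: AC1_chain|exact: D2_chain].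
Qed.

Lemma C1_lin2 x y : C1 (fun z : R * R => x * z.1 + y * z.2) (fun=> x) (fun=> y).
Proof.
split; [exact: cst_continuous|exact: cst_continuous| |] => s t /=.
  have h : is_derive s 1 (fun s : R => x * s) x.
    by apply: (is_derive_eq (is_deriveM (is_derive_cst x s 1) (is_derive_id s 1))); rewrite scaler0 addr0 /GRing.scale /= mulr1.
  by apply: (is_derive_eq (is_deriveD h (is_derive_cst (y * t) s 1))); rewrite addr0.
have h : is_derive t 1 (fun s : R => y * s) y.
  by apply: (is_derive_eq (is_deriveM (is_derive_cst y t 1) (is_derive_id t 1))); rewrite scaler0 addr0 /GRing.scale /= mulr1.
by apply: (is_derive_eq (is_deriveD (is_derive_cst (x * s) t 1) h)); rewrite add0r.
Qed.

Lemma W12_lin x y u u1 u2 v v1 v2 : W12 u u1 u2 -> W12 v v1 v2 ->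
  W12 (fun p => x * u p + y * v p) (fun p => x * u1 p + y * v1 p) (fun p => x * u2 p + y * v2 p).
Proof. by move=> Wu Wv; have := W12_chain (C1_lin2 x y) Wu Wv. Qed.

Lemma W12_mul u u1 u2 v v1 v2 : W12 u u1 u2 -> W12 v v1 v2 ->
  W12 (fun p => u p * v p) (fun p => u1 p * v p + u p * v1 p) (fun p => u2 p * v p + u p * v2 p).
Proof.
move=> Wu Wv; have := W12_chain C1_mul Wu Wv.
congr (W12 _ _ _); apply/funext => p /=; ring.
Qed.

Lemma W12_pos u u1 u2 : W12 u u1 u2 ->
  W12 (fun p => Num.max (u p) 0) (fun p => if 0 < u p then u1 p else 0)
      (fun p => if 0 < u p then u2 p else 0).
Proof.
move=> W; have [mu_ mu1 mu2] := W12_mf W; case: W => [[_ _ A] [_ [h [mh uh B]]]].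
have mif (k g : R * R -> R) : measurable_fun setT k -> measurable_fun setT g ->
    measurable_fun setT (fun p => if 0 < k p then g p else 0).
  move=> mk mg; apply: measurable_fun_ifT => //.
  by apply: measurable_fun_ltr => //; exact: measurable_cst.
have mmax (k : R * R -> R) : measurable_fun setT k -> measurable_fun setT (fun p => Num.max (k p) 0).
  by move=> mk; apply: measurable_maxr => //; exact: measurable_cst.
split.
  split; [exact: mmax|exact: mif|].
  by apply: filterS A => s As; exact: (ac_pos As).
have D : D2 (fun p => Num.max (h p) 0) (fun p => if 0 < h p then u2 p else 0).
  split; first exact: mif.
  exists (fun p => Num.max (h p) 0); split; [exact: mmax|exact: aeW|].
  by apply: filterS B => t Bt; exact: (per_pos Bt).
apply: (@D2_aef (fun p => Num.max (h p) 0)); last by apply: filterS uh => p ->.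
by apply: (D2_ae D); [exact: mif|apply: filterS uh => p ->].
Qed.

Lemma W12_t (f g : R -> R) : ac f g -> W12 (fun p => f p.1) (fun p => g p.1) (fun=> 0).
Proof.
move=> A; have mf := continuous_measurable_fun (ac_continuous A).
have mg := li_mf A.1.
split.
  split; [exact: (measurableT_comp mf measurable_fst)|exact: (measurableT_comp mg measurable_fst)|exact: aeW].
split; first exact: measurable_cst.
exists (fun p => f p.1); split; [exact: (measurableT_comp mf measurable_fst)|exact: aeW|].
apply: aeW => t; split => //; exists (fun=> f t) => //.
by have := ac_cst (f t); congr ac; apply/funext => s; rewrite mulr0.
Qed.

Lemma W12_cst c : W12 (fun=> c) (fun=> 0) (fun=> 0).
Proof. exact: W12_t (ac_cst c). Qed.

(** Zero values on the two end slices permit extension by zero in x_1; in x_2 the cut multiplies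
    each slice by a constant. *)
Lemma W12_cut a b u u1 u2 : a <= b -> W12 u u1 u2 ->
  {ae nu, forall s, u (a, s) = 0} -> {ae nu, forall s, u (b, s) = 0} ->
  W12 (fun p => ind a b p.1 * u p) (fun p => ind a b p.1 * u1 p) (fun p => ind a b p.1 * u2 p).
Proof.
move=> ab W ua ub; have [mu_ mu1 mu2] := W12_mf W; case: W => [[_ _ A] [_ [h [mh uh B]]]].
have mi (g : R * R -> R) : measurable_fun setT g -> measurable_fun setT (fun p => ind a b p.1 * g p).
  by move=> mg; apply: measurable_funM => //; exact: (measurableT_comp (mf_ind a b) measurable_fst).
split.
  split; [exact: mi|exact: mi|].
  by apply: filterS3 A ua ub => s As h1 h2; exact: (ac_cut ab As h1 h2).
split; first exact: mi.
exists (fun p => ind a b p.1 * h p); split; [exact: mi|by apply: filterS uh => p ->|].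
by apply: filterS B => t Bt; exact: (per_scale (ind a b t) Bt).
Qed.

Lemma AC1_ibp f g a b : AC1 f g -> a <= b -> L1 M (fun p => ind a b p.1 * g p) ->
  L1 nu (fun s => f (b, s) - f (a, s)) /\
  Int nu (fun s => f (b, s) - f (a, s)) = Int M (fun p => ind a b p.1 * g p).
Proof.
move=> [mf mg A] ab L; have [_ L2 ->] := fub2 L.
have e : {ae nu, forall s, Int leb (fun t => ind a b t * g (t, s)) = f (b, s) - f (a, s)}.
  by apply: filterS A => s [_ /(_ a b ab) ->].
have md : measurable_fun setT (fun s => f (b, s) - f (a, s)).
  by apply: measurable_funB; exact: mf_pairr.
split; first by apply: (@L1_ae _ _ _ nu _ _ _ L2) => //; exact: e.
by apply/esym/Int_ae => //; exact: (L1_mf L2).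
Qed.

Lemma D2_slice0 f g : D2 f g ->
  {ae leb, forall t, L1 nu (fun s => g (t, s)) /\ Int nu (fun s => g (t, s)) = 0}.
Proof.
move=> [mg [h [mh fh A]]]; apply: filterS A => t At.
by have [? []] := per_L1 At (mf_pairr t mg).
Qed.

Lemma D2_ibp f g : D2 f g -> L1 M g -> Int M g = 0.
Proof.
move=> D L; have [_ L1' ->] := fub1 L; rewrite -[RHS](Int0 leb).
apply: Int_ae; [exact: (L1_mf L1')|exact: measurable_cst|].
by apply: filterS (D2_slice0 D) => t [].
Qed.

(** A slice oscillates by at most its total variation over a period, and averaging this over the
    second point costs nothing because [nu] has mass 1. *)
Lemma D2_osc f g : D2 f g -> measurable_fun setT f ->
  {ae leb, forall t, L1 nu (fun s => f (t, s)) /\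
    {ae nu, forall s, `|f (t, s) - Int nu (fun s => f (t, s))| <= Int nu (fun s => `|g (t, s)|)}}.
Proof.
move=> [mg [h [mh fh A]]] mf; apply: filterS2 A (ae_prod1 fh) => t At ft.
have [Lg [_ osc]] := per_L1 At (mf_pairr t mg).
set B := Int nu _ in osc *.
have [_ [H AH HE]] := At.
have in01 : {ae nu, forall s, 0 <= s <= 1}.
  exists (~` `[0, 1]%classic); split.
  - by apply: measurableC.
  - rewrite nuE (_ : _ `&` _ = set0) ?measure0//; apply/seteqP; split => s // [h1 h2].
    by exfalso; apply: h1; move: h2; rewrite /= !in_itv/= => /andP[-> /ltW ->].
  - by move=> s /= h1 h2; apply: h1; move: h2; rewrite in_itv.
have Lh : L1 nu (fun s => h (t, s)).
  have [Lc _] := Int_nu_cst (`|h (t, 0)| + B).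
  apply: (L1_dom _ Lc); first exact: mf_pairr.
  apply: filterS in01 => s hs.
  have := osc s 0 hs ltac:(rewrite lexx ler01//).
  by have := ler_normD (h (t, s) - h (t, 0)) (h (t, 0)); rewrite subrK; lra.
have Lf : L1 nu (fun s => f (t, s)).
  by apply: (L1_ae _ Lh); [exact: mf_pairr|apply: filterS ft => s /= ->].
split => //.
have -> : Int nu (fun s => f (t, s)) = Int nu (fun s => h (t, s)).
  by apply: Int_ae; [exact: mf_pairr|exact: mf_pairr|exact: ft].
have in02 := in01; apply: filterS2 ft in01 => s /= -> hs.
have [Lc Ic] := Int_nu_cst (h (t, s)).
rewrite -{1}Ic -IntB//; apply: (le_trans (Int_norm (L1B Lc Lh))).
have [LB <-] := Int_nu_cst B.
apply: Int_le => //; first by apply: L1_norm; exact: L1B.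
by apply: filterS in02 => s' hs'; exact: osc.
Qed.

End W12.

#[global] Instance ae_mm_filter {R : realType} :
  Filter (almost_everywhere (@lebesgue_measure R \x @lebesgue_measure R)%E).
Proof. exact: ae_filter_ringOfSetsType. Qed.

(** * From weak gradients to line-by-line derivatives *)

Section WeakW12.
Context {R : realType}.
Implicit Types (a b c t x y r : R) (eta zeta : R -> R).
Local Notation leb := (@lebesgue_measure R).
Local Notation mm := (leb \x leb)%E.
Local Notation nu := (@nu R).
Local Notation M := (@M R).

Lemma der_e1 (F : R * R -> R) x y (d : R) :
  is_derive x 1 (fun x => F (x, y)) d <-> is_derive (x, y) e1 F d.
Proof.
have E : (fun h : R => h^-1 *: ((F \o shift (x, y)) (h *: (e1 : R * R)) - F (x, y))) =
  (fun h : R => h^-1 *: (((fun x => F (x, y)) \o shift x) (h *: (1 : R)) - F (x, y))).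
  apply/funext => h; congr (_ *: (_ - _)).
  by congr (F (_, _)); rewrite ?add0r ?mulr0//=; rewrite ?scaler0 ?mulr0 ?add0r.
split => -[h1 h2]; split.
- by rewrite /derivable E.
- by rewrite -h2 /derive E.
- by move: h1; rewrite /derivable E.
- by move: h2; rewrite /derive E.
Qed.

Lemma der_e2 (F : R * R -> R) x y (d : R) :
  is_derive y 1 (fun y => F (x, y)) d <-> is_derive (x, y) e2 F d.
Proof.
have E : (fun h : R => h^-1 *: ((F \o shift (x, y)) (h *: (e2 : R * R)) - F (x, y))) =
  (fun h : R => h^-1 *: (((fun y => F (x, y)) \o shift y) (h *: (1 : R)) - F (x, y))).
  apply/funext => h; congr (_ *: (_ - _)).
  by congr (F (_, _)); rewrite ?add0r ?mulr0//=; rewrite ?scaler0 ?mulr0 ?add0r.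
split => -[h1 h2]; split.
- by rewrite /derivable E.
- by rewrite -h2 /derive E.
- by move: h1; rewrite /derivable E.
- by move: h2; rewrite /derive E.
Qed.

Lemma test1_der eta : test1 eta -> forall x : R, is_derive x 1 eta (derive1 eta x).
Proof. by move=> [_ _ d _] x; apply: DeriveDef; [exact: d|rewrite derive1E]. Qed.

Lemma tensor_der eta zeta : test1 eta -> test1 zeta -> forall p,
  is_derive p e1 (fun p : R * R => eta p.1 * zeta p.2) (derive1 eta p.1 * zeta p.2) /\
  is_derive p e2 (fun p : R * R => eta p.1 * zeta p.2) (eta p.1 * derive1 zeta p.2).
Proof.
move=> Te Tz [x y] /=; split.
  apply/der_e1 => /=.
  apply: (is_derive_eq (is_deriveM (test1_der Te x) (is_derive_cst (zeta y) x 1))).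
  by rewrite scaler0 add0r /GRing.scale /= mulrC.
apply/der_e2 => /=.
apply: (is_derive_eq (is_deriveM (is_derive_cst (eta x) y 1) (test1_der Tz y))).
by rewrite scaler0 addr0.
Qed.

Lemma tensor_test2 eta zeta : test1 eta -> test1 zeta ->
  [/\ test2 (fun p : R * R => eta p.1 * zeta p.2),
   'D_e1 (fun p : R * R => eta p.1 * zeta p.2) = (fun p => derive1 eta p.1 * zeta p.2) &
   'D_e2 (fun p : R * R => eta p.1 * zeta p.2) = (fun p => eta p.1 * derive1 zeta p.2)].
Proof.
move=> Te Tz.
have E1 : 'D_e1 (fun p : R * R => eta p.1 * zeta p.2) = (fun p => derive1 eta p.1 * zeta p.2).
  by apply/funext => p; have [h _] := tensor_der Te Tz p; exact: derive_val.
have E2 : 'D_e2 (fun p : R * R => eta p.1 * zeta p.2) = (fun p => eta p.1 * derive1 zeta p.2).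
  by apply/funext => p; have [_ h] := tensor_der Te Tz p; exact: derive_val.
have ct (k1 k2 : R -> R) : continuous k1 -> continuous k2 -> continuous (fun p : R * R => k1 p.1 * k2 p.2).
  move=> c1 c2 p.
  have h1 : (fun p : R * R => k1 p.1) @ p --> k1 p.1 by apply: (cvg_comp fst k1 _ (c1 _)); exact: cvg_fst.
  have h2 : (fun p : R * R => k2 p.2) @ p --> k2 p.2 by apply: (cvg_comp snd k2 _ (c2 _)); exact: cvg_snd.
  exact: (cvgM h1 h2).
have [ce [r1 er] _ cde] := Te; have [cz [r2 zr] _ cdz] := Tz.
split => //; split.
- exact: ct.
- exists (Num.max r1 r2) => p; rewrite !gt_max => -[/andP[h _]|/andP[_ h]].
    by rewrite er// mul0r.
  by rewrite zr// mulr0.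
- by move=> p; have [[h1 _] [h2 _]] := tensor_der Te Tz p.
- by rewrite E1; exact: ct.
- by rewrite E2; exact: ct.
Qed.

Definition swap (p : R * R) : R * R := (p.2, p.1).

Lemma mf_swap : measurable_fun [set: R * R] swap.
Proof. by apply: measurable_fun_pair; [exact: measurable_snd|exact: measurable_fst]. Qed.

Lemma L1_swap (f : R * R -> R) : L1 mm f -> L1 mm (f \o swap) /\ Int mm (f \o swap) = Int mm f.
Proof.
move=> Lf; have mf := L1_mf Lf.
have L : L1 mm (f \o swap).
  apply: L1_prod12; first exact: (measurableT_comp mf mf_swap).
  have := (integrable21ltyP leb leb (measurable_int _ Lf)).1 Lf.
  by [].
split => //; have [_ _ ->] := fub1 L; by have [_ _ ->] := fub2 Lf.
Qed.

Lemma ae_swap (P : R * R -> Prop) : {ae mm, forall p, P p} -> {ae mm, forall p, P (swap p)}.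
Proof.
move=> [N [mN N0 PN]].
have h : {ae mm, forall p, ~ N p} by exists N; split => // p /= /contrapT.
have h2 : {ae mm, forall p, ~ N (swap p)}.
  apply: prod_ae1.
    rewrite (_ : [set p | _] = swap @^-1` (~` N))//.
    by rewrite -[X in measurable X]setTI; apply: mf_swap => //; exact: measurableC.
  exact: (ae_prod2 h).
by apply: filterS h2 => p np; apply: contrapT => nP; apply: np; exact: PN.
Qed.

Lemma boxE r : (box r : set (R * R)) = [set p | (`|p.1| <= r) && (`|p.2| <= r)].
Proof. by apply/seteqP; split => p /= => [[-> ->]|/andP]. Qed.

Lemma ind2_box r (f : R * R -> R) : (fun p => ind2 r p * f p) = f \_ (box r).
Proof.
rewrite boxE patch_indic; apply/funext => p; rewrite ind2E /= indicE mulrC; congr (_ * _).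
by case: ifPn => h; [rewrite mem_set|rewrite memNset//=; exact/negP].
Qed.

Lemma mbox r : measurable (box r : set (R * R)).
Proof.
rewrite (_ : box r = ind2 r @^-1` [set 1]); last first.
  apply/seteqP; split => p /=; rewrite boxE /= ind2E; first by move=> ->.
  by case: ifP => // _ /eqP; rewrite eq_sym oner_eq0.
by rewrite -[X in measurable X]setTI; apply: mf_ind2.
Qed.

Lemma li2_int r (f : R * R -> R) : L1 mm (fun p => ind2 r p * f p) <->
  mm.-integrable (box r) (EFin \o f).
Proof.
rewrite /L1 ind2_box -restrict_EFin; apply: iff_sym; apply: integrable_mkcond; exact: mbox.
Qed.

Lemma L1_ind2 r : L1 mm (ind2 r).
Proof.
have lc : li (fun=> 1 : R) by apply: li_cont; exact: cst_continuous.
have l : L1 leb (ind (- r) r) by have := lc (- r) r; congr L1; apply/funext => t; rewrite mulr1.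
by have [] := L1_tensor l l.
Qed.

Lemma L2loc_li2 (f : R * R -> R) : L2loc2 f -> li2 f /\ forall r, L1 mm (fun p => ind2 r p * f p ^+ 2).
Proof.
move=> [mf Hf].
have H2 r : L1 mm (fun p => ind2 r p * f p ^+ 2) by apply/li2_int; exact: Hf.
split=> // r; apply: (L1_domT _ (L1D (L1_ind2 r) (H2 r))).
  exact: (measurable_funM (mf_ind2 r) mf).
move=> p; rewrite ind2E; case: ifP => _; last by rewrite !mul0r normr0 addr0.
rewrite !mul1r -[f p ^+ 2]real_normK ?num_real//; have := normr_ge0 (f p); nra.
Qed.

Lemma weak_rep1 (f g : R * R -> R) : weak_deriv2 f e1 g ->
  exists fH : R * R -> R, [/\ measurable_fun setT fH, {ae mm, forall p, f p = fH p} &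
    {ae leb, forall s, ac (fun t => fH (t, s)) (fun t => g (t, s))}].
Proof.
move=> [Lf Lg H]; have [lf _] := L2loc_li2 Lf; have [lg _] := L2loc_li2 Lg.
apply: weak_rep => // eta zeta Te Tz.
have [T2 E1 _] := tensor_test2 Te Tz; have h := H _ T2.
have {}h := congr1 fine h; rewrite fineN in h; rewrite /Int /Rintegral -h.
by congr fine; apply: eq_integral => p _; rewrite -(congr1 (@^~ p) E1).
Qed.

Lemma weak_rep2 (f g : R * R -> R) : weak_deriv2 f e2 g ->
  exists fV : R * R -> R, [/\ measurable_fun setT fV, {ae mm, forall p, f p = fV p} &
    {ae leb, forall t, ac (fun s => fV (t, s)) (fun s => g (t, s))}].
Proof.
move=> [Lf Lg H]; have [lf _] := L2loc_li2 Lf; have [lg _] := L2loc_li2 Lg.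
have sw (k : R * R -> R) : li2 k -> li2 (k \o swap).
  move=> lk r; have [+ _] := L1_swap (lk r); congr L1; apply/funext => p /=.
  by congr (_ * _); rewrite /ind2 /swap /= mulrC.
have [fH [mfH fE A]] : exists fH : R * R -> R, [/\ measurable_fun setT fH, {ae mm, forall p, (f \o swap) p = fH p} &
    {ae leb, forall s, ac (fun t => fH (t, s)) (fun t => (g \o swap) (t, s))}].
  apply: weak_rep; [exact: sw|exact: sw|move=> eta zeta Te Tz].
  have [T2 _ E2] := tensor_test2 Tz Te; have h := H _ T2.
  have {}h := congr1 fine h; rewrite fineN in h.
  have [_ L1'] := li2_test (sw _ lf) Te Tz; have [L2' _] := li2_test (sw _ lg) Te Tz.
  have -> : (fun p => (f \o swap) p * (derive1 eta p.1 * zeta p.2)) =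
     (fun p => (derive1 eta p.1 * zeta p.2 * (f \o swap) p)) by apply/funext => p; ring.
  have -> : (fun p => (g \o swap) p * (eta p.1 * zeta p.2)) =
     (fun p => (eta p.1 * zeta p.2 * (g \o swap) p)) by apply/funext => p; ring.
  have [_ <-] := L1_swap L1'; have [_ <-] := L1_swap L2'.
  have -> : (fun p => derive1 eta p.1 * zeta p.2 * (f \o swap) p) \o swap =
    (fun p => f p * (zeta p.1 * derive1 eta p.2)).
    by apply/funext => -[x y]; rewrite /swap /=; ring.
  have -> : (fun p => eta p.1 * zeta p.2 * (g \o swap) p) \o swap =
    (fun p => g p * (zeta p.1 * eta p.2)).
    by apply/funext => -[x y]; rewrite /swap /=; ring.
  rewrite /Int /Rintegral -h.
  by congr fine; apply: eq_integral => p _; rewrite -(congr1 (@^~ p) E2).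
exists (fH \o swap); split; [exact: (measurableT_comp mfH mf_swap)| |exact: A].
by have := ae_swap fE; apply: filterS => -[x y].
Qed.

Lemma ac_per (h g : R -> R) : ac h g -> h 0 = h 1 -> per h g.
Proof.
move=> A h01; split => //.
have [lg E] := A.
have lk : li (fun s => ind 0 1 s * g s).
  move=> x y; have mg := li_mf lg.
  apply: (@L1_bM _ _ _ leb 1) => //; [exact: mf_ind|exact: ind_bnd].
exists (fun s => h 0 + S0 (fun s => ind 0 1 s * g s) s).
  have := ac_lin 1 1 (ac_cst (h 0)) (S0_ac lk); congr ac; apply/funext => s; ring.
move=> s /andP[s0 s1].
have -> : S0 (fun s => ind 0 1 s * g s) s = J 0 s g.
  rewrite /S0 (_ : J s 0 _ = 0) ?subr0; last first.
    by move: s0; rewrite le_eqVlt => /predU1P[<-|s0]; [rewrite J_xx|rewrite J_gt].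
  congr Int; apply/funext => t; rewrite !indE; case: ifPn => [/andP[t0 t1]|_]; last by rewrite !mul0r.
  by rewrite ifT ?mul1r ?t0//= (le_trans t1).
by rewrite -E//; ring.
Qed.

(** Periodicity reaches the vertical representative: on almost every vertical line [h] and its
    translate by 1 are continuous and agree a.e., hence everywhere, in particular at 0 and 1. *)
Lemma weak_W12 (v g1 g2 : R * R -> R) : (forall p, v (p.1, p.2 + 1) = v p) ->
  weak_deriv2 v e1 g1 -> weak_deriv2 v e2 g2 ->
  exists V, W12 V g1 g2 /\ {ae M, forall p, v p = V p}.
Proof.
move=> pv w1 w2; have [V [mV vV A]] := weak_rep1 w1; have [h [mh vh B]] := weak_rep2 w2.
have mg1 : measurable_fun setT g1 by have [_ []] := w1.
have mg2 : measurable_fun setT g2 by have [_ []] := w2.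
exists V; split; last exact: ae_M.
split; first by split => //; exact: ae_nu.
split => //; exists h; split => //.
  by apply: ae_M; apply: filterS2 vV vh => p -> ->.
apply: filterS2 B (ae_prod1 vh) => t At vt.
apply: (ac_per At).
have ch := ac_continuous At.
have e : {ae leb, forall s, h (t, s) = h (t, s + 1)}.
  by apply: filterS2 vt (ae_shift 1 vt) => s /= <- <-; rewrite (pv (t, s)).
have cs : continuous (fun s : R => h (t, s + 1)) by exact: (ac_continuous (ac_shift 1 At)).
by rewrite (ae_cont_eq ch cs e) add0r.
Qed.

End WeakW12.

Section L1Slices.
Context d1 d2 (T1 : measurableType d1) (T2 : measurableType d2) (R : realType).
Context (m1 : {sigma_finite_measure set T1 -> \bar R}).
Context (m2 : {sigma_finite_measure set T2 -> \bar R}).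

Lemma L1_slices (f : T1 * T2 -> R) (B : T2 -> R) : measurable_fun setT f -> L1 m2 B ->
  {ae m2, forall y, L1 m1 (fun x => f (x, y)) /\ Int m1 (fun x => `|f (x, y)|) <= B y} ->
  L1 (m1 \x m2)%E f.
Proof.
move=> mf LB H; apply: L1_prod21 => //.
have LB' := L1_norm LB.
have mfa : measurable_fun setT (fun p => (`|f p|)%:E).
  by apply/measurable_EFinP; exact: measurableT_comp.
apply: (@le_lt_trans _ _ (\int[m2]_y (`|B y|)%:E)%E); last by rewrite (L1_finE LB') ltry.
apply: ae_ge0_le_integral => //.
- by move=> y _; apply: integral_ge0.
- exact: (@measurable_fun_fubini_tonelli_G _ _ _ _ _ m1 (fun p => (`|f p|)%:E)).
- by apply/measurable_EFinP; apply: measurableT_comp => //; exact: (L1_mf LB).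
apply: (@filterS _ _ (ae_filter_ringOfSetsType m2) _ _ _ H) => y [L h] _.
rewrite (L1_finE (L1_norm L)) lee_fin; exact: (le_trans h (ler_norm _)).
Qed.

End L1Slices.

(** * Steklov averages in the first variable *)

Section Steklov.
Context {R : realType}.
Implicit Types (a b c t x y r : R).
Local Notation leb := (@lebesgue_measure R).
Local Notation nu := (@nu R).
Local Notation M := (@M R).

Definition stk h (G : R -> R) t := h^-1 * J t (t + h) G.

Lemma J_shift0 h (G : R -> R) t : li G -> J t (t + h) G = Int leb (fun x => ind 0 h x * G (x + t)).
Proof.
move=> lG; rewrite /J; have [_ <-] := Int_shift t (lG t (t + h)).
congr Int; apply/funext => x; congr (_ * _); rewrite !indE.
by congr (if _ then _ else _); congr andb; apply/idP/idP; lra.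
Qed.

Lemma mf_stk h (G : R -> R) : measurable_fun setT G -> measurable_fun setT (stk h G).
Proof.
move=> mG; apply: measurable_funM; first exact: measurable_cst.
have h1 : measurable_fun [set: R] (fun t : R => (t, 0 : R)).
  by apply: measurable_fun_pair => //; exact: measurable_cst.
have mk : measurable_fun [set: R * R] (fun p : R * R => G p.1).
  exact: (measurableT_comp mG measurable_fst).
have mh : measurable_fun [set: R * R] (fun p : R * R => p.1 + h).
  exact: (measurableT_comp (mf_shift h) measurable_fst).
exact: (measurableT_comp (mf_J2 mk measurable_fst mh) h1).
Qed.

(** The average is a mean of translates of [G], so this is Fubini in the shift variable. *)
Lemma stk_L1 h (G : R -> R) : 0 < h -> L1 leb G ->
  L1 leb (stk h G) /\ Int leb (stk h G) = Int leb G.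
Proof.
move=> h0 LG; have mG := L1_mf LG; have lG := L1_mf_li mG LG.
pose k (p : R * R) := ind 0 h p.2 * G (p.1 + p.2).
have lc : li (fun=> 1 : R) by apply: li_cont; exact: cst_continuous.
have Li : L1 leb (ind 0 h) by have := lc 0 h; congr L1; apply/funext => t; rewrite mulr1.
have Ih : Int leb (ind 0 h) = h.
  rewrite -[RHS](subr0 h) -[RHS]mul1r -(J_cst 1 (ltW h0)); congr Int.
  by apply/funext => t; rewrite mulr1.
have mk : measurable_fun setT k.
  apply: measurable_funM; first exact: (measurableT_comp (mf_ind 0 h) measurable_snd).
  apply: (measurableT_comp mG); apply: measurable_funD; [exact: measurable_fst|exact: measurable_snd].
have sl x : L1 leb (fun t => k (t, x)) /\ Int leb (fun t => k (t, x)) = ind 0 h x * Int leb G.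
  have [L E] := Int_shift x LG; split; first exact: (L1Z (ind 0 h x) L).
  by rewrite -E -IntZ.
have Lk : L1 (leb \x leb)%E k.
  apply: (@L1_slices _ _ _ _ _ leb leb k (fun x => Int leb (fun t => `|G t|) * ind 0 h x)) => //.
    exact: (L1Z _ Li).
  apply: aeW => x; have [L _] := sl x; split => //.
  have [L' E'] := Int_shift x (L1_norm LG); rewrite mulrC -E' -(IntZ _ L').
  by rewrite le_eqVlt; apply/orP; left; apply/eqP; congr Int; apply/funext => t;
    rewrite normrM ger0_norm ?ind_ge0.
have E t : stk h G t = h^-1 * Int leb (fun x => k (t, x)).
  rewrite /stk (J_shift0 h t lG); congr (_ * Int _ _); apply/funext => x.
  by rewrite /k /= addrC.
have [_ L1k E1] := fub1 Lk; have [_ L2k E2] := fub2 Lk.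
have -> : stk h G = (fun t => h^-1 * Int leb (fun x => k (t, x))) by apply/funext => t.
split; first exact: (L1Z _ L1k).
rewrite (IntZ _ L1k) -E1 E2.
have -> : (fun y => Int leb (fun x => k (x, y))) = (fun y => Int leb G * ind 0 h y).
  by apply/funext => x; have [_ ->] := sl x; rewrite mulrC.
by rewrite (IntZ _ Li) Ih; field; rewrite gt_eqF.
Qed.

Lemma li_sq (F : R -> R) : measurable_fun setT F -> L1 leb (fun t => F t ^+ 2) -> li F.
Proof.
move=> mF LF a b.
have lc : li (fun=> 1 : R) by apply: li_cont; exact: cst_continuous.
apply: (@L1_domT _ _ _ leb _ (fun t => ind a b t * 1 + F t ^+ 2)).
- by apply: measurable_funM => //; exact: mf_ind.
- exact: (L1D (lc a b) LF).
move=> t; rewrite indE; case: ifP => _; last by rewrite !mul0r normr0 add0r sqr_ge0.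
rewrite !mul1r -[F t ^+ 2]real_normK ?num_real//; have := normr_ge0 (F t); nra.
Qed.

Lemma stk_sq h (F : R -> R) t : 0 < h -> li F -> li (fun t => F t ^+ 2) ->
  stk h F t ^+ 2 <= stk h (fun t => F t ^+ 2) t.
Proof.
move=> h0 lF lF2; rewrite /stk exprMn.
have mF := li_mf lF.
have lc : li (fun=> 1 : R) by apply: li_cont; exact: cst_continuous.
have sq1 x : ind t (t + h) x ^+ 2 = ind t (t + h) x * 1.
  by rewrite indE; case: ifP => _; rewrite ?expr1n ?expr0n ?mulr1.
have := @cauchy_schwarz _ _ _ leb (ind t (t + h)) (fun x => ind t (t + h) x * F x).
have -> : (fun x => ind t (t + h) x ^+ 2) = (fun x => ind t (t + h) x * 1).
  by apply/funext.
have -> : (fun x => (ind t (t + h) x * F x) ^+ 2) = (fun x => ind t (t + h) x * F x ^+ 2).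
  by apply/funext => x; rewrite exprMn sq1 mulr1.
have -> : (fun x => ind t (t + h) x * (ind t (t + h) x * F x)) = (fun x => ind t (t + h) x * F x).
  by apply/funext => x; rewrite mulrA -expr2 sq1 mulr1.
move=> /(_ (mf_ind _ _) (L1_mf (lF _ _)) (lc _ _) (lF2 _ _)).
have := J_cst 1 (_ : t <= t + h); rewrite /J => ->; last lra.
rewrite -/(J t (t + h) F) -/(J t (t + h) (fun t => F t ^+ 2)) => hh.
rewrite expr2 -mulrA ler_pM2l ?invr_gt0// mulrC ler_pdivrMr// mulrC.
by move: hh; rewrite mul1r (_ : t + h - t = h)//; ring.
Qed.

Lemma ae_stk (G : R -> R) : li G ->
  {ae leb, forall t, stk (n.+1%:R^-1) G t @[n --> \oo] --> G t}.
Proof.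
move=> lG.
have locG : locally_integrable [set: R] G.
  split; [exact: (li_mf lG)|exact: openT|move=> K _ cK].
  have [N [_ HN]] := compact_bounded cK.
  have [r0 r0N] : exists r, N < r by exists (N + 1); lra.
  have /li_integrable/integrableP[_] := lG (- r0) r0.
  apply: le_lt_trans.
  apply: ge0_subset_integral => //.
  - exact: compact_measurable.
  - by apply/measurable_EFinP; apply: measurableT_comp => //; apply: measurable_funTS; exact: (li_mf lG).
  - by move=> x Kx /=; have := HN _ r0N x Kx; rewrite in_itv/= ler_norml.
(* The differentiation theorem is applied to integrals from a fixed left end; the left ends -m
   exhaust the line. *)
have H (m : nat) : {ae leb, forall t, - m%:R < t -> stk (n.+1%:R^-1) G t @[n --> \oo] --> G t}.
  have iG y : leb.-integrable [set` Interval (BLeft (- m%:R)) (BRight y)] (EFin \o G).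
    exact/li_integrable.
  apply: filterS (FTC1 iG locG) => t /= h mt.
  have {h}[dF FE] : _ /\ _ := h mt.
  pose F y := Rintegral leb [set` Interval (BLeft (- m%:R : R)) (BRight y)] G.
  have c : (fun h : R => h^-1 *: ((F \o shift t) (h *: (1 : R)) - F t)) @ 0^' --> G t.
    by rewrite -[X in _ --> X]FE derive1E; exact: dF.
  have /cvgr_dnbhsP := c => /(_ (fun n => n.+1%:R^-1)) c'.
  apply: cvg_trans (c' _); last first.
    by split; [move=> n; rewrite invr_eq0 pnatr_eq0|exact: (@cvg_harmonic R)].
  apply: near_eq_cvg; near=> n; rewrite /stk /=.
  have n0 : 0 < (n.+1%:R^-1 : R) by rewrite invr_gt0 ltr0n.
  congr (_ * _); rewrite /F -!J_itv {1}/GRing.scale /= mulr1 [_ + t]addrC.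
  rewrite (@J_cat _ (- m%:R) t (t + n.+1%:R^-1) G lG); [ring|by rewrite (ltW mt) lerDl ltW].
apply: filterS (ae_foralln H) => t Ht.
have [m tm] : exists m : nat, - m%:R < t.
  exists (Num.truncn `|t|).+1; have := truncnS_gt `|t|; rewrite ltr_norml; lra.
exact: (Ht m).
Unshelve. all: end_near. Qed.

(* Scheffe-type argument: stk (F^2) -> F^2 in L^1 because both have the same integral,
   and |stk F - F|^2 is dominated by 4 F^2 + 2 (stk (F^2) - F^2)^+. *)
Lemma stk_L2cvg (F : R -> R) : measurable_fun setT F -> L1 leb (fun t => F t ^+ 2) ->
  [/\ forall n, L1 leb (fun t => (stk (n.+1%:R^-1) F t - F t) ^+ 2) &
   Int leb (fun t => (stk (n.+1%:R^-1) F t - F t) ^+ 2) @[n --> \oo] --> (0 : R)].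
Proof.
move=> mF LF; have lF := li_sq mF LF.
have mF2 : measurable_fun setT (fun t => F t ^+ 2) by exact: (L1_mf LF).
have lF2 := L1_mf_li mF2 LF.
have n0 n : 0 < (n.+1%:R^-1 : R) by rewrite invr_gt0 ltr0n.
pose S n := stk (n.+1%:R^-1) F; pose Q n := stk (n.+1%:R^-1) (fun t => F t ^+ 2).
have mS n : measurable_fun setT (S n) by exact: mf_stk.
have mQ n : measurable_fun setT (Q n) by exact: mf_stk.
have SQ n t : S n t ^+ 2 <= Q n t by exact: stk_sq.
have [LQ IQ] : (forall n, L1 leb (Q n)) /\ forall n, Int leb (Q n) = Int leb (fun t => F t ^+ 2).
  by split => n; [exact: (stk_L1 (n0 n) LF).1|exact: (stk_L1 (n0 n) LF).2].
have LS n : L1 leb (fun t => S n t ^+ 2).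
  apply: (@L1_domT _ _ _ leb _ (Q n)) => //; first exact: (measurable_funX 2 (mS n)).
  by move=> t; rewrite ger0_norm ?sqr_ge0.
have LSF n : L1 leb (fun t => (S n t - F t) ^+ 2).
  have mN : measurable_fun setT (fun t => - F t) by exact: measurableT_comp.
  have LFN : L1 leb (fun t => (- F t) ^+ 2).
    by move: LF; congr L1; apply/funext => t; rewrite sqrrN.
  exact: (@L1_sqD _ _ _ leb (S n) (fun t => - F t) (mS n) mN (LS n) LFN).
split => //.
pose P n t := Num.max 0 (F t ^+ 2 - Q n t).
pose B n t := Num.min ((S n t - F t) ^+ 2) (4 * F t ^+ 2).
have mP n : measurable_fun setT (P n).
  by apply: measurable_maxr; [exact: measurable_cst|exact: measurable_funB].
have mB n : measurable_fun setT (B n).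
  by apply: measurable_minr; [exact: (L1_mf (LSF n))|apply: measurable_funM => //; exact: measurable_cst].
have cS := ae_stk lF; have cQ := ae_stk lF2.
have cst0 (c : R) : (fun=> c) @ \oo --> c by exact: (@cvg_cst _ (c : R) _ (nbhs \oo) _).
have P_le n t : 0 <= P n t <= F t ^+ 2.
  rewrite /P le_max lexx ge_max sqr_ge0/=.
  have : 0 <= Q n t by apply: le_trans (SQ n t); exact: sqr_ge0.
  lra.
have LP n : L1 leb (P n).
  by apply: (@L1_domT _ _ _ leb _ _ (mP n) LF) => t; have /andP[h1 h2] := P_le n t; rewrite ger0_norm.
have [_ IP] : L1 leb (fun=> 0 : R) /\ Int leb (P n) @[n --> \oo] --> Int leb (fun=> 0 : R).
  apply: (@DCT _ _ _ leb P (fun=> 0) (fun t => F t ^+ 2) mP _ LF).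
  - exact: measurable_cst.
    apply: filterS cQ => t ct.
    have c1 : (F t ^+ 2 - Q n t) @[n --> \oo] --> F t ^+ 2 - F t ^+ 2 by exact: (cvgB (cst0 _) ct).
    have c2 : `|F t ^+ 2 - Q n t| @[n --> \oo] --> `|F t ^+ 2 - F t ^+ 2| by exact: (cvg_norm c1).
    rewrite subrr normr0 in c2.
    apply: (@squeeze_cvgr _ _ _ _ (fun=> 0) (fun n => `|F t ^+ 2 - Q n t|)) => //.
    by apply: nearW => n; rewrite /P le_max lexx ge_max normr_ge0 ler_norm.
  by apply: aeW => t n; have /andP[h1 h2] := P_le n t; rewrite ger0_norm.
have B_le n t : 0 <= B n t <= 4 * F t ^+ 2.
  by rewrite /B le_min sqr_ge0/= mulr_ge0 ?sqr_ge0// ge_min lexx orbT.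
have LF4 := L1Z 4 LF.
have LB n : L1 leb (B n).
  by apply: (@L1_domT _ _ _ leb _ _ (mB n) LF4) => t; have /andP[h1 h2] := B_le n t; rewrite ger0_norm.
have [_ IB] : L1 leb (fun=> 0 : R) /\ Int leb (B n) @[n --> \oo] --> Int leb (fun=> 0 : R).
  apply: (@DCT _ _ _ leb B (fun=> 0) (fun t => 4 * F t ^+ 2) mB _ LF4).
  - exact: measurable_cst.
    apply: filterS cS => t ct.
    have c1 : (S n t - F t) @[n --> \oo] --> F t - F t by exact: (cvgB ct (cst0 (F t))).
    have c2 : (S n t - F t) * (S n t - F t) @[n --> \oo] --> (F t - F t) * (F t - F t) by exact: (cvgM c1 c1).
    rewrite subrr mul0r in c2.
    apply: (@squeeze_cvgr _ _ _ _ (fun=> 0) (fun n => (S n t - F t) * (S n t - F t))) => //.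
    by apply: nearW => n; rewrite /B le_min sqr_ge0/= mulr_ge0 ?sqr_ge0// ge_min -expr2 lexx.
  by apply: aeW => t n; have /andP[h1 h2] := B_le n t; rewrite ger0_norm.
rewrite Int0 in IP; rewrite Int0 in IB.
have c3 : (Int leb (B n) + 2 * Int leb (P n)) @[n --> \oo] --> (0 + 2 * 0 : R).
  exact: (cvgD IB (cvgM (cst0 2) IP)).
rewrite mulr0 addr0 in c3.
apply: (@squeeze_cvgr _ _ _ _ (fun=> 0) (fun n => Int leb (B n) + 2 * Int leb (P n))) => //.
apply: nearW => n; rewrite Int_ge0/=; last by move=> t; rewrite sqr_ge0.
(* 2 (Q - F^2)^+ = 2 (Q - F^2) + 2 P *)
have LQF := L1B (LQ n) LF.
have L1' := L1D (L1Z 2 LQF) (L1Z 2 (LP n)).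
have -> : Int leb (B n) + 2 * Int leb (P n) =
  Int leb (fun t => B n t + (2 * (Q n t - F t ^+ 2) + 2 * P n t)).
  rewrite (IntD (LB n) L1') (IntD (L1Z 2 LQF) (L1Z 2 (LP n))) (IntZ 2 LQF) (IntZ 2 (LP n)).
  by rewrite (IntB (LQ n) LF) IQ subrr mulr0 add0r.
apply: Int_leT; [exact: LSF|exact: (L1D (LB n) L1')|move=> t].
rewrite -[stk _ F t]/(S n t).
have := SQ n t; rewrite /B /P; set s := S n t; set q := Q n t; set f := F t => h.
rewrite minEle maxEle; case: ifP => h1; case: ifP => h2; rewrite ?h1 ?h2.
- lra.
- move/negbT: h2; rewrite -ltNge; lra.
- have := sqr_ge0 (s + f); nra.
- have := sqr_ge0 (s + f); move/negbT: h2; rewrite -ltNge; nra.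
Qed.

Lemma stk_weak (F K : R -> R) : measurable_fun setT F -> measurable_fun setT K ->
  L1 leb (fun t => F t ^+ 2) -> L1 leb (fun t => K t ^+ 2) ->
  Int leb (fun t => stk (n.+1%:R^-1) F t * K t) @[n --> \oo] --> Int leb (fun t => F t * K t).
Proof.
move=> mF mK LF LK; have [LS c] := stk_L2cvg mF LF.
have cst0 (k : R) : (fun=> k) @ \oo --> k by exact: (@cvg_cst _ (k : R) _ (nbhs \oo) _).
have mS n : measurable_fun setT (stk (n.+1%:R^-1) F) by exact: mf_stk.
have mD n : measurable_fun setT (fun t => stk (n.+1%:R^-1) F t - F t) by exact: measurable_funB.
have LFK : L1 leb (fun t => F t * K t) := @L1_sqM _ _ _ leb F K mF mK LF LK.
have LDK n := @L1_sqM _ _ _ leb _ K (mD n) mK (LS n) LK.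
have E n : Int leb (fun t => stk (n.+1%:R^-1) F t * K t) =
  Int leb (fun t => (stk (n.+1%:R^-1) F t - F t) * K t) + Int leb (fun t => F t * K t).
  by rewrite -(IntD (LDK n) LFK); congr Int; apply/funext => t; ring.
have c2 : (Int leb (fun t => (stk (n.+1%:R^-1) F t - F t) ^+ 2) * Int leb (fun t => K t ^+ 2)) @[n --> \oo]
  --> (0 * Int leb (fun t => K t ^+ 2) : R) by exact: (cvgM c (cst0 _)).
rewrite mul0r in c2.
have c3 : Int leb (fun t => (stk n.+1%:R^-1 F t - F t) * K t) @[n --> \oo] --> (0 : R).
apply/cvgr0Pnorm_lt => e e0.
have e20 : 0 < e ^+ 2 by exact: exprn_gt0.
have /cvgr0Pnorm_lt/(_ _ e20) := c2; apply: filterS => n h.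
have := @cauchy_schwarz _ _ _ leb _ K (mD n) mK (LS n) LK.
have := le_lt_trans (ler_norm _) h.
set X := Int leb (fun t => (stk _ F t - F t) * K t); set Y := Int _ _ * Int _ _ => h1 h2.
by rewrite ltr_norml; apply/andP; split; nra.
have c4 : (Int leb (fun t => (stk n.+1%:R^-1 F t - F t) * K t) + Int leb (fun t => F t * K t)) @[n --> \oo]
   --> 0 + Int leb (fun t => F t * K t) by exact: (cvgD c3 (cst0 _)).
rewrite add0r in c4; apply: cvg_trans c4; apply: near_eq_cvg.
by apply: nearW => n; rewrite E.
Qed.

(** Averaging in x_1 alone gives a mere L^2 function an x_1-derivative on almost every horizontal
    line. *)
Definition stk2 h (F : R * R -> R) (p : R * R) := stk h (fun t => F (t, p.2)) p.1.

Lemma mf_stk2 h (F : R * R -> R) : measurable_fun setT F -> measurable_fun setT (stk2 h F).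
Proof.
move=> mF; apply: measurable_funM; first exact: measurable_cst.
have mh : measurable_fun [set: R * R] (fun p : R * R => p.1 + h).
  exact: (measurableT_comp (mf_shift h) measurable_fst).
exact: (mf_J2 mF measurable_fst mh).
Qed.

Lemma stk2_L2 h (F : R * R -> R) : 0 < h -> measurable_fun setT F -> L1 M (fun p => F p ^+ 2) ->
  L1 M (fun p => stk2 h F p ^+ 2) /\
  {ae nu, forall s, [/\ L1 leb (fun t => F (t, s) ^+ 2), L1 leb (fun t => stk2 h F (t, s) ^+ 2) &
    Int leb (fun t => stk2 h F (t, s) ^+ 2) <= Int leb (fun t => F (t, s) ^+ 2)]}.
Proof.
move=> h0 mF LF; have [A L2 _] := fub2 LF; have mS := mf_stk2 h mF.
have B : {ae nu, forall s, [/\ L1 leb (fun t => F (t, s) ^+ 2), L1 leb (fun t => stk2 h F (t, s) ^+ 2) &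
    Int leb (fun t => stk2 h F (t, s) ^+ 2) <= Int leb (fun t => F (t, s) ^+ 2)]}.
  apply: filterS A => s As.
  have mFs : measurable_fun setT (fun t => F (t, s)) by exact: mf_pairl.
  have lF := li_sq mFs As; have lF2 := L1_mf_li (L1_mf As) As.
  have [LQ IQ] := stk_L1 h0 As.
  have sq t : stk2 h F (t, s) ^+ 2 <= stk h (fun t => F (t, s) ^+ 2) t.
    exact: (stk_sq t h0 lF lF2).
  have L : L1 leb (fun t => stk2 h F (t, s) ^+ 2).
    apply: (@L1_domT _ _ _ leb _ _ _ LQ); first exact: (measurable_funX 2 (mf_pairl s mS)).
    by move=> t; rewrite ger0_norm ?sqr_ge0.
  by split => //; rewrite -IQ; exact: (Int_leT L LQ sq).
split => //.
apply: (@L1_slices _ _ _ _ _ leb nu _ _ _ L2); first exact: (measurable_funX 2 mS).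
apply: filterS B => s [B1 B2 B3]; split => //.
apply: le_trans B3; rewrite le_eqVlt; apply/orP; left; apply/eqP; congr Int.
by apply/funext => t; rewrite ger0_norm ?sqr_ge0.
Qed.

(** On almost every horizontal line this is [stk_weak]; averages contract the L^2 norm, so the line
    integrals are dominated by the sum of the squared norms of F and K on that line. *)
Lemma stk2_weak (F K : R * R -> R) : measurable_fun setT F -> measurable_fun setT K ->
  L1 M (fun p => F p ^+ 2) -> L1 M (fun p => K p ^+ 2) ->
  Int M (fun p => stk2 (n.+1%:R^-1) F p * K p) @[n --> \oo] --> Int M (fun p => F p * K p).
Proof.
move=> mF mK LF LK.
have n0 n : 0 < (n.+1%:R^-1 : R) by rewrite invr_gt0 ltr0n.
have mS n := mf_stk2 (n.+1%:R^-1) mF.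
have S n := stk2_L2 (n0 n) mF LF.
have LSK n : L1 M (fun p => stk2 (n.+1%:R^-1) F p * K p).
  exact: (@L1_sqM _ _ _ M _ K (mS n) mK (S n).1 LK).
have LFK : L1 M (fun p => F p * K p) := @L1_sqM _ _ _ M F K mF mK LF LK.
have [_ L2 IE] := fub2 LFK.
have En n := fub2 (LSK n).
have [AF LF2 _] := fub2 LF; have [AK LK2 _] := fub2 LK.
have [_ c] : L1 nu (fun s => Int leb (fun t => F (t, s) * K (t, s))) /\
  Int nu (fun s => Int leb (fun t => stk2 (n.+1%:R^-1) F (t, s) * K (t, s))) @[n --> \oo] -->
  Int nu (fun s => Int leb (fun t => F (t, s) * K (t, s))).
  apply: (@DCT _ _ _ nu (fun n s => Int leb (fun t => stk2 (n.+1%:R^-1) F (t, s) * K (t, s)))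
    (fun s => Int leb (fun t => F (t, s) * K (t, s)))
    (fun s => Int leb (fun t => F (t, s) ^+ 2) + Int leb (fun t => K (t, s) ^+ 2))).
  - by move=> n; have [_ L _] := En n; exact: (L1_mf L).
  - exact: (L1_mf L2).
  - exact: L1D.
  - apply: filterS2 AF AK => s h1 h2.
    exact: (stk_weak (mf_pairl s mF) (mf_pairl s mK) h1 h2).
  have B : {ae nu, forall s n, [/\ L1 leb (fun t => F (t, s) ^+ 2), L1 leb (fun t => stk2 (n.+1%:R^-1) F (t, s) ^+ 2) &
    Int leb (fun t => stk2 (n.+1%:R^-1) F (t, s) ^+ 2) <= Int leb (fun t => F (t, s) ^+ 2)]}.
    by apply/ae_foralln => n; exact: (S n).2.
  apply: filterS2 B AK => s Bs h2 n; have [B1 B2 B3] := Bs n.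
  have := @cauchy_schwarz _ _ _ leb _ _ (mf_pairl s (mS n)) (mf_pairl s mK) B2 h2.
  have i0 (g : R -> R) : 0 <= Int leb (fun t => g t ^+ 2) by apply: Int_ge0 => t; exact: sqr_ge0.
  have := i0 (fun t => K (t, s)); have := i0 (fun t => stk2 (n.+1%:R^-1) F (t, s)).
  move: B3; set X := Int leb (fun t => stk2 _ F (t, s) * K (t, s)).
  set A := Int leb (fun t => F (t, s) ^+ 2); set A' := Int leb (fun t => stk2 _ F (t, s) ^+ 2).
  set B1' := Int leb (fun t => K (t, s) ^+ 2) => a1 a2 a3 a4; rewrite ler_norml; apply/andP; split; nra.
rewrite IE; apply: cvg_trans c; apply: near_eq_cvg; apply: nearW => n.
by have [_ _ ->] := En n.
Qed.

End Steklov.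

(** * The Jacobian as a null Lagrangian *)

Section Jacobian.
Context {R : realType}.
Implicit Types (a b c t r : R).
Local Notation leb := (@lebesgue_measure R).
Local Notation nu := (@nu R).
Local Notation M := (@M R).

Lemma mf_ts h (f : R * R -> R) : measurable_fun setT f ->
  measurable_fun setT (fun p : R * R => f (p.1 + h, p.2)).
Proof.
move=> mf; apply: (measurableT_comp mf).
apply: measurable_fun_pair; last exact: measurable_snd.
exact: (measurableT_comp (mf_shift h) measurable_fst).
Qed.

Lemma L1_ts h (f : R * R -> R) : L1 M f -> L1 M (fun p : R * R => f (p.1 + h, p.2)).
Proof.
move=> Lf; have mf := L1_mf Lf; have [A LB _] := fub2 (L1_norm Lf).
apply: (@L1_slices _ _ _ _ _ leb nu _ _ _ LB); first exact: mf_ts.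
have [A' _ _] := fub2 Lf; apply: filterS2 A A' => s As As'.
have [L _] := Int_shift h As'; have [_ <-] := Int_shift h As; by split.
Qed.

Lemma D2_ts h (f g : R * R -> R) : D2 f g ->
  D2 (fun p => f (p.1 + h, p.2)) (fun p => g (p.1 + h, p.2)).
Proof.
move=> [mg [k [mk fk A]]]; split; first exact: mf_ts.
have fk' : {ae M, forall p, f (p.1 + h, p.2) = k (p.1 + h, p.2)}.
  have [N [mN N0 PN]] := fk.
  have a1 : {ae M, forall p, ~ N p} by exists N; split => // p /= /contrapT.
  have a2 : {ae M, forall p : R * R, ~ N (p.1 + h, p.2)}.
    apply: prod_ae2.
      rewrite (_ : [set p | _] = (fun p : R * R => (p.1 + h, p.2)) @^-1` (~` N))//.
      rewrite -[X in measurable X]setTI; apply: (_ : measurable_fun _ _) => //; last exact: measurableC.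
      apply: measurable_fun_pair; last exact: measurable_snd.
      exact: (measurableT_comp (mf_shift h) measurable_fst).
    by apply: filterS (ae_prod2 a1) => s; exact: ae_shift.
  by apply: filterS a2 => p np; apply: contrapT => nP; apply: np; exact: PN.
exists (fun p => k (p.1 + h, p.2)); split => //; first exact: mf_ts.
exact: (ae_shift h A).
Qed.

Lemma stk_ac h (G : R -> R) : li G -> 0 < h ->
  ac (stk h G) (fun t => h^-1 * G (t + h) + (- h^-1) * G t).
Proof.
move=> lG h0; have A := S0_ac lG.
have := ac_lin (h^-1) (- h^-1) (ac_shift h A) A; congr ac; apply/funext => t.
rewrite /stk; have [_ /(_ t (t + h)) <-] := A; [ring|lra].
Qed.

Lemma stk_supp r h (G : R -> R) t : 0 < h -> h <= 1 -> (forall x, r < `|x| -> G x = 0) ->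
  r + 1 < `|t| -> stk h G t = 0.
Proof.
move=> h0 h1 G0 rt; rewrite /stk /J (_ : (fun x => _) = fun=> 0) ?Int0 ?mulr0//.
apply/funext => x; rewrite indE; case: ifPn => [/andP[h2 h3]|]; last by rewrite mul0r.
rewrite G0 ?mulr0//; move: rt; rewrite !ltNge !ler_norml => /negP rt; apply/negP => /andP[h4 h5].
by apply: rt; apply/andP; split; lra.
Qed.

(** The formal proof integrates by parts twice through the mixed derivative of p, which need not
    exist. After averaging in x_1 it does: the average of p1 is the difference quotient D of p,
    whose x_2-derivative Dp2 is also the x_1-derivative of the average of p2. Parts in x_2 and in
    x_1 give the integral of D q2 and that of the averaged p2 times q1 as minus the integral of Dp2
    q; then h tends to 0. *)
Lemma jacobian_swap r (p p1 p2 q q1 q2 : R * R -> R) : 0 <= r ->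
  W12 p p1 p2 -> W12 q q1 q2 ->
  L1 M (fun x => p x ^+ 2) -> L1 M (fun x => p1 x ^+ 2) -> L1 M (fun x => p2 x ^+ 2) ->
  (forall x, r < `|x.1| -> [/\ p x = 0, p1 x = 0 & p2 x = 0]) ->
  (forall b, [/\ L1 M (fun x => ind (- b) b x.1 * q x ^+ 2),
    L1 M (fun x => ind (- b) b x.1 * q1 x ^+ 2) & L1 M (fun x => ind (- b) b x.1 * q2 x ^+ 2)]) ->
  [/\ L1 M (fun x => p1 x * q2 x), L1 M (fun x => p2 x * q1 x) &
  Int M (fun x => p1 x * q2 x) = Int M (fun x => p2 x * q1 x)].
Proof.
move=> r0 Wp Wq Lp Lp1 Lp2 sp Lq.
have [mp mp1 mp2] := W12_mf Wp; have [mq mq1 mq2] := W12_mf Wq.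
have [Ap Bp] := Wp; have [Aq Bq] := Wq.
have mi b (f : R * R -> R) : measurable_fun setT f -> measurable_fun setT (fun x => ind (- b) b x.1 * f x).
  by move=> mf; apply: measurable_funM => //; exact: (measurableT_comp (mf_ind _ _) measurable_fst).
pose b := r + 1.
pose cut (f : R * R -> R) x := ind (- b) b x.1 * f x.
have cut2 (f : R * R -> R) : L1 M (fun x => ind (- b) b x.1 * f x ^+ 2) -> L1 M (fun x => cut f x ^+ 2).
  by congr L1; apply/funext => x; rewrite /cut indE; case: ifP => _; rewrite ?mul1r ?mul0r ?expr0n.
have [/cut2 LK /cut2 LK1 /cut2 LK2] := Lq b.
have cutM (f g : R * R -> R) : (forall x, b < `|x.1| -> f x = 0) ->
    (fun x => f x * g x) = (fun x => f x * cut g x).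
  move=> f0; apply/funext => x; rewrite /cut indE -ler_norml.
  by have [|h] := leP `|x.1| b; rewrite ?mul1r// f0 ?mul0r.
have bnd (x : R * R) : b < `|x.1| -> r < `|x.1| by rewrite /b; lra.
have LM (f g : R * R -> R) : measurable_fun setT f -> measurable_fun setT g ->
    L1 M (fun x => f x ^+ 2) -> L1 M (fun x => cut g x ^+ 2) -> (forall x, b < `|x.1| -> f x = 0) ->
    L1 M (fun x => f x * g x).
  move=> mf mg Lf Lg f0; rewrite (cutM f g f0).
  exact: (@L1_sqM _ _ _ M f (cut g) mf (mi _ _ mg) Lf Lg).
have p1s x : b < `|x.1| -> p1 x = 0 by move=> /bnd /sp[].
have p2s x : b < `|x.1| -> p2 x = 0 by move=> /bnd /sp[].
split; [exact: LM|exact: LM|].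
rewrite (cutM p1 q2 p1s) (cutM p2 q1 p2s).
have c1 := stk2_weak mp1 (mi b _ mq2) Lp1 LK2; have c2 := stk2_weak mp2 (mi b _ mq1) Lp2 LK1.
suff E n : Int M (fun x => stk2 (n.+1%:R^-1) p1 x * cut q2 x) = Int M (fun x => stk2 (n.+1%:R^-1) p2 x * cut q1 x).
  apply: (@cvg_unique _ (@Rhausdorff R) (Int M (fun x => stk2 (n.+1%:R^-1) p1 x * cut q2 x) @[n --> \oo])) => //.
  by apply: cvg_trans c2; apply: near_eq_cvg; apply: nearW => n; rewrite E.
set h := n.+1%:R^-1.
have h0 : 0 < h by rewrite invr_gt0 ltr0n.
have h1 : h <= 1 by rewrite invf_le1 ?ltr0n// ler1n.
pose D (x : R * R) := h^-1 * p (x.1 + h, x.2) + (- h^-1) * p x.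
pose Dp2 (x : R * R) := h^-1 * p2 (x.1 + h, x.2) + (- h^-1) * p2 x.
have D2D : D2 D Dp2.
  have mp' := mf_ts h mp.
  exact: (D2_chain mp' mp (C1_lin2 _ _) (D2_ts h Bp) Bp).
have mlin (f : R * R -> R) : measurable_fun setT f ->
   measurable_fun setT (fun x : R * R => h^-1 * f (x.1 + h, x.2) + (- h^-1) * f x).
  move=> mf; apply: measurable_funD; apply: measurable_funM => //; try exact: measurable_cst.
  exact: mf_ts.
have mD : measurable_fun setT D by exact: mlin.
have mDp2 : measurable_fun setT Dp2 by exact: mlin.
have L2lin (f : R * R -> R) : measurable_fun setT f -> L1 M (fun x => f x ^+ 2) ->
   L1 M (fun x : R * R => (h^-1 * f (x.1 + h, x.2) + (- h^-1) * f x) ^+ 2).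
  move=> mf Lf; apply: (@L1_sqD _ _ _ M).
  - by apply: measurable_funM; [exact: measurable_cst|exact: mf_ts].
  - by apply: measurable_funM; [exact: measurable_cst|].
  - have := L1Z (h^-1 ^+ 2) (L1_ts h Lf); congr L1; apply/funext => x; ring.
  - have := L1Z (h^-1 ^+ 2) Lf; congr L1; apply/funext => x; ring.
have slin (f : R * R -> R) : (forall x, r < `|x.1| -> f x = 0) ->
    forall x : R * R, b < `|x.1| -> h^-1 * f (x.1 + h, x.2) + (- h^-1) * f x = 0.
  move=> f0 x bx; rewrite !f0 ?mulr0 ?addr0//=; first exact: bnd.
  move: bx; rewrite /b !ltNge !ler_norml => /negP bx; apply/negP => /andP[h4 h5].
  apply: bx; clear -h4 h5 h0 h1; by apply/andP; split; lra.
have D_s : forall x, b < `|x.1| -> D x = 0 by apply: slin => x /sp[].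
have Dp2_s : forall x, b < `|x.1| -> Dp2 x = 0 by apply: slin => x /sp[].
have LD2 : L1 M (fun x => D x ^+ 2) by exact: L2lin.
have LDp2 : L1 M (fun x => Dp2 x ^+ 2) by exact: L2lin.
have [LS2 AS] := stk2_L2 h0 mp2 Lp2.
have mS := mf_stk2 h mp2; have mS1 := mf_stk2 h mp1.
have S_s x : b < `|x.1| -> stk2 h p2 x = 0.
  by apply: (stk_supp h0 h1) => t rt; have [] := sp (t, x.2) rt.
have E1 : {ae M, forall x, stk2 h p1 x = D x}.
  have h2 : {ae nu, forall s t, stk2 h p1 (t, s) = D (t, s)}.
    have [[_ _ A] _] := Wp; apply: filterS A => s [_ A] t.
    rewrite /stk2 /stk /D /= -A; [ring|lra].
  by apply: filterS (ae_M_s h2) => -[t s] /=; exact.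
have LDq : L1 M (fun x => Dp2 x * q x) by exact: LM.
have LDq2 : L1 M (fun x => D x * q2 x) by exact: LM.
have LSq1 : L1 M (fun x => stk2 h p2 x * q1 x) by exact: LM.
have I1 : Int M (fun x => Dp2 x * q x) + Int M (fun x => D x * q2 x) = 0.
  rewrite -(IntD LDq LDq2); apply: D2_ibp; last exact: L1D.
  have := D2_chain mD mq C1_mul D2D Bq.
  have <- : (fun x => Dp2 x * q x + D x * q2 x) =
    (fun x => (fun z : R * R => z.2) (D x, q x) * Dp2 x + (fun z : R * R => z.1) (D x, q x) * q2 x).
    by apply/funext => x /=; ring.
  by apply.
have AS' : AC1 (stk2 h p2) Dp2.
  split => //; apply: filterS AS => s [B1 _ _].
  have := stk_ac (li_sq (mf_pairl s mp2) B1) h0; by congr ac.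
have I2 : Int M (fun x => Dp2 x * q x) + Int M (fun x => stk2 h p2 x * q1 x) = 0.
  rewrite -(IntD LDq LSq1); have L := L1D LDq LSq1.
  have A : AC1 (fun x => stk2 h p2 x * q x) (fun x => Dp2 x * q x + stk2 h p2 x * q1 x).
    have := AC1_chain C1_mul AS' Aq.
    by congr AC1; apply/funext => x /=; ring.
  have b1 : b < b + 1 by rewrite ltrDl.
  have b10 : 0 <= b + 1 by rewrite /b !addr_ge0.
  have bb : - (b + 1) <= b + 1 by apply: (le_trans _ b10); rewrite oppr_le0.
  have cE : (fun x => ind (- (b + 1)) (b + 1) x.1 * (Dp2 x * q x + stk2 h p2 x * q1 x)) =
     (fun x => Dp2 x * q x + stk2 h p2 x * q1 x).
    apply/funext => x; rewrite indE -ler_norml; case: ifPn => [_|]; first by rewrite mul1r.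
    by rewrite -ltNge mul0r => h2; rewrite Dp2_s ?S_s ?mul0r ?addr0//; exact: lt_trans h2.
  have L' := L; rewrite -cE in L'.
  have [_ I] := AC1_ibp A bb L'.
  rewrite cE in I; rewrite -I -[RHS](Int0 nu); congr Int; apply/funext => s.
  by rewrite !S_s ?mul0r ?subr0//= ?normrN ger0_norm.
rewrite -(cutM (stk2 h p2) q1 S_s).
have -> : Int M (fun x => stk2 h p1 x * cut q2 x) = Int M (fun x => D x * q2 x).
  rewrite (cutM D q2 D_s); apply: Int_ae.
  - by apply: measurable_funM => //; exact: mi.
  - by apply: measurable_funM => //; exact: mi.
  - by apply: filterS E1 => x ->.
by clear -I1 I2; lra.
Qed.

End Jacobian.

(** * A Gagliardo-Nirenberg inequality on slabs *)

Section GagliardoNirenberg.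
Context {R : realType}.
Implicit Types (a b c t r : R) (f g h phi : R * R -> R).
Local Notation leb := (@lebesgue_measure R).
Local Notation nu := (@nu R).
Local Notation M := (@M R).

Definition slab a b f (x : R * R) := ind a b x.1 * f x.

Lemma mf_slab a b f : measurable_fun setT f -> measurable_fun setT (slab a b f).
Proof.
by move=> mf; apply: measurable_funM => //; exact: (measurableT_comp (mf_ind _ _) measurable_fst).
Qed.

Lemma L1_ind a b : a <= b -> L1 leb (ind a b) /\ Int leb (ind a b) = b - a.
Proof.
move=> ab; have lc : li (fun=> 1 : R) by apply: li_cont; exact: cst_continuous.
have E : ind a b = (fun t => ind a b t * 1) by apply/funext => t; rewrite mulr1.
by rewrite E; split; [exact: lc|rewrite -[LHS]/(J a b (fun=> 1)) J_cst ?mul1r].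
Qed.

(** |phi(t,s)| is bounded by a function of s, the integral of |phi1| along the horizontal line from
    the zero slice, and by a function of t, the mean of |phi| on the slice plus the integral of
    |phi2| there. The product of the two bounds integrates by Fubini. The mean term is absorbed
    through the first bound, which yields the factor 1 + (b - a). *)
Lemma gagliardo_nirenberg a b phi phi1 phi2 : a <= b -> W12 phi phi1 phi2 ->
  {ae nu, forall s, phi (a, s) = 0} -> L1 M (slab a b phi1) -> L1 M (slab a b phi2) ->
  L1 M (fun x => slab a b phi x ^+ 2) /\
  Int M (fun x => slab a b phi x ^+ 2) <=
    (1 + (b - a)) * (Int M (fun x => `|slab a b phi1 x|) + Int M (fun x => `|slab a b phi2 x|)) ^+ 2.
Proof.
move=> ab W pa L1' L2'; have [mp m1 m2] := W12_mf W; have [A D] := W.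
set f := slab a b phi; set f1 := slab a b phi1; set f2 := slab a b phi2.
have mf : measurable_fun setT f by exact: mf_slab.
have La1 := L1_norm L1'; have La2 := L1_norm L2'.
have [_ LA IA] := fub2 La1; have [_ LB2 IB2] := fub1 La2.
set FA := fun s => Int leb (fun t => `|f1 (t, s)|).
have [Li Ii] := L1_ind ab.
have bA : {ae M, forall x, `|f x| <= ind a b x.1 * FA x.2}.
  have h : {ae nu, forall s, forall t, `|f (t, s)| <= ind a b t * FA s}.
    have [_ _ A'] := A; have [S1 _ _] := fub2 La1.
    apply: filterS3 A' pa S1 => s [lg As] p0 Ls t; rewrite /f /slab indE /=.
    case: ifPn => [/andP[at_ tb]|_]; last by rewrite !mul0r normr0.
    rewrite !mul1r -[phi (t, s)]subr0 -p0 As//.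
    apply: (le_trans (J_norm a t lg)); apply: Int_leT.
    - exact: (li_norm lg).
    - exact: Ls.
    - move=> x; rewrite /f1 /slab /= normrM (ger0_norm (ind_ge0 _ _ _)) !indE.
      case: ifPn => [/andP[ax xt]|_]; first by rewrite ax (le_trans xt tb).
      by rewrite mul0r mulr_ge0//; case: ifP.
  by apply: filterS (ae_M_s h) => -[t s] /=; exact.
have FA0 s : 0 <= FA s by apply: Int_ge0.
have [LiA IiA] := L1_tensor Li LA.
have Lf : L1 M f by exact: (@L1_dom _ _ _ M _ _ mf LiA bA).
have Laf := L1_norm Lf.
have [_ LB1 IB1] := fub1 Laf.
set FB := fun t => Int nu (fun s => `|f (t, s)|) + Int nu (fun s => `|f2 (t, s)|).
have LB : L1 leb FB by exact: (L1D LB1 LB2).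
have FB0 t : 0 <= FB t by apply: addr_ge0; exact: Int_ge0.
have bB : {ae M, forall x, `|f x| <= FB x.1}.
  apply: prod_ae1.
    have mFB : measurable_fun setT (fun x : R * R => FB x.1) by exact: (measurableT_comp (L1_mf LB) measurable_fst).
    have mfa : measurable_fun setT (fun x : R * R => `|f x|) by exact: measurableT_comp.
    by have := measurable_fun_le measurableT mfa mFB; rewrite setTI.
  have [S1 _ _] := fub1 Lf.
  apply: filterS2 (D2_osc D mp) S1 => t [Lt ot] Ls.
  apply: filterS ot => s; rewrite /FB /f /f2 /slab /= indE; case: ifPn => _ h; last first.
    by rewrite mul0r normr0 addr_ge0//; exact: Int_ge0.
  have E (k : R * R -> R) : (fun s => `|1 * k (t, s)|) = (fun s => `|k (t, s)|).
    by apply/funext => z; rewrite mul1r.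
  rewrite !E mul1r.
  rewrite -[phi (t, s)](subrK (Int nu (fun s => phi (t, s)))).
  apply: (le_trans (ler_normD _ _)); rewrite addrC lerD//; exact: Int_norm.
have [LAB IAB] := L1_tensor LB LA.
have bAB : {ae M, forall x, f x ^+ 2 <= FB x.1 * FA x.2}.
  apply: filterS2 bA bB => x h1 h2; rewrite -[f x ^+ 2]real_normK ?num_real// expr2.
  have h3 : `|f x| <= FA x.2.
    by apply: (le_trans h1); rewrite indE; case: ifP => _; rewrite ?mul1r ?mul0r.
  by apply: ler_pM.
have L : L1 M (fun x => f x ^+ 2).
  apply: (L1_dom _ LAB); first exact: (measurable_funX 2 mf).
  by apply: filterS bAB => x; rewrite ger0_norm ?sqr_ge0.
split => //.
apply: (le_trans (Int_le L LAB bAB)); rewrite IAB IntD// -IB1 -IB2 -IA.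
have h : Int M (fun x => `|f x|) <= (b - a) * Int M (fun x => `|f1 x|).
  by rewrite IA -Ii -IiA; exact: (Int_le Laf LiA bA).
have i1 : 0 <= Int M (fun x => `|f1 x|) by apply: Int_ge0.
have i2 : 0 <= Int M (fun x => `|f2 x|) by apply: Int_ge0.
have ba : 0 <= b - a by rewrite subr_ge0.
move: h i1 i2 ba; clear; set X := Int _ _; set Y := Int _ _; set Z := Int _ _; set d := b - a => h i1 i2 ba.
rewrite expr2.
have : (X + Z) * Y <= ((d + 1) * (Y + Z)) * Y by apply: ler_wpM2r => //; nra.
have : ((d + 1) * (Y + Z)) * Y <= ((d + 1) * (Y + Z)) * (Y + Z).
  by apply: ler_wpM2l; [apply: mulr_ge0; lra|lra].
lra.
Qed.

End GagliardoNirenberg.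

Section MonotoneL1.
Context d (T : measurableType d) (R : realType) (m : {measure set T -> \bar R}).

Lemma L1_mono (f_ : nat -> T -> R) (f : T -> R) (B : R) :
  (forall n, L1 m (f_ n)) -> measurable_fun setT f -> (forall n x, 0 <= f_ n x) ->
  (forall x, {homo f_^~ x : n k / (n <= k)%N >-> n <= k}) ->
  (forall x, f_ n x @[n --> \oo] --> f x) -> (forall n, Int m (f_ n) <= B) -> L1 m f.
Proof.
move=> L mf f0 nd cv IB.
have mE n : measurable_fun setT (EFin \o f_ n) by apply/measurable_EFinP; exact: (L1_mf (L n)).
have c := @cvg_monotone_convergence _ _ _ m setT measurableT (fun n x => (f_ n x)%:E) mE.
have f0' x : 0 <= f x.
  rewrite -(cvg_lim (@Rhausdorff R) (cv x)); apply: limr_ge; first by apply/cvg_ex; exists (f x).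
  exact: nearW.
have {}c : (\int[m]_x (f_ n x)%:E)%E @[n --> \oo] --> (\int[m]_x (f x)%:E)%E.
  have E : (\int[m]_x limn (fun n => (f_ n x)%:E))%E = (\int[m]_x (f x)%:E)%E.
    apply: eq_integral => x _; apply/cvg_lim => //; apply: cvg_EFin; first exact: nearW.
    exact: cv.
  rewrite -E; apply: c; first by move=> n x _; rewrite lee_fin.
  by move=> x _ n k nk; rewrite lee_fin; exact: nd.
apply: L1P => //.
have -> : (\int[m]_x `|f x|%:E)%E = (\int[m]_x (f x)%:E)%E.
  by apply: eq_integral => x _; rewrite ger0_norm.
apply: (@le_lt_trans _ _ B%:E); last exact: ltry.
rewrite -(cvg_lim _ c)//; apply: lime_le; first by apply/cvg_ex; eexists; exact: c.
by apply: nearW => n; rewrite (L1_finE (L n)) lee_fin.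
Qed.

End MonotoneL1.

(** * Exponential integrability of Sobolev functions on slabs *)

Section MoserTrudinger.
Context {R : realType}.
Implicit Types (a b c t r s : R) (f g h v phi : R * R -> R).
Local Notation leb := (@lebesgue_measure R).
Local Notation nu := (@nu R).
Local Notation M := (@M R).

Lemma W12_gt s v v1 v2 : W12 v v1 v2 ->
  W12 (fun x => Num.max (v x - s) 0) (fun x => if s < v x then v1 x else 0)
      (fun x => if s < v x then v2 x else 0).
Proof.
move=> W; have W' : W12 (fun x => v x - s) v1 v2.
  have := W12_lin 1 1 W (W12_cst (- s)).
  by congr (W12 _ _ _); apply/funext => x; rewrite ?mul1r ?mulr0 ?addr0.
have := W12_pos W'.
by congr (W12 _ _ _); apply/funext => x; rewrite subr_gt0.
Qed.

Section Levels.
Variables (a b s0 : R) (v v1 v2 : R * R -> R).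
Hypotheses (ab : a <= b) (W : W12 v v1 v2) (va : {ae nu, forall s, v (a, s) <= s0}).
Hypotheses (L1' : L1 M (slab a b (fun x => v1 x ^+ 2))) (L2' : L1 M (slab a b (fun x => v2 x ^+ 2))).

Definition lev s (x : R * R) : R := if s < v x then 1 else 0.
(** The distribution function of [v] on the slab. *)
Definition Alev s := Int M (slab a b (lev s)).
(** The Dirichlet energy above level [s], nonincreasing in [s]. *)
Definition Dlev s := Int M (slab a b (fun x => lev s x * (v1 x ^+ 2 + v2 x ^+ 2))).

Lemma mf_lev s : measurable_fun setT (lev s).
Proof.
have [mv _ _] := W12_mf W.
apply: measurable_fun_ifT; [|exact: measurable_cst|exact: measurable_cst].
by apply: measurable_fun_ltr => //; exact: measurable_cst.
Qed.

Lemma lev_bnd s x : `|lev s x| <= 1.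
Proof. by rewrite /lev; case: ifP => _; rewrite ?normr1 ?normr0. Qed.

Lemma slab1_L1 : L1 M (slab a b (fun=> 1)) /\ Int M (slab a b (fun=> 1)) = b - a.
Proof.
have [Li Ii] := L1_ind ab; have [L1c I1c] := @Int_nu_cst R 1.
have [L E] := L1_tensor Li L1c; split; first exact: L.
by rewrite -[LHS]/(Int M (fun x : R * R => ind a b x.1 * 1)) E Ii I1c mulr1.
Qed.

Lemma slab_bM c (k f : R * R -> R) : measurable_fun setT k -> (forall x, `|k x| <= c) ->
  L1 M (slab a b f) -> L1 M (slab a b (fun x => k x * f x)).
Proof.
move=> mk kc Lf; have := @L1_bM _ _ _ M c k (slab a b f) mk kc Lf.
by congr L1; apply/funext => x; rewrite /slab; ring.
Qed.

Lemma L1_lev s : L1 M (slab a b (lev s)).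
Proof.
have [Lc _] := slab1_L1; have := slab_bM (mf_lev s) (lev_bnd s) Lc.
by congr L1; apply/funext => x; rewrite /slab mulr1.
Qed.

Lemma L1_Dlev s : L1 M (slab a b (fun x => lev s x * (v1 x ^+ 2 + v2 x ^+ 2))).
Proof.
apply: (slab_bM (mf_lev s) (lev_bnd s)).
by have := L1D L1' L2'; congr L1; apply/funext => x; rewrite /slab mulrDr.
Qed.

Lemma cs_slab (k f : R * R -> R) : measurable_fun setT k -> measurable_fun setT f ->
  (forall x, k x = 0 \/ k x = 1) -> L1 M (slab a b (fun x => f x ^+ 2)) ->
  [/\ L1 M (slab a b k), L1 M (slab a b (fun x => k x * f x ^+ 2)), L1 M (slab a b (fun x => k x * f x)) &
   Int M (fun x => `|slab a b (fun x => k x * f x) x|) ^+ 2 <=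
     Int M (slab a b k) * Int M (slab a b (fun x => k x * f x ^+ 2))].
Proof.
move=> mk mf k01 Lf.
have k1 x : `|k x| <= 1 by case: (k01 x) => ->; rewrite ?normr0 ?normr1.
have [Lc _] := slab1_L1.
have Lk : L1 M (slab a b k).
  by have := slab_bM mk k1 Lc; congr L1; apply/funext => x; rewrite /slab mulr1.
have Lkf2 := slab_bM mk k1 Lf.
have kk x : ind a b x.1 * k x * (ind a b x.1 * k x) = ind a b x.1 * k x.
  by case: (k01 x) => ->; rewrite ?mulr0 ?mulr1 ?mul0r// indE; case: ifP => _; rewrite ?mulr1 ?mulr0.
have E1 : (fun x => slab a b k x ^+ 2) = slab a b k by apply/funext => x; rewrite expr2 /slab kk.
have mkf : measurable_fun setT (slab a b (fun x => k x * f x)) by apply: mf_slab; exact: measurable_funM.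
have mg : measurable_fun setT (fun x => `|slab a b (fun x => k x * f x) x|) by exact: measurableT_comp.
have E2 : (fun x => `|slab a b (fun x => k x * f x) x| ^+ 2) = slab a b (fun x => k x * f x ^+ 2).
  apply/funext => x; rewrite real_normK ?num_real// /slab [RHS]mulrA -kk; ring.
have E3 : (fun x => slab a b k x * `|slab a b (fun x => k x * f x) x|) = (fun x => `|slab a b (fun x => k x * f x) x|).
  apply/funext => x; rewrite /slab; case: (k01 x) => ->; first by rewrite !(mulr0,mul0r) normr0.
  by rewrite indE; case: ifP => _; rewrite !(mul1r,mul0r) ?normr0.
have h1 : L1 M (fun x => slab a b k x ^+ 2) by rewrite E1.
have h2 : L1 M (fun x => `|slab a b (fun x => k x * f x) x| ^+ 2) by rewrite E2.
have mck := mf_slab a b mk.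
have L3 := @L1_sqM _ _ _ M _ _ mck mg h1 h2.
have := @cauchy_schwarz _ _ _ M _ _ mck mg h1 h2; rewrite E1 E2 E3 => cs.
split => //.
rewrite E3 in L3; apply: (@L1_domT _ _ _ M _ _ mkf L3) => x; exact: lexx.
Qed.

(** The truncation of [v] between [s] and [s + tau] equals [tau] where v > s + tau, vanishes on the
    left slice since s >= s0, and has its gradient in the layer between the two levels. Apply
    [gagliardo_nirenberg] to it and Cauchy-Schwarz on the layer, whose measure is at most
    [Alev s]. *)
Lemma level_step s tau : s0 <= s -> 0 < tau ->
  tau ^+ 2 * Alev (s + tau) <= 2 * (1 + (b - a)) * Alev s * (Dlev s - Dlev (s + tau)).
Proof.
move=> ss tau0.
have [mv m1 m2] := W12_mf W.
pose k x := lev s x - lev (s + tau) x.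
have mk : measurable_fun setT k by apply: measurable_funB; exact: mf_lev.
have Wp : W12 (fun x => Num.max (v x - s) 0 - Num.max (v x - (s + tau)) 0)
    (fun x => k x * v1 x) (fun x => k x * v2 x).
  have := W12_lin 1 (-1) (W12_gt s W) (W12_gt (s + tau) W).
  congr (W12 _ _ _); apply/funext => x; rewrite /k /lev; first by ring.
    by case: ifP => _; case: ifP => _; ring.
  by case: ifP => _; case: ifP => _; ring.
have k01 x : k x = 0 \/ k x = 1.
  rewrite /k /lev; case: (ltP s (v x)) => h1; case: (ltP (s + tau) (v x)) => h2; rewrite ?subrr ?subr0.
  - by left.
  - by right.
  - by exfalso; move: h1 h2 tau0; lra.
  - by left.
have [Lk Lk1 Lkv1 cs1] := cs_slab mk m1 k01 L1'; have [_ Lk2 Lkv2 cs2] := cs_slab mk m2 k01 L2'.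
have pa : {ae nu, forall s', Num.max (v (a, s') - s) 0 - Num.max (v (a, s') - (s + tau)) 0 = 0}.
  by apply: filterS va => s' h; rewrite !max_r ?subrr//; move: h ss tau0; lra.
have [Lphi gn] := gagliardo_nirenberg ab Wp pa Lkv1 Lkv2.
have LA := L1_lev (s + tau).
have h1 : tau ^+ 2 * Alev (s + tau) <= Int M (fun x => slab a b (fun x => Num.max (v x - s) 0 - Num.max (v x - (s + tau)) 0) x ^+ 2).
  rewrite -(IntZ _ LA); apply: Int_leT => //; first exact: L1Z.
  move=> x; rewrite /slab /lev; case: ifPn => h; last by rewrite !mulr0 sqr_ge0.
  rewrite indE; case: ifP => _; last by rewrite !mul0r mulr0 expr0n.
  rewrite !mul1r mulr1 !max_l ?subr_ge0 ?(ltW h)//; last first.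
    by apply: (le_trans _ (ltW h)); rewrite lerDl ltW.
  by rewrite (_ : v x - s - _ = tau) ?lexx//; ring.
have h2 : Int M (slab a b k) <= Alev s.
  apply: (Int_leT Lk (L1_lev s)) => x; rewrite /slab ler_wpM2l ?ind_ge0//.
  by rewrite /k lerBlDr lerDl /lev; case: ifP.
have h3 : Int M (slab a b (fun x => k x * v1 x ^+ 2)) + Int M (slab a b (fun x => k x * v2 x ^+ 2)) =
   Dlev s - Dlev (s + tau).
  rewrite -(IntD Lk1 Lk2) -(IntB (L1_Dlev s) (L1_Dlev (s + tau))); congr Int.
  by apply/funext => x; rewrite /slab /k; ring.
have i0 (f : R * R -> R) : 0 <= Int M (slab a b (fun x => k x * f x ^+ 2)).
  apply: Int_ge0 => x; rewrite /slab; apply: mulr_ge0; first exact: ind_ge0.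
  by apply: mulr_ge0; [case: (k01 x) => ->; rewrite ?lexx ?ler01|exact: sqr_ge0].
have i1 := i0 v1; have i2 := i0 v2.
apply: (le_trans h1); apply: (le_trans gn).
rewrite -h3; move: cs1 cs2 h2 i1 i2.
have : 0 <= b - a by rewrite subr_ge0.
clear; set A := Int M (slab a b k); set X := Int M (fun x => `|slab a b (fun x => k x * v1 x) x|).
set Y := Int M (fun x => `|slab a b (fun x => k x * v2 x) x|).
set E1 := Int _ _; set E2 := Int _ _; set d := b - a => d0 c1 c2 AA e1 e2.
have h1 : X ^+ 2 <= Alev s * E1 by apply: (le_trans c1); exact: ler_wpM2r.
have h2 : Y ^+ 2 <= Alev s * E2 by apply: (le_trans c2); exact: ler_wpM2r.
rewrite [2 * _]mulrC -!mulrA; apply: ler_wpM2l; first by lra.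
have := sqr_ge0 (X - Y); lra.
Qed.

Lemma Alev_ge0 s : 0 <= Alev s.
Proof.
by apply: Int_ge0 => x; rewrite /slab mulr_ge0 ?ind_ge0// /lev; case: ifP.
Qed.

(** By x <= exp(x-1) the factor gained in each step becomes an exponential, so the energy
    differences telescope: the energy lost is counted once, while every step contributes -1. *)
Lemma level_iter s tau n : s0 <= s -> 0 < tau ->
  Alev (s + n%:R * tau) <= Alev s *
    expR (2 * (1 + (b - a)) / tau ^+ 2 * (Dlev s - Dlev (s + n%:R * tau)) - n%:R).
Proof.
move=> ss tau0; elim: n => [|n IH].
  by rewrite mulr0n mul0r addr0 [X in expR X](_ : _ = 0) ?expR0 ?mulr1//; ring.
have E : s + n.+1%:R * tau = s + n%:R * tau + tau by rewrite -natr1; ring.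
set s' := s + n%:R * tau in IH E *.
have ss' : s0 <= s' by apply: (le_trans ss); rewrite lerDl mulr_ge0// ltW.
have := level_step ss' tau0; rewrite -E; set s'' := s + n.+1%:R * tau.
set C := 2 * (1 + (b - a)) => h.
have t2 : 0 < tau ^+ 2 by exact: exprn_gt0.
have h1 : Alev s'' <= Alev s' * (C / tau ^+ 2 * (Dlev s' - Dlev s'')).
  rewrite -(ler_pM2l t2); apply: (le_trans h); rewrite le_eqVlt; apply/orP; left; apply/eqP.
  by field; rewrite gt_eqF.
set x := C / tau ^+ 2 * (Dlev s' - Dlev s'') in h1.
have h2 : Alev s'' <= Alev s' * expR (x - 1).
  apply: (le_trans h1); apply: ler_wpM2l; first exact: Alev_ge0.
  by have := expR_ge1Dx (x - 1); lra.
apply: (le_trans h2); apply: (le_trans (ler_wpM2r (expR_ge0 _) IH)).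
rewrite -[X in X <= _]mulrA -expRD le_eqVlt; apply/orP; left; apply/eqP; congr (_ * expR _).
by rewrite /x /C -natr1; ring.
Qed.

Lemma Dlev_small e : 0 < e -> exists2 s, Num.max s0 0 <= s & Dlev s <= e.
Proof.
move=> e0; have [mv m1 m2] := W12_mf W.
pose D n := slab a b (fun x => lev n%:R x * (v1 x ^+ 2 + v2 x ^+ 2)).
have mg : measurable_fun setT (fun x => v1 x ^+ 2 + v2 x ^+ 2).
  by apply: measurable_funD; [exact: (measurable_funX 2 m1)|exact: (measurable_funX 2 m2)].
have mD n : measurable_fun setT (D n) by apply: mf_slab; apply: measurable_funM => //; exact: mf_lev.
have LG : L1 M (slab a b (fun x => v1 x ^+ 2 + v2 x ^+ 2)).
  by have := L1D L1' L2'; congr L1; apply/funext => x; rewrite /slab mulrDr.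
have [_ c] : L1 M (fun=> 0 : R) /\ Int M (D n) @[n --> \oo] --> Int M (fun=> 0 : R).
  apply: (@DCT _ _ _ M D (fun=> 0) _ mD _ LG).
  - exact: measurable_cst.
  - apply: aeW => x; apply: (@cvg_near_cst _ _ _ _ _).
    have := nbhs_infty_ger (v x); apply: filterS => n h.
    by rewrite /D /slab /lev ltNge h/= mul0r mulr0.
  apply: aeW => x n; rewrite /D /slab /lev ger0_norm.
    apply: ler_wpM2l; first exact: ind_ge0.
    by case: ifP => _; rewrite ?mul1r// mul0r addr_ge0 ?sqr_ge0.
  by rewrite mulr_ge0 ?ind_ge0// mulr_ge0 ?addr_ge0 ?sqr_ge0//; case: ifP.
rewrite Int0 in c; have /cvgr0Pnorm_lt/(_ _ e0) h1 := c.
have h2 := nbhs_infty_ger (Num.max s0 0).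
have [n [h3 h4]] := @filter_ex _ _ _ _ (filterI h1 h2).
by exists n%:R => //; apply/ltW/(le_lt_trans (ler_norm _)).
Qed.

(* The choice of N j^2 steps of size 1/(N j) turns the exponential gain per step into a Gaussian one. *)
Lemma level_gauss (N : nat) : (0 < N)%N -> exists2 s, Num.max s0 0 <= s &
  forall j : nat, Alev (s + j%:R) <= Alev s * expR (- (N%:R / 2 * j%:R ^+ 2)).
Proof.
move=> N0; have N0' : 0 < N%:R :> R by rewrite ltr0n.
pose C := 2 * (1 + (b - a)).
have ba : 0 <= b - a by rewrite subr_ge0.
have C0 : 0 < C by rewrite /C; lra.
(* With n = N J^2 steps of size tau = 1/(N J), an energy above [s] of at most 1/(2 C N) uses up only
   half of the gain n, since C/tau^2 times it is N J^2/2. *)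
have e0 : 0 < (2 * C * N%:R)^-1 by rewrite invr_gt0; apply: mulr_gt0 => //; apply: mulr_gt0.
have [s ss Ds] := Dlev_small e0; exists s => // -[|j].
  by rewrite addr0 expr0n mulr0 oppr0 expR0 mulr1.
have s0s : s0 <= s by move: ss; rewrite ge_max => /andP[].
set J := (j.+1)%:R : R.
have J0 : 0 < J by rewrite ltr0n.
have t0 : 0 < (N%:R * J)^-1 by rewrite invr_gt0 mulr_gt0.
have := level_iter (N * j.+1 ^ 2)%N s0s t0.
have nE : ((N * j.+1 ^ 2)%N%:R : R) = N%:R * J ^+ 2 by rewrite natrM natrX.
rewrite nE (_ : N%:R * J ^+ 2 * (N%:R * J)^-1 = J); last by field; rewrite !gt_eqF.
move=> h; apply: (le_trans h); apply: ler_wpM2l; first exact: Alev_ge0.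
rewrite ler_expR -/C.
have D0 : 0 <= Dlev (s + J).
  apply: Int_ge0 => x; rewrite /slab mulr_ge0 ?ind_ge0// mulr_ge0 ?addr_ge0 ?sqr_ge0//.
  by rewrite /lev; case: ifP.
have h1 : Dlev s - Dlev (s + J) <= (2 * C * N%:R)^-1 by lra.
have h2 : C / (N%:R * J)^-1 ^+ 2 * (Dlev s - Dlev (s + J)) <= C / (N%:R * J)^-1 ^+ 2 * (2 * C * N%:R)^-1.
  by apply: ler_wpM2l => //; apply: mulr_ge0; [exact: ltW|rewrite invr_ge0 sqr_ge0].
have h3 : C / (N%:R * J)^-1 ^+ 2 * (2 * C * N%:R)^-1 = N%:R * J ^+ 2 / 2.
  by field; rewrite !gt_eqF.
by move: h2; rewrite h3; lra.
Qed.

(** Sum over layers: where s + j < v <= s + j + 1 the integrand is at most exp(gamma (s+j+1)^2),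
    while the measure is at most exp(-N j^2/2) times [Alev s]. The truncations [f_] at level s + n
    thus have bounded integrals, and monotone convergence concludes. *)
Lemma moser_trudinger gamma : 0 <= gamma ->
  L1 M (slab a b (fun x => expR (gamma * Num.max (v x) 0 ^+ 2))).
Proof.
move=> g0; have [mv m1 m2] := W12_mf W.
(* From (s+j+1)^2 <= 2(s+1)^2 + 2j^2, the choice N/2 >= 2 gamma + 1 leaves exp(-j^2) <= 2^-j in the
   j-th layer. *)
pose N := (Num.truncn (4 * gamma) + 3)%N.
have N4 : 4 * gamma + 2 <= N%:R.
  by rewrite /N natrD; have := truncnS_gt (4 * gamma); rewrite -natr1; lra.
have N0 : (0 < N)%N by rewrite /N addnS.
have [s ss A] := level_gauss N0.
have s0' : 0 <= s by move: ss; rewrite ge_max => /andP[].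
pose E x := expR (gamma * Num.max (v x) 0 ^+ 2).
pose f_ (n : nat) := slab a b (fun x => if v x <= s + n%:R then E x else 0).
pose B := expR (gamma * s ^+ 2) * (b - a) + expR (2 * gamma * (s + 1) ^+ 2) * Alev s * 2.
have mmax : measurable_fun setT (fun x => Num.max (v x) 0).
  by apply: measurable_maxr => //; exact: measurable_cst.
have mE : measurable_fun setT E.
  apply: measurableT_comp; first exact: measurable_expR.
  by apply: measurable_funM; [exact: measurable_cst|exact: (measurable_funX 2 mmax)].
have mf n : measurable_fun setT (f_ n).
  apply: mf_slab; apply: measurable_fun_ifT => //.
  by apply: measurable_fun_ler => //; exact: measurable_cst.
pose c (j : nat) := expR (gamma * (s + j.+1%:R) ^+ 2).
pose h (n : nat) x := expR (gamma * s ^+ 2) * slab a b (fun=> 1) x +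
   \sum_(j < n) c j * slab a b (lev (s + j%:R)) x.
have [Lc Ic] := slab1_L1.
have Lh n : L1 M (h n) /\ Int M (h n) = expR (gamma * s ^+ 2) * (b - a) + \sum_(j < n) c j * Alev (s + j%:R).
  elim: n => [|n [IL IH]].
    have E0 : h 0%N = (fun x => expR (gamma * s ^+ 2) * slab a b (fun=> 1) x).
      by apply/funext => x; rewrite /h big_ord0 addr0.
    by rewrite E0 big_ord0 addr0 (IntZ _ Lc) Ic; split => //; exact: L1Z.
  have Ln : L1 M (fun x => c n * slab a b (lev (s + n%:R)) x) by apply: L1Z; exact: L1_lev.
  have E1 : h n.+1 = (fun x => h n x + c n * slab a b (lev (s + n%:R)) x).
    by apply/funext => x; rewrite /h big_ord_recr /= addrA.
  rewrite E1 (IntD IL Ln) (IntZ _ (L1_lev _)) IH big_ord_recr /= addrA; split => //.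
  exact: L1D.
have sg x : 0 <= slab a b (fun=> 1) x by rewrite /slab mulr1 ind_ge0.
have lg t x : 0 <= slab a b (lev t) x by rewrite /slab mulr_ge0 ?ind_ge0// /lev; case: ifP.
have f0 n x : 0 <= f_ n x.
  by rewrite /f_ /slab mulr_ge0 ?ind_ge0//; case: ifP => // _; exact: expR_ge0.
have fh n x : f_ n x <= h n x.
  have h0 m : 0 <= h m x.
    rewrite /h addr_ge0//; first by rewrite mulr_ge0 ?expR_ge0.
    by apply: sumr_ge0 => i _; rewrite mulr_ge0 ?expR_ge0.
  have base : v x <= s -> slab a b E x <= expR (gamma * s ^+ 2) * slab a b (fun=> 1) x.
    move=> vs; rewrite /slab mulr1 mulrC ler_wpM2r ?ind_ge0// ler_expR ler_wpM2l//.
    have m0 : 0 <= Num.max (v x) 0 by rewrite le_max lexx orbT.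
    have ms : Num.max (v x) 0 <= s by rewrite ge_max vs.
    by rewrite ler_pXn2r ?nnegrE.
  elim: n => [|n IH].
    rewrite /f_ /h big_ord0 !addr0 /slab; case: ifPn => [vs|_]; first exact: base.
    by rewrite mulr0; exact: (mulr_ge0 (expR_ge0 _) (sg x)).
  have E1 : h n.+1 x = h n x + c n * slab a b (lev (s + n%:R)) x.
    by rewrite /h big_ord_recr /= addrA.
  have [vn|vn] := leP (v x) (s + n%:R).
    have -> : f_ n.+1 x = f_ n x.
      rewrite /f_ /slab vn ifT//; apply: (le_trans vn); rewrite lerD2l ler_nat//.
    by rewrite E1; apply: (le_trans IH); rewrite lerDl mulr_ge0// ?expR_ge0.
  rewrite E1; apply: ler_wpDl; first exact: h0.
  rewrite /f_ /slab /lev vn mulr1 mulrC ler_wpM2r ?ind_ge0//.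
  case: ifPn => [vs|_]; last exact: expR_ge0.
  rewrite ler_expR ler_wpM2l//.
  have m0 : 0 <= Num.max (v x) 0 by rewrite le_max lexx orbT.
  have ms : Num.max (v x) 0 <= s + n.+1%:R by rewrite ge_max vs addr_ge0.
  by rewrite ler_pXn2r ?nnegrE// (le_trans m0).
have Lf n : L1 M (f_ n).
  have [L _] := Lh n; apply: (@L1_domT _ _ _ M _ _ (mf n) L) => x.
  by rewrite ger0_norm.
have cA j : c j * Alev (s + j%:R) <= expR (2 * gamma * (s + 1) ^+ 2) * Alev s * (2^-1) ^+ j.
  apply: (le_trans (ler_wpM2l (expR_ge0 _) (A j))).
  rewrite mulrCA [X in _ <= X](_ : _ = Alev s * (expR (2 * gamma * (s + 1) ^+ 2) * 2^-1 ^+ j)); last by ring.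
  apply: ler_wpM2l; first exact: Alev_ge0.
  have h1 : c j * expR (- (N%:R / 2 * j%:R ^+ 2)) <= expR (2 * gamma * (s + 1) ^+ 2) * expR (- j%:R).
    rewrite -!expRD ler_expR.
    have jj : j%:R <= j%:R ^+ 2 :> R by rewrite -natrX ler_nat; case: (j) => // k; rewrite -[X in (X <= _)%N]expn1 leq_pexp2l.
    have sq : (s + j.+1%:R) ^+ 2 <= 2 * (s + 1) ^+ 2 + 2 * j%:R ^+ 2.
      by rewrite -natr1; have := sqr_ge0 (s + 1 - j%:R); nra.
    have := ler_wpM2l g0 sq.
    have := ler_wpM2r (sqr_ge0 (j%:R : R)) N4; lra.
  apply: (le_trans h1); rewrite ler_wpM2l ?expR_ge0//.
  have -> : - j%:R = j%:R * -1 :> R by rewrite mulrN1.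
  rewrite expRM_natl lerXn2r ?nnegrE ?expR_ge0 ?invr_ge0//.
  rewrite expRN lef_pV2 ?posrE ?expR_gt0//; have := expR_ge1Dx (1 : R); lra.
have IB n : Int M (f_ n) <= B.
  have [L IE] := Lh n; apply: (le_trans (Int_leT (Lf n) L (fh n))); rewrite IE /B lerD2l.
  apply: (@le_trans _ _ (\sum_(j < n) expR (2 * gamma * (s + 1) ^+ 2) * Alev s * (2^-1) ^+ j)).
    by apply: ler_sum.
  rewrite -mulr_sumr ler_wpM2l ?mulr_ge0 ?expR_ge0 ?Alev_ge0//.
  suff -> : \sum_(j < n) (2^-1 : R) ^+ j = 2 - 2 * 2^-1 ^+ n.
    by rewrite lerBlDr lerDl mulr_ge0// exprn_ge0// invr_ge0.
  elim: n {L IE} => [|n IH]; first by rewrite big_ord0 expr0; ring.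
  by rewrite big_ord_recr /= IH exprSr; field.
apply: (@L1_mono _ _ _ M f_ _ B Lf _ f0 _ _ IB).
- exact: mf_slab.
- move=> x n k nk; rewrite /f_ /slab ler_wpM2l ?ind_ge0//.
  have nk' : s + n%:R <= s + k%:R by rewrite lerD2l ler_nat.
  case: ifPn => h1; first by rewrite (le_trans h1 nk').
  by case: ifP => // _; exact: expR_ge0.
- move=> x; apply: cvg_near_cst; have := nbhs_infty_ger (v x - s); apply: filterS => n h1.
  by rewrite /f_ /slab ifT// -lerBlDl.
Qed.

End Levels.
End MoserTrudinger.

(** * Harmonic functions: conjugates, potentials and gradient bounds *)

Section Harmonic.
Context {R : realType}.
Implicit Types (a b c t x y r K : R) (F w : R * R -> R).
Local Notation leb := (@lebesgue_measure R).
Local Notation mm := (leb \x leb)%E.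

Lemma cont_bnd2 F x x' y y' : continuous F ->
  exists2 C : R, 0 <= C & forall s t, x <= s <= x' -> y <= t <= y' -> `|F (s, t)| <= C.
Proof.
move=> cF; pose A : set (R * R) := (`[x, x']%classic `*` `[y, y']%classic).
have cA : compact A by apply: compact_setX; exact: segment_compact.
have [N [_ HN]] : bounded_set [set F p | p in A].
  apply: compact_bounded; apply: continuous_compact => //; exact: continuous_subspaceT.
exists (Num.max 0 (N + 1)); first by rewrite le_max lexx.
move=> s t hs ht; rewrite le_max; apply/orP; right; apply: HN; first by rewrite ltrDl.
by exists (s, t) => //; split; rewrite /= in_itv.
Qed.

Lemma S0_diff (g h : R -> R) y : li g -> li h -> S0 (fun t => g t - h t) y = S0 g y - S0 h y.
Proof.
move=> lg lh.
have E : (fun t => g t - h t) = (fun t => g t + (-1) * h t) by apply/funext => t; ring.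
have l1 := liZ (-1) lh.
by rewrite /S0 E !(J_D _ _ lg l1) !(J_Z _ _ _ lh); ring.
Qed.

Lemma cont_slice1 F y : continuous F -> continuous (fun x => F (x, y)).
Proof.
move=> cF x; have h : (fun x : R => (x, y)) @ x --> (x, y).
  have h1 : (fun z : R => z) @ x --> x by exact: cvg_id.
  have h2 : (fun=> y) @ x --> y by exact: cvg_cst.
  exact: (cvg_pair h1 h2).
exact: (cvg_comp _ _ h (cF _)).
Qed.

Lemma cont_slice2 F x : continuous F -> continuous (fun y => F (x, y)).
Proof.
move=> cF y; have h : (fun y : R => (x, y)) @ y --> (x, y).
  have h1 : (fun=> x) @ y --> x by exact: cvg_cst.
  have h2 : (fun z : R => z) @ y --> y by exact: cvg_id.
  exact: (cvg_pair h1 h2).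
exact: (cvg_comp _ _ h (cF _)).
Qed.

Lemma C1_fix1 F F1 F2 x : C1 F F1 F2 -> continuous F2 -> ac (fun y => F (x, y)) (fun y => F2 (x, y)).
Proof.
move=> [_ _ _ d] c2; apply: (@derive_ac _ (fun y => F (x, y)) (fun y => F2 (x, y))) => y.
exact: cont_slice2.
Qed.

Lemma C1_fix2 F F1 F2 y : C1 F F1 F2 -> continuous F1 -> ac (fun x => F (x, y)) (fun x => F1 (x, y)).
Proof.
move=> [_ _ d _] c2; apply: (@derive_ac _ (fun x => F (x, y)) (fun x => F1 (x, y))) => x.
exact: cont_slice1.
Qed.

(** Both sides are the integral over the rectangle of the common derivative [S], by Fubini. *)
Lemma rectangle (P Q P1 S Q2 : R * R -> R) x x' y y' : C1 P P1 S -> C1 Q S Q2 ->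
  x <= x' -> y <= y' ->
  J x x' (fun s => P (s, y') - P (s, y)) = J y y' (fun t => Q (x', t) - Q (x, t)).
Proof.
move=> CP CQ xx yy; have [_ cS _ _] := CP; have [cS' _ _ _] := CQ.
pose k (p : R * R) := ind x x' p.1 * ind y y' p.2 * S p.
have mS : measurable_fun setT S.
  have := measurable_comp2 cS (@measurable_fst _ _ (measurableTypeR R) (measurableTypeR R)) (@measurable_snd _ _ (measurableTypeR R) (measurableTypeR R)).
  by congr (measurable_fun _ _); apply/funext => -[].
have lc : li (fun=> 1 : R) by apply: li_cont; exact: cst_continuous.
have Li u v : L1 leb (ind u v) by have := lc u v; congr L1; apply/funext => t; rewrite mulr1.
have [LT _] := L1_tensor (Li x x') (Li y y').
have [C C0 HC] := cont_bnd2 x x' y y' cS.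
have mk : measurable_fun setT k by apply: measurable_funM => //; exact: (L1_mf LT).
have Lk : L1 mm k.
  apply: (@L1_domT _ _ _ mm _ _ mk (L1Z C LT)) => -[s t]; rewrite /k /= !indE.
  case: ifP => hs; last by rewrite !mul0r normr0 mulr0.
  case: ifP => ht; last by rewrite !(mulr0,mul0r) normr0.
  by rewrite !mul1r mulr1; exact: HC.
have [_ _ E1] := fub1 Lk; have [_ _ E2] := fub2 Lk.
transitivity (Int mm k).
  rewrite E1; congr Int; apply/funext => s.
  have [_ ->//] := C1_fix1 s CP cS; rewrite /J -IntZ; last first.
    by have [l _] := C1_fix1 s CP cS; exact: l.
  by congr Int; apply/funext => t; rewrite /k /=; ring.
rewrite E2; congr Int; apply/funext => t.
have [_ ->//] := C1_fix2 t CQ cS; rewrite /J -IntZ; last first.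
  by have [l _] := C1_fix2 t CQ cS; exact: l.
by congr Int; apply/funext => s; rewrite /k /=; ring.
Qed.

(** The potential of a closed field, integrated along the first axis and then vertically. Its second
    partial derivative is immediate; the first comes from [rectangle]. *)
Lemma poincare (P Q P1 S Q2 : R * R -> R) : C1 P P1 S -> C1 Q S Q2 ->
  exists Phi, C1 Phi P Q.
Proof.
move=> CP CQ; have cP := C1_continuous CP; have cQ := C1_continuous CQ.
have lQ x : li (fun y => Q (x, y)) by apply: li_cont; exact: cont_slice2.
have lP y : li (fun x => P (x, y)) by apply: li_cont; exact: cont_slice1.
pose Phi (p : R * R) := S0 (fun s => P (s, 0)) p.1 + S0 (fun t => Q (p.1, t)) p.2.
exists Phi; split => // x y.
- suff A : ac (fun x => Phi (x, y)) (fun x => P (x, y)).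
    by apply: (ac_is_derive A); exact: cont_slice1.
  split=> // x1 x2 x12.
  have E1 : Phi (x2, y) - Phi (x1, y) = J x1 x2 (fun s => P (s, 0)) +
      S0 (fun t => Q (x2, t) - Q (x1, t)) y.
    have [_ <-//] := S0_ac (lP 0).
    rewrite (S0_diff y (lQ x2) (lQ x1)) /Phi /=; ring.
  have lPN z : li (fun s => (-1) * P (s, z)) by apply: liZ.
  have JB z z' : J x1 x2 (fun s => P (s, z') - P (s, z)) = J x1 x2 (fun s => P (s, z')) - J x1 x2 (fun s => P (s, z)).
    have -> : (fun s => P (s, z') - P (s, z)) = (fun s => P (s, z') + (-1) * P (s, z)) by apply/funext => s; ring.
    by rewrite (J_D _ _ (lP z') (lPN z)) (J_Z _ _ _ (lP z)); ring.
  rewrite E1 /S0; have [y0|y0] := leP 0 y.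
    rewrite -(rectangle CP CQ x12 y0) JB.
    have -> : J y 0 (fun t => Q (x2, t) - Q (x1, t)) = 0.
      by move: y0; rewrite le_eqVlt => /predU1P[<-|y0]; [exact: J_xx|exact: J_gt].
    ring.
  by rewrite (J_gt _ y0) -(rectangle CP CQ x12 (ltW y0)) JB; ring.
- have A := S0_ac (lQ x); have d := ac_is_derive A (@cont_slice2 Q x cQ y).
  by apply: (is_derive_eq (is_deriveD (is_derive_cst (S0 (fun s => P (s, 0)) x) y 1) d)); rewrite add0r.
Qed.

Lemma C1_opp F F1 F2 : C1 F F1 F2 -> C1 (fun p => - F p) (fun p => - F1 p) (fun p => - F2 p).
Proof.
move=> [c1 c2 d1 d2]; split.
- by move=> p; apply: cvgN; exact: c1.
- by move=> p; apply: cvgN; exact: c2.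
- by move=> x y; exact: (is_deriveN (d1 x y)).
- by move=> x y; exact: (is_deriveN (d2 x y)).
Qed.

Lemma C1_swap F F1 F2 : C1 F F1 F2 -> C1 (F \o swap) (F2 \o swap) (F1 \o swap).
Proof.
have cs : continuous (@swap R).
  move=> p.
  have h1 : (fun q : R * R => q.2) @ p --> p.2 by exact: cvg_snd.
  have h2 : (fun q : R * R => q.1) @ p --> p.1 by exact: cvg_fst.
  exact: (cvg_pair h1 h2).
move=> [c1 c2 d1 d2]; split.
- by move=> p; apply: continuous_comp; [exact: cs|exact: c2].
- by move=> p; apply: continuous_comp; [exact: cs|exact: c1].
- by move=> x y; exact: d2.
- by move=> x y; exact: d1.
Qed.

Definition c2harm w w1 w2 w11 w12 w21 w22 := [/\ C1 w w1 w2, C1 w1 w11 w12, C1 w2 w21 w22 &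
  forall p, w11 p + w22 p = 0].

Lemma C1_partials F : (forall p, derivable F p e1 /\ derivable F p e2) ->
  continuous ('D_e1 F) -> continuous ('D_e2 F) -> C1 F ('D_e1 F) ('D_e2 F).
Proof.
move=> d c1 c2; split; [exact: c1|exact: c2|move=> x y|move=> x y].
- by apply/der_e1; apply: DeriveDef; [exact: (d (x, y)).1|].
- by apply/der_e2; apply: DeriveDef; [exact: (d (x, y)).2|].
Qed.

Lemma is_C2_harm w : is_C2 w -> is_harmonic w ->
  exists w1 w2 w11 w12 w21 w22, c2harm w w1 w2 w11 w12 w21 w22.
Proof.
move=> [cw dw d2w [c1 c2] [c11 c12 c21 c22]] hw.
exists ('D_e1 w), ('D_e2 w), ('D_e1 ('D_e1 w)), ('D_e2 ('D_e1 w)), ('D_e1 ('D_e2 w)), ('D_e2 ('D_e2 w)).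
have h1 : C1 w ('D_e1 w) ('D_e2 w) := C1_partials dw c1 c2.
have d1 p : derivable ('D_e1 w) p e1 /\ derivable ('D_e1 w) p e2 by have [? ? _ _] := d2w p.
have d2 p : derivable ('D_e2 w) p e1 /\ derivable ('D_e2 w) p e2 by have [_ _ ? ?] := d2w p.
exact: (And4 h1 (C1_partials d1 c11 c12) (C1_partials d2 c21 c22) hw).
Qed.

(** [al] is the harmonic conjugate. The fields (al, w) and (-w, al) are closed by the Cauchy-Riemann
    equations, and their potentials give d_1 Phi1(u) + d_2 Phi2(u) = al(u) div u + w(u) omega, the
    divergence form of w(u) omega. *)
Lemma harmonic_conj w w1 w2 w11 w12 w21 w22 : c2harm w w1 w2 w11 w12 w21 w22 ->
  exists al Phi1 Phi2, [/\ C1 al (fun p => - w2 p) w1, C1 Phi1 al w & C1 Phi2 (fun p => - w p) al].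
Proof.
move=> [Cw Cw1 Cw2 h].
have CN : C1 (fun p => - w2 p) (fun p => - w21 p) w11.
  have := C1_opp Cw2; congr (C1 _ _ _); apply/funext => p; have := h p; lra.
have [al Ca] := poincare CN Cw1; exists al.
have [Phi1 h1] := poincare Ca Cw; have [Phi2 h2] := poincare (C1_opp Cw) Ca.
by exists Phi1, Phi2.
Qed.

(** A positive second derivative at [c] makes the first one positive just to the right of [c], and
    the mean value theorem then yields a value above [g c]. *)
Lemma second_derivative_max (g dg : R -> R) (L a b c : R) : a < c < b ->
  (forall x, is_derive x 1 g (dg x)) -> is_derive c 1 dg L ->
  (forall t, a < t < b -> g t <= g c) -> L <= 0.
Proof.
move=> /andP[ac cb] dG dL gm; rewrite leNgt; apply/negP => L0.
have ab : a <= b by lra.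
have cab : c \in `]a, b[ by rewrite in_itv/= ac cb.
have d0 : is_derive c 1 g 0.
  apply: (@derive1_at_max _ g a b c ab _ cab); first by move=> t _; have [] := dG t.
  by move=> t; rewrite in_itv/=; exact: gm.
have dc0 : dg c = 0 by have [_ <-] := dG c; have [_ ->] := d0.
have [dv dE] := dL.
have cv : (fun h : R => h^-1 *: ((dg \o shift c) (h *: (1 : R)) - dg c)) @ 0^' --> L.
  by rewrite -dE; exact: dv.
have /cvgrPdist_lt/(_ _ L0) H0 := cv.
have /nbhs_ballP[e /= e0 He] : nbhs (0 : R) (fun h : R => h != 0 ->
  `|L - h^-1 *: ((dg \o shift c) (h *: (1 : R)) - dg c)| < L) by exact: H0.
pose d := Num.min (e / 2) ((b - c) / 2).
have d0' : 0 < d by rewrite lt_min; apply/andP; split; lra.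
have de : d <= e / 2 by rewrite ge_min lexx.
have db : d <= (b - c) / 2 by rewrite ge_min lexx orbT.
have pos t : c < t -> t < c + e -> 0 < dg t.
  move=> ct te.
  have h0 : t - c != 0 by rewrite subr_eq0 gt_eqF.
  have b0 : ball (0 : R) e (t - c) by rewrite /ball/= sub0r normrN gtr0_norm; lra.
  have := He _ b0 h0.
  rewrite dc0 subr0 {1}/GRing.scale /= /GRing.scale /= mulr1 subrK.
  rewrite ltr_norml => /andP[_ h1].
  have h2 : 0 < (t - c)^-1 * dg t by lra.
  by move: h2; rewrite pmulr_rgt0// invr_gt0 subr_gt0.
have cd : c < c + d by rewrite ltrDl.
have [|xi xi1 xi2] := @MVT _ g dg c (c + d) cd (fun x _ => dG x).
  apply: continuous_subspaceT => x; apply: differentiable_continuous.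
  by apply/derivable1_diffP; have [] := dG x.
have : g (c + d) <= g c by apply: gm; apply/andP; split; lra.
have : 0 < dg xi by move: xi1; rewrite in_itv/= => /andP[h1 h2]; apply: pos => //; lra.
have E : c + d - c = d by ring.
rewrite E in xi2 => h1 h2.
have : 0 < dg xi * d by exact: mulr_gt0.
rewrite -xi2; lra.
Qed.

Lemma max_rectangle (f f1 f2 f11 f22 : R * R -> R) x0 x1 y0 y1 : continuous f ->
  (forall x y, is_derive x 1 (fun x => f (x, y)) (f1 (x, y))) ->
  (forall x y, is_derive y 1 (fun y => f (x, y)) (f2 (x, y))) ->
  (forall x y, is_derive x 1 (fun x => f1 (x, y)) (f11 (x, y))) ->
  (forall x y, is_derive y 1 (fun y => f2 (x, y)) (f22 (x, y))) ->
  (forall p, 0 < f11 p + f22 p) ->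
  (forall x y, x0 <= x <= x1 -> y0 <= y <= y1 -> x = x0 \/ x = x1 \/ y = y0 \/ y = y1 -> f (x, y) <= 0) ->
  forall x y, x0 <= x <= x1 -> y0 <= y <= y1 -> f (x, y) <= 0.
Proof.
move=> cf d1 d2 d11 d22 pos bd x y hx hy.
pose A : set (R * R) := (`[x0, x1]%classic `*` `[y0, y1]%classic).
have cA : compact A by apply: compact_setX; exact: segment_compact.
have A0 : A !=set0 by exists (x, y); split; rewrite /= in_itv.
have [[cx cy]] := compact_EVT_max A0 cA (continuous_subspaceT cf).
rewrite inE => -[]; rewrite /= !in_itv/= => hcx hcy Hm.
have {}Hm s t : x0 <= s <= x1 -> y0 <= t <= y1 -> f (s, t) <= f (cx, cy).
  by move=> hs ht; apply: Hm; rewrite inE; split; rewrite /= in_itv.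
apply: (le_trans (Hm _ _ hx hy)).
have [/andP[ix1 ix2]|nx] := boolP (x0 < cx < x1); last first.
  apply: bd => //; move: nx hcx; rewrite negb_and -!leNgt => /orP[h|h] /andP[h1 h2].
    by left; apply/eqP; rewrite eq_le h h1.
  by right; left; apply/eqP; rewrite eq_le h h2.
have [/andP[iy1 iy2]|ny] := boolP (y0 < cy < y1); last first.
  apply: bd => //; move: ny hcy; rewrite negb_and -!leNgt => /orP[h|h] /andP[h1 h2].
    by right; right; left; apply/eqP; rewrite eq_le h h1.
  by right; right; right; apply/eqP; rewrite eq_le h h2.
exfalso.
have h1 : f11 (cx, cy) <= 0.
  apply: (@second_derivative_max (fun x => f (x, cy)) (fun x => f1 (x, cy)) _ x0 x1 cx) => //.
    by rewrite ix1.
  by move=> t /andP[t0 t1]; apply: Hm => //; rewrite !ltW.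
have h2 : f22 (cx, cy) <= 0.
  apply: (@second_derivative_max (fun y => f (cx, y)) (fun y => f2 (cx, y)) _ y0 y1 cy) => //.
    by rewrite iy1.
  by move=> t /andP[t0 t1]; apply: Hm => //; rewrite !ltW.
have := pos (cx, cy); lra.
Qed.

Lemma is_derive_affine (g : R -> R) (d c m x : R) : is_derive (c + m * x) 1 g d ->
  is_derive x 1 (fun x => g (c + m * x)) (d * m).
Proof.
move=> dg; have h : is_derive x 1 (fun s : R => m * s) m.
  by apply: (is_derive_eq (is_deriveM (is_derive_cst m x 1) (is_derive_id x 1))); rewrite scaler0 addr0 /GRing.scale /= mulr1.
have h2 : is_derive x 1 (fun s : R => c + m * s) m.
  by apply: (is_derive_eq (is_deriveD (is_derive_cst c x 1) h)); rewrite add0r.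
exact: (@is_derive1_comp _ g (fun s : R => c + m * s) x d m dg h2).
Qed.

Lemma is_derive_lin3 (f g h : R -> R) (a b c : R) (df dg dh x : R) :
  is_derive x 1 f df -> is_derive x 1 g dg -> is_derive x 1 h dh ->
  is_derive x 1 (fun x => a * f x + b * g x + c * h x) (a * df + b * dg + c * dh).
Proof.
have Z (k : R) (p : R -> R) dp : is_derive x 1 p dp -> is_derive x 1 (fun x => k * p x) (k * dp).
  move=> d; apply: (is_derive_eq (is_deriveM (is_derive_cst k x 1) d)).
  by rewrite scaler0 addr0 /GRing.scale.
by move=> d1 d2 d3; exact: (is_deriveD (is_deriveD (Z a _ _ d1) (Z b _ _ d2)) (Z c _ _ d3)).
Qed.

Lemma is_derive_quad (a b c x : R) : is_derive x 1 (fun x => a * (x * x) + b * x + c * 1) (2 * a * x + b).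
Proof.
have d2 : is_derive x 1 (fun x : R => x * x) (2 * x).
  apply: (is_derive_eq (is_deriveM (is_derive_id x 1) (is_derive_id x 1))).
  by rewrite /GRing.scale /=; ring.
have di : is_derive x 1 (fun s : R => s) 1 by exact: is_derive_id.
have dc : is_derive x 1 (fun=> 1 : R) 0 by exact: is_derive_cst.
apply: (is_derive_eq (is_derive_lin3 a b c d2 di dc)).
by ring.
Qed.

(* Odd reflection across the line through z, compared with the harmonic barrier
   K (y^2 - x^2 + 2 x) on the half box. *)
Lemma gradient_bound1 w w1 w2 w11 w12 w21 w22 z1 z2 K : c2harm w w1 w2 w11 w12 w21 w22 -> 0 <= K ->
  (forall x y, `|x - z1| <= 1 -> `|y - z2| <= 1 -> `|w (x, y)| <= K) ->
  `|w1 (z1, z2)| <= 2 * K.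
Proof.
move=> [Cw Cw1 Cw2 hw] K0 wK.
have [cw1 cw2 d1 d2] := Cw; have [_ _ d11 _] := Cw1; have [_ _ _ d22] := Cw2.
suff main (s : R) : s = 1 \/ s = -1 -> s * w1 (z1, z2) <= 2 * K.
  by rewrite ler_norml; have := main 1 (or_introl erefl); have := main (-1) (or_intror erefl); lra.
move=> s1; have ss : s * s = 1 by case: s1 => ->; ring.
have sn : `|s| = 1 by case: s1 => ->; rewrite ?normrN normr1.
have cw := C1_continuous Cw.
pose v x y := w (z1 + s * x, z2 + 1 * y) - w (z1 + (- s) * x, z2 + 1 * y).
have bnd x y : 0 <= x <= 1 -> -1 <= y <= 1 -> 2^-1 * v x y <= K * (y * y - x * x + 2 * x).
  move=> hx hy; apply/ler_addgt0Pr => e e0.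
  pose q1 (p : R * R) := w (z1 + s * p.1, z2 + 1 * p.2).
  pose q2 (p : R * R) := w (z1 + (- s) * p.1, z2 + 1 * p.2).
  (* The [e] added to the coefficient of x^2 gives this function Laplacian 2e > 0, and the constant
     -e keeps it nonpositive on the boundary. *)
  pose f (p : R * R) := 2^-1 * q1 p + (- 2^-1) * q2 p +
     1 * ((K + e) * (p.1 * p.1) + (- 2 * K) * p.1 + (- K * p.2 * p.2 - e) * 1).
  pose f1 (p : R * R) := 2^-1 * (w1 (z1 + s * p.1, z2 + 1 * p.2) * s) + (- 2^-1) * (w1 (z1 + (- s) * p.1, z2 + 1 * p.2) * - s) +
     1 * (2 * (K + e) * p.1 + (- 2 * K)).
  pose f2 (p : R * R) := 2^-1 * (w2 (z1 + s * p.1, z2 + 1 * p.2) * 1) + (- 2^-1) * (w2 (z1 + (- s) * p.1, z2 + 1 * p.2) * 1) +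
     1 * (2 * (- K) * p.2 + 0).
  pose f11 (p : R * R) := 2^-1 * (w11 (z1 + s * p.1, z2 + 1 * p.2) * s * s) + (- 2^-1) * (w11 (z1 + (- s) * p.1, z2 + 1 * p.2) * - s * - s) +
     1 * (2 * 0 * p.1 + 2 * (K + e)).
  pose f22 (p : R * R) := 2^-1 * (w22 (z1 + s * p.1, z2 + 1 * p.2) * 1 * 1) + (- 2^-1) * (w22 (z1 + (- s) * p.1, z2 + 1 * p.2) * 1 * 1) +
     1 * (2 * 0 * p.2 + 2 * (- K)).
  have aff (c m : R) : continuous (fun x : R => c + m * x).
    move=> u; have h1 : (fun x : R => m * x) @ u --> m * u by apply: cvgM; [exact: (@cvg_cst _ (m : R) _ (nbhs u) _)|exact: cvg_id].
    exact: (cvgD (@cvg_cst _ (c : R) _ (nbhs u) _) h1).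
  have cq (m : R) : continuous (fun p : R * R => w (z1 + m * p.1, z2 + 1 * p.2)).
    move=> p.
    have h1 : (fun p : R * R => z1 + m * p.1) @ p --> z1 + m * p.1.
      by apply: (cvg_comp fst (fun x : R => z1 + m * x)); [exact: cvg_fst|exact: aff].
    have h2 : (fun p : R * R => z2 + 1 * p.2) @ p --> z2 + 1 * p.2.
      by apply: (cvg_comp snd (fun x : R => z2 + 1 * x)); [exact: cvg_snd|exact: aff].
    have h12 : (fun p : R * R => (z1 + m * p.1, z2 + 1 * p.2)) @ p --> (z1 + m * p.1, z2 + 1 * p.2).
      exact: (cvg_pair h1 h2).
    exact: (cvg_comp _ _ h12 (cw _)).
  have cf : continuous f.
    move=> p.
    have k (c : R) : (fun=> c) @ p --> c by exact: (@cvg_cst _ (c : R) _ (nbhs p) _).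
    have p1 : (fun q : R * R => q.1) @ p --> p.1 by exact: cvg_fst.
    have p2 : (fun q : R * R => q.2) @ p --> p.2 by exact: cvg_snd.
    exact: (cvgD (cvgD (cvgM (k 2^-1) (cq s p)) (cvgM (k (- 2^-1)) (cq (- s) p)))
       (cvgM (k 1) (cvgD (cvgD (cvgM (k (K + e)) (cvgM p1 p1)) (cvgM (k (- 2 * K)) p1))
          (cvgM (cvgB (cvgM (cvgM (k (- K)) p2) p2) (k e)) (k 1))))).
  have ax (F G : R * R -> R) (m u t : R) : (forall x y : R, is_derive x 1 (fun x => F (x, y)) (G (x, y))) ->
    is_derive u 1 (fun x => F (z1 + m * x, z2 + 1 * t)) (G (z1 + m * u, z2 + 1 * t) * m).
    move=> dF; exact: (@is_derive_affine (fun x => F (x, z2 + 1 * t)) _ z1 m u (dF _ _)).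
  have ay (F G : R * R -> R) (m u t : R) : (forall x y : R, is_derive y 1 (fun y => F (x, y)) (G (x, y))) ->
    is_derive t 1 (fun y => F (z1 + m * u, z2 + 1 * y)) (G (z1 + m * u, z2 + 1 * t) * 1).
    move=> dF; exact: (@is_derive_affine (fun y => F (z1 + m * u, y)) _ z2 1 t (dF _ _)).
  have Z (k : R) (p : R -> R) (dp u : R) : is_derive u 1 p dp -> is_derive u 1 (fun x => p x * k) (dp * k).
    move=> d; apply: (is_derive_eq (is_deriveM d (is_derive_cst k u 1))).
    by rewrite scaler0 add0r /GRing.scale /= mulrC.
  have lin (A B u : R) : is_derive u 1 (fun x : R => A * x + B) (2 * 0 * u + A).
    have := is_derive_quad 0 A B u; congr is_derive; apply/funext => x'; ring.
  have F1 x' y' : is_derive x' 1 (fun x => f (x, y')) (f1 (x', y')).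
    exact: (is_derive_lin3 2^-1 (- 2^-1) 1 (ax w w1 s x' y' d1) (ax w w1 (- s) x' y' d1) (is_derive_quad (K + e) (- 2 * K) (- K * y' * y' - e) x')).
  have F2 x' y' : is_derive y' 1 (fun y => f (x', y)) (f2 (x', y')).
    have := is_derive_lin3 2^-1 (- 2^-1) 1 (ay w w2 s x' y' d2) (ay w w2 (- s) x' y' d2)
       (is_derive_quad (- K) 0 ((K + e) * (x' * x') + (- 2 * K) * x' - e) y').
    congr is_derive; apply/funext => y''; rewrite /f /q1 /q2 /=; ring.
  have F11 x' y' : is_derive x' 1 (fun x => f1 (x, y')) (f11 (x', y')).
    exact: (is_derive_lin3 2^-1 (- 2^-1) 1 (Z s _ _ _ (ax w1 w11 s x' y' d11)) (Z (- s) _ _ _ (ax w1 w11 (- s) x' y' d11)) (lin (2 * (K + e)) (- 2 * K) x')).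
  have F22 x' y' : is_derive y' 1 (fun y => f2 (x', y)) (f22 (x', y')).
    exact: (is_derive_lin3 2^-1 (- 2^-1) 1 (Z 1 _ _ _ (ay w2 w22 s x' y' d22)) (Z 1 _ _ _ (ay w2 w22 (- s) x' y' d22)) (lin (2 * (- K)) 0 y')).
  have pos p : 0 < f11 p + f22 p.
    have := hw (z1 + s * p.1, z2 + 1 * p.2); have := hw (z1 + (- s) * p.1, z2 + 1 * p.2).
    have E (A : R) : A * s * s = A by rewrite -mulrA ss mulr1.
    have E' (A : R) : A * - s * - s = A by rewrite -[RHS](E A); ring.
    by rewrite /f11 /f22 E E'; lra.
  have := max_rectangle (x0 := 0) (x1 := 1) (y0 := -1) (y1 := 1) cf F1 F2 F11 F22 pos _ hx hy.
  have fE : f (x, y) <= 0 -> 2^-1 * v x y <= K * (y * y - x * x + 2 * x) + e.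
    have xx : 0 <= x * x by rewrite -expr2 sqr_ge0.
    have := mulr_ge0 (ltW e0) xx.
    rewrite /f /q1 /q2 /v /=; lra.
  move=> H; apply/fE/H => {x y hx hy H fE} x y hx hy hbd.
  have wb m : m = s \/ m = - s -> `|w (z1 + m * x, z2 + 1 * y)| <= K.
    move=> hm; have mn : `|m| = 1 by case: hm => ->; rewrite ?normrN.
    apply: wK; first by rewrite addrC addKr normrM mn mul1r ler_norml; lra.
    by rewrite addrC addKr mul1r ler_norml.
  have := wb s (or_introl erefl); have := wb (- s) (or_intror erefl).
  rewrite /f /q1 /q2 /= => W1 W2.
  case: hbd => [x0|hbd].
    rewrite x0 !mulr0 addr0; have := mulr_ge0 K0 (sqr_ge0 y); rewrite expr2; lra.
  have {W1 W2} W : 2^-1 * w (z1 + s * x, z2 + 1 * y) + (- 2^-1) * w (z1 + (- s) * x, z2 + 1 * y) <= K.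
    by move: W1 W2; rewrite !ler_norml; lra.
  have y2 : 0 <= y * y by rewrite -expr2 sqr_ge0.
  have x2 : x * x <= 1 by nra.
  have x2' : x * x <= 2 * x by nra.
  case: hbd => [x1|hbd].
    rewrite x1 in W *; have := mulr_ge0 K0 y2; lra.
  have yy : y * y = 1 by case: hbd => ->; ring.
  have -> : - K * y * y - e = - K * (y * y) - e by ring.
  rewrite yy; have := mulr_ge0 K0 (_ : 0 <= 2 * x - x * x); have := ler_wpM2l (ltW e0) x2; lra.
have dv : is_derive (0 : R) 1 (fun x : R => 2^-1 * v x 0) (s * w1 (z1, z2)).
  have e1 := @is_derive_affine (fun x => w (x, z2 + 1 * 0)) _ z1 s 0 (d1 _ _).
  have e2 := @is_derive_affine (fun x => w (x, z2 + 1 * 0)) _ z1 (- s) 0 (d1 _ _).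
  have dc : is_derive (0 : R) 1 (fun=> 0 : R) 0 by exact: is_derive_cst.
  have := is_derive_lin3 2^-1 (- 2^-1) 0 e1 e2 dc.
  congr is_derive; first by apply/funext => x; rewrite /v; ring.
  by rewrite !mulr0 !addr0; field.
have dq := is_derive_quad (- K) (2 * K) 0 (0 : R).
rewrite leNgt; apply/negP => lt.
(* the difference vanishes at 0, is nonnegative for x > 0, but would have negative slope *)
have dc : is_derive (0 : R) 1 (fun=> 0 : R) 0 by exact: is_derive_cst.
have dd := is_derive_lin3 1 (-1) 0 dq dv dc.
set D := 1 * _ + _ + _ in dd.
have D0 : D < 0 by rewrite /D; lra.
have [dv' dE] := dd.
set h := (fun x => _) in dv' dE.
have cv : (fun t : R => t^-1 *: ((h \o shift 0) (t *: (1 : R)) - h 0)) @ 0^' --> D.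
  by rewrite -dE; exact: dv'.
have D0' : 0 < - D by lra.
have /cvgrPdist_lt/(_ _ D0') H0 := cv.
have /nbhs_ballP[e /= e0 He] : nbhs (0 : R) (fun t : R => t != 0 ->
  `|D - t^-1 *: ((h \o shift 0) (t *: (1 : R)) - h 0)| < - D) by exact: H0.
pose t := Num.min (e / 2) 1.
have t0 : 0 < t by rewrite lt_min; apply/andP; split; lra.
have te : t <= e / 2 by rewrite ge_min lexx.
have t1 : t <= 1 by rewrite ge_min lexx orbT.
have bt : ball (0 : R) e t by rewrite /ball/= sub0r normrN gtr0_norm; lra.
have t0' : t != 0 by rewrite gt_eqF.
have := He _ bt t0'; rewrite {1}/GRing.scale /= /GRing.scale /= mulr1 addr0.
have v00 : v 0 0 = 0 by rewrite /v !mulr0 !addr0 subrr.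
have h0 : h 0 = 0 by rewrite /h v00; ring.
have ht : 0 <= h t.
  have ht1 : 0 <= t <= 1 by rewrite t1 ltW.
  have hm : -1 <= (0 : R) <= 1 by apply/andP; split; lra.
  by have := bnd t 0 ht1 hm; rewrite /h; lra.
rewrite h0 subr0 ltr_norml => /andP[h1 h2].
have : t^-1 * h t < 0 by lra.
by rewrite pmulr_rlt0 ?invr_gt0// ltNge ht.
Qed.

Lemma gradient_bound w w1 w2 w11 w12 w21 w22 z K : c2harm w w1 w2 w11 w12 w21 w22 -> 0 <= K ->
  (forall x y, `|x - z.1| <= 1 -> `|y - z.2| <= 1 -> `|w (x, y)| <= K) ->
  `|w1 z| <= 2 * K /\ `|w2 z| <= 2 * K.
Proof.
case: z => z1 z2 h K0 wK; split; first exact: (gradient_bound1 h K0 wK).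
have [Cw Cw1 Cw2 hw] := h.
have hs : c2harm (w \o swap) (w2 \o swap) (w1 \o swap) (w22 \o swap) (w21 \o swap) (w12 \o swap) (w11 \o swap).
  split; [exact: C1_swap|exact: C1_swap|exact: C1_swap|].
  by move=> p /=; rewrite addrC hw.
by apply: (@gradient_bound1 _ _ _ _ _ _ _ z2 z1 K hs K0) => x y hx hy; exact: wK.
Qed.

(** On the unit box around z one has |z'|^2 <= 2|z|^2 + 4, so [gradient_bound] gives the exponent 2
    beta and the factor exp(4 beta). For [al] the gradient is integrated from the origin along the
    axes; the resulting factor |x| + |y| is absorbed by exp(|z|^2), hence gamma = 2 beta + 1. *)
Lemma growth_bound w w1 w2 w11 w12 w21 w22 al C beta : c2harm w w1 w2 w11 w12 w21 w22 ->
  C1 al (fun p => - w2 p) w1 -> 0 <= C -> 0 <= beta ->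
  (forall z, `|w z| <= C * expR (beta * (z.1 ^+ 2 + z.2 ^+ 2))) ->
  exists C' gamma : R, [/\ 0 <= C', 0 <= gamma & forall z, [/\
    `|al z| <= C' * expR (gamma * (z.1 ^+ 2 + z.2 ^+ 2)),
    `|w1 z| <= C' * expR (gamma * (z.1 ^+ 2 + z.2 ^+ 2)) &
    `|w2 z| <= C' * expR (gamma * (z.1 ^+ 2 + z.2 ^+ 2))]].
Proof.
move=> h Ca C0 b0 wb; have [_ _ a1 a2] := Ca.
pose C1' := 2 * (C * expR (4 * beta)).
have C10 : 0 <= C1' by rewrite /C1' mulr_ge0// mulr_ge0 ?expR_ge0.
pose B (z : R * R) := C1' * expR (2 * beta * (z.1 ^+ 2 + z.2 ^+ 2)).
have B0 z : 0 <= B z by rewrite /B mulr_ge0 ?expR_ge0.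
have wB z : `|w1 z| <= B z /\ `|w2 z| <= B z.
  have [|x y hx hy|] := @gradient_bound _ _ _ _ _ _ _ z (C * expR (4 * beta) * expR (2 * beta * (z.1 ^+ 2 + z.2 ^+ 2))) h.
  - by rewrite !mulr_ge0 ?expR_ge0.
  - apply: (le_trans (wb _)); rewrite -mulrA -expRD ler_wpM2l// ler_expR /=.
    have x2 : x ^+ 2 <= 2 * z.1 ^+ 2 + 2.
      by move: hx; rewrite ler_norml => /andP[h1 h2]; have := sqr_ge0 (x - 2 * z.1); nra.
    have y2 : y ^+ 2 <= 2 * z.2 ^+ 2 + 2.
      by move: hy; rewrite ler_norml => /andP[h1 h2]; have := sqr_ge0 (y - 2 * z.2); nra.
    have := ler_wpM2l b0 x2; have := ler_wpM2l b0 y2; lra.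
  - by rewrite /B /C1' -!mulrA.
have Bm x y x' y' : `|x| <= `|x'| -> `|y| <= `|y'| -> B (x, y) <= B (x', y').
  move=> hx hy; rewrite /B ler_wpM2l// ler_expR ler_wpM2l ?mulr_ge0//= lerD//.
    by rewrite -[x ^+ 2]real_normK ?num_real// -[x' ^+ 2]real_normK ?num_real// lerXn2r ?nnegrE.
  by rewrite -[y ^+ 2]real_normK ?num_real// -[y' ^+ 2]real_normK ?num_real// lerXn2r ?nnegrE.
have seg (u v : R) : Num.min 0 u <= v <= Num.max 0 u -> `|v| <= `|u|.
  by rewrite ge_min le_max => /andP[/orP[h1|h1] /orP[h2|h2]]; rewrite ler_norml; case: (ler0P u) => hu;
    apply/andP; split; lra.
have alB x y : `|al (x, y)| <= `|al (0, 0)| + (`|x| + `|y|) * B (x, y).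
  have m1 : `|al (x, 0) - al (0, 0) - 0 * (x - 0)| <= B (x, y) * `|x - 0|.
    apply: (@MVT_lin _ (fun x => al (x, 0)) (fun x => - w2 (x, 0)) 0 x 0 _ (fun z => a1 z 0)) => z hz.
    rewrite subr0 normrN; apply: (le_trans (wB (z, 0)).2); apply: Bm; first exact: seg.
    by rewrite normr0.
  have m2 : `|al (x, y) - al (x, 0) - 0 * (y - 0)| <= B (x, y) * `|y - 0|.
    apply: (@MVT_lin _ (fun y => al (x, y)) (fun y => w1 (x, y)) 0 y 0 _ (fun z => a2 x z)) => z hz.
    by rewrite subr0; apply: (le_trans (wB (x, z)).1); apply: Bm => //; exact: seg.
  rewrite mul0r !subr0 in m1; rewrite mul0r !subr0 in m2.
  have -> : al (x, y) = al (0, 0) + ((al (x, 0) - al (0, 0)) + (al (x, y) - al (x, 0))) by ring.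
  apply: (le_trans (ler_normD _ _)); rewrite lerD2l; apply: (le_trans (ler_normD _ _)).
  by rewrite mulrDl [_ * B _]mulrC [`|y| * _]mulrC lerD.
exists (`|al (0, 0)| + 2 * C1'), (2 * beta + 1).
have E0 z : 0 <= z.1 ^+ 2 + z.2 ^+ 2 :> R by rewrite addr_ge0 ?sqr_ge0.
have BC (z : R * R) : B z <= (`|al (0, 0)| + 2 * C1') * expR ((2 * beta + 1) * (z.1 ^+ 2 + z.2 ^+ 2)).
  apply: ler_pM; rewrite ?expR_ge0//; first by have := normr_ge0 (al (0, 0)); lra.
  by rewrite ler_expR; have := E0 z; lra.
split; [by rewrite addr_ge0 ?mulr_ge0|by rewrite addr_ge0 ?mulr_ge0|].
move=> z; have [h1 h2] := wB z; split; [|exact: (le_trans h1)|exact: (le_trans h2)].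
case: z {h1 h2} => x y /=; apply: (le_trans (alB x y)); rewrite [X in _ <= X]mulrDl; apply: lerD.
  have g0 : 0 <= (2 * beta + 1) * (x ^+ 2 + y ^+ 2).
    by apply: mulr_ge0; [rewrite addr_ge0 ?mulr_ge0|exact: (E0 (x, y))].
  by rewrite ler_peMr//; have := expR_ge1Dx ((2 * beta + 1) * (x ^+ 2 + y ^+ 2)); lra.
rewrite /B [(2 * beta + 1) * _]mulrDl mul1r expRD /=.
have xe (u v : R) : `|u| <= expR (u ^+ 2 + v ^+ 2).
  have h1 := expR_ge1Dx (u ^+ 2 + v ^+ 2); have h2 := sqr_ge0 v.
  have h3 := sqr_ge0 (`|u| - 1); have h4 := real_normK (num_real u); nra.
have h1 := xe x y; have h2 := xe y x; rewrite [y ^+ 2 + _]addrC in h2.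
have : (`|x| + `|y|) <= 2 * expR (x ^+ 2 + y ^+ 2) by lra.
set e := expR (2 * beta * _); set e' := expR (x ^+ 2 + y ^+ 2) => h3.
have ce : 0 <= C1' * e by rewrite mulr_ge0 ?expR_ge0.
have := ler_wpM2r ce h3; lra.
Qed.

End Harmonic.

(** * Small slices, level sets and cutoffs *)

Section Prelim.
Context {R : realType}.
Implicit Types (a b t r s : R).
Local Notation leb := (@lebesgue_measure R).
Local Notation nu := (@nu R).
Local Notation M := (@M R).

(** Otherwise |q| >= e a.e. on an interval of length n, however far out, with n e larger than the
    integral of |q|. *)
Lemma L1_small (q : R -> R) (P : R -> Prop) e T : L1 leb q -> 0 < e -> {ae leb, forall t, P t} ->
  (exists t, [/\ T < t, P t & q t < e]) /\ (exists t, [/\ t < T, P t & q t < e]).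
Proof.
move=> Lq e0 HP.
have key (n : nat) x : Int leb (fun t => `|q t|) < n%:R * e ->
    exists t, [/\ x <= t <= x + n%:R, P t & q t < e].
  move=> hn; apply: contrapT => hN.
  have h : {ae leb, forall t, ind x (x + n%:R) t * e <= `|q t|}.
    apply: filterS HP => t Pt; rewrite indE; case: ifPn => [ht|_]; last by rewrite mul0r.
    rewrite mul1r leNgt; apply/negP => qe; apply: hN; exists t; split => //.
    exact: (le_lt_trans (ler_norm _)).
  have xn : x <= x + n%:R by rewrite lerDl.
  have [Li Ii] := L1_ind xn.
  have Le : L1 leb (fun t => ind x (x + n%:R) t * e).
    by have := L1Z e Li; congr L1; apply/funext => t; rewrite mulrC.
  have := Int_le Le (L1_norm Lq) h.
  have -> : Int leb (fun t => ind x (x + n%:R) t * e) = n%:R * e.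
    have -> : (fun t => ind x (x + n%:R) t * e) = (fun t => e * ind x (x + n%:R) t).
      by apply/funext => t; rewrite mulrC.
    by rewrite (IntZ _ Li) Ii; ring.
  by rewrite leNgt hn.
have [n hn] : exists n : nat, Int leb (fun t => `|q t|) < n%:R * e.
  exists (Num.truncn (Int leb (fun t => `|q t|) / e)).+1.
  by rewrite -ltr_pdivrMr//; exact: truncnS_gt.
split.
  have [t [/andP[h1 h2] h3 h4]] := key n (T + 1) hn.
  by exists t; split => //; apply: lt_le_trans h1; rewrite ltrDl.
have [t [/andP[h1 h2] h3 h4]] := key n (T - 1 - n%:R) hn.
exists t; split => //; apply: (le_lt_trans h2); rewrite subrK; lra.
Qed.

Lemma ae_nu_ex (P : R -> Prop) : {ae nu, forall s, P s} -> exists s, P s.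
Proof.
move=> h; apply: contrapT => hN.
have h1 : {ae nu, forall s, (1 : R) = 0} by apply: filterS h => s Ps; exfalso; apply: hN; exists s.
have [_ I1] := @Int_nu_cst R 1; have [_ I0] := @Int_nu_cst R 0.
have : Int nu (fun=> 1 : R) = Int nu (fun=> 0 : R).
  by apply: (Int_ae _ _ h1); exact: measurable_cst.
by rewrite I1 I0 => /eqP; rewrite oner_eq0.
Qed.

Lemma Int_nu_sq (f : R -> R) : measurable_fun setT f -> L1 nu (fun s => f s ^+ 2) ->
  L1 nu f /\ Int nu (fun s => `|f s|) ^+ 2 <= Int nu (fun s => f s ^+ 2).
Proof.
move=> mf Lf; have [L1c I1] := @Int_nu_cst R 1.
have mc1 : measurable_fun [set: R] (fun _ : R => 1 : R) by exact: measurable_cst.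
have Lc2 : L1 nu (fun=> (1 : R) ^+ 2) by rewrite expr1n.
have mfa : measurable_fun setT (fun s => `|f s|) by exact: measurableT_comp.
have E2 : (fun s => `|f s| ^+ 2) = (fun s => f s ^+ 2) by apply/funext => s; rewrite real_normK ?num_real.
have Lfa : L1 nu (fun s => `|f s| ^+ 2) by rewrite E2.
have L := @L1_sqM _ _ _ nu (fun=> 1) _ mc1 mfa Lc2 Lfa.
have := @cauchy_schwarz _ _ _ nu (fun=> 1) _ mc1 mfa Lc2 Lfa.
have E1 : (fun s => 1 * `|f s|) = (fun s => `|f s|) by apply/funext => s; rewrite mul1r.
rewrite E1 in L *; rewrite E2 expr1n I1 mul1r => h; split => //.
by apply: (@L1_domT _ _ _ nu _ _ mf L) => s; exact: lexx.
Qed.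

Lemma D2_osc2 (f g : R * R -> R) : D2 f g -> measurable_fun setT f -> L1 M (fun x => g x ^+ 2) ->
  {ae leb, forall t, [/\ L1 nu (fun s => f (t, s)), L1 nu (fun s => g (t, s)),
    Int nu (fun s => `|g (t, s)|) ^+ 2 <= Int nu (fun s => g (t, s) ^+ 2) &
    {ae nu, forall s, `|f (t, s) - Int nu (fun s => f (t, s))| <= Int nu (fun s => `|g (t, s)|)}]}.
Proof.
move=> D mf Lg; have [A _ _] := fub1 Lg; have [mg _] := D.
apply: filterS2 A (D2_osc D mf) => t At [Lf o].
by have [L h] := Int_nu_sq (mf_pairr t mg) At.
Qed.

Lemma D2_slab a b (f g : R * R -> R) : D2 f g -> D2 (slab a b f) (slab a b g).
Proof.
move=> [mg [h [mh fh A]]]; split; first exact: mf_slab.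
exists (slab a b h); split; [exact: mf_slab|by apply: filterS fh => x; rewrite /slab => ->|].
by apply: filterS A => t At; exact: (per_scale (ind a b t) At).
Qed.

(** Serves twice: at the top level of a truncation, and to annihilate the gradient of u_1 once u_1
    is constant. *)
Lemma W12_level c (v v1 v2 : R * R -> R) : W12 v v1 v2 ->
  {ae M, forall x, v x = c -> v1 x = 0 /\ v2 x = 0}.
Proof.
move=> W; have [mv m1 m2] := W12_mf W.
have ms (k g : R * R -> R) : measurable_fun setT k -> measurable_fun setT g ->
    measurable [set x | k x = c -> g x = 0].
  move=> mk mg.
  rewrite (_ : [set x | _] = ~` [set x | k x = c] `|` [set x | g x = 0]); last first.
    apply/seteqP; split => x /=; last by case.
    by move=> h; have [e|] := pselect (k x = c); [right; exact: h|left].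
  apply: measurableU; first by apply: measurableC; apply: (measurable_eq_set (f := k) (g := fun=> c)) => //; exact: measurable_cst.
  by apply: (measurable_eq_set (f := g) (g := fun=> 0)) => //; exact: measurable_cst.
have lev (f g : R -> R) : ac f g -> {ae leb, forall t, f t = c -> g t = 0}.
  move=> A; have A' : ac (fun t => f t - c) g.
    by have := ac_lin 1 (- c) A (ac_cst 1); congr ac; apply/funext => t; ring.
  by apply: filterS (ac_level0 A') => t h e; apply: h; rewrite e subrr.
have [[_ _ A] [_ [h [mh vh B]]]] := W.
have h1 : {ae M, forall x, v x = c -> v1 x = 0}.
  by apply: prod_ae2; [exact: ms|apply: filterS A => s; exact: lev].
have h2 : {ae M, forall x, h x = c -> v2 x = 0}.
  apply: prod_ae1; first exact: ms.
  apply: filterS B => t [_ [H AH HE]].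
  have l := ae_nu (lev _ _ AH).
  have in01 : {ae nu, forall s, 0 <= s <= 1}.
    exists (~` `[0, 1]%classic); split.
    - by apply: measurableC.
    - rewrite nuE (_ : _ `&` _ = set0) ?measure0//; apply/seteqP; split => s // [k1 k2].
      by exfalso; apply: k1; move: k2; rewrite /= !in_itv/= => /andP[-> /ltW ->].
    - by move=> s /= k1 k2; apply: k1; move: k2; rewrite in_itv.
  apply: filterS2 l in01 => s ls s01 hs; have := ls; rewrite (HE s s01) indE s01 mul1r.
  by apply.
by apply: filterS3 h1 h2 vh => x k1 k2 e vx; split; [exact: k1|apply: k2; rewrite -e].
Qed.

(** The trapezoidal cutoff, written with positive parts so that its derivative comes from
    [ac_pos]. *)
Definition trap (n t : R) := Num.max (t + (n + 1)) 0 - Num.max (t + n) 0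
   - Num.max (t + (- n)) 0 + Num.max (t + (- (n + 1))) 0.
Definition trap' (n t : R) : R := (if 0 < t + (n + 1) then 1 else 0) - (if 0 < t + n then 1 else 0)
   - (if 0 < t + (- n) then 1 else 0) + (if 0 < t + (- (n + 1)) then 1 else 0).

Lemma trap_ac n : ac (trap n) (trap' n).
Proof.
have id_ac : ac (fun t : R => t) (fun=> 1).
  apply: derive_ac => t; exact: cst_continuous.
have pa (c : R) : ac (fun t : R => Num.max (t + c) 0) (fun t => if 0 < t + c then 1 else 0).
  exact: (ac_pos (ac_shift c id_ac)).
have := ac_lin 1 1 (ac_lin 1 (-1) (pa (n + 1)) (pa n)) (ac_lin (-1) 1 (pa (- n)) (pa (- (n + 1)))).
by congr ac; apply/funext => t; rewrite /trap /trap' !mul1r !mulN1r !addrA.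
Qed.

Lemma trapP n t : 0 <= n -> [/\ 0 <= trap n t <= 1, (`|t| <= n -> trap n t = 1),
  (n + 1 < `|t| -> trap n t = 0 /\ trap' n t = 0),
  (`|t| < n -> trap' n t = 0) & `|trap' n t| <= 1].
Proof.
move=> n0; rewrite /trap /trap' !maxEle.
case: (ler0P t) => t0; case: (lerP (t + (n + 1)) 0) => h1; case: (lerP (t + n) 0) => h2;
 case: (lerP (t + - n) 0) => h3; case: (lerP (t + - (n + 1)) 0) => h4; try (exfalso; lra);
 (split; [apply/andP; split; lra|move=> h; lra|move=> h; split; lra|move=> h; lra|
   rewrite ler_norml; apply/andP; split; lra]).
Qed.

End Prelim.

(** * Restriction to slabs and the algebra of the estimates *)

Section SlabFacts.
Context {R : realType}.
Local Notation M := (@M R).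
Implicit Types (f : R * R -> R) (a b al be : R).

Lemma L1_slab a b f : L1 M f -> L1 M (slab a b f).
Proof.
move=> Lf; apply: (@L1_bM _ _ _ M 1) => //.
  exact: (measurableT_comp (mf_ind _ _) measurable_fst).
by move=> x; exact: ind_bnd.
Qed.

Lemma slab_sub al be f : (forall b, 0 <= b -> L1 M (slab (- b) b f)) -> L1 M (slab al be f).
Proof.
move=> H; pose b := `|al| + `|be|.
have b0 : 0 <= b by rewrite addr_ge0.
have := L1_slab al be (H b b0); congr L1; apply/funext => x; rewrite /slab !indE.
case: ifPn => [/andP[h1 h2]|_]; last by rewrite !mul0r.
rewrite mul1r ifT ?mul1r// -ler_norml; rewrite /b ler_norml.
have := ler_norm be; have := ler_norm (- al); rewrite normrN => h3 h4.
have := normr_ge0 al; have := normr_ge0 be => h5 h6.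
apply/andP; split; lra.
Qed.

Lemma slab_norm a b f x : `|slab a b f x| <= `|f x|.
Proof. by rewrite /slab indE; case: ifP => _; rewrite ?mul1r ?mul0r ?normr0. Qed.

Lemma slab_sq a b f : (fun x => slab a b f x ^+ 2) = slab a b (fun x => f x ^+ 2).
Proof.
by apply/funext => x; rewrite /slab indE; case: ifP => _; rewrite ?mul1r ?mul0r ?expr0n.
Qed.

Lemma mul_le_sqD (x y : R) : x * y <= x ^+ 2 + y ^+ 2.
Proof. by have := sqr_ge0 (x - y); have := sqr_ge0 x; have := sqr_ge0 y; lra. Qed.

(* 2 phi (w1 p2 - w2 p1) <= |p|^2 + phi^2 |dw|^2 *)
Lemma young_flux (sg g11 g12 g21 g22 W dw1 dw2 phi n : R) : sg * sg = 1 -> g11 + g22 = 0 ->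
  g21 - g12 = W -> n = 1 \/ n = 0 /\ g11 = 0 /\ g12 = 0 ->
  (sg * g11) ^+ 2 + (sg * g12) ^+ 2 + (2 * sg * (sg * g11 * g22 - sg * g12 * g21)
    + 2 * sg * (W * (sg * g12) + phi * (dw1 * g12 + dw2 * g22)))
  <= phi ^+ 2 * (n * (dw1 ^+ 2 + dw2 ^+ 2)).
Proof.
move=> s1 d o H.
have -> : g22 = - g11 by rewrite -[RHS]addr0 -d; ring.
have -> : g21 = W + g12 by rewrite -o; ring.
have -> : (sg * g11) ^+ 2 + (sg * g12) ^+ 2 + (2 * sg * (sg * g11 * - g11 - sg * g12 * (W + g12))
    + 2 * sg * (W * (sg * g12) + phi * (dw1 * g12 + dw2 * - g11))) =
    - (sg * sg) * (g11 ^+ 2 + g12 ^+ 2) + 2 * phi * (dw1 * (sg * g12) - dw2 * (sg * g11)) by ring.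
case: H => [->|[-> [-> ->]]]; last by rewrite !(mulr0, mul0r, expr0n, addr0, subr0).
have := sqr_ge0 (sg * g12 - phi * dw1); have := sqr_ge0 (sg * g11 + phi * dw2).
rewrite !sqrrD !exprMn -[sg ^+ 2]/(sg * sg) s1; lra.
Qed.

Lemma gn_algebra (d E1 E2 X Y F : R) : 0 <= d -> F <= (1 + d) * (X + Y) ^+ 2 ->
  X ^+ 2 <= d * E1 -> Y ^+ 2 <= d * E2 -> F <= 2 * (1 + d) * d * (E1 + E2).
Proof.
move=> d0 h hX hY; apply: (le_trans h).
have -> : 2 * (1 + d) * d * (E1 + E2) = (1 + d) * (2 * (d * (E1 + E2))) by ring.
by apply: ler_wpM2l; [lra|have := sqr_ge0 (X - Y); lra].
Qed.

(** Gagliardo-Nirenberg for phi^2: the 4 comes from grad(phi^2) = 2 phi grad(phi) after squaring,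
    and another 2 from (X+Y)^2 <= 2(X^2+Y^2). *)
Lemma gn2_algebra (d e1 e2 X Y F2 F4 : R) : 0 <= d -> F4 <= (1 + d) * (X + Y) ^+ 2 ->
  X ^+ 2 <= 4 * F2 * e1 -> Y ^+ 2 <= 4 * F2 * e2 -> F4 <= 8 * (1 + d) * F2 * (e1 + e2).
Proof.
move=> d0 h hX hY; apply: (le_trans h).
have -> : 8 * (1 + d) * F2 * (e1 + e2) = (1 + d) * (2 * (4 * F2 * e1 + 4 * F2 * e2)) by ring.
by apply: ler_wpM2l; [lra|have := sqr_ge0 (X - Y); lra].
Qed.

(** The chain E^2 <= Q^2 <= F4 th <= 16 (1+d)^2 d th E^2 forces E = 0 when the last coefficient is
    below 1; its 16 is 8 from the bound on F4 times 2 from that on F2. *)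
Lemma absorb_algebra (d E F2 F4 th Q : R) : 0 <= d -> 0 <= E -> 0 <= F2 -> F2 <= 2 * (1 + d) * d * E ->
  F4 <= 8 * (1 + d) * F2 * E -> E <= Q -> Q ^+ 2 <= F4 * th -> 0 <= th ->
  16 * (1 + d) ^+ 2 * d * th < 1 -> F2 <= 0.
Proof.
move=> d0 E0 F20 hF2 hF4 hE hQ th0 small.
have h1 : F4 <= 16 * (1 + d) ^+ 2 * d * E ^+ 2.
  apply: (le_trans hF4).
  have : 0 <= 8 * (1 + d) * E by rewrite !mulr_ge0//; lra.
  by move=> /ler_wpM2l /(_ _ _ hF2); lra.
have h2 : E ^+ 2 <= Q ^+ 2 by rewrite lerXn2r ?nnegrE// (le_trans E0).
have h3 : E ^+ 2 <= 16 * (1 + d) ^+ 2 * d * th * E ^+ 2.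
  by apply: (le_trans h2); apply: (le_trans hQ); have := ler_wpM2r th0 h1; lra.
have h4 : E ^+ 2 <= 0.
  rewrite leNgt; apply/negP => p; move: h3; rewrite leNgt => /negP; apply.
  by rewrite -subr_gt0 -[X in X - _]mul1r -mulrBl mulr_gt0// subr_gt0.
have h5 : E = 0 by apply/eqP; rewrite -sqrf_eq0 eq_le h4 sqr_ge0.
by move: hF2; rewrite h5 mulr0.
Qed.

(** The larger of the two squares carries the exponential, at the price of doubling [g]. The four
    terms reflect that [moser_trudinger] speaks of positive parts only, so each component is needed
    with both signs. *)
Lemma expR_split (g x y : R) : 0 <= g ->
  expR (g * (x ^+ 2 + y ^+ 2)) <= expR (2 * g * Num.max x 0 ^+ 2) + expR (2 * g * Num.max (- x) 0 ^+ 2)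
    + (expR (2 * g * Num.max y 0 ^+ 2) + expR (2 * g * Num.max (- y) 0 ^+ 2)).
Proof.
move=> g0.
have one (z : R) : expR (2 * g * z ^+ 2) <= expR (2 * g * Num.max z 0 ^+ 2) + expR (2 * g * Num.max (- z) 0 ^+ 2).
  have [z0|z0] := leP 0 z; first by rewrite lerDl expR_ge0.
  have zn : 0 <= - z by rewrite oppr_ge0; exact: ltW.
  by rewrite (max_l zn) sqrrN lerDr expR_ge0.
suff h : expR (g * (x ^+ 2 + y ^+ 2)) <= expR (2 * g * x ^+ 2) + expR (2 * g * y ^+ 2).
  by apply: (le_trans h); apply: lerD; exact: one.
have [xy|yx] := leP (x ^+ 2) (y ^+ 2).
  apply: (@le_trans _ _ (expR (2 * g * y ^+ 2))); last by rewrite lerDr expR_ge0.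
  by rewrite ler_expR; have := ler_wpM2l g0 xy; lra.
apply: (@le_trans _ _ (expR (2 * g * x ^+ 2))); last by rewrite lerDl expR_ge0.
by rewrite ler_expR; have := ler_wpM2l g0 (ltW yx); lra.
Qed.

End SlabFacts.

(** * The calibration: vorticity equation, vanishing of the first component, one-dimensional
    profile *)

Section Core.
Context {R : realType}.
Implicit Types (b t r s e : R).
Local Notation leb := (@lebesgue_measure R).
Local Notation nu := (@nu R).
Local Notation M := (@M R).
Variables (U1 U2 G11 G12 G21 G22 w w1 w2 al Phi1 Phi2 : R * R -> R) (a um up Cg gam : R).
Hypotheses (WU1 : W12 U1 G11 G12) (WU2 : W12 U2 G21 G22).
Hypotheses (L11 : L1 M (fun x => G11 x ^+ 2)) (L12 : L1 M (fun x => G12 x ^+ 2))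
  (L21 : L1 M (fun x => G21 x ^+ 2)) (L22 : L1 M (fun x => G22 x ^+ 2)).
Hypothesis div0 : {ae M, forall x, G11 x + G22 x = 0}.
Hypotheses (Cw : C1 w w1 w2) (Ca : C1 al (fun p => - w2 p) w1) (CP1 : C1 Phi1 al w)
  (CP2 : C1 Phi2 (fun p => - w p) al).
Hypothesis Lw : L1 M (fun x => w (U1 x, U2 x) ^+ 2).
Hypothesis lim_p : forall e, 0 < e -> exists T, {ae leb, forall t, T < t ->
  `|Int nu (fun s => U1 (t, s)) - a| < e /\ `|Int nu (fun s => U2 (t, s)) - up| < e}.
Hypothesis lim_m : forall e, 0 < e -> exists T, {ae leb, forall t, t < T ->
  `|Int nu (fun s => U1 (t, s)) - a| < e /\ `|Int nu (fun s => U2 (t, s)) - um| < e}.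
Hypotheses (Cg0 : 0 <= Cg) (gam0 : 0 <= gam).
Hypothesis grow : {ae M, forall x, [/\
  `|al (U1 x, U2 x)| <= Cg * expR (gam * (U1 x ^+ 2 + U2 x ^+ 2)),
  `|w1 (U1 x, U2 x)| <= Cg * expR (gam * (U1 x ^+ 2 + U2 x ^+ 2)) &
  `|w2 (U1 x, U2 x)| <= Cg * expR (gam * (U1 x ^+ 2 + U2 x ^+ 2))]}.
(** The only trace of minimality in this part: the energy, with the potential lowered to w^2/2, is
    at most the flux c. *)
Hypothesis en : Int M (fun x => (G11 x ^+ 2 + G12 x ^+ 2 + G21 x ^+ 2 + G22 x ^+ 2) / 2
  + w (U1 x, U2 x) ^+ 2 / 2) <= Phi1 (a, up) - Phi1 (a, um).

Let mU1 : measurable_fun setT U1. Proof. by have [] := W12_mf WU1. Qed.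
Let mU2 : measurable_fun setT U2. Proof. by have [] := W12_mf WU2. Qed.
Let m11 : measurable_fun setT G11. Proof. by have [] := W12_mf WU1. Qed.
Let m12 : measurable_fun setT G12. Proof. by have [] := W12_mf WU1. Qed.
Let m21 : measurable_fun setT G21. Proof. by have [] := W12_mf WU2. Qed.
Let m22 : measurable_fun setT G22. Proof. by have [] := W12_mf WU2. Qed.
Let mF (F : R * R -> R) : continuous F -> measurable_fun setT (fun x => F (U1 x, U2 x)).
Proof. by move=> cF; exact: measurable_comp2. Qed.

Definition qG t := Int nu (fun s => G12 (t, s) ^+ 2) + Int nu (fun s => G22 (t, s) ^+ 2).

Lemma L1_qG : L1 leb qG.
Proof. by have [_ h1 _] := fub1 L12; have [_ h2 _] := fub1 L22; exact: L1D. Qed.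

Definition gs e l t := {ae nu, forall s, `|U1 (t, s) - a| < e /\ `|U2 (t, s) - l| < e}.

Let good_aux e l t : 0 < e -> qG t < (e / 2) ^+ 2 ->
  `|Int nu (fun s => U1 (t, s)) - a| < e / 2 /\ `|Int nu (fun s => U2 (t, s)) - l| < e / 2 ->
  [/\ Int nu (fun s => `|G12 (t, s)|) ^+ 2 <= Int nu (fun s => G12 (t, s) ^+ 2),
    {ae nu, forall s, `|U1 (t, s) - Int nu (fun s => U1 (t, s))| <= Int nu (fun s => `|G12 (t, s)|)},
    Int nu (fun s => `|G22 (t, s)|) ^+ 2 <= Int nu (fun s => G22 (t, s) ^+ 2) &
    {ae nu, forall s, `|U2 (t, s) - Int nu (fun s => U2 (t, s))| <= Int nu (fun s => `|G22 (t, s)|)}] ->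
  gs e l t.
Proof.
move=> e0 qe [n1 n2] [h1 o1 h2 o2]; apply: filterS2 o1 o2 => s k1 k2.
have i1 : 0 <= Int nu (fun s => G12 (t, s) ^+ 2) by apply: Int_ge0 => z; exact: sqr_ge0.
have i2 : 0 <= Int nu (fun s => G22 (t, s) ^+ 2) by apply: Int_ge0 => z; exact: sqr_ge0.
have j1 : 0 <= Int nu (fun s => `|G12 (t, s)|) by apply: Int_ge0.
have j2 : 0 <= Int nu (fun s => `|G22 (t, s)|) by apply: Int_ge0.
have key (B I : R) : 0 <= B -> B ^+ 2 <= I -> I <= qG t -> B < e / 2.
  move=> B0 BI Iq; have h : B ^+ 2 < (e / 2) ^+ 2 by apply: (le_lt_trans BI); exact: le_lt_trans qe.
  have e20 : 0 <= e / 2 by apply: divr_ge0 => //; exact: ltW.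
  by move: h; rewrite ltr_pXn2r ?nnegrE.
have l1 := key _ _ j1 h1; have l2 := key _ _ j2 h2.
have {l1} l1 : Int nu (fun s => `|G12 (t, s)|) < e / 2 by apply: l1; rewrite /qG lerDl.
have {l2} l2 : Int nu (fun s => `|G22 (t, s)|) < e / 2 by apply: l2; rewrite /qG lerDr.
split.
- rewrite -(subrK (Int nu (fun s => U1 (t, s))) (U1 (t, s))) -addrA.
  apply: (le_lt_trans (ler_normD _ _)); rewrite [e]splitr; apply: ltrD => //; exact: le_lt_trans l1.
- rewrite -(subrK (Int nu (fun s => U2 (t, s))) (U2 (t, s))) -addrA.
  apply: (le_lt_trans (ler_normD _ _)); rewrite [e]splitr; apply: ltrD => //; exact: le_lt_trans l2.
Qed.

Let osc_ae : {ae leb, forall t,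
  [/\ Int nu (fun s => `|G12 (t, s)|) ^+ 2 <= Int nu (fun s => G12 (t, s) ^+ 2),
    {ae nu, forall s, `|U1 (t, s) - Int nu (fun s => U1 (t, s))| <= Int nu (fun s => `|G12 (t, s)|)},
    Int nu (fun s => `|G22 (t, s)|) ^+ 2 <= Int nu (fun s => G22 (t, s) ^+ 2) &
    {ae nu, forall s, `|U2 (t, s) - Int nu (fun s => U2 (t, s))| <= Int nu (fun s => `|G22 (t, s)|)}]}.
Proof.
have [_ D1] := WU1; have [_ D2] := WU2.
by apply: filterS2 (D2_osc2 D1 mU1 L12) (D2_osc2 D2 mU2 L22) => t [_ _ ? ?] [_ _ ? ?].
Qed.

(** The vertical energy [qG] is integrable, hence small on some slices arbitrarily far out; there
    the slice is uniformly close to its mean, which is close to the limit. *)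
Lemma good_p e T : 0 < e -> exists2 t, T < t & gs e up t.
Proof.
move=> e0; have e20 : 0 < e / 2 by rewrite divr_gt0.
have [T' HT'] := lim_p e20.
have H : {ae leb, forall t, T' < t -> gs e up t \/ (e / 2) ^+ 2 <= qG t}.
  apply: filterS2 HT' osc_ae => t ht ot T't.
  have [h|h] := ltP (qG t) ((e / 2) ^+ 2); [left|by right].
  by apply: (good_aux e0 h (ht T't) ot).
have [[t [t1 t2 t3]] _] := L1_small (Num.max T T') L1_qG (exprn_gt0 2 e20) H.
move: t1; rewrite gt_max => /andP[t1 t1']; exists t => //.
by case: (t2 t1') => // h; move: (le_lt_trans h t3); rewrite ltxx.
Qed.

Lemma good_m e T : 0 < e -> exists2 t, t < T & gs e um t.
Proof.
move=> e0; have e20 : 0 < e / 2 by rewrite divr_gt0.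
have [T' HT'] := lim_m e20.
have H : {ae leb, forall t, t < T' -> gs e um t \/ (e / 2) ^+ 2 <= qG t}.
  apply: filterS2 HT' osc_ae => t ht ot T't.
  have [h|h] := ltP (qG t) ((e / 2) ^+ 2); [left|by right].
  by apply: (good_aux e0 h (ht T't) ot).
have [_ [t [t1 t2 t3]]] := L1_small (Num.min T T') L1_qG (exprn_gt0 2 e20) H.
move: t1; rewrite lt_min => /andP[t1 t1']; exists t => //.
by case: (t2 t1') => // h; move: (le_lt_trans h t3); rewrite ltxx.
Qed.

Let EU (g : R) x := expR (g * (U1 x ^+ 2 + U2 x ^+ 2)).

(** [moser_trudinger] needs a slice on which the function is bounded: a good slice to the left of
    the slab serves, with bound [s0]. It is applied to both components with both signs. *)
Lemma expU (g b : R) : 0 <= g -> 0 <= b -> L1 M (slab (- b) b (EU g)).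
Proof.
move=> g0 b0; have [a' ab' ga'] := good_m (- b) (@ltr01 R).
have ab : a' <= b by apply/ltW/(lt_le_trans ab'); lra.
pose s0 := `|a| + `|um| + 1.
have g2 : 0 <= 2 * g by rewrite mulr_ge0.
have neg (v v1 v2 : R * R -> R) : W12 v v1 v2 -> W12 (fun x => - v x) (fun x => - v1 x) (fun x => - v2 x).
  move=> W; have := W12_lin (-1) 0 W (W12_cst 0); congr (W12 _ _ _); apply/funext => x; ring.
have MT (v v1 v2 : R * R -> R) : W12 v v1 v2 -> L1 M (fun x => v1 x ^+ 2) -> L1 M (fun x => v2 x ^+ 2) ->
    {ae nu, forall s, `|v (a', s)| <= s0} ->
    L1 M (slab a' b (fun x => expR (2 * g * Num.max (v x) 0 ^+ 2) + expR (2 * g * Num.max (- v x) 0 ^+ 2))).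
  move=> W Lv1 Lv2 va.
  have h1 := @moser_trudinger _ a' b s0 v v1 v2 ab W _ (L1_slab a' b Lv1) (L1_slab a' b Lv2) _ g2.
  have h2 := @moser_trudinger _ a' b s0 _ _ _ ab (neg _ _ _ W) _ _ _ _ g2.
  have {}h1 : L1 M (slab a' b (fun x => expR (2 * g * Num.max (v x) 0 ^+ 2))).
    by apply: h1; apply: filterS va => s; exact: le_trans (ler_norm _).
  have {}h2 : L1 M (slab a' b (fun x => expR (2 * g * Num.max (- v x) 0 ^+ 2))).
    apply: h2.
    - by apply: filterS va => s; apply: le_trans; rewrite -normrN; exact: ler_norm.
    - by have := L1_slab a' b Lv1; congr L1; apply/funext => x; rewrite /slab sqrrN.
    - by have := L1_slab a' b Lv2; congr L1; apply/funext => x; rewrite /slab sqrrN.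
  by have := L1D h1 h2; congr L1; apply/funext => x; rewrite /slab mulrDr.
have M1 := MT _ _ _ WU1 L11 L12 _; have M2 := MT _ _ _ WU2 L21 L22 _.
have {}M1 := M1 _; have b1 : {ae nu, forall s, `|U1 (a', s)| <= s0}.
  apply: filterS ga' => s [h _]; rewrite -(subrK a (U1 (a', s))).
  apply: (le_trans (ler_normD _ _)); rewrite /s0; have := normr_ge0 um; move: h; lra.
have b2 : {ae nu, forall s, `|U2 (a', s)| <= s0}.
  apply: filterS ga' => s [_ h]; rewrite -(subrK um (U2 (a', s))).
  apply: (le_trans (ler_normD _ _)); rewrite /s0; have := normr_ge0 a; move: h; lra.
have LS := L1D (MT _ _ _ WU1 L11 L12 b1) (MT _ _ _ WU2 L21 L22 b2).
apply: (@L1_domT _ _ _ M _ _ _ LS).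
  apply: mf_slab; apply: measurableT_comp; first exact: measurable_expR.
  apply: measurable_funM; first exact: measurable_cst.
  by apply: measurable_funD; [exact: (measurable_funX 2 mU1)|exact: (measurable_funX 2 mU2)].
move=> x; rewrite ger0_norm; last by rewrite /slab mulr_ge0 ?ind_ge0 ?expR_ge0.
rewrite /slab !indE -mulrDr; case: ifPn => [/andP[h1 h2]|_]; last first.
  rewrite mul0r; apply: mulr_ge0; first by case: ifP.
  by apply: addr_ge0; apply: addr_ge0; exact: expR_ge0.
rewrite ifT ?mul1r; first exact: expR_split.
by rewrite h2 andbT (le_trans (ltW ab')).
Qed.

Lemma dom_exp (f : R * R -> R) (k g : R) al' be' : measurable_fun setT f -> 0 <= g ->
  {ae M, forall x, `|f x| <= k * EU g x} -> L1 M (slab al' be' f).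
Proof.
move=> mf g0 fk; apply: slab_sub => b b0; have L := L1Z k (expU g0 b0).
apply: (@L1_dom _ _ _ M _ _ (mf_slab _ _ mf) L).
apply: filterS fk => x h; rewrite /slab normrM (ger0_norm (ind_ge0 _ _ _)) mulrCA.
by rewrite ler_wpM2l ?ind_ge0.
Qed.

Lemma L1_slabU al' be' : L1 M (slab al' be' (fun x => U1 x ^+ 2)) /\ L1 M (slab al' be' (fun x => U2 x ^+ 2)).
Proof.
have h x : U1 x ^+ 2 <= EU 1 x /\ U2 x ^+ 2 <= EU 1 x.
  have := expR_ge1Dx (1 * (U1 x ^+ 2 + U2 x ^+ 2)); have := sqr_ge0 (U1 x); have := sqr_ge0 (U2 x).
  by rewrite /EU; lra.
split; apply: (@dom_exp _ 1 1) => //; first [exact: (measurable_funX 2 mU1)|exact: (measurable_funX 2 mU2)|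
  by apply: aeW => x; rewrite mul1r ger0_norm ?sqr_ge0; have [] := h x].
Qed.

Lemma L1_slab_al al' be' : L1 M (slab al' be' (fun x => al (U1 x, U2 x) ^+ 2)).
Proof.
apply: (@dom_exp _ (Cg ^+ 2) (gam + gam)); first exact: (measurable_funX 2 (mF (C1_continuous Ca))).
  by rewrite addr_ge0.
apply: filterS grow => x [h _ _]; rewrite normrX /EU mulrDl expRD.
rewrite -expr2 -exprMn; apply: lerXn2r => //; rewrite nnegrE//.
by rewrite mulr_ge0 ?expR_ge0.
Qed.

Lemma L1_slab_dw al' be' :
  L1 M (slab al' be' (fun x => (w1 (U1 x, U2 x) ^+ 2 + w2 (U1 x, U2 x) ^+ 2) ^+ 2)).
Proof.
have [cw1 cw2 _ _] := Cw.
(* |grad w|^2 carries two exponential factors and is squared, hence the exponent 4 gam. *)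
apply: (@dom_exp _ (2 * Cg ^+ 2 * (2 * Cg ^+ 2)) ((gam + gam) + (gam + gam))).
- have h : measurable_fun setT (fun x => w1 (U1 x, U2 x) ^+ 2 + w2 (U1 x, U2 x) ^+ 2).
    by apply: measurable_funD; [exact: (measurable_funX 2 (mF cw1))|exact: (measurable_funX 2 (mF cw2))].
  exact: (measurable_funX 2 h).
- by rewrite !addr_ge0.
apply: filterS grow => x [_ h1 h2].
have sq (z : R) : `|z| <= Cg * EU gam x -> z ^+ 2 <= Cg ^+ 2 * EU (gam + gam) x.
  move=> h; rewrite /EU mulrDl expRD -expr2 -exprMn -[z ^+ 2]real_normK ?num_real//.
  by apply: lerXn2r => //; rewrite nnegrE// mulr_ge0 ?expR_ge0.
have s1 := sq _ h1; have s2 := sq _ h2.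
have p0 : 0 <= w1 (U1 x, U2 x) ^+ 2 + w2 (U1 x, U2 x) ^+ 2 by rewrite addr_ge0 ?sqr_ge0.
rewrite normrX ger0_norm//.
have -> : 2 * Cg ^+ 2 * (2 * Cg ^+ 2) * EU (gam + gam + (gam + gam)) x = (2 * Cg ^+ 2 * EU (gam + gam) x) ^+ 2.
  have E : EU (gam + gam + (gam + gam)) x = EU (gam + gam) x * EU (gam + gam) x.
    by rewrite /EU [in LHS]mulrDl expRD.
  by rewrite E; ring.
have le : w1 (U1 x, U2 x) ^+ 2 + w2 (U1 x, U2 x) ^+ 2 <= 2 * Cg ^+ 2 * EU (gam + gam) x by lra.
by rewrite lerXn2r ?nnegrE// (le_trans p0).
Qed.

Let LG11G22 : L1 M (fun x => G11 x * G22 x) := @L1_sqM _ _ _ M _ _ m11 m22 L11 L22.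
Let LG12G21 : L1 M (fun x => G12 x * G21 x) := @L1_sqM _ _ _ M _ _ m12 m21 L12 L21.
Let det x := G11 x * G22 x - G12 x * G21 x.
Let L1_det : L1 M det := L1B LG11G22 LG12G21.

Let mtrap n : measurable_fun setT (fun x : R * R => trap n x.1) /\
  measurable_fun setT (fun x : R * R => trap' n x.1).
Proof.
have [l _] := trap_ac n; split; last exact: (measurableT_comp (li_mf l) measurable_fst).
apply: (measurableT_comp _ measurable_fst); apply: continuous_measurable_fun.
exact: (ac_continuous (trap_ac n)).
Qed.

(** [jacobian_swap] for the cut function trap U1: the Jacobian of U, weighted by the cutoff, is left
    with the term in which the cutoff is differentiated. *)
Let trap_jac (n : nat) : L1 M (fun x => trap' n%:R x.1 * (U1 x * G22 x)) /\
  Int M (fun x => trap n%:R x.1 * det x) = - Int M (fun x => trap' n%:R x.1 * (U1 x * G22 x)).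
Proof.
have n0 : 0 <= n%:R :> R by [].
have T x := trapP x n0; have [mt mt'] := mtrap n%:R.
have Wp := W12_mul (W12_t (trap_ac n%:R)) WU1.
set p1 := (fun x => trap' _ _ * _ + _) in Wp; set p2 := (fun x => 0 * _ + _) in Wp.
have [mp mp1 mp2] := W12_mf Wp.
have [LU1 _] := L1_slabU (- (n%:R + 1)) (n%:R + 1).
have out (x : R * R) : (- (n%:R + 1) <= x.1 <= n%:R + 1) = false -> trap n%:R x.1 = 0 /\ trap' n%:R x.1 = 0.
  by rewrite -ler_norml => /negbT; rewrite -ltNge => h; have [_ _ k _ _] := T x.1; exact: k.
have Lp : L1 M (fun x => (trap n%:R x.1 * U1 x) ^+ 2).
  apply: (@L1_domT _ _ _ M _ _ (measurable_funX 2 mp) LU1) => x.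
  rewrite ger0_norm ?sqr_ge0// /slab indE; case: ifPn => [_|/negbTE/out[-> _]]; last by rewrite !mul0r expr0n.
  have [/andP[k1 k2] _ _ _ _] := T x.1; rewrite mul1r exprMn ler_piMl ?sqr_ge0//.
  by rewrite expr_le1.
have Lp1 : L1 M (fun x => p1 x ^+ 2).
  apply: (@L1_domT _ _ _ M _ _ (measurable_funX 2 mp1) (L1D (L1Z 2 LU1) (L1Z 2 L11))) => x.
  have [/andP[k1 k2] _ _ _ k3] := T x.1.
  rewrite ger0_norm ?sqr_ge0// /slab indE /p1; case: ifPn => [_|/negbTE/out[-> ->]]; last first.
    by rewrite !mul0r addr0 expr0n !mulr0 add0r mulr_ge0 ?sqr_ge0.
  rewrite mul1r.
  have s1 : (trap' n%:R x.1 * U1 x) ^+ 2 <= U1 x ^+ 2.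
    rewrite exprMn ler_piMl ?sqr_ge0// -real_normK ?num_real//.
    by rewrite expr_le1.
  have s2 : (trap n%:R x.1 * G11 x) ^+ 2 <= G11 x ^+ 2.
    by rewrite exprMn ler_piMl ?sqr_ge0// expr_le1.
  by move: s1 s2; set y := _ * U1 x; set z := _ * G11 x => s1 s2; have := sqr_ge0 (y - z); lra.
have Lp2 : L1 M (fun x => p2 x ^+ 2).
  apply: (@L1_domT _ _ _ M _ _ (measurable_funX 2 mp2) L12) => x.
  have [/andP[k1 k2] _ _ _ k3] := T x.1.
  rewrite ger0_norm ?sqr_ge0// /p2 mul0r add0r exprMn ler_piMl ?sqr_ge0//.
  by rewrite expr_le1.
have n1 : 0 <= n%:R + 1 :> R by rewrite addr_ge0.
have sp (x : R * R) : n%:R + 1 < `|x.1| -> [/\ trap n%:R x.1 * U1 x = 0, p1 x = 0 & p2 x = 0].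
  move=> h; have [_ _ k _ _] := T x.1; have [k1 k2] := k h.
  by rewrite /p1 /p2 k1 k2 !mul0r !addr0.
have Lq b : [/\ L1 M (fun x => ind (- b) b x.1 * U2 x ^+ 2),
    L1 M (fun x => ind (- b) b x.1 * G21 x ^+ 2) & L1 M (fun x => ind (- b) b x.1 * G22 x ^+ 2)].
  by split; [exact: (L1_slabU (- b) b).2|exact: (L1_slab (- b) b L21)|exact: (L1_slab (- b) b L22)].
have [LJ1 LJ2 J] := jacobian_swap n1 Wp WU2 Lp Lp1 Lp2 sp Lq.
have bt (x : R) : `|trap n%:R x| <= 1 by have [/andP[k1 k2] _ _ _ _] := T x; rewrite ger0_norm.
have LTd : L1 M (fun x => trap n%:R x.1 * det x).
  exact: (@L1_bM _ _ _ M 1 (fun x => trap n%:R x.1) det mt (fun x => bt x.1) L1_det).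
have LT : L1 M (fun x => trap' n%:R x.1 * (U1 x * G22 x)).
  have := L1B LJ1 (@L1_bM _ _ _ M 1 (fun x => trap n%:R x.1) _ mt (fun x => bt x.1) LG11G22).
  by congr L1; apply/funext => x; rewrite /p1; ring.
split => //; apply/eqP; rewrite -addr_eq0 -(IntD LTd LT); apply/eqP.
transitivity (Int M (fun x => p1 x * G22 x - p2 x * G21 x)).
  by congr Int; apply/funext => x; rewrite /p1 /p2 /det; ring.
by rewrite (IntB LJ1 LJ2) J subrr.
Qed.

(** G22 has mean zero on almost every slice, so U1 may be replaced by its deviation from the slice
    mean, which is at most the integral of |G12|. This turns a flux involving U1 itself into one
    bounded by the integrable [qG]. *)
Let flux_t : {ae leb, forall t, L1 nu (fun s => U1 (t, s) * G22 (t, s)) /\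
  `|Int nu (fun s => U1 (t, s) * G22 (t, s))| <= qG t}.
Proof.
have [_ D1] := WU1; have [_ DD2] := WU2.
apply: filterS3 (D2_osc2 D1 mU1 L12) (D2_osc2 DD2 mU2 L22) (D2_slice0 DD2) => t [l1 l2 l3 o] [k1 k2 k3 _] [z1 z2].
set m := Int nu (fun s => U1 (t, s)) in o.
set B := Int nu (fun s => `|G12 (t, s)|) in l3 o.
have mUt := mf_pairr t mU1; have mGt := mf_pairr t m22.
have LB : L1 nu (fun s => B * `|G22 (t, s)|) by exact: (L1Z B (L1_norm z1)).
have md : measurable_fun setT (fun s => (U1 (t, s) - m) * G22 (t, s)).
  by apply: measurable_funM => //; apply: measurable_funB => //; exact: measurable_cst.
have bd : {ae nu, forall s, `|(U1 (t, s) - m) * G22 (t, s)| <= B * `|G22 (t, s)|}.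
  by apply: filterS o => s h; rewrite normrM; apply: ler_wpM2r.
have Ld : L1 nu (fun s => (U1 (t, s) - m) * G22 (t, s)).
  by apply: (@L1_dom _ _ _ nu _ _ md LB); exact: bd.
have -> : (fun s => U1 (t, s) * G22 (t, s)) = (fun s => (U1 (t, s) - m) * G22 (t, s) + m * G22 (t, s)).
  by apply/funext => s; ring.
split; first exact: (L1D Ld (L1Z m z1)).
rewrite (IntD Ld (L1Z m z1)) (IntZ m z1) z2 mulr0 addr0.
apply: (le_trans (Int_norm Ld)); apply: (le_trans (Int_le (L1_norm Ld) LB bd)).
rewrite (IntZ B (L1_norm z1)) /qG.
have B0 : 0 <= B by apply: Int_ge0.
move: l3 k3; set B' := Int nu (fun s => `|G22 (t, s)|); set I1 := Int _ _; set I2 := Int _ _ => l3 k3.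
apply: (@le_trans _ _ (B ^+ 2 + B' ^+ 2)); last exact: lerD.
exact: mul_le_sqD.
Qed.

(** As the cutoffs widen, the flux where they vary tends to 0: at each t it is eventually zero, and
    [flux_t] dominates it. *)
Lemma Int_det : Int M (fun x => G11 x * G22 x - G12 x * G21 x) = 0.
Proof.
have c1 : Int M (fun x => trap n%:R x.1 * det x) @[n --> \oo] --> Int M det.
  have [] // := @DCT _ _ _ M (fun (n : nat) x => trap n%:R x.1 * det x) det (fun x => `|det x|).
  - by move=> n; apply: measurable_funM; [exact: (mtrap n%:R).1|exact: (L1_mf L1_det)].
  - exact: (L1_mf L1_det).
  - exact: L1_norm.
  - apply: aeW => x; apply: cvg_near_cst; have := nbhs_infty_ger (`|x.1|); apply: filterS => n h.
    have [_ k _ _ _] := trapP x.1 (ler0n R n); by rewrite k// mul1r.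
  apply: aeW => x n; rewrite normrM; have [/andP[k1 k2] _ _ _ _] := trapP x.1 (ler0n R n).
  by rewrite (ger0_norm k1); apply: ler_piMl.
have c2 : Int M (fun x => trap' n%:R x.1 * (U1 x * G22 x)) @[n --> \oo] --> (0 : R).
  have E n : Int M (fun x => trap' n%:R x.1 * (U1 x * G22 x)) =
     Int leb (fun t => Int nu (fun s => trap' n%:R t * (U1 (t, s) * G22 (t, s)))).
    by have [_ _ ->] := fub1 (trap_jac n).1.
  have mLn n : measurable_fun setT (fun t => Int nu (fun s => trap' n%:R t * (U1 (t, s) * G22 (t, s)))).
    by have [_ l _] := fub1 (trap_jac n).1; exact: (L1_mf l).
  have mc0 : measurable_fun [set: R] (fun=> 0 : R) by exact: measurable_cst.
  have a1 : {ae leb, forall t, Int nu (fun s => trap' n%:R t * (U1 (t, s) * G22 (t, s))) @[n --> \oo] --> (0 : R)}.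
    apply: aeW => t; apply: cvg_near_cst; have := nbhs_infty_gtr (`|t|); apply: filterS => n h.
    have [_ _ _ k _] := trapP t (ler0n R n); rewrite k//.
    by rewrite (_ : (fun s => _) = fun=> 0) ?Int0//; apply/funext => s; rewrite mul0r.
  have a2 : {ae leb, forall t (n : nat), `|Int nu (fun s => trap' n%:R t * (U1 (t, s) * G22 (t, s)))| <= qG t}.
    apply: filterS flux_t => t [L h] n; rewrite (IntZ _ L) normrM.
    have [_ _ _ _ k] := trapP t (ler0n R n).
    apply: (le_trans _ h); exact: ler_piMl.
  have [_] := @DCT _ _ _ leb (fun (n : nat) t => Int nu (fun s => trap' n%:R t * (U1 (t, s) * G22 (t, s))))
     (fun=> 0) qG mLn mc0 L1_qG a1 a2.
  rewrite Int0 => c; apply: cvg_trans c; apply: near_eq_cvg; apply: nearW => n; by rewrite E.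
have c3 : (- Int M (fun x => trap' n%:R x.1 * (U1 x * G22 x))) @[n --> \oo] --> (- 0 : R) by exact: (cvgN c2).
rewrite oppr0 in c3.
apply/esym/(@cvg_unique _ (@Rhausdorff R) (Int M (fun x => trap n%:R x.1 * det x) @[n --> \oo])) => //.
apply: cvg_trans c3; apply: near_eq_cvg; apply: nearW => n; by rewrite (trap_jac n).2.
Qed.

Let om x := G21 x - G12 x.
Let wU x := w (U1 x, U2 x).
Let mom : measurable_fun setT om. Proof. exact: measurable_funB. Qed.
Let cw : continuous w. Proof. exact: (C1_continuous Cw). Qed.
Let mwU : measurable_fun setT wU. Proof. exact: mF. Qed.

Let L1_om2 : L1 M (fun x => om x ^+ 2).
Proof.
apply: (@L1_sqD _ _ _ M G21 (fun x => - G12 x)) => //; first exact: measurableT_comp.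
by move: L12; congr L1; apply/funext => x; rewrite sqrrN.
Qed.

Let L1_wom : L1 M (fun x => wU x * om x) := @L1_sqM _ _ _ M _ _ mwU mom Lw L1_om2.

(** The divergence identity of [harmonic_conj] on a slab: div u = 0 removes the terms in [al],
    periodicity removes the x_2-part, and the two end slices remain. *)
Let flux al' be' : al' <= be' ->
  L1 nu (fun s => Phi1 (U1 (be', s), U2 (be', s)) - Phi1 (U1 (al', s), U2 (al', s))) /\
  Int nu (fun s => Phi1 (U1 (be', s), U2 (be', s)) - Phi1 (U1 (al', s), U2 (al', s)))
   = Int M (slab al' be' (fun x => wU x * om x)).
Proof.
move=> ab; have [A1 DD1] := WU1; have [A2 DD2] := WU2.
have ca := C1_continuous Ca.
pose alU x := al (U1 x, U2 x).
have malU : measurable_fun setT alU by exact: mF.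
have Lal := L1_slab_al al' be'.
have LalU (g : R * R -> R) : measurable_fun setT g -> L1 M (fun x => g x ^+ 2) -> L1 M (slab al' be' (fun x => alU x * g x)).
  move=> mg Lg; have L : L1 M (fun x => slab al' be' alU x ^+ 2) by rewrite slab_sq.
  have := @L1_sqM _ _ _ M _ _ (mf_slab al' be' malU) mg L Lg.
  by congr L1; apply/funext => x; rewrite /slab mulrA.
have LwU (g : R * R -> R) : measurable_fun setT g -> L1 M (fun x => g x ^+ 2) -> L1 M (slab al' be' (fun x => wU x * g x)).
  by move=> mg Lg; apply: L1_slab; exact: (@L1_sqM _ _ _ M _ _ mwU mg Lw Lg).
have la1 := LalU _ m11 L11; have la2 := LalU _ m22 L22; have lw1 := LwU _ m21 L21; have lw2 := LwU _ m12 L12.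
have Lg1 : L1 M (fun x => ind al' be' x.1 * (alU x * G11 x + wU x * G21 x)).
  by have := L1D la1 lw1; congr L1; apply/funext => x; rewrite /slab mulrDr.
have [Lnu E1] := AC1_ibp (AC1_chain CP1 A1 A2) ab Lg1.
have Lg2 : L1 M (slab al' be' (fun x => - wU x * G12 x + alU x * G22 x)).
  by have := L1B la2 lw2; congr L1; apply/funext => x; rewrite /slab; ring.
have E2 := D2_ibp (D2_slab al' be' (D2_chain mU1 mU2 CP2 DD1 DD2)) Lg2.
split; first exact: Lnu.
rewrite E1 -[LHS]addr0 -E2 -(IntD Lg1 Lg2); apply: Int_ae.
- by have := L1D Lg1 Lg2; exact: L1_mf.
- by apply: mf_slab; exact: (L1_mf L1_wom).
apply: filterS div0 => x d; rewrite /slab /om -/(wU x) -/(alU x).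
have -> : G22 x = - G11 x by rewrite -[RHS]addr0 -d; ring.
ring.
Qed.

(** Continuity of [Phi1] at the two ends of the segment, as U is uniformly close to these ends on
    good slices. *)
Let flux_lim e : 0 < e -> exists2 d, 0 < d & forall t t', gs d um t -> gs d up t' -> t <= t' ->
  `|Int M (slab t t' (fun x => wU x * om x)) - (Phi1 (a, up) - Phi1 (a, um))| <= e.
Proof.
move=> e0; have cP := C1_continuous CP1.
have e20 : 0 < e / 2 by rewrite divr_gt0.
have near l : exists2 d, 0 < d & forall x y, `|x - a| < d -> `|y - l| < d -> `|Phi1 (x, y) - Phi1 (a, l)| < e / 2.
  have /cvgrPdist_lt/(_ _ e20)/nbhs_ballP[d /= d0 Hd] := cP (a, l).
  exists d => // x y hx hy; rewrite distrC; apply: Hd; split; by rewrite /ball/= distrC.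
have [d1 d10 H1] := near up; have [d2 d20 H2] := near um.
exists (Num.min d1 d2) => [|t t' gt gt' tt]; first by rewrite lt_min d10.
have [L <-] := flux tt; have [Lc Ic] := @Int_nu_cst R (Phi1 (a, up) - Phi1 (a, um)).
rewrite -Ic -(IntB L Lc); have Ld := L1B L Lc.
have [Le Ie] := @Int_nu_cst R e; rewrite -Ie.
apply: (le_trans (Int_norm Ld)); apply: (Int_le (L1_norm Ld) Le).
apply: filterS2 gt gt' => s; rewrite !lt_min => -[/andP[_ h1] /andP[_ h2]] [/andP[k1 _] /andP[k2 _]].
have b1 := H1 _ _ k1 k2; have b2 := H2 _ _ h1 h2.
rewrite (_ : _ - (_ - _) = (Phi1 (U1 (t', s), U2 (t', s)) - Phi1 (a, up)) -
  (Phi1 (U1 (t, s), U2 (t, s)) - Phi1 (a, um))); last by ring.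
by rewrite [X in _ <= X]splitr; apply: (le_trans (ler_normB _ _)); apply: lerD; exact: ltW.
Qed.

(** Slabs bounded by ever better slices exhaust the cylinder, so the flux is known in the limit. *)
Lemma Int_wom : Int M (fun x => wU x * om x) = Phi1 (a, up) - Phi1 (a, um).
Proof.
set c := _ - _.
have H (n : nat) : exists tt : R * R, [/\ tt.1 < - n%:R, n%:R < tt.2 &
   `|Int M (slab tt.1 tt.2 (fun x => wU x * om x)) - c| <= n.+1%:R^-1].
  have n0 : 0 < (n.+1%:R^-1 : R) by rewrite invr_gt0.
  have [d d0 Hd] := flux_lim n0.
  have [t t1 gt] := good_m (- n%:R) d0; have [t' t1' gt'] := good_p n%:R d0.
  exists (t, t'); split => //; apply: Hd => //=.
  by apply: ltW; apply: (lt_trans t1); apply: le_lt_trans t1'; apply: (@le_trans _ _ 0); rewrite ?oppr_le0.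
have [T HT] := choice H.
have c1 : Int M (slab (T n).1 (T n).2 (fun x => wU x * om x)) @[n --> \oo] --> Int M (fun x => wU x * om x).
  have [] // := @DCT _ _ _ M (fun n => slab (T n).1 (T n).2 (fun x => wU x * om x)) _ (fun x => `|wU x * om x|)
    (fun n => mf_slab _ _ (L1_mf L1_wom)) (L1_mf L1_wom) (L1_norm L1_wom).
  - apply: aeW => x; apply: cvg_near_cst; have := nbhs_infty_ger (`|x.1|); apply: filterS => n.
    have [h1 h2 _] := HT n; rewrite ler_norml => /andP[h3 h4]; rewrite /slab indE ifT ?mul1r//.
    by rewrite (le_trans (ltW h1) h3) (le_trans h4 (ltW h2)).
  - by apply: aeW => x n; exact: slab_norm.
have c2 : Int M (slab (T n).1 (T n).2 (fun x => wU x * om x)) @[n --> \oo] --> c.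
  apply/cvgrPdist_le => e e0.
  have /cvgr0Pnorm_le/(_ _ e0) := @cvg_harmonic R; apply: filterS => n h.
  have [_ _ k] := HT n; rewrite distrC; apply: (le_trans k).
  by apply: le_trans h; exact: ler_norm.
exact: (@cvg_unique _ (@Rhausdorff R) (Int M (slab (T n).1 (T n).2 (fun x => wU x * om x)) @[n --> \oo])).
Qed.

(** A square is completed: where div u = 0, (omega - w)^2 equals twice the energy density plus 2(det
    - w omega). With [Int_det] and [Int_wom] its integral is twice energy minus c, hence at most
    0. *)
Lemma vorticity : {ae M, forall x, G21 x - G12 x = w (U1 x, U2 x)}.
Proof.
have LG := L1D (L1D (L1D L11 L12) L21) L22.
have LE : L1 M (fun x => (G11 x ^+ 2 + G12 x ^+ 2 + G21 x ^+ 2 + G22 x ^+ 2) / 2 + wU x ^+ 2 / 2).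
  by have := L1D (L1Z 2^-1 LG) (L1Z 2^-1 Lw); congr L1; apply/funext => x; rewrite /wU; ring.
have md : measurable_fun setT (fun x => om x - wU x) by exact: measurable_funB.
have Ld : L1 M (fun x => (om x - wU x) ^+ 2).
  apply: (@L1_sqD _ _ _ M om (fun x => - wU x)) => //; first exact: measurableT_comp.
  by move: Lw; congr L1; apply/funext => x; rewrite sqrrN.
have I : Int M (fun x => (om x - wU x) ^+ 2) <= 0.
  have -> : Int M (fun x => (om x - wU x) ^+ 2) = Int M (fun x => 2 * ((G11 x ^+ 2 + G12 x ^+ 2 + G21 x ^+ 2 + G22 x ^+ 2) / 2
      + wU x ^+ 2 / 2) + 2 * (det x - wU x * om x)).
    apply: Int_ae; first exact: (L1_mf Ld).
      exact: (L1_mf (L1D (L1Z 2 LE) (L1Z 2 (L1B L1_det L1_wom)))).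
    apply: filterS div0 => x d; have dE : G22 x = - G11 x by rewrite -[RHS]addr0 -d; ring.
    by rewrite /om /det dE; field.
  rewrite (IntD (L1Z 2 LE) (L1Z 2 (L1B L1_det L1_wom))) (IntZ 2 LE) (IntZ 2 (L1B L1_det L1_wom)).
  rewrite (IntB L1_det L1_wom) Int_det Int_wom sub0r mulrN subr_le0 ler_pM2l//.
have := Int_ge0_eq0 Ld (aeW _ (fun x => sqr_ge0 _)) I.
by apply: filterS => x /eqP; rewrite sqrf_eq0 subr_eq0 => /eqP.
Qed.

Section LevelSet.
Variables (sg k0 ta tb : R).
Hypotheses (sg1 : sg * sg = 1) (ga : gs k0 um ta) (tab : ta <= tb) (gb : gs k0 up tb).

Let v x := sg * U1 x + (- sg * a).
Let Wv : W12 v (fun x => sg * G11 x) (fun x => sg * G12 x).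
Proof.
have := W12_lin sg (- sg * a) WU1 (W12_cst 1); congr (W12 _ _ _); apply/funext => x; rewrite /v; ring.
Qed.
Let mv : measurable_fun setT v. Proof. by have [] := W12_mf Wv. Qed.
(** The gradient condition matters at the top: the set where [v] attains its supremum can have
    positive measure, but its gradient vanishes there, so [chi] tends to 0 even on it. *)
Let chi k x : R := if (k < v x) && ((G11 x != 0) || (G12 x != 0)) then 1 else 0.
Let h x := w1 (U1 x, U2 x) ^+ 2 + w2 (U1 x, U2 x) ^+ 2.
Let cw1 : continuous w1. Proof. by have [] := Cw. Qed.
Let cw2 : continuous w2. Proof. by have [] := Cw. Qed.
Let mh : measurable_fun setT h.
Proof. by apply: measurable_funD; [exact: (measurable_funX 2 (mF cw1))|exact: (measurable_funX 2 (mF cw2))]. Qed.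
Let mchi k : measurable_fun setT (chi k).
Proof.
apply: measurable_fun_ifT; [|exact: measurable_cst|exact: measurable_cst].
apply: measurable_and; first by apply: measurable_fun_ltr => //; exact: measurable_cst.
by apply: measurable_or; apply: measurable_neg; apply: measurable_fun_eqr => //; exact: measurable_cst.
Qed.
Let chi01 k x : chi k x = 1 \/ chi k x = 0.
Proof. by rewrite /chi; case: ifP; [left|right]. Qed.
Let Lh2 : L1 M (slab ta tb (fun x => h x ^+ 2)). Proof. exact: L1_slab_dw. Qed.
Let Lch2 k : L1 M (slab ta tb (fun x => (chi k x * h x) ^+ 2)).
Proof.
have mm : measurable_fun setT (slab ta tb (fun x => (chi k x * h x) ^+ 2)).
  apply: mf_slab; have m : measurable_fun setT (fun x => chi k x * h x) by exact: measurable_funM.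
  exact: (measurable_funX 2 m).
apply: (@L1_domT _ _ _ M _ _ mm Lh2) => x.
rewrite ger0_norm; last by apply: mulr_ge0; [exact: ind_ge0|exact: sqr_ge0].
rewrite /slab; apply: ler_wpM2l; first exact: ind_ge0.
by case: (chi01 k x) => ->; rewrite ?mul1r// mul0r expr0n sqr_ge0.
Qed.
Let P k := {ae M, forall x, ta <= x.1 <= tb -> v x <= k}.

Let level_key k : k0 <= k ->
  16 * (1 + (tb - ta)) ^+ 2 * (tb - ta) * Int M (slab ta tb (fun x => (chi k x * h x) ^+ 2)) < 1 -> P k.
Proof.
move=> kk small; have Wp := W12_gt k Wv.
set phi := (fun x => Num.max _ _) in Wp; set f1 := (fun x => if _ then sg * G11 x else _) in Wp.
set f2 := (fun x => if _ then sg * G12 x else _) in Wp.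
have [mp mf1 mf2] := W12_mf Wp.
have d0 : 0 <= tb - ta by rewrite subr_ge0.
have vb t s : `|U1 (t, s) - a| < k0 -> phi (t, s) = 0.
  move=> hu; rewrite /phi max_r// /v subr_le0; apply: (le_trans (ler_norm _)).
  have -> : sg * U1 (t, s) + - sg * a = sg * (U1 (t, s) - a) by ring.
  have sn : `|sg| = 1 by apply/eqP; rewrite -sqrp_eq1// real_normK ?num_real// expr2 sg1.
  by rewrite normrM sn mul1r (le_trans (ltW hu)).
have pa : {ae nu, forall s, phi (ta, s) = 0} by apply: filterS ga => s [hs _]; exact: vb.
have pb : {ae nu, forall s, phi (tb, s) = 0} by apply: filterS gb => s [hs _]; exact: vb.
(* Since k >= k0, phi vanishes on both end slices; cut to the slab it has the bounded support in x_1
   that [jacobian_swap] requires. *)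
have Wc := W12_cut tab Wp pa pb.
have sqf (f g : R * R -> R) : measurable_fun setT f -> (forall x, f x = sg * g x \/ f x = 0) ->
    L1 M (fun x => g x ^+ 2) -> L1 M (fun x => f x ^+ 2).
  move=> mf fg Lg; apply: (@L1_domT _ _ _ M _ _ (measurable_funX 2 mf) Lg) => x.
  rewrite ger0_norm ?sqr_ge0//; case: (fg x) => ->; last by rewrite expr0n sqr_ge0.
  by rewrite exprMn -[sg ^+ 2]/(sg * sg) sg1 mul1r.
have Lf1 : L1 M (fun x => f1 x ^+ 2).
  by apply: (sqf _ _ mf1 _ L11) => x; rewrite /f1; case: ifP; [left|right].
have Lf2 : L1 M (fun x => f2 x ^+ 2).
  by apply: (sqf _ _ mf2 _ L12) => x; rewrite /f2; case: ifP; [left|right].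
have Ls1 := L1_slab ta tb Lf1; have Ls2 := L1_slab ta tb Lf2.
have m1 : measurable_fun [set: R * R] (fun=> 1 : R) by exact: measurable_cst.
have [_ _ X1 cs1] := cs_slab tab m1 mf1 (fun _ => or_intror erefl) Ls1.
have [_ _ X2 cs2] := cs_slab tab m1 mf2 (fun _ => or_intror erefl) Ls2.
have E1 (f : R * R -> R) : (fun x => 1 * f x) = f by apply/funext => x; rewrite mul1r.
rewrite !E1 in X1 cs1; rewrite !E1 in X2 cs2.
have [_ Ic] := slab1_L1 tab; rewrite Ic in cs1 cs2.
have [Lphi gn1] := gagliardo_nirenberg tab Wp pa X1 X2.
(* Gagliardo-Nirenberg for phi, then Cauchy-Schwarz on the slab of measure tb - ta, bounds the
   integral of phi^2 by E. *)
have hF2 := gn_algebra d0 gn1 cs1 cs2.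
set E := Int M (slab ta tb _) + _ in hF2.
set F2 := Int M (fun x => slab ta tb phi x ^+ 2) in hF2.
(* The second use of Gagliardo-Nirenberg, for phi^2, bounds the integral of phi^4 by that of phi^2
   times E. *)
have Wpp := W12_mul Wp Wp.
have ppa : {ae nu, forall s, phi (ta, s) * phi (ta, s) = 0} by apply: filterS pa => s ->; rewrite mul0r.
have msl := mf_slab ta tb mp.
have dbl (f : R * R -> R) : measurable_fun setT f -> L1 M (slab ta tb (fun x => f x ^+ 2)) ->
    L1 M (slab ta tb (fun x => f x * phi x + phi x * f x)) /\
    Int M (fun x => `|slab ta tb (fun x => f x * phi x + phi x * f x) x|) ^+ 2 <=
      4 * F2 * Int M (slab ta tb (fun x => f x ^+ 2)).
  move=> mf Lf; have msf := mf_slab ta tb mf.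
  have Lf' : L1 M (fun x => slab ta tb f x ^+ 2) by rewrite slab_sq.
  have L := @L1_sqM _ _ _ M _ _ msl msf Lphi Lf'.
  have Eq : slab ta tb (fun x => f x * phi x + phi x * f x) = (fun x => 2 * (slab ta tb phi x * slab ta tb f x)).
    by apply/funext => x; rewrite /slab indE; case: ifP => _; ring.
  have sn (z : R * R -> R) : (fun x => `|z x| ^+ 2) = (fun x => z x ^+ 2).
    by apply/funext => x; rewrite real_normK ?num_real.
  split; first by rewrite Eq; exact: L1Z.
  have ma := measurableT_comp (@normr_measurable R setT) msl; have mb := measurableT_comp (@normr_measurable R setT) msf.
  have La : L1 M (fun x => `|slab ta tb phi x| ^+ 2) by rewrite sn.
  have Lb : L1 M (fun x => `|slab ta tb f x| ^+ 2) by rewrite sn.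
  have := @cauchy_schwarz _ _ _ M (fun x => `|slab ta tb phi x|) (fun x => `|slab ta tb f x|) ma mb La Lb.
  rewrite !sn -/F2 slab_sq.
  have -> : (fun x => `|slab ta tb (fun x => f x * phi x + phi x * f x) x|) =
     (fun x => 2 * (`|slab ta tb phi x| * `|slab ta tb f x|)).
    by apply/funext => x; rewrite Eq !normrM ger0_norm.
  have Lab : L1 M (fun x => `|slab ta tb phi x| * `|slab ta tb f x|).
    by have := L1_norm L; congr L1; apply/funext => x; rewrite normrM.
  rewrite (IntZ 2 Lab) => cs; rewrite exprMn -mulrA (_ : 2 ^+ 2 = 4); last by ring.
  by rewrite ler_pM2l.
have [Y1 ds1] := dbl f1 mf1 Ls1; have [Y2 ds2] := dbl f2 mf2 Ls2.
have [Lphi2 gn2] := gagliardo_nirenberg tab Wpp ppa Y1 Y2.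
set F4 := Int M (fun x => slab ta tb (fun p => phi p * phi p) x ^+ 2) in gn2.
have F20 : 0 <= F2 by apply: Int_ge0 => x; exact: sqr_ge0.
have hF4 : F4 <= 8 * (1 + (tb - ta)) * F2 * E.
  exact: (gn2_algebra d0 gn2 ds1 ds2).
have Lp1 : L1 M (fun x => (ind ta tb x.1 * f1 x) ^+ 2) by have := Ls1; rewrite -slab_sq.
have Lp2 : L1 M (fun x => (ind ta tb x.1 * f2 x) ^+ 2) by have := Ls2; rewrite -slab_sq.
pose r := `|ta| + `|tb|.
have r0 : 0 <= r by rewrite addr_ge0.
have sp (x : R * R) : r < `|x.1| -> [/\ ind ta tb x.1 * phi x = 0, ind ta tb x.1 * f1 x = 0 & ind ta tb x.1 * f2 x = 0].
  move=> hx; rewrite indE; case: ifPn => [/andP[hx1 hx2]|_]; last by rewrite !mul0r.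
  exfalso; move: hx; rewrite ltNge => /negP; apply; rewrite /r ler_norml.
  have n1 := ler_norm tb; have n2 := ler_norm (- ta); rewrite normrN in n2.
  apply/andP; split; first by rewrite opprD lerBlDr; apply: (le_trans _ (le_trans hx1 _)); [rewrite lerNl|rewrite lerDl].
  by apply: (le_trans hx2); apply: (le_trans n1); rewrite lerDr.
have Lq b : [/\ L1 M (fun x => ind (- b) b x.1 * U2 x ^+ 2),
    L1 M (fun x => ind (- b) b x.1 * G21 x ^+ 2) & L1 M (fun x => ind (- b) b x.1 * G22 x ^+ 2)].
  by split; [exact: (L1_slabU (- b) b).2|exact: (L1_slab (- b) b L21)|exact: (L1_slab (- b) b L22)].
have [LJ1 LJ2 JJ] := jacobian_swap r0 Wc WU2 Lphi Lp1 Lp2 sp Lq.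
have [Ac Dc] := Wc; have [_ DU1] := WU1; have [_ DU2] := WU2.
have mch : measurable_fun setT (slab ta tb (fun x => chi k x * h x)) by apply: mf_slab; exact: measurable_funM.
have Lch : L1 M (fun x => slab ta tb (fun x => chi k x * h x) x ^+ 2) by rewrite slab_sq; exact: Lch2.
have mpp : measurable_fun setT (slab ta tb (fun p => phi p * phi p)) by apply: mf_slab; exact: measurable_funM.
have LQ := @L1_sqM _ _ _ M _ _ mpp mch Lphi2 Lch.
have hQ := @cauchy_schwarz _ _ _ M _ _ mpp mch Lphi2 Lch.
rewrite [X in _ <= _ * Int M X]slab_sq in hQ.
have Lwp (z g : R * R -> R) : measurable_fun setT z -> (forall x, z x ^+ 2 <= h x) ->
    measurable_fun setT g -> L1 M (fun x => g x ^+ 2) -> L1 M (fun x => ind ta tb x.1 * phi x * (z x * g x)).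
  move=> mz zh mg Lg.
  have Lhs : L1 M (fun x => slab ta tb h x ^+ 2) by rewrite slab_sq.
  have Lph := @L1_sqM _ _ _ M _ _ mpp (mf_slab ta tb mh) Lphi2 Lhs.
  have mpz : measurable_fun setT (fun x => slab ta tb phi x * z x) by exact: measurable_funM.
  have Lpz : L1 M (fun x => (slab ta tb phi x * z x) ^+ 2).
    apply: (@L1_domT _ _ _ M _ _ (measurable_funX 2 mpz) Lph) => x.
    rewrite ger0_norm ?sqr_ge0// /slab indE; case: ifP => _; last by rewrite !mul0r expr0n.
    by rewrite !mul1r exprMn -expr2; apply: ler_wpM2l; [exact: sqr_ge0|exact: zh].
  have := @L1_sqM _ _ _ M _ _ mpz mg Lpz Lg; congr L1; apply/funext => x; rewrite /slab; ring.
have w1h x : w1 (U1 x, U2 x) ^+ 2 <= h x by rewrite /h lerDl sqr_ge0.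
have w2h x : w2 (U1 x, U2 x) ^+ 2 <= h x by rewrite /h lerDr sqr_ge0.
have LZ1 := Lwp _ _ (mF cw1) w1h m12 L12; have LZ2 := Lwp _ _ (mF cw2) w2h m22 L22.
have mf2s : measurable_fun setT (fun x => ind ta tb x.1 * f2 x) by exact: (mf_slab ta tb mf2).
have LZ0 := @L1_sqM _ _ _ M _ _ mwU mf2s Lw Lp2.
(* The x_2-derivative of phi w(u), with integral zero by periodicity. *)
pose Zf x := wU x * (ind ta tb x.1 * f2 x) + ind ta tb x.1 * phi x *
  (w1 (U1 x, U2 x) * G12 x + w2 (U1 x, U2 x) * G22 x).
have LZ : L1 M Zf.
  by have := L1D LZ0 (L1D LZ1 LZ2); congr L1; apply/funext => x; rewrite /Zf; ring.
have IZ : Int M Zf = 0.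
  apply: D2_ibp => //.
  exact: (D2_chain msl mwU C1_mul Dc (D2_chain mU1 mU2 Cw DU1 DU2)).
have LE1 : L1 M (fun x => (ind ta tb x.1 * f1 x) ^+ 2 + (ind ta tb x.1 * f2 x) ^+ 2) by exact: L1D.
have LJ := L1B LJ1 LJ2.
have EE : E = Int M (fun x => (ind ta tb x.1 * f1 x) ^+ 2 + (ind ta tb x.1 * f2 x) ^+ 2).
  by rewrite (IntD Lp1 Lp2) /E -!slab_sq.
(* Multiples of the two null integrals are added to E so that the vorticity equation cancels the
   terms in w; [young_flux] then bounds the integrand. *)
have hE : E <= Int M (fun x => slab ta tb (fun p => phi p * phi p) x * slab ta tb (fun x => chi k x * h x) x).
  have LS := L1D (L1Z (2 * sg) LJ) (L1Z (2 * sg) LZ).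
  have -> : E = Int M (fun x => (ind ta tb x.1 * f1 x) ^+ 2 + (ind ta tb x.1 * f2 x) ^+ 2 +
      (2 * sg * (ind ta tb x.1 * f1 x * G22 x - ind ta tb x.1 * f2 x * G21 x) + 2 * sg * Zf x)).
    rewrite (IntD LE1 LS) (IntD (L1Z (2 * sg) LJ) (L1Z (2 * sg) LZ)) (IntZ _ LJ) (IntZ _ LZ) IZ.
    by rewrite (IntB LJ1 LJ2) JJ subrr !mulr0 !addr0.
  apply: (Int_le (L1D LE1 LS) LQ); apply: filterS2 div0 vorticity => x dx vx.
  rewrite /Zf /slab /f1 /f2 indE; case: ifP => _; last by rewrite !(mul0r, mulr0, subrr, addr0, expr0n).
  rewrite !mul1r /phi; case: ifPn => vk; last first.
    rewrite (_ : Num.max (v x - k) 0 = 0); last by apply: max_r; rewrite subr_le0 leNgt.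
    by rewrite !(mul0r, mulr0, subrr, addr0, expr0n).
  apply: young_flux => //; rewrite /chi vk /=; case: ifPn; first by left.
  by rewrite negb_or !negbK => /andP[/eqP -> /eqP ->]; right.
have E0 : 0 <= E by rewrite EE; apply: Int_ge0 => x; rewrite addr_ge0 ?sqr_ge0.
have th0 : 0 <= Int M (slab ta tb (fun x => (chi k x * h x) ^+ 2)).
  by apply: Int_ge0 => x; apply: mulr_ge0; [exact: ind_ge0|exact: sqr_ge0].
have F2le := absorb_algebra d0 E0 F20 hF2 hF4 hE hQ th0 small.
have := Int_ge0_eq0 Lphi (aeW _ (fun x => sqr_ge0 _)) F2le; apply: filterS => x /eqP.
rewrite sqrf_eq0 /slab indE => /eqP + hx; rewrite hx mul1r /phi => e.
by rewrite -subr_le0 -e le_max lexx.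
Qed.

(** If [chi] at the levels kk n is eventually zero at a.e. point of the slab, dominated convergence
    brings the smallness that [level_key] asks for. *)
Let level_seq (kk : nat -> R) : (forall n, k0 <= kk n) ->
  {ae M, forall x, ta <= x.1 <= tb -> exists m, forall n, (m <= n)%N -> chi (kk n) x = 0} ->
  exists n, P (kk n).
Proof.
move=> kk0 H; pose C := 16 * (1 + (tb - ta)) ^+ 2 * (tb - ta).
have c : Int M (slab ta tb (fun x => (chi (kk n) x * h x) ^+ 2)) @[n --> \oo] --> (0 : R).
  have a1 : {ae M, forall x, slab ta tb (fun x => (chi (kk n) x * h x) ^+ 2) x @[n --> \oo] --> (0 : R)}.
    apply: filterS H => x Hx; apply: cvg_near_cst.
    have [hx|hx] := boolP (ta <= x.1 <= tb); last first.
      by apply: nearW => n; rewrite /slab indE (negbTE hx) mul0r.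
    have [m Hm] := Hx hx; exists m => // n /= mn.
    by rewrite /slab Hm// mul0r expr0n mulr0.
  have a2 : {ae M, forall x n, `|slab ta tb (fun x => (chi (kk n) x * h x) ^+ 2) x| <= slab ta tb (fun x => h x ^+ 2) x}.
    apply: aeW => x n; rewrite ger0_norm; last by apply: mulr_ge0; [exact: ind_ge0|exact: sqr_ge0].
    rewrite /slab; apply: ler_wpM2l; first exact: ind_ge0.
    by case: (chi01 (kk n) x) => ->; rewrite ?mul1r// mul0r expr0n sqr_ge0.
  have mc0 : measurable_fun [set: R * R] (fun=> 0 : R) by exact: measurable_cst.
  have [_] := @DCT _ _ _ M (fun n => slab ta tb (fun x => (chi (kk n) x * h x) ^+ 2)) (fun=> 0)
    (slab ta tb (fun x => h x ^+ 2)) (fun n => L1_mf (Lch2 (kk n))) mc0 Lh2 a1 a2.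
  by rewrite Int0.
have c2 : C * Int M (slab ta tb (fun x => (chi (kk n) x * h x) ^+ 2)) @[n --> \oo] --> C * (0 : R).
  exact: (cvgM (@cvg_cst _ (C : R) _ (nbhs \oo) _) c).
rewrite mulr0 in c2; have /cvgr0Pnorm_lt/(_ _ (@ltr01 R)) := c2.
move=> /(@filter_ex _ _ _ _)[n hn]; exists n; apply: level_key => //.
exact: (le_lt_trans (ler_norm _) hn).
Qed.

(** Let L be the infimum of the levels that bound v. The set of such levels is nonempty by
    [level_seq] along k0 + n, and L belongs to it. If L > k0, levels increasing to L also satisfy
    [level_seq], and one of them bounds v below L, a contradiction. *)
Lemma level_zero : {ae M, forall x, ta <= x.1 <= tb -> sg * (U1 x - a) <= k0}.
Proof.
suff : P k0 by apply: filterS => x H hx; have := H hx; rewrite /v; congr (_ <= _); ring.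
apply: contrapT => nP.
pose S : set R := [set k | k0 <= k /\ P k].
have chi0 k x : v x <= k -> chi k x = 0 by rewrite /chi leNgt => /negbTE ->.
have S0 : S !=set0.
  have [||n Pn] := @level_seq (fun n => k0 + n%:R); [by move=> n; rewrite lerDl| |by exists (k0 + n%:R); split; rewrite ?lerDl].
  apply: aeW => x _; exists (Num.truncn `|v x - k0|).+1 => n mn; apply: chi0.
  rewrite -lerBlDl; apply: (le_trans (ler_norm _)); apply: (le_trans (ltW (truncnS_gt _))).
  by rewrite ler_nat.
have lbS : lbound S k0 by move=> k [].
have hS : has_inf S by split => //; exists k0.
set L := inf S; have L0 : k0 <= L by exact: lb_le_inf.
have PL : P L.
  have H (n : nat) : P (L + n.+1%:R^-1).
    have n0 : 0 < (n.+1%:R^-1 : R) by rewrite invr_gt0.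
    have [k [_ Pk] kL] := inf_adherent n0 hS.
    by apply: filterS Pk => x Hx hx; apply: (le_trans (Hx hx)); exact: ltW.
  apply: filterS (ae_foralln H) => x Hx hx; apply/ler_addgt0Pr => e e0.
  have /cvgr0Pnorm_lt/(_ _ e0) := @cvg_harmonic R; move=> /(@filter_ex _ _ _ _)[n hn].
  apply: (le_trans (Hx n hx)); rewrite lerD2l ltW//; exact: (le_lt_trans (ler_norm _) hn).
have {}L0 : k0 < L.
  by rewrite lt_neqAle L0 andbT; apply/eqP => e; apply: nP; rewrite e.
(* Levels starting at k0 and increasing strictly to L without reaching it. *)
pose kk (n : nat) := L - (L - k0) * n.+1%:R^-1.
have kkL n : k0 <= kk n < L.
  have n0 : 0 < (n.+1%:R^-1 : R) by rewrite invr_gt0.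
  have n1 : (n.+1%:R^-1 : R) <= 1 by rewrite invf_le1 ?ltr0n// ler1n.
  have d0 : 0 < L - k0 by rewrite subr_gt0.
  rewrite /kk ltrBlDr ltrDl mulr_gt0// andbT lerBrDr -lerBrDl.
  by rewrite ler_piMr// ltW.
have [||n Pn] := @level_seq kk; first by move=> n; have /andP[] := kkL n.
  apply: filterS2 PL (W12_level L Wv) => x Hx HL hx.
  (* At v = L the gradient is zero and [chi] vanishes at every level; at v < L it vanishes once the
     level exceeds v. *)
  have := Hx hx; rewrite le_eqVlt => /predU1P[e|lt].
    exists 0%N => n _; have [g1 g2] := HL e.
    have s0 : sg != 0 by apply/eqP => e0; move: sg1; rewrite e0 mul0r => /eqP; rewrite eq_sym oner_eq0.
    move/eqP: g1; rewrite mulf_eq0 (negbTE s0) /= => g1; move/eqP: g2; rewrite mulf_eq0 (negbTE s0) /= => g2.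
    by rewrite /chi g1 g2 /= andbF.
  have d0 : 0 < (L - v x) / (L - k0) by rewrite divr_gt0// subr_gt0.
  have /cvgr0Pnorm_lt/(_ _ d0)[m _ Hm] := @cvg_harmonic R.
  exists m => n mn; apply: chi0; rewrite /kk lerBrDr -lerBrDl mulrC -ler_pdivlMr ?subr_gt0//.
  by apply/ltW/(le_lt_trans (ler_norm _)); exact: Hm.
have /andP[k1 k2] := kkL n.
have : L <= kk n by apply: ge_inf; [exists k0|split].
by rewrite leNgt k2.
Qed.

End LevelSet.

Lemma first_component : {ae M, forall x, U1 x = a}.
Proof.
have H (n : nat) : {ae M, forall x, - n%:R <= x.1 <= n%:R -> `|U1 x - a| <= n.+1%:R^-1}.
  have n0 : 0 < (n.+1%:R^-1 : R) by rewrite invr_gt0.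
  have [t t1 g1] := good_m (- n%:R) n0; have [t' t2 g2] := good_p n%:R n0.
  have tt : t <= t'.
    apply: ltW; apply: (lt_trans t1); apply: le_lt_trans t2.
    by apply: (@le_trans _ _ 0); rewrite ?oppr_le0.
  have s1 : (1 : R) * 1 = 1 by rewrite mulr1.
  have s2 : (-1 : R) * -1 = 1 by rewrite mulrNN mulr1.
  apply: filterS2 (level_zero s1 g1 tt g2) (level_zero s2 g1 tt g2) => x h1 h2 /andP[hx1 hx2].
  have hx : t <= x.1 <= t' by rewrite (le_trans (ltW t1) hx1) (le_trans hx2 (ltW t2)).
  have k1 := h1 hx; have k2 := h2 hx; rewrite mul1r in k1; rewrite mulN1r lerNl in k2.
  by rewrite ler_norml k1 k2.
apply: filterS (ae_foralln H) => x Hx; apply/eqP; rewrite -subr_eq0 -normr_eq0 eq_le normr_ge0 andbT.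
apply/ler_addgt0Pr => e e0; rewrite add0r.
have /cvgr0Pnorm_lt/(_ _ e0)[m _ Hm] := @cvg_harmonic R.
pose n := maxn m (Num.truncn `|x.1|).+1.
have mn : (m <= n)%N by rewrite leq_maxl.
have h := Hm n mn; apply: (@le_trans _ _ n.+1%:R^-1); last by apply/ltW/(le_lt_trans (ler_norm _)); exact: h.
apply: Hx; rewrite -ler_norml; apply: (le_trans (ltW (truncnS_gt _))).
by rewrite ler_nat leq_maxr.
Qed.

(** A constant U1 has zero gradient, so div u = 0 gives G22 = 0, whence U2 equals its slice mean,
    and the vorticity equation reduces to G21 = w(a, U2). *)
Lemma core_profile : exists g : R -> R, ac g (fun t => w (a, g t)) /\
  {ae M, forall x, [/\ U1 x = a, U2 x = g x.1 &
    [/\ G11 x = 0, G12 x = 0, G21 x = w (a, g x.1) & G22 x = 0]]}.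
Proof.
have [[_ _ A2] D2_] := WU2.
have hG : {ae M, forall x, G11 x = 0 /\ G12 x = 0}.
  by apply: filterS2 first_component (W12_level a WU1) => x u; exact.
have h0 : {ae M, forall x, [/\ U1 x = a, G22 x = 0 & G21 x = w (a, U2 x)]}.
  apply: filterS3 first_component (filterI div0 vorticity) (W12_level a WU1) => x u [d v] l.
  have [g1 g2] := l u; rewrite u g2 subr0 in v; split => //.
  by rewrite -[RHS]d g1 add0r.
have osc := D2_osc2 D2_ mU2 L22.
pose m t := Int nu (fun s => U2 (t, s)).
have mm : measurable_fun setT m by exact: measurable_Int_param.
have Um : {ae M, forall x, U2 x = m x.1}.
  apply: prod_ae1; first by apply: measurable_eq_set => //; exact: (measurableT_comp mm measurable_fst).
  apply: filterS2 osc (ae_prod1 h0) => t [_ _ _ o] ht.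
  have B0 : Int nu (fun s => `|G22 (t, s)|) = 0.
    rewrite -[RHS](Int0 nu); apply: Int_ae; [|exact: measurable_cst|by apply: filterS ht => s [_ -> _]; rewrite normr0].
    by apply: measurableT_comp => //; exact: mf_pairr.
  by apply: filterS o => s; rewrite B0 normr_le0 subr_eq0 => /eqP.
(* One horizontal line on which all a.e. statements hold supplies the profile, as U2 is absolutely
   continuous there. *)
have [s [[As Us] Hs]] := ae_nu_ex (filterI (filterI A2 (ae_prod2 Um)) (ae_prod2 h0)).
exists (fun t => U2 (t, s)); split.
  apply: (ac_ae As).
    have := measurable_comp2 cw (measurable_cst a) (mf_pairl s mU2); exact.
  by apply: filterS Hs => t [].
have e : {ae leb, forall t, m t = U2 (t, s)} by apply: filterS Us.
apply: filterS3 (filterI (ae_M_t e) hG) Um h0 => x [<- [g1 g2]] u [-> v2 v3].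
by split; rewrite // -u; split.
Qed.

End Core.

(** * An autonomous flow, and functions of x_1 seen on the cylinder *)

Section Lift.
Context {R : realType}.
Implicit Types (a b c t r s : R).
Local Notation leb := (@lebesgue_measure R).
Local Notation mm := (leb \x leb)%E.
Local Notation nu := (@nu R).
Local Notation M := (@M R).

(** Separation of variables: the primitive T of 1/k increases with slope at least 1/C, so it is a
    bijection of the line, and its inverse solves the equation. Continuity of [k] is enough. *)
Lemma flow_exists (k : R -> R) c C : continuous k -> 0 < c -> (forall r, c <= k r <= C) ->
  exists rho : R -> R, [/\ forall t, is_derive t 1 rho (k (rho t)), continuous rho & rho 0 = 0].
Proof.
move=> ck c0 kb.
have k0 r : 0 < k r by have /andP[h _] := kb r; exact: lt_le_trans h.
have C0 : 0 < C by have /andP[h1 h2] := kb 0; rewrite (lt_le_trans c0)// (le_trans h1).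
have cik : continuous (fun r => (k r)^-1).
  by move=> r; apply: (cvgV _ (ck r)); rewrite gt_eqF.
have [P AP dP] := primitive cik.
pose T r := P r - P 0.
have dT r : is_derive r 1 T (k r)^-1.
  by apply: (is_derive_eq (is_deriveB (dP r) (is_derive_cst (P 0) r 1))); rewrite subr0.
have [lP EP] := AP.
have Tm r r' : r <= r' -> (r' - r) / C <= T r' - T r.
  move=> rr; have -> : T r' - T r = P r' - P r by rewrite /T; ring.
  rewrite EP// mulrC -(J_cst C^-1 rr); apply: J_le => //; first by apply: li_cont; exact: cst_continuous.
  by move=> t _; rewrite lef_pV2 ?posrE//; have /andP[] := kb t.
have Tinj r r' : T r = T r' -> r = r'.
  have aux x y : x < y -> T x < T y.
    move=> xy; rewrite -subr_gt0; apply: lt_le_trans (Tm _ _ (ltW xy)).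
    by rewrite divr_gt0// subr_gt0.
  move=> e; case: (ltgtP r r') => // h; by have := aux _ _ h; rewrite e ltxx.
have cT : continuous T.
  by move=> r; apply: differentiable_continuous; apply/derivable1_diffP; have [] := dT r.
have T0 : T 0 = 0 by rewrite /T subrr.
have Tsurj t : exists r, T r = t.
  (* The slope bound gives T(B) >= |t| and T(-B) <= -|t|, so t lies between two values of T. *)
  pose B := C * `|t|; have B0 : 0 <= B by rewrite mulr_ge0// ltW.
  have h1 : `|t| <= T B.
    by have := Tm 0 B B0; rewrite T0 !subr0 /B mulrC mulKf ?gt_eqF.
  have h2 : T (- B) <= - `|t|.
    have BN : - B <= 0 by rewrite oppr_le0.
    have := Tm (- B) 0 BN; rewrite T0 sub0r opprK add0r [B / C]mulrC /B mulKf ?gt_eqF// => h2.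
    by rewrite lerNr.
  have BB : - B <= B by apply: (@le_trans _ _ 0); rewrite ?oppr_le0.
  have [|r _ rt] := @IVT _ T (- B) B t BB (continuous_subspaceT cT); last by exists r.
  have := ler_norm t; have := ler_norm (- t); rewrite normrN => n1 n2.
  by rewrite ge_min le_max; apply/andP; split; apply/orP; [left|right]; [lra|exact: le_trans h1].
have [g gT] := choice Tsurj.
have dg t : is_derive t 1 g (k (g t)).
  have h1 : {near g t, cancel T g} by near=> r; apply: Tinj; rewrite gT.
  have k1 : (k (g t))^-1 != 0 by rewrite invr_eq0 gt_eqF.
  have h3 : {near g t, continuous T} by near=> r; exact: cT.
  have := is_derive_inverse h1 h3 (dT (g t)) k1.
  by rewrite gT invrK.
exists g; split => //; last by apply: Tinj; rewrite gT T0.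
by move=> r; apply: differentiable_continuous; apply/derivable1_diffP; have [] := dg r.
Unshelve. all: by end_near. Qed.

Lemma L1_ind2M (F : R * R -> R) (phi : R * R -> R) r : li2 F -> continuous phi ->
  (forall p, r < `|p.1| \/ r < `|p.2| -> phi p = 0) -> L1 mm (fun p => F p * phi p).
Proof.
move=> lF cphi sp; have [C C0 HC] := cont_bnd2 (- r) r (- r) r cphi.
have mphi : measurable_fun setT phi.
  have := measurable_comp2 cphi (@measurable_fst _ _ (measurableTypeR R) (measurableTypeR R)) (@measurable_snd _ _ (measurableTypeR R) (measurableTypeR R)).
  by congr (measurable_fun _ _); apply/funext => -[].
have bphi p : `|phi p| <= C.
  have [h1|h1] := leP `|p.1| r; last by rewrite sp ?normr0//; left.
  have [h2|h2] := leP `|p.2| r; last by rewrite sp ?normr0//; right.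
  by case: p h1 h2 => x y /= h1 h2; apply: HC; rewrite -ler_norml.
have := @L1_bM _ _ _ mm C phi _ mphi bphi (lF r); congr L1; apply/funext => p.
rewrite ind2E; case: ifPn => [_|]; first by rewrite mul1r mulrC.
by rewrite negb_and -!ltNge => /orP h; rewrite sp// !mulr0 ?mul0r.
Qed.

Lemma test2_slices (phi : R * R -> R) : test2 phi ->
  [/\ forall s, test1 (fun t => phi (t, s)) /\ (forall t, derive1 (fun t => phi (t, s)) t = 'D_e1 phi (t, s)),
    forall t, test1 (fun s => phi (t, s)) /\ (forall s, derive1 (fun s => phi (t, s)) s = 'D_e2 phi (t, s)) &
    exists r, forall p, r < `|p.1| \/ r < `|p.2| -> [/\ phi p = 0, 'D_e1 phi p = 0 & 'D_e2 phi p = 0]].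
Proof.
move=> [cphi [r sp] dphi c1 c2].
have C : C1 phi ('D_e1 phi) ('D_e2 phi) by exact: C1_partials.
have [_ _ d1 d2] := C.
have E1 s t : derive1 (fun t => phi (t, s)) t = 'D_e1 phi (t, s) by rewrite derive1E; have [_ ->] := d1 t s.
have E2 t s : derive1 (fun s => phi (t, s)) s = 'D_e2 phi (t, s) by rewrite derive1E; have [_ ->] := d2 t s.
have T1 s : test1 (fun t => phi (t, s)).
  split; [exact: cont_slice1| |by move=> t; have [] := d1 t s|].
    by exists r => t h; apply: sp; left.
  have -> : derive1 (fun t => phi (t, s)) = (fun t => 'D_e1 phi (t, s)) by apply/funext => t; exact: E1.
  exact: (@cont_slice1 _ ('D_e1 phi) s c1).
have T2 t : test1 (fun s => phi (t, s)).
  split; [exact: cont_slice2| |by move=> s; have [] := d2 t s|].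
    by exists r => s h; apply: sp; right.
  have -> : derive1 (fun s => phi (t, s)) = (fun s => 'D_e2 phi (t, s)) by apply/funext => s; exact: E2.
  exact: (@cont_slice2 _ ('D_e2 phi) t c2).
split => //; exists r => -[x y] /= h; rewrite sp//; split => //.
- have [h1|h1] := ltP r `|y|.
    rewrite -E1 (_ : (fun t => phi (t, y)) = fun=> 0) ?derive1_cst//.
    by apply/funext => t; apply: sp; right.
  have {}h : r < `|x| by case: h => // h2; move: (lt_le_trans h2 h1); rewrite ltxx.
  rewrite -E1 derive1E; have h2 : is_derive x 1 (fun t => phi (t, y)) 0.
    apply: (@near_eq_is_derive _ _ _ (fun=> 0)).
    have cn : {for x, continuous (fun z : R => `|z|)} by exact: norm_continuous.
    near=> z; rewrite sp//; left => /=; near: z; exact: (cvgr_gt _ cn _ h).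
  by have [_ ->] := h2.
- have [h1|h1] := ltP r `|x|.
    rewrite -E2 (_ : (fun s => phi (x, s)) = fun=> 0) ?derive1_cst//.
    by apply/funext => t; apply: sp; left.
  have {}h : r < `|y| by case: h => // h2; move: (lt_le_trans h2 h1); rewrite ltxx.
  rewrite -E2 derive1E; have h2 : is_derive y 1 (fun s => phi (x, s)) 0.
    apply: (@near_eq_is_derive _ _ _ (fun=> 0)).
    have cn : {for y, continuous (fun z : R => `|z|)} by exact: norm_continuous.
    near=> z; rewrite sp//; right => /=; near: z; exact: (cvgr_gt _ cn _ h).
  by have [_ ->] := h2.
Unshelve. all: by end_near. Qed.

Lemma lift_L2loc (f : R -> R) : measurable_fun setT f -> li (fun t => f t ^+ 2) ->
  L2loc2 (fun p => f p.1).
Proof.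
move=> mf lf; have lc : li (fun=> 1 : R) by apply: li_cont; exact: cst_continuous.
have Li u v : L1 leb (ind u v) by have := lc u v; congr L1; apply/funext => t; rewrite mulr1.
split; first exact: (measurableT_comp mf measurable_fst).
move=> r; apply/li2_int; have [L _] := L1_tensor (lf (- r) r) (Li (- r) r).
by move: L; congr L1; apply/funext => p; rewrite /ind2; ring.
Qed.

Lemma L2loc_li2' (f : R * R -> R) : L2loc2 f -> li2 f.
Proof. by move=> /L2loc_li2[]. Qed.

(** By Fubini on slices of the test function: parts along horizontal lines for x_1, while along
    vertical lines a test function's derivative integrates to 0. *)
Lemma lift_weak (f g : R -> R) : ac f g -> li (fun t => g t ^+ 2) ->
  weak_deriv2 (fun p => f p.1) e1 (fun p => g p.1) /\ weak_deriv2 (fun p => f p.1) e2 (fun=> 0).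
Proof.
move=> A lg2; have cf := ac_continuous A; have [lg _] := A.
have Lf : L2loc2 (fun p => f p.1).
  apply: lift_L2loc; first exact: continuous_measurable_fun.
  by apply: li_cont => t; apply: (cvgM (cf t) (cf t)).
have Lg : L2loc2 (fun p => g p.1) by apply: lift_L2loc => //; exact: (li_mf lg).
have L0 : L2loc2 (fun _ : R * R => 0 : R).
  apply: (@lift_L2loc (fun=> 0)); first exact: measurable_cst.
  by apply: li_cont => t; rewrite expr0n; exact: cst_continuous.
have ere (F H : R * R -> R) : L1 mm F -> L1 mm H -> Int mm F = - Int mm H ->
    (\int[mu2]_p (F p)%:E = - \int[mu2]_p (H p)%:E)%E.
  by move=> LF LH e; rewrite (L1_finE LF) (L1_finE LH) e EFinN.
split; split => // phi T; have [T1 T2 [r sp]] := test2_slices T; have [cphi _ _ c1 c2] := T.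
- have L1' := L1_ind2M (L2loc_li2' Lf) c1 (fun p h => let: And3 _ k _ := sp p h in k).
  have L2' := L1_ind2M (L2loc_li2' Lg) cphi (fun p h => let: And3 k _ _ := sp p h in k).
  apply: ere => //; have [_ _ ->] := fub2 L1'; have [_ L ->] := fub2 L2'.
  rewrite -(IntN L); congr Int; apply/funext => s; have [t1 e] := T1 s.
  have [_ [_ <-]] := ac_ibp A t1; congr Int; apply/funext => t; by rewrite e.
- have L1' := L1_ind2M (L2loc_li2' Lf) c2 (fun p h => let: And3 _ _ k := sp p h in k).
  apply: ere => //.
    by have := @L1_0 _ _ _ mm; congr L1; apply/funext => p; rewrite mul0r.
  have [_ _ ->] := fub1 L1'.
  have -> : (fun p : R * R => 0 * phi p) = fun=> 0 by apply/funext => p; rewrite mul0r.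
  rewrite Int0 oppr0 -[RHS](Int0 leb); congr Int; apply/funext => t; have [t2 e] := T2 t.
  have [La [_ Ea]] := ac_ibp (ac_cst 1) t2.
  have E : (fun s => f t * 'D_e2 phi (t, s)) = (fun s => f t * (1 * derive1 (fun s => phi (t, s)) s)).
    by apply/funext => s; rewrite e mul1r.
  rewrite E (IntZ _ La) Ea (_ : (fun s => 0 * phi (t, s)) = fun=> 0) ?Int0 ?oppr0 ?mulr0//.
  by apply/funext => s; rewrite mul0r.
Qed.

Lemma ge0_cyl_fst (F : R -> R) : measurable_fun setT F -> (forall t, 0 <= F t) ->
  (\int[mu2]_(p in cyl) (F p.1)%:E = \int[leb]_t (F t)%:E)%E.
Proof.
move=> mF F0.
have mf : measurable_fun [set: R * R] (fun p : R * R => (F p.1)%:E).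
  by apply/measurable_EFinP; exact: (measurableT_comp mF measurable_fst).
have f0 (p : R * R) : (0 <= (F p.1)%:E)%E by rewrite lee_fin.
rewrite (ge0_cyl_M mf f0) (fubini_tonelli1 (m1 := leb) (m2 := nu) _ mf f0).
apply: eq_integral => t _; rewrite /fubini_F /=.
have [L I] := @Int_nu_cst R (F t); by rewrite (L1_finE L) I.
Qed.

End Lift.

(** * A one-dimensional competitor of almost optimal energy *)

Section Competitor.
Context {R : realType}.
Implicit Types (t r s : R).
Local Notation leb := (@lebesgue_measure R).
Local Notation nu := (@nu R).

(** The speed |De| k equals |x| + d, slightly more than the optimal |x| with x = w. With y = |x| the
    claim reduces to (y+d)^2/2 + y^2/2 <= (y+d)^2. *)
Lemma competitor_pointwise (D De x k d W : R) : 0 < D -> `|De| = D -> 0 <= De * x -> 0 < d ->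
  k = (`|x| + d) / D -> W <= x ^+ 2 / 2 ->
  (De * k) ^+ 2 / 2 + W <= x * (De * k) + d * D * k.
Proof.
move=> D0 DD Dx d0 kE hW.
have Dk : D * k = `|x| + d by rewrite kE; field; rewrite gt_eqF.
have E1 : (De * k) ^+ 2 = (`|x| + d) ^+ 2.
  by rewrite exprMn -[De ^+ 2]real_normK ?num_real// DD -exprMn Dk.
have E2 : x * (De * k) = `|x| * (`|x| + d).
  by rewrite -Dk -DD !mulrA -normrM ger0_norm// mulrC.
have E3 : d * D * k = d * (`|x| + d) by rewrite -mulrA Dk.
rewrite E1 E2 E3; move: hW; rewrite -[x ^+ 2]real_normK ?num_real//.
have := normr_ge0 x; set y := `|x| => y0 hW; have := mulr_ge0 y0 (ltW d0); have := sqr_ge0 d; lra.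
Qed.

Variables (W w al w1 w2 al1 al2 Phi1 : R * R -> R) (a um up : R).
Hypotheses (cW : continuous W) (W0 : forall z, 0 <= W z) (Wm : W (a, um) = 0) (Wp : W (a, up) = 0).
Hypotheses (Cw : C1 w w1 w2) (CP : C1 Phi1 al w).
Hypothesis (Ww : forall z, w z ^+ 2 / 2 <= W z).
Hypothesis seg : forall t : R, 0 < t < 1 ->
  W (a, (1 - t) * um + t * up) = (w (a, (1 - t) * um + t * up)) ^+ 2 / 2 /\
  0 < (up - um) * w (a, (1 - t) * um + t * up).

(** Traversing the segment at speed |w| would cost exactly c, but w vanishes at both ends, so this
    may take infinite time. At speed |w| + d the traversal takes time at most |up - um|/d, and the
    excess cost is at most d |up - um|. *)
Lemma competitor d : 0 < d -> exists th dth : R -> R, [/\ ac th dth, L1 leb (fun t => dth t ^+ 2),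
  (exists B, forall t, (t < - B -> th t = um) /\ (B < t -> th t = up)),
  L1 leb (fun t => dth t ^+ 2 / 2 + W (a, th t)) &
  Int leb (fun t => dth t ^+ 2 / 2 + W (a, th t)) <=
    Phi1 (a, up) - Phi1 (a, um) + d * `|up - um|].
Proof.
move=> d0; have cw := C1_continuous Cw.
pose De := up - um; pose D := `|De|.
have D0 : 0 < D.
  have h : 0 < (2^-1 : R) < 1 by apply/andP; split; lra.
  have [_ h2] := seg h; rewrite normr_gt0; apply/eqP => e; move: h2; rewrite -/De e mul0r ltxx//.
pose q (x : R) := w (a, um + x * De).
have cq : continuous q.
  move=> x; have h1 : (fun x : R => x * De) @ x --> x * De.
    by apply: cvgM; [exact: cvg_id|exact: (@cvg_cst _ (De : R) _ (nbhs x) _)].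
  have h2 : (fun x : R => um + x * De) @ x --> um + x * De by exact: (cvgD (@cvg_cst _ (um : R) _ (nbhs x) _) h1).
  have h3 := @cont_slice2 R w a cw (um + x * De).
  exact: (@cvg_comp _ _ _ (fun x => um + x * De) (fun y => w (a, y)) _ _ _ h2 h3).
(* The projection onto [0,1]: it extends the speed along the segment to a bounded function on the
   whole line, as [flow_exists] requires. *)
pose clip (r : R) := (`|r| - `|r - 1| + 1) / 2.
have clip01 r : 0 <= clip r <= 1.
  rewrite /clip; case: (ler0P r) => h1; case: (ler0P (r - 1)) => h2; apply/andP; split; lra.
have clip_id r : 0 <= r <= 1 -> clip r = r.
  move=> /andP[h1 h2]; have e1 : `|r - 1| = 1 - r by rewrite distrC ger0_norm// subr_ge0.
  by rewrite /clip e1 ger0_norm//; field.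
have kst (c x : R) : (fun=> c) @ x --> c by exact: (@cvg_cst _ (c : R) _ (nbhs x) _).
have cclip : continuous clip.
  move=> x; have h1 : (fun r : R => `|r|) @ x --> `|x| by exact: norm_continuous.
  have h0 : (fun r : R => r) @ x --> x by exact: cvg_id.
  have h2 : (fun r : R => r - 1) @ x --> x - 1 by exact: (cvgB h0 (kst 1 x)).
  have h3 : (fun r : R => `|r - 1|) @ x --> `|x - 1| by exact: (cvg_norm h2).
  exact: (cvgM (cvgD (cvgB h1 h3) (kst 1 x)) (kst 2^-1 x)).
pose k r := (`|q (clip r)| + d) / D.
have ck : continuous k.
  move=> x; have h1 : (fun r => q (clip r)) @ x --> q (clip x).
    exact: (@cvg_comp _ _ _ clip q _ _ _ (cclip x) (cq _)).
  have h2 : (fun r => `|q (clip r)|) @ x --> `|q (clip x)| by exact: (cvg_norm h1).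
  exact: (cvgM (cvgD h2 (kst d x)) (kst D^-1 x)).
have [C C0 HC] := cont_bnd 0 1 cq.
have dD0 : 0 < d / D by rewrite divr_gt0.
have kb r : d / D <= k r <= (C + d) / D.
  by rewrite !ler_pM2r ?invr_gt0// lerDr normr_ge0 lerD2r HC.
have [rho [drho crho rho0]] := flow_exists ck dD0 kb.
have ckr : continuous (fun t => k (rho t)) by move=> t; exact: (@cvg_comp _ _ _ rho k _ _ _ (crho t) (ck _)).
have Ar : ac rho (fun t => k (rho t)) by exact: (derive_ac ckr drho).
have [lkr Er] := Ar.
have lcst (c : R) : li (fun=> c) by apply: li_cont; exact: cst_continuous.
have grow t t' : t <= t' -> d / D * (t' - t) <= rho t' - rho t.
  move=> tt; rewrite Er// -(J_cst _ tt); apply: J_le => // x _.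
  by have /andP[] := kb (rho x).
(* The parameter [rho] grows at least at rate d/D, hence has reached 1 by this time. *)
pose B := D / d.
have B0 : 0 < B by rewrite divr_gt0.
have rneg t : t <= 0 -> rho t <= 0.
  move=> t0; have := grow _ _ t0; rewrite rho0 !sub0r => h.
  have : 0 <= d / D * - t by rewrite mulr_ge0 ?oppr_ge0// ltW.
  lra.
have rbig t : B <= t -> 1 <= rho t.
  move=> tB; have t0 : 0 <= t by apply: le_trans tB; exact: ltW.
  have := grow _ _ t0; rewrite rho0 !subr0; apply: le_trans.
  have -> : 1 = d / D * B by rewrite /B; field; rewrite !gt_eqF.
  by rewrite ler_pM2l.
(* [rho] stopped at 0 and at 1, written with positive parts so that [ac_pos] differentiates it. *)
pose rh t := Num.max (rho t) 0 - Num.max (rho t - 1) 0.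
pose drh t := (if 0 < rho t then k (rho t) else 0) - (if 0 < rho t - 1 then k (rho t) else 0).
have Arh : ac rh drh.
  have A1 : ac (fun t => rho t - 1) (fun t => k (rho t)).
    by have := ac_lin 1 (-1) Ar (ac_cst 1); congr ac; apply/funext => t; ring.
  have := ac_lin 1 (-1) (ac_pos Ar) (ac_pos A1).
  by congr ac; apply/funext => t; rewrite /rh /drh !mul1r mulN1r.
have c1 t : rho t <= 0 -> rh t = 0 /\ drh t = 0.
  move=> h; rewrite /rh /drh max_r// max_r ?subrr; last by lra.
  by rewrite ltNge h /= ltNge (_ : rho t - 1 <= 0) ?subrr//; lra.
have c2 t : 0 < rho t <= 1 -> rh t = rho t /\ drh t = k (rho t).
  move=> /andP[h1 h2]; rewrite /rh /drh max_l ?(ltW h1)// max_r ?subr_le0// subr0 h1.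
  by rewrite ltNge subr_le0 h2 /= subr0.
have c3 t : 1 < rho t -> rh t = 1 /\ drh t = 0.
  move=> h; have h0 : 0 < rho t by apply: lt_trans h.
  rewrite /rh /drh max_l ?(ltW h0)// max_l ?subr_ge0 ?(ltW h)// h0 subr_gt0 h subrr.
  by split => //; ring.
pose th t := um + De * rh t; pose dth t := De * drh t.
have Ath : ac th dth.
  by have := ac_lin um De (ac_cst 1) Arh; congr ac; apply/funext => t; rewrite /th /dth; ring.
(* The derivative of Phi1(a, th) + d D rh, whose total increment is c + d D; it dominates the energy
   density on [0,B], and outside that interval the density is zero. *)
pose dH t := w (a, th t) * dth t + d * D * drh t.
have AH : ac (fun t => Phi1 (a, th t) + d * D * rh t) dH.
  have := ac_lin 1 (d * D) (ac_chain CP (ac_cst a) Ath) Arh.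
  by congr ac; apply/funext => t; rewrite /dH; ring.
pose e t := dth t ^+ 2 / 2 + W (a, th t).
have e0 t : 0 <= e t by rewrite /e addr_ge0// divr_ge0// sqr_ge0.
have wz z : W z = 0 -> w z = 0.
  move=> Wz; have := Ww z; rewrite Wz => h; apply/eqP; rewrite -sqrf_eq0 eq_le sqr_ge0 andbT.
  by move: h; rewrite pmulr_lle0 ?invr_gt0.
have edge : (forall t, rho t <= 0 -> e t = 0) /\ (forall t, 1 < rho t -> e t = 0).
  split=> t h.
    have [h1 h2] := c1 t h; rewrite /e /dth h2 mulr0 expr0n mul0r add0r.
    by rewrite /th h1 mulr0 addr0.
  have [h1 h2] := c3 t h; rewrite /e /dth h2 mulr0 expr0n mul0r add0r.
  by rewrite /th h1 mulr1 /De addrC subrK.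
have edH t : e t <= ind 0 B t * dH t.
  have [h1|h1] := leP (rho t) 0.
    have [_ h2] := c1 t h1; rewrite (edge.1 t h1) /dH /dth h2 !mulr0 addr0 mulr0//.
  have [h2|h2] := ltP 1 (rho t).
    have [_ h3] := c3 t h2; rewrite (edge.2 t h2) /dH /dth h3 !mulr0 addr0 mulr0//.
  have h12 : 0 < rho t <= 1 by rewrite h1.
  have [r1 r2] := c2 t h12.
  rewrite indE; case: ifPn => [_|hB]; last first.
    have {}hB : B < t.
      move: hB; rewrite negb_and -!ltNge => /orP[tn|//].
      by move: (le_lt_trans (rneg t (ltW tn)) h1); rewrite ltxx.
    have := grow _ _ (ltW hB); have := rbig B (lexx _) => k1 k2.
    have : 0 < d / D * (t - B) by rewrite mulr_gt0// subr_gt0.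
    lra.
  have thE : th t = (1 - rho t) * um + rho t * up by rewrite /th r1 /De; ring.
  have qE : q (clip (rho t)) = w (a, th t).
    by rewrite clip_id ?(ltW h1)// /q /th r1 [rho t * _]mulrC.
  rewrite mul1r /e /dH /dth r2; apply: (competitor_pointwise D0 _ _ d0) => //.
  - move: h2; rewrite le_eqVlt => /predU1P[r11|lt1].
      by rewrite (wz (a, th t)) ?mulr0// thE r11 subrr mul0r add0r mul1r.
    have r01 : 0 < rho t < 1 by rewrite h1.
    by rewrite thE; have [_ /ltW] := seg r01.
  - by rewrite /k qE.
  - move: h2; rewrite le_eqVlt => /predU1P[r11|lt1].
      have -> : W (a, th t) = 0 by rewrite thE r11 subrr mul0r add0r mul1r.
      by rewrite divr_ge0// sqr_ge0.
    have r01 : 0 < rho t < 1 by rewrite h1.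
    by rewrite thE; have [-> _] := seg r01.
have mth : measurable_fun setT th by apply: continuous_measurable_fun; exact: (ac_continuous Ath).
have mdth : measurable_fun setT dth by have [l _] := Ath; exact: (li_mf l).
have me : measurable_fun setT e.
  apply: measurable_funD.
    by apply: measurable_funM; [exact: (measurable_funX 2 mdth)|exact: measurable_cst].
  exact: (measurable_comp2 cW (@measurable_cst _ _ _ _ setT (a : R)) mth).
have [ldH EH] := AH.
have Le : L1 leb e by apply: (@L1_domT _ _ _ leb _ _ me (ldH 0 B)) => t; rewrite ger0_norm.
exists th, dth; split => //.
- apply: (@L1_domT _ _ _ leb _ _ (measurable_funX 2 mdth) (L1Z 2 Le)) => t.
  rewrite ger0_norm ?sqr_ge0// /e; have := W0 (a, th t); lra.
- exists B => t; split => ht; rewrite /th.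
    have [|-> _] := c1 t; last by rewrite mulr0 addr0.
    by apply: rneg; apply: ltW; apply: (lt_trans ht); rewrite oppr_lt0.
  have [|-> _] := c3 t; last by rewrite mulr1 /De addrC subrK.
  have := grow _ _ (ltW ht); have := rbig B (lexx _) => k1 k2.
  have : 0 < d / D * (t - B) by rewrite mulr_gt0// subr_gt0.
  lra.
apply: (le_trans (Int_leT Le (ldH 0 B) edH)).
have := EH 0 B (ltW B0); rewrite /J => <-.
have [h1 _] := c1 0 (rneg 0 (lexx _)).
have h2 : rh B = 1.
  have := rbig B (lexx _); rewrite le_eqVlt => /predU1P[e1|lt1]; last by have [] := c3 _ lt1.
  by have [] := c2 B _; rewrite -?e1 ?ltr01 ?lexx.
rewrite /th h1 h2 !mulr0 mulr1 !addr0 mulr1 (_ : um + De = up); last by rewrite /De addrC subrK.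
by rewrite -/De -/D; lra.
Qed.

End Competitor.

(** * Curves in the line z_1 = a as admissible functions on the cylinder *)

Section LiftAdmissible.
Context {R : realType}.
Implicit Types (t r s a um up : R).
Local Notation leb := (@lebesgue_measure R).
Local Notation nu := (@nu R).

Definition liftG (g : R -> R) (p : R * R) : (R * R) * (R * R) := ((0, 0), (g p.1, 0)).

Lemma lift_weak_grad a (f g : R -> R) : ac f g -> L1 leb (fun t => g t ^+ 2) ->
  weak_grad (fun p : R * R => (a, f p.1)) (liftG g).
Proof.
move=> A L; have [l _] := A; have mg := li_mf l.
have mg2 : measurable_fun setT (fun t => g t ^+ 2) by exact: (measurable_funX 2 mg).
have [h1 h2] := lift_weak A (L1_mf_li mg2 L).
have l0 : li (fun _ : R => (0 : R) ^+ 2).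
  by apply: li_cont => t; exact: cst_continuous.
have [h3 h4] := lift_weak (ac_cst a) l0.
exact: (And4 h3 h4 h1 h2).
Qed.

Lemma grad_lift (g : R -> R) p : grad_sq (liftG g) p = g p.1 ^+ 2.
Proof. by rewrite /grad_sq /=; ring. Qed.

Lemma ubar_lift a (f : R -> R) t : ubar (fun p : R * R => (a, f p.1)) t = (a, f t).
Proof.
have h (c : R) : Rintegral leb `[0, 1[ (fun=> c) = c.
  have mc : measurable_fun [set: R] (fun _ : R => c) by exact: measurable_cst.
  by rewrite -(Int_nuE mc); exact: (Int_nu_cst c).2.
by rewrite /ubar /= /lebR !h.
Qed.

Lemma lift_admissible a um up (f g : R -> R) : ac f g -> L1 leb (fun t => g t ^+ 2) ->
  ess_lim_ninfty (fun t => (a, f t)) (a, um) -> ess_lim_pinfty (fun t => (a, f t)) (a, up) ->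
  admissibleP (a, um) (a, up) (fun p : R * R => (a, f p.1)).
Proof.
move=> A L lm lp; have [l _] := A; have mg := li_mf l.
have uE : ubar (fun p : R * R => (a, f p.1)) = (fun t => (a, f t)).
  by apply/funext => t; rewrite ubar_lift.
split; [|by rewrite uE|by rewrite uE].
split; first by move=> p.
exists (liftG g); split; [exact: lift_weak_grad| |by apply: aeW => p; rewrite /= addr0].
under eq_integral do rewrite grad_lift.
rewrite (@ge0_cyl_fst _ (fun t => g t ^+ 2)) ?(L1_finE L) ?ltry//; first exact: (measurable_funX 2 mg).
by move=> t; exact: sqr_ge0.
Qed.

Lemma energy_lift (W : R * R -> R) a (f g : R -> R) : continuous W -> (forall z, 0 <= W z) ->
  measurable_fun setT f -> measurable_fun setT g ->
  energy W (fun p : R * R => (a, f p.1)) (liftG g) = energy1 W (fun t => (a, f t)) g.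
Proof.
move=> cW W0 mf mg; rewrite /energy /energy1.
under eq_integral do rewrite grad_lift.
apply: (@ge0_cyl_fst _ (fun t => g t ^+ 2 / 2 + W (a, f t))).
  apply: measurable_funD.
    by apply: measurable_funM; [exact: (measurable_funX 2 mg)|exact: measurable_cst].
  exact: (measurable_comp2 cW (@measurable_cst _ _ _ _ setT (a : R)) mf).
by move=> t; rewrite addr_ge0// divr_ge0// sqr_ge0.
Qed.

End LiftAdmissible.

(** * The calibration applied to functions given by weak gradients *)

Section CoreApply.
Context {R : realType}.
Implicit Types (t r s a um up : R).
Local Notation leb := (@lebesgue_measure R).
Local Notation mm := (leb \x leb)%E.
Local Notation nu := (@nu R).
Local Notation M := (@M R).

(** Integer translations bring every point into one period, and countably many translates of a null
    set are null. *)
Lemma ae_M_per (f : R * R -> R) (g : R -> R) : measurable_fun setT f -> measurable_fun setT g ->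
  (forall p, f (p.1, p.2 + 1) = f p) -> {ae M, forall x, f x = g x.1} -> {ae mm, forall x, f x = g x.1}.
Proof.
move=> mf mg pf H; apply: prod_ae1.
  by apply: measurable_eq_set => //; exact: (measurableT_comp mg measurable_fst).
have pn t s (n : nat) : f (t, s + n%:R) = f (t, s).
  elim: n => [|n IH]; first by rewrite addr0.
  by rewrite -IH -natr1 addrA; exact: (pf (t, s + n%:R)).
apply: filterS (ae_prod1 H) => t /nu_ae Ht.
have H1 : {ae leb, forall s (n : nat), 0 <= s + n%:R <= 1 -> f (t, s + n%:R) = g t}.
  by apply/ae_foralln => n; exact: (ae_shift n%:R Ht).
have H2 : {ae leb, forall s (n : nat), 0 <= s + - n%:R <= 1 -> f (t, s + - n%:R) = g t}.
  by apply/ae_foralln => n; exact: (ae_shift (- n%:R) Ht).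
apply: filterS2 H1 H2 => s h1 h2 /=; have [s0|s0] := leP 0 s.
  have b1 := truncn_le s; rewrite s0 in b1; have b2 := truncnS_gt s.
  rewrite -[X in f (t, X)](subrK (Num.truncn s)%:R s) pn; apply: h2.
  by rewrite subr_ge0 b1 /= lerBlDr addrC natr1 ltW.
have s1 : 0 <= - s by rewrite oppr_ge0 ltW.
have b1 := truncn_le (- s); rewrite s1 in b1; have b2 := truncnS_gt (- s).
rewrite -(pn t s (Num.truncn (- s)).+1); apply: h1; rewrite -natr1 in b2 *.
by apply/andP; split; lra.
Qed.

Variables (W w w1 w2 al Phi1 Phi2 : R * R -> R) (a um up : R).
Hypotheses (cW : continuous W) (W0 : forall z, 0 <= W z) (Ww : forall z, w z ^+ 2 / 2 <= W z).
Hypotheses (Cw : C1 w w1 w2) (Ca : C1 al (fun p => - w2 p) w1) (CP1 : C1 Phi1 al w)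
  (CP2 : C1 Phi2 (fun p => - w p) al).

(** The common form in which both alternatives of the theorem enter: bounded [u] with gam = 0, or
    exponential growth of w through [growth_bound]. *)
Definition tame (u : R * R -> R * R) := exists C gam : R, [/\ 0 <= C, 0 <= gam & {ae mm, forall x, [/\
  `|al (u x)| <= C * expR (gam * ((u x).1 ^+ 2 + (u x).2 ^+ 2)),
  `|w1 (u x)| <= C * expR (gam * ((u x).1 ^+ 2 + (u x).2 ^+ 2)) &
  `|w2 (u x)| <= C * expR (gam * ((u x).1 ^+ 2 + (u x).2 ^+ 2))]}].

Lemma tame_bounded (u : R * R -> R * R) (B : R) :
  {ae mm, forall x, `|(u x).1| <= B /\ `|(u x).2| <= B} -> tame u.
Proof.
move=> ub; have [c1 c2 _ _] := Cw; have ca := C1_continuous Ca.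
have [C0 C00 h0] := cont_bnd2 (- B) B (- B) B ca.
have [C1' C10 h1] := cont_bnd2 (- B) B (- B) B c1.
have [C2 C20 h2] := cont_bnd2 (- B) B (- B) B c2.
exists (C0 + C1' + C2), 0; split => //; first by rewrite !addr_ge0.
apply: filterS ub => x [b1 b2]; rewrite mul0r expR0 mulr1.
case: (u x) b1 b2 => y z /= b1 b2; rewrite ler_norml in b1; rewrite ler_norml in b2.
have k0 := h0 _ _ b1 b2; have k1 := h1 _ _ b1 b2; have k2 := h2 _ _ b1 b2.
by split; [apply: (le_trans k0)|apply: (le_trans k1)|apply: (le_trans k2)]; lra.
Qed.

Lemma ubar_Int (u : R * R -> R * R) : measurable_fun setT (fun p => (u p).1) ->
  measurable_fun setT (fun p => (u p).2) ->
  forall t, ubar u t = (Int nu (fun s => (u (t, s)).1), Int nu (fun s => (u (t, s)).2)).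
Proof.
by move=> m1 m2 t; rewrite /ubar /lebR (Int_nuE (mf_pairr t m1)) (Int_nuE (mf_pairr t m2)).
Qed.

(** The hypothesis is an energy bound by c and not minimality, so that it serves for the given
    minimizer and for lifted one-dimensional minimizers alike. *)
Lemma core_apply (u : R * R -> R * R) G : periodic2 u -> weak_grad u G ->
  {ae mm, forall p, (G p).1.1 + (G p).2.2 = 0} ->
  (energy W u G <= (Phi1 (a, up) - Phi1 (a, um))%:E)%E ->
  ess_lim_ninfty (ubar u) (a, um) -> ess_lim_pinfty (ubar u) (a, up) -> tame u ->
  exists g : R -> R, [/\ ac g (fun t => w (a, g t)), {ae mm, forall x, u x = (a, g x.1)} &
    energy W u G = energy1 W (fun t => (a, g t)) (fun t => w (a, g t))].
Proof.
move=> pu [wg1 wg2 wg3 wg4] dv en lm lp [C [gam [C0 gam0 gr]]].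
have [[mu1 _] [m11 _] _] := wg1; have [_ [m12 _] _] := wg2.
have [[mu2' _] [m21 _] _] := wg3; have [_ [m22 _] _] := wg4.
have p1 p : (u (p.1, p.2 + 1)).1 = (u p).1 by rewrite pu.
have p2 p : (u (p.1, p.2 + 1)).2 = (u p).2 by rewrite pu.
have [U1 [WU1 e1]] := weak_W12 p1 wg1 wg2; have [U2 [WU2 e2]] := weak_W12 p2 wg3 wg4.
have eU : {ae M, forall x, u x = (U1 x, U2 x)}.
  by apply: filterS2 e1 e2 => x; case: (u x) => y z /= -> ->.
have [mU1 _ _] := W12_mf WU1; have [mU2 _ _] := W12_mf WU2.
have mWu : measurable_fun setT (fun p => W (u p)).
  have := measurable_comp2 cW mu1 mu2'; congr (measurable_fun _ _).
  by apply/funext => p; case: (u p).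
pose F p := grad_sq G p / 2 + W (u p).
have mg : measurable_fun setT (fun p => grad_sq G p).
  by apply: measurable_funD; [apply: measurable_funD; [apply: measurable_funD|]|];
   apply: measurable_funX.
have mF : measurable_fun setT F.
  by apply: measurable_funD => //; apply: measurable_funM => //; exact: measurable_cst.
have g0 p : 0 <= grad_sq G p by rewrite /grad_sq !addr_ge0 ?sqr_ge0.
have F0 p : 0 <= F p by rewrite /F addr_ge0// divr_ge0.
have mFE : measurable_fun setT (fun p => (F p)%:E) by exact/measurable_EFinP.
have enE : energy W u G = (\int[M]_p (F p)%:E)%E.
  by rewrite /energy -(ge0_cyl_M mFE)// => p; rewrite lee_fin.
have EFn : (\int[M]_p `|F p|%:E = \int[M]_p (F p)%:E)%E.
  by apply: eq_integral => p _; rewrite ger0_norm.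
have fin : (\int[M]_p `|F p|%:E < +oo)%E.
  by rewrite EFn -enE; apply: (le_lt_trans en); exact: ltry.
have LF : L1 M F by exact: (@L1P _ _ _ M F mF fin).
have IF : Int M F <= Phi1 (a, up) - Phi1 (a, um).
  by move: en; rewrite enE (L1_finE LF) lee_fin.
clear fin EFn; move: enE; move: (energy W u G) en => E0 _ enE.
have Lsq (k : R * R -> R) : measurable_fun setT k -> (forall p, k p ^+ 2 <= grad_sq G p) -> L1 M (fun x => k x ^+ 2).
  move=> mk kg; apply: (@L1_domT _ _ _ M _ _ (measurable_funX 2 mk) (L1Z 2 LF)) => x.
  rewrite ger0_norm ?sqr_ge0// /F; have := kg x; have := W0 (u x); lra.
have L11 : L1 M (fun x => (G x).1.1 ^+ 2).
  by apply: Lsq => // p; rewrite /grad_sq -!addrA lerDl !addr_ge0 ?sqr_ge0.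
have L12 : L1 M (fun x => (G x).1.2 ^+ 2).
  by apply: (Lsq (fun x => (G x).1.2)) => // p; rewrite /grad_sq [X in X + _ + _]addrC -!addrA lerDl !addr_ge0 ?sqr_ge0.
have L21 : L1 M (fun x => (G x).2.1 ^+ 2).
  by apply: (Lsq (fun x => (G x).2.1)) => // p; rewrite /grad_sq [X in X + _]addrC -!addrA lerDl !addr_ge0 ?sqr_ge0.
have L22 : L1 M (fun x => (G x).2.2 ^+ 2).
  by apply: (Lsq (fun x => (G x).2.2)) => // p; rewrite /grad_sq lerDr !addr_ge0 ?sqr_ge0.
have mwU : measurable_fun setT (fun x => w (U1 x, U2 x)).
  by exact: (measurable_comp2 (C1_continuous Cw) mU1 mU2).
have Lw : L1 M (fun x => w (U1 x, U2 x) ^+ 2).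
  apply: (@L1_dom _ _ _ M _ _ (measurable_funX 2 mwU) (L1Z 2 LF)).
  apply: filterS eU => x e; rewrite ger0_norm ?sqr_ge0// -e /F.
  have := Ww (u x); have := g0 x; lra.
have LE : L1 M (fun x => ((G x).1.1 ^+ 2 + (G x).1.2 ^+ 2 + (G x).2.1 ^+ 2 + (G x).2.2 ^+ 2) / 2
  + w (U1 x, U2 x) ^+ 2 / 2).
  by have := L1D (L1Z 2^-1 (L1D (L1D (L1D L11 L12) L21) L22)) (L1Z 2^-1 Lw); congr L1; apply/funext => x; ring.
have en' : Int M (fun x => ((G x).1.1 ^+ 2 + (G x).1.2 ^+ 2 + (G x).2.1 ^+ 2 + (G x).2.2 ^+ 2) / 2
  + w (U1 x, U2 x) ^+ 2 / 2) <= Phi1 (a, up) - Phi1 (a, um).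
  apply: le_trans IF; apply: (Int_le LE LF); apply: filterS eU => x e.
  by rewrite /F /grad_sq lerD2l e; exact: Ww.
have ub : {ae leb, forall t, ubar u t = (Int nu (fun s => U1 (t, s)), Int nu (fun s => U2 (t, s)))}.
  apply: filterS2 (ae_prod1 e1) (ae_prod1 e2) => t h1 h2; rewrite (ubar_Int mu1 mu2'); congr (_, _).
    apply: Int_ae; [exact: (mf_pairr t mu1)|exact: (mf_pairr t mU1)|exact: h1].
  apply: Int_ae; [exact: (mf_pairr t mu2')|exact: (mf_pairr t mU2)|exact: h2].
have limp e : 0 < e -> exists T, {ae leb, forall t, T < t ->
  `|Int nu (fun s => U1 (t, s)) - a| < e /\ `|Int nu (fun s => U2 (t, s)) - up| < e}.
  move=> e0; have [T HT] := lp _ e0; exists T.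
  by apply: filterS2 HT ub => t ht ue Tt; have := ht Tt; rewrite ue.
have limm e : 0 < e -> exists T, {ae leb, forall t, t < T ->
  `|Int nu (fun s => U1 (t, s)) - a| < e /\ `|Int nu (fun s => U2 (t, s)) - um| < e}.
  move=> e0; have [T HT] := lm _ e0; exists T.
  by apply: filterS2 HT ub => t ht ue Tt; have := ht Tt; rewrite ue.
have gr' : {ae M, forall x, [/\
  `|al (U1 x, U2 x)| <= C * expR (gam * (U1 x ^+ 2 + U2 x ^+ 2)),
  `|w1 (U1 x, U2 x)| <= C * expR (gam * (U1 x ^+ 2 + U2 x ^+ 2)) &
  `|w2 (U1 x, U2 x)| <= C * expR (gam * (U1 x ^+ 2 + U2 x ^+ 2))]}.
  by apply: filterS2 (ae_M gr) eU => x h e; rewrite e in h.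
have [g [Ag Hg]] := @core_profile R U1 U2 _ _ _ _ w w1 w2 al Phi1 Phi2 a um up C gam WU1 WU2
  L11 L12 L21 L22 (ae_M dv) Cw Ca CP1 CP2 Lw limp limm C0 gam0 gr' en'.
have mgg : measurable_fun setT g by apply: continuous_measurable_fun; exact: (ac_continuous Ag).
have mwg : measurable_fun setT (fun t => w (a, g t)) by have [l _] := Ag; exact: (li_mf l).
exists g; split => //.
- have h1 : {ae M, forall x, (u x).1 = (fun=> a) x.1} by apply: filterS2 eU Hg => x -> [].
  have h2 : {ae M, forall x, (u x).2 = g x.1} by apply: filterS2 eU Hg => x -> [].
  have k1 := ae_M_per mu1 (@measurable_cst _ _ _ _ setT (a : R)) p1 h1.
  have k2 := ae_M_per mu2' mgg p2 h2.
  by apply: filterS2 k1 k2 => x; case: (u x) => y z /= -> ->.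
rewrite enE -(energy_lift a cW W0 mgg mwg) /energy.
pose F' (p : R * R) := grad_sq (liftG (fun t => w (a, g t))) p / 2 + W (a, g p.1).
have mF' : measurable_fun setT F'.
  have m1 : measurable_fun setT (fun p : R * R => g p.1) by exact: (measurableT_comp mgg measurable_fst).
  have m2 : measurable_fun setT (fun p : R * R => w (a, g p.1)) by exact: (measurableT_comp mwg measurable_fst).
  apply: measurable_funD; last exact: (measurable_comp2 cW (@measurable_cst _ _ _ _ setT (a : R)) m1).
  apply: measurable_funM; last exact: measurable_cst.
  by have := measurable_funX 2 m2; congr (measurable_fun _ _); apply/funext => p; rewrite -[LHS](grad_lift (fun t => w (a, g t))).
have mFE' : measurable_fun setT (fun p => (F' p)%:E) by exact/measurable_EFinP.
have F0' p : (0 <= (F' p)%:E)%E.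
  by rewrite lee_fin /F' addr_ge0// divr_ge0// /grad_sq !addr_ge0 ?sqr_ge0.
rewrite [RHS](ge0_cyl_M mFE' F0'); apply: ae_eq_integral => //.
apply: filterS2 eU Hg => x e [h1 h2 [h3 h4 h5 h6]] _; rewrite /F /F' e h1 h2 /grad_sq /=.
by rewrite h3 h4 h5 h6; congr (_%:E); ring.
Qed.

End CoreApply.

(** * The one-dimensional problem and its ODE *)

Section OneDim.
Context {R : realType}.
Implicit Types (t r s a um up : R) (f g h : R -> R).
Local Notation leb := (@lebesgue_measure R).
Local Notation mm := (leb \x leb)%E.

Lemma li_sym g : measurable_fun setT g ->
  (forall r : R, leb.-integrable `[- r, r] (fun t => (g t)%:E)) -> li g.
Proof.
move=> mg H a b; pose r := `|a| + `|b|.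
have L : L1 leb (fun t => ind (- r) r t * g t) by apply/li_integrable; exact: H.
have := @L1_bM _ _ _ leb 1 (ind a b) _ (mf_ind a b) (ind_bnd a b) L; congr L1; apply/funext => t.
rewrite !indE; case: ifPn => [/andP[h1 h2]|_]; last by rewrite !mul0r.
rewrite mul1r ifT ?mul1r//; rewrite /r.
have := ler_norm b; have := ler_norm (- a); rewrite normrN => h3 h4.
have := normr_ge0 a; have := normr_ge0 b => h5 h6.
by apply/andP; split; lra.
Qed.

Lemma weak1_rep f d : weak_deriv1 f d -> exists2 h, ac h d & {ae leb, forall t, f t = h t}.
Proof.
move=> [mf md H W].
have lf : li f by apply: li_sym => // r; have [] := H r.
have ld : li d by apply: li_sym => // r; have [] := H r.
apply: weak_ac => // eta T; have h := W _ T.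
by have := congr1 fine h; rewrite fineN.
Qed.

Lemma ac_weak1 f d : ac f d -> weak_deriv1 f d.
Proof.
move=> A; have [ld _] := A; have cf := ac_continuous A.
split; [exact: continuous_measurable_fun|exact: (li_mf ld)| |].
  by move=> r; split; apply/li_integrable; [exact: li_cont|exact: ld].
move=> eta T; have [L1' [L2' E]] := ac_ibp A T.
by rewrite (L1_finE L1') (L1_finE L2') E EFinN.
Qed.

Lemma ac_ae_eq f d f' d' : ac f d -> ac f' d' -> {ae leb, forall t, f t = f' t} ->
  f = f' /\ {ae leb, forall t, d t = d' t}.
Proof.
move=> A A' e; have E : f = f'.
  by apply/funext; apply: ae_cont_eq => //; [exact: (ac_continuous A)|exact: (ac_continuous A')].
split => //; have [ld Ed] := A; have [ld' Ed'] := A'; rewrite -E in Ed'.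
have lN := liZ (-1) ld'.
have l : li (fun t => d t + (-1) * d' t) by exact: liD.
have J0 q1 q2 : q1 <= q2 -> J q1 q2 (fun t => d t + (-1) * d' t) = 0.
  by move=> q12; rewrite (J_D _ _ ld lN) (J_Z _ _ _ ld') -Ed// -Ed'//; ring.
by apply: filterS (J0_ae0 l J0) => t h; apply/eqP; rewrite -subr_eq0 -h; apply/eqP; ring.
Qed.

Lemma energy1_ae (W : R * R -> R) a f f' d d' : continuous W ->
  measurable_fun setT f -> measurable_fun setT f' -> measurable_fun setT d -> measurable_fun setT d' ->
  {ae leb, forall t, f t = f' t} -> {ae leb, forall t, d t = d' t} ->
  energy1 W (fun t => (a, f t)) d = energy1 W (fun t => (a, f' t)) d'.
Proof.
move=> cW mf mf' md md' e1 e2.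
have mE (k l : R -> R) : measurable_fun setT k -> measurable_fun setT l ->
    measurable_fun setT (fun t => (l t ^+ 2 / 2 + W (a, k t))%:E).
  move=> mk ml; apply/measurable_EFinP; apply: measurable_funD.
    by apply: measurable_funM; [exact: (measurable_funX 2 ml)|exact: measurable_cst].
  exact: (measurable_comp2 cW (@measurable_cst _ _ _ _ setT (a : R)) mk).
apply: ae_eq_integral => //; [exact: mE|exact: mE|].
by apply: filterS2 e1 e2 => t -> -> _.
Qed.

Lemma sq_ae_L1 (d d' : R -> R) : measurable_fun setT d -> {ae leb, forall t, d t = d' t} ->
  measurable_fun setT d' -> (\int[leb]_t (d t ^+ 2)%:E < +oo)%E -> L1 leb (fun t => d' t ^+ 2).
Proof.
move=> md e md' fin; have L : L1 leb (fun t => d t ^+ 2).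
  apply: L1P; first exact: (measurable_funX 2 md).
  by under eq_integral do rewrite ger0_norm ?sqr_ge0//.
apply: (@L1_ae _ _ _ leb _ _ (measurable_funX 2 md') L); by apply: filterS e => t ->.
Qed.

Lemma ess_lim_ae_p (f f' : R -> R * R) l : {ae leb, forall t, f t = f' t} ->
  ess_lim_pinfty f l -> ess_lim_pinfty f' l.
Proof.
move=> e H eps e0; have [T HT] := H _ e0; exists T.
by apply: filterS2 HT e => t h <-.
Qed.

Lemma ess_lim_ae_n (f f' : R -> R * R) l : {ae leb, forall t, f t = f' t} ->
  ess_lim_ninfty f l -> ess_lim_ninfty f' l.
Proof.
move=> e H eps e0; have [T HT] := H _ e0; exists T.
by apply: filterS2 HT e => t h <-.
Qed.

(** Every admissible curve is a.e. an absolutely continuous one, and its energy does not depend on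
    the weak derivative chosen. *)
Lemma adm_rep (W : R * R -> R) a um up (h : R -> R * R) : continuous W ->
  admissible1 a (a, um) (a, up) h -> exists hc dc : R -> R, [/\ ac hc dc, L1 leb (fun t => dc t ^+ 2),
    {ae leb, forall t, h t = (a, hc t)} /\ weak_deriv1 (fun t => (h t).2) dc,
    ess_lim_ninfty (fun t => (a, hc t)) (a, um) /\ ess_lim_pinfty (fun t => (a, hc t)) (a, up) &
    forall dh, weak_deriv1 (fun t => (h t).2) dh -> energy1 W h dh = energy1 W (fun t => (a, hc t)) dc].
Proof.
move=> cW [h1 [dc [wd fin]] ln lp]; have [hc A e] := weak1_rep wd.
have md : measurable_fun setT dc by have [l _] := A; exact: (li_mf l).
have mh : measurable_fun setT hc by apply: continuous_measurable_fun; exact: (ac_continuous A).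
have eh : {ae leb, forall t, h t = (a, hc t)}.
  by apply: filterS e => t <-; rewrite -(h1 t); case: (h t).
exists hc, dc; split => //.
- by apply: (sq_ae_L1 md _ md fin); exact: aeW.
- by split; [exact: (ess_lim_ae_n eh)|exact: (ess_lim_ae_p eh)].
move=> dh wdh; have [hc' A' e'] := weak1_rep wdh.
have [_ ed] : hc' = hc /\ {ae leb, forall t, dh t = dc t}.
  by apply: (ac_ae_eq A' A); apply: filterS2 e e' => t <- <-.
have -> : h = (fun t => (a, (h t).2)).
  by apply/funext => t; rewrite -(h1 t); case: (h t).
have mh2 : measurable_fun setT (fun t => (h t).2) by have [] := wd.
have mdh : measurable_fun setT dh by have [] := wdh.
exact: energy1_ae.
Qed.

Lemma ac_is_admissible a um up f d : ac f d -> L1 leb (fun t => d t ^+ 2) ->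
  ess_lim_ninfty (fun t => (a, f t)) (a, um) -> ess_lim_pinfty (fun t => (a, f t)) (a, up) ->
  admissible1 a (a, um) (a, up) (fun t => (a, f t)).
Proof.
move=> A L ln lp; split => //; exists d; split; first exact: ac_weak1.
by rewrite (L1_finE L) ltry.
Qed.

(* Gronwall: exp(-2Lt) (f - g)^2 is nonincreasing for t >= 0, exp(2Lt) (f - g)^2 nondecreasing for t <= 0. *)
Lemma ode_unique (F F' : R -> R) f g : (forall x : R, is_derive x 1 F (F' x)) -> continuous F' ->
  ac f (fun t => F (f t)) -> ac g (fun t => F (g t)) -> f 0 = g 0 -> forall t, f t = g t.
Proof.
move=> dF cF' Af Ag fg0 t.
have cf := ac_continuous Af; have cg := ac_continuous Ag.
pose T := `|t|; have T0 : 0 <= T by exact: normr_ge0.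
have [B1 B10 H1] := cont_bnd (- T) T cf; have [B2 B20 H2] := cont_bnd (- T) T cg.
pose B := B1 + B2.
have [L L0 HL] := cont_bnd (- B) B cF'.
have lip s : - T <= s <= T -> `|F (f s) - F (g s)| <= L * `|f s - g s|.
  move=> hs; have b1 : `|f s| <= B by rewrite (le_trans (H1 s hs))// /B lerDl.
  have b2 : `|g s| <= B by rewrite (le_trans (H2 s hs))// /B lerDr.
  have := @MVT_lin _ F F' (g s) (f s) 0 L dF; rewrite mul0r subr0; apply => z.
  rewrite ge_min le_max subr0 => hz; apply: HL; move: b1 b2; rewrite !ler_norml => /andP[p1 p2] /andP[p3 p4].
  by move: hz => /andP[/orP[q1|q1] /orP[q2|q2]]; apply/andP; split; lra.
pose D s := f s - g s.
have AD : ac D (fun s => F (f s) - F (g s)).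
  by have := ac_lin 1 (-1) Af Ag; congr ac; apply/funext => s; rewrite /D; ring.
have AD2 := ac_mul AD AD.
have key (s : R) : - T <= s <= T -> `|(F (f s) - F (g s)) * D s| <= L * D s ^+ 2.
  move=> hs; rewrite normrM -[D s ^+ 2]real_normK ?num_real// expr2 mulrA.
  by apply: ler_wpM2r => //; exact: lip.
have Ae (m : R) : ac (fun s => expR (m * s)) (fun s => m * expR (m * s)).
  have d (s : R) : is_derive s 1 (fun s => expR (m * s)) (m * expR (m * s)).
    have := @is_derive_affine _ expR (expR (0 + m * s)) 0 m s (is_derive_expR _).
    by congr is_derive; [apply/funext => x; rewrite add0r|rewrite add0r mulrC].
  apply: derive_ac => // s.
  have c0 : {for s, continuous (fun x : R => expR (m * x))}.
    by apply: differentiable_continuous; apply/derivable1_diffP; have [] := d s.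
  exact: (cvgM (@cvg_cst _ (m : R) _ (nbhs s) _) c0).
have D00 : D 0 = 0 by rewrite /D fg0 subrr.
have l0 : li (fun _ : R => 0 : R) by apply: li_cont; exact: cst_continuous.
have fin (P : R) : P * (D t * D t) <= 0 -> 0 < P -> f t = g t.
  move=> h P0; apply/eqP; rewrite -subr_eq0 -/(D t) -sqrf_eq0 eq_le sqr_ge0 andbT expr2.
  by move: h; rewrite pmulr_rle0.
pose dP m s := m * expR (m * s) * (D s * D s) +
  expR (m * s) * ((F (f s) - F (g s)) * D s + D s * (F (f s) - F (g s))).
have A m : ac (fun s => expR (m * s) * (D s * D s)) (dP m) by exact: (ac_mul (Ae m) AD2).
have [t0|t0] := leP 0 t.
  have [lA EA] := A (- (2 * L)).
  have tT : t <= T by exact: ler_norm.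
  have le s : 0 <= s <= t -> dP (- (2 * L)) s <= 0.
    move=> /andP[s0 st].
    have hs : - T <= s <= T by apply/andP; split; [apply: (le_trans _ s0); rewrite oppr_le0|exact: le_trans tT].
    have := key s hs; rewrite ler_norml => /andP[_ k2].
    have := ler_wpM2l (expR_ge0 (- (2 * L) * s)) k2; rewrite /dP expr2; lra.
  have := J_le lA l0 le; rewrite -EA// (J_cst 0 t0) mul0r D00 !mulr0 subr0 => h.
  by apply: (fin _ h); exact: expR_gt0.
have [lA EA] := A (2 * L).
have tT : - T <= t by rewrite lerNl /T -normrN; exact: ler_norm.
have le s : t <= s <= 0 -> 0 <= dP (2 * L) s.
  move=> /andP[ts s0].
  have hs : - T <= s <= T by apply/andP; split; [exact: le_trans ts|exact: le_trans T0].
  have := key s hs; rewrite ler_norml => /andP[k1 _].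
  have := ler_wpM2l (expR_ge0 (2 * L * s)) k1; rewrite /dP expr2; lra.
have := J_le l0 lA le; rewrite -EA ?(ltW t0)// (J_cst 0 (ltW t0)) mul0r D00 !mulr0 sub0r oppr_ge0 => h.
by apply: (fin _ h); exact: expR_gt0.
Qed.

(** Fixes the translation: beyond suitable times the curve is closer to its limit than half the
    length of the segment, so it crosses the midpoint. *)
Lemma hit_middle a um up f : continuous f -> um != up ->
  ess_lim_ninfty (fun t => (a, f t)) (a, um) -> ess_lim_pinfty (fun t => (a, f t)) (a, up) ->
  exists t, f t = (um + up) / 2.
Proof.
move=> cf ne ln lp; pose e := `|up - um| / 2.
have e0 : 0 < e by rewrite divr_gt0// normr_gt0 subr_eq0 eq_sym.
have [T1 HT1] := ln _ e0; have [T2 HT2] := lp _ e0.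
(* [L1_small] for the zero function just picks points of a set of full measure beyond a given
   bound. *)
have L0 : L1 leb (fun=> 0 : R) by exact: L1_0.
have [_ [t1 [k1 h1 _]]] := L1_small (Num.min T1 T2) L0 ltr01 HT1.
have [[t2 [k2 h2 _]] _] := L1_small (Num.max T1 T2) L0 ltr01 HT2.
move: k1; rewrite lt_min => /andP[k1 k1']; move: k2; rewrite gt_max => /andP[k2 k2'].
have [_ d1] := h1 k1; have [_ d2] := h2 k2'.
have tt : t1 <= t2 by apply/ltW/(lt_trans k1).
have [|t _ ft] := @IVT _ f t1 t2 ((um + up) / 2) tt (continuous_subspaceT cf); last by exists t.
rewrite ge_min le_max; move: d1 d2; rewrite /= !ltr_norml /e.
by case: (ler0P (up - um)) => _ /andP[p1 p2] /andP[p3 p4]; apply/andP; split; apply/orP;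
  first [left; lra|right; lra].
Qed.

(** Makes lifted one-dimensional minimizers [tame], whatever the growth of w. *)
Lemma limits_bounded a um up f : continuous f ->
  ess_lim_ninfty (fun t => (a, f t)) (a, um) -> ess_lim_pinfty (fun t => (a, f t)) (a, up) ->
  exists B, {ae mm, forall x : R * R, `|a| <= B /\ `|f x.1| <= B}.
Proof.
move=> cf ln lp; have [T1 HT1] := ln _ (@ltr01 R); have [T2 HT2] := lp _ (@ltr01 R).
have [C C0 HC] := cont_bnd T1 T2 cf.
exists (`|a| + `|um| + `|up| + C + 1).
have h : {ae leb, forall t, `|f t| <= `|a| + `|um| + `|up| + C + 1}.
  have a0 := normr_ge0 a; have m0 := normr_ge0 um; have p0 := normr_ge0 up.
  apply: filterS2 HT1 HT2 => t /= h1 h2.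
  have tri (l : R) : `|f t| <= `|f t - l| + `|l| by rewrite -{1}(subrK l (f t)); exact: ler_normD.
  have [t1|t1] := ltP t T1; first by have [_ k] := h1 t1; have := tri um; lra.
  have [t2|t2] := ltP T2 t; first by have [_ k] := h2 t2; have := tri up; lra.
  have := HC t; rewrite t1 t2 => /(_ isT); lra.
have h' : {ae mm, forall x : R * R, `|f x.1| <= `|a| + `|um| + `|up| + C + 1}.
  apply: prod_ae1.
    have mf : measurable_fun [set: R * R] (fun x : R * R => `|f x.1|).
      apply: measurableT_comp => //; apply: (measurableT_comp _ measurable_fst).
      exact: continuous_measurable_fun.
    have mK : measurable_fun [set: R * R] (fun _ : R * R => `|a| + `|um| + `|up| + C + 1) by exact: measurable_cst.
    by have := measurable_fun_le measurableT mf mK; rewrite setTI.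
  by apply: filterS h => t ht; exact: aeW.
apply: filterS h' => x hx; split => //.
have m0 := normr_ge0 um; have p0 := normr_ge0 up; lra.
Qed.

End OneDim.

(** * Minimality of the profile and uniqueness up to translation *)

Section Main.
Context {R : realType}.
Local Notation leb := (@lebesgue_measure R).
Local Notation mm := (leb \x leb)%E.
Local Notation nu := (@nu R).

(** The factor [up - um] in the sign condition makes the flux c the integral of |w| along the
    segment for either order of the end points. *)
Lemma main_signed (W w w1 w2 w11 w12 w21 w22 : R * R -> R) (a um up : R) (u : R * R -> R * R) :
  continuous W -> (forall z, 0 <= W z) -> W (a, um) = 0 -> W (a, up) = 0 ->
  c2harm w w1 w2 w11 w12 w21 w22 -> (forall z, w z ^+ 2 / 2 <= W z) ->
  (forall t : R, 0 < t < 1 ->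
     W (a, (1 - t) * um + t * up) = (w (a, (1 - t) * um + t * up)) ^+ 2 / 2 /\
     0 < (up - um) * w (a, (1 - t) * um + t * up)) ->
  global_minP W (a, um) (a, up) u ->
  ((exists B : R, {ae mm, forall x, `|(u x).1| <= B /\ `|(u x).2| <= B}) \/
   (exists C beta : R, [/\ 0 <= C, 0 <= beta &
      forall z, `|w z| <= C * expR (beta * (z.1 ^+ 2 + z.2 ^+ 2))])) ->
  exists g : R -> R * R,
    [/\ minimizer1 W a (a, um) (a, up) g,
        (forall h, minimizer1 W a (a, um) (a, up) h ->
           exists tau : R, {ae leb, forall t, h t = g (t + tau)}) &
        {ae mm, forall x, u x = g x.1}].
Proof.
move=> cW W0 Wm Wp hw Ww seg [[[pu [G [wg _ dv]]] ln lp] gm] gr.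
have [al [Phi1 [Phi2 [Ca CP1 CP2]]]] := harmonic_conj hw.
have [Cw _ _ _] := hw; have cw := C1_continuous Cw.
have ne : um != up.
  have h : 0 < (2^-1 : R) < 1 by apply/andP; split; lra.
  by apply/eqP => e; have [_] := seg _ h; rewrite e subrr mul0r ltxx.
have tu : tame w1 w2 al u.
  case: gr => [[B uB]|[C [beta [C0 b0 hC]]]]; first exact: (tame_bounded Cw Ca uB).
  have [C' [gam [C0' g0 H]]] := growth_bound hw Ca C0 b0 hC.
  by exists C', gam; split => //; apply: aeW => x; exact: H.
pose c := Phi1 (a, up) - Phi1 (a, um).
(* The competitor lifts to the cylinder, so minimality of u bounds its energy by c + d |up - um| for
   every d > 0. *)
have en : (energy W u G <= c%:E)%E.
  apply/lee_addgt0Pr => e e0; pose D := `|up - um|.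
  have D0 : 0 <= D by exact: normr_ge0.
  (* The excess d D stays below e, and the added 1 keeps the quotient defined for every D >= 0. *)
  have d0 : 0 < e / (D + 1) by rewrite divr_gt0// ltr_wpDl.
  have [th [dth [A L [B HB] Le Ie]]] := competitor cW W0 Wm Wp Cw CP1 Ww seg d0.
  have lm : ess_lim_ninfty (fun t => (a, th t)) (a, um).
    move=> eps eps0; exists (- B); apply: aeW => t tB; have [h _] := HB t.
    by rewrite /= h// !subrr normr0.
  have lp' : ess_lim_pinfty (fun t => (a, th t)) (a, up).
    move=> eps eps0; exists B; apply: aeW => t tB; have [_ h] := HB t.
    by rewrite /= h// !subrr normr0.
  have le := gm _ (lift_admissible A L lm lp') _ _ wg (lift_weak_grad a A L).
  apply: (le_trans le); have [l _] := A.
  have mth : measurable_fun setT th by apply: continuous_measurable_fun; exact: (ac_continuous A).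
  rewrite (energy_lift a cW W0 mth (li_mf l)) /energy1 /lebR (L1_finE Le) -EFinD lee_fin.
  apply: (le_trans Ie); rewrite -/D -/c lerD2l mulrAC ler_pdivrMr ?ltr_wpDl//.
  by apply: ler_wpM2l; [exact: ltW|rewrite lerDl].
have [g [Ag ue Eg]] := core_apply cW W0 Ww Cw Ca CP1 CP2 pu wg dv en ln lp tu.
have [lg _] := Ag; have mwg := li_mf lg.
have mg : measurable_fun setT g by apply: continuous_measurable_fun; exact: (ac_continuous Ag).
have eub : {ae leb, forall t, ubar u t = (a, g t)}.
  have [w1' _ w3' _] := wg; have [[mu1 _] _ _] := w1'; have [[mu2' _] _ _] := w3'.
  apply: filterS (ae_prod1 ue) => t /ae_nu ht; rewrite (ubar_Int mu1 mu2'); congr (_, _).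
    rewrite -[RHS](@Int_nu_cst R a).2; apply: Int_ae; [exact: (mf_pairr t mu1)|exact: measurable_cst|].
    by apply: filterS ht => s ->.
  rewrite -[RHS](@Int_nu_cst R (g t)).2; apply: Int_ae; [exact: (mf_pairr t mu2')|exact: measurable_cst|].
  by apply: filterS ht => s ->.
have lng := ess_lim_ae_n eub ln; have lpg := ess_lim_ae_p eub lp.
have Lg : L1 leb (fun t => w (a, g t) ^+ 2).
  have mWg : measurable_fun setT (fun t => W (a, g t)).
    exact: (measurable_comp2 cW (@measurable_cst _ _ _ _ setT (a : R)) mg).
  have mw2 := measurable_funX 2 mwg.
  have me : measurable_fun setT (fun t => w (a, g t) ^+ 2 / 2 + W (a, g t)).
    by apply: measurable_funD => //; apply: measurable_funM => //; exact: measurable_cst.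
  have fin : (\int[leb]_t `|w (a, g t) ^+ 2 / 2 + W (a, g t)|%:E < +oo)%E.
    have -> : (\int[leb]_t `|w (a, g t) ^+ 2 / 2 + W (a, g t)|%:E)%E = energy W u G.
      rewrite Eg; apply: eq_integral => t _.
      by rewrite ger0_norm// addr_ge0// divr_ge0// sqr_ge0.
    by apply: (le_lt_trans en); exact: ltry.
  have Le : L1 leb (fun t => w (a, g t) ^+ 2 / 2 + W (a, g t)).
    by apply: L1P; [exact: me|exact: fin].
  apply: (@L1_domT _ _ _ leb _ _ mw2 (L1Z 2 Le)) => t.
  by rewrite ger0_norm ?sqr_ge0//; have := W0 (a, g t); lra.
have adg := ac_is_admissible Ag Lg lng lpg.
have Eany dg : weak_deriv1 (fun t => (a, g t).2) dg -> energy1 W (fun t => (a, g t)) dg = energy W u G.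
  move=> wdg; have [gc [dc [_ _ _ _ H]]] := adm_rep cW adg.
  by rewrite Eg (H _ wdg) (H _ (ac_weak1 Ag)).
exists (fun t => (a, g t)); split => //.
(* A one-dimensional competitor lifts to the cylinder with the same energy, so minimality of u there
   gives minimality of its profile. *)
- split => // h adh dg dh wdg wdh; rewrite (Eany _ wdg).
  have [hc [dc [Ah Lh _ [lnh lph] Hh]]] := adm_rep cW adh.
  rewrite (Hh _ wdh); have [l _] := Ah.
  have mh : measurable_fun setT hc by apply: continuous_measurable_fun; exact: (ac_continuous Ah).
  rewrite -(energy_lift a cW W0 mh (li_mf l)).
  exact: (gm _ (lift_admissible Ah Lh lnh lph) _ _ wg (lift_weak_grad a Ah Lh)).
move=> h [adh minh]; have [hc [dc [Ah Lh [eh wh] [lnh lph] Hh]]] := adm_rep cW adh.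
have [l _] := Ah.
have mh : measurable_fun setT hc by apply: continuous_measurable_fun; exact: (ac_continuous Ah).
(* Another minimizer has at most the energy of g, hence at most c, which is all that [core_apply]
   asks of its lift. *)
have enh : (energy W (fun p : R * R => (a, hc p.1)) (liftG dc) <= c%:E)%E.
  rewrite (energy_lift a cW W0 mh (li_mf l)) -(Hh _ wh).
  apply: (le_trans (minh _ adg _ _ wh (ac_weak1 Ag))).
  by rewrite (Eany _ (ac_weak1 Ag)).
have ubE : ubar (fun p : R * R => (a, hc p.1)) = (fun t => (a, hc t)).
  by apply/funext => t; rewrite ubar_lift.
have lnh' : ess_lim_ninfty (ubar (fun p : R * R => (a, hc p.1))) (a, um) by rewrite ubE.
have lph' : ess_lim_pinfty (ubar (fun p : R * R => (a, hc p.1))) (a, up) by rewrite ubE.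
have th : tame w1 w2 al (fun p : R * R => (a, hc p.1)).
  have [B hB] := limits_bounded (ac_continuous Ah) lnh lph.
  apply: (tame_bounded (u := fun p : R * R => (a, hc p.1)) (B := B) Cw Ca).
  exact: hB.
have ph : periodic2 (fun p : R * R => (a, hc p.1)) by move=> p.
have dvh : {ae mm, forall p, (liftG dc p).1.1 + (liftG dc p).2.2 = 0}.
  by apply: aeW => p; rewrite /= addr0.
have [g' [Ag' ue' _]] := core_apply cW W0 Ww Cw Ca CP1 CP2 ph (lift_weak_grad a Ah Lh) dvh enh lnh' lph' th.
have e1 : {ae leb, forall t, hc t = g' t}.
  by apply: filterS (ae_prod1 ue') => t /ae_nu/ae_nu_ex[s] [].
have [E _] := ac_ae_eq Ah Ag' e1; rewrite -E in Ag'.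
(* Both curves solve y' = w(a, y) and pass through the midpoint, at times t1 and t2; shifted to pass
   there at time 0 they coincide by [ode_unique]. *)
have [t1 h1] := hit_middle (ac_continuous Ag) ne lng lpg.
have [t2 h2] := hit_middle (ac_continuous Ah) ne lnh lph.
have [_ cw2 _ d2] := Cw.
have A1 := ac_shift t1 Ag; have A2 := ac_shift t2 Ag'.
have e0 : hc (0 + t2) = g (0 + t1) by rewrite !add0r h1 h2.
have ode := @ode_unique R (fun y => w (a, y)) (fun y => w2 (a, y)) _ _ (d2 a) (@cont_slice2 R w2 a cw2) A2 A1 e0.
exists (t1 - t2); apply: filterS eh => t ->.
by rewrite -[X in hc X](subrK t2 t) (ode (t - t2)); congr (_, g _); ring.
Qed.

Lemma c2harm_opp (w w1 w2 w11 w12 w21 w22 : R * R -> R) : c2harm w w1 w2 w11 w12 w21 w22 ->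
  c2harm (fun z => - w z) (fun z => - w1 z) (fun z => - w2 z) (fun z => - w11 z) (fun z => - w12 z)
    (fun z => - w21 z) (fun z => - w22 z).
Proof.
move=> [h1 h2 h3 h]; split; [exact: C1_opp|exact: C1_opp|exact: C1_opp|].
by move=> p; rewrite -opprD h oppr0.
Qed.

End Main.

Theorem theorem4p22 (R : realType) (W : R * R -> R) (a u2m u2p : R)
  (w : R * R -> R) (u : R * R -> R * R) :
  continuous W ->
  (forall z, 0 <= W z) ->
  W (a, u2m) = 0 -> W (a, u2p) = 0 ->
  is_C2 w -> is_harmonic w ->
  (forall z, (w z) ^+ 2 / 2 <= W z) ->
  (forall t : R, 0 < t < 1 ->
     W (a, (1 - t) * u2m + t * u2p) = (w (a, (1 - t) * u2m + t * u2p)) ^+ 2 / 2 /\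
     0 < w (a, (1 - t) * u2m + t * u2p)) ->
  global_minP W (a, u2m) (a, u2p) u ->
  ((exists M : R, {ae mu2, forall x, `|(u x).1| <= M /\ `|(u x).2| <= M}) \/
   (exists C beta : R, [/\ 0 < C, 0 < beta &
      forall z, `|w z| <= C * expR (beta * (z.1 ^+ 2 + z.2 ^+ 2))])) ->
  exists g : R -> R * R,
    [/\ minimizer1 W a (a, u2m) (a, u2p) g,
        (forall h, minimizer1 W a (a, u2m) (a, u2p) h ->
           exists tau : R, {ae lebR, forall t, h t = g (t + tau)}) &
        {ae mu2, forall x, u x = g x.1}].
Proof.
move=> cW W0 Wm Wp hC2 hh Ww seg gm gr.
have [w1 [w2 [w11 [w12 [w21 [w22 hw]]]]]] := is_C2_harm hC2 hh.
have gr' : (exists B : R, {ae mu2, forall x, `|(u x).1| <= B /\ `|(u x).2| <= B}) \/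
   (exists C beta : R, [/\ 0 <= C, 0 <= beta &
      forall z, `|w z| <= C * expR (beta * (z.1 ^+ 2 + z.2 ^+ 2))]).
  by case: gr => [h|[C [beta [C0 b0 h]]]]; [left|right; exists C, beta; split => //; exact: ltW].
(* When u2p < u2m the function w is replaced by -w, which is again harmonic with the same square and
   bounds. *)
case: (ltgtP u2m u2p) => h.
- apply: (main_signed cW W0 Wm Wp hw Ww _ gm gr') => t t01.
  by have [e p] := seg t t01; split => //; rewrite mulr_gt0// subr_gt0.
- apply: (main_signed cW W0 Wm Wp (c2harm_opp hw) _ _ gm) => [z|t t01|]; first by rewrite sqrrN.
    have [e p] := seg t t01; split; first by rewrite sqrrN.
    by rewrite mulrN -mulNr opprB mulr_gt0// subr_gt0.
  case: gr' => [hb|[C [beta [C0 b0 hC]]]]; [by left|right; exists C, beta; split => // z].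
  by rewrite normrN.
(* With equal end points the segment is the point (a, u2m), where W = 0 forces w = 0 against w >
   0. *)
exfalso; have t01 : 0 < (2^-1 : R) < 1 by apply/andP; split; lra.
have [_] := seg _ t01; rewrite -h (_ : _ + _ = u2m); last by field.
have := Ww (a, u2m); rewrite Wm => hz.
have : w (a, u2m) ^+ 2 <= 0 by move: hz; rewrite pmulr_lle0 ?invr_gt0.
rewrite le_eqVlt ltNge sqr_ge0 orbF sqrf_eq0 => /eqP ->.
by rewrite ltxx.
Qed.
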